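(* Let $U$ be a domain in $\mathbf{C}^n$ and let $f:U\rightarrow\mathbf{C}^k$ be a holomorphic mapping that satisfies a system of equations $Q(x,f(x))=0$ for $x\in U$, where $Q$ is a Nash mapping from a neighborhood in $\mathbf{C}^n\times\mathbf{C}^k$ of the graph of $f$ into some $\mathbf{C}^q$. Let $R\in\mathbf{C}[x,z_1,\ldots,z_k]$ be any polynomial which is adapted to $(f,Q)$ (in the sense defined in the context). Then for every $U_0\in\mathcal{U}_{f,R}$ there is a sequence $\{f^{\nu}:U_0\rightarrow\mathbf{C}^k\}$ of Nash mappings converging uniformly to $f|_{U_0}$ such that $Q(x,f^{\nu}(x))=0$ for $x\in U_0$ and $\nu\in\mathbf{N}$.
   Context: Nash mappings. For $\Omega\subset\mathbf{C}^n$ open, a holomorphic function $f$ on $\Omega$ is a Nash function if every $x_0\in\Omega$ has an open neighborhood $W\subset\Omega$ and a complex polynomial $P\neq0$ in $n+1$ variables with $P(x,f(x))=0$ for $x\in W$. A holomorphic mapping to $\mathbf{C}^N$ is a Nash mapping if its components are Nash functions. Convergence of chains. Let $\Omega\subset\mathbf{C}^m$ be open. Closed subsets $Y_\nu$ of $\Omega$ converge locally uniformly to a closed subset $Y$ if every $a\in Y$ is the limit of some sequence $a_\nu\in Y_\nu$, and every compact $K\subset\Omega$ disjoint from $Y$ is disjoint from $Y_\nu$ for almost all $\nu$. A positive $p$-chain in $\Omega$ is a formal sum $\sum_j\alpha_jC_j$ with integers $\alpha_j>0$ and $\{C_j\}$ a locally finite family of pairwise distinct irreducible $p$-dimensional analytic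 subsets of $\Omega$; its support is $\bigcup_jC_j$. Positive $p$-chains $Z_\nu$ converge to a positive $p$-chain $Z$ if the supports $|Z_\nu|$ converge locally uniformly to $|Z|$ and, for each regular point $a$ of $|Z|$ and each submanifold $T$ of $\Omega$ of dimension $m-p$ transversal to $|Z|$ at $a$ with $\overline{T}$ compact and $|Z|\cap\overline{T}=\{a\}$, we have $\deg(Z_\nu\cdot T)=\deg(Z\cdot T)$ for almost all $\nu$ ($\cdot$ is the intersection product, $\deg$ of a chain of points is the sum of its multiplicities). A pure-dimensional analytic set is regarded as the chain of its irreducible components, each with multiplicity one; convergence of such sets in the sense of chains means convergence of these chains. Adapted polynomials. Let $U\subset\mathbf{C}^n$ be a domain, $f:U\rightarrow\mathbf{C}^k$ holomorphic, and $Q$ a Nash mapping from a neighborhood of the graph of $f$ into some $\mathbf{C}^q$ with $Q(x,f(x))=0$ for $x\in U$. A polynomial $R\in\mathbf{C}[x,z_1,\ldots,z_k]$ is called adapted to $(f,Q)$ if $R(x,f(x))$ is not identically zero on $U$ and the following holds: if for some open $\tilde{U},U_0\subset U$ with $U_0\subset\subset\tilde{U}$ there is a sequence $\{g^\nu:\tilde{U}\rightarrow\mathbf{C}^k\}$ of Nash mappings converging locally uniformly to $f|_{\tilde{U}}$ such that $\{x\in\tilde{U}:R(x,g^\nu(x))=0\}$ converges to $\{x\in\tilde{U}:R(x,f(x))=0\}$ in the sense of chains, then there is a sequence $\{f^\nu:U_0\rightarrow\mathbf{C}^k\}$ of Nash mappings converging uniformly to $f|_{U_0}$ with $Q(x,f^\nu(x))=0$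 for $x\in U_0$, $\nu\in\mathbf{N}$. (Adapted polynomials exist for every such $(f,Q)$.) The family $\mathcal{U}_{f,R}$. Write $x=(x_1,\ldots,x_n)$, $x'=(x_1,\ldots,x_{n-1})$, $\pi(x)=x'$. Let $U\subset\mathbf{C}^n$ be a domain, $f:U\rightarrow\mathbf{C}^k$ holomorphic, $R\in\mathbf{C}[x,z_1,\ldots,z_k]$ with $R(x,f(x))$ not identically zero. The family $\mathcal{U}_{f,R}$ of open subsets of $U$ is defined by recursion on $n$. ''Unitary'' means monic; an ''optimal polynomial'' in $\mathcal{O}(\check{U}_1)[x_n]$ is a unitary polynomial whose discriminant is not identically zero. If $n=1$: $U_0\in\mathcal{U}_{f,R}$ iff $U_0$ is an open relatively compact subset of some open simply connected subset of $U$. If $n>1$: an open $U_0\subset\mathbf{C}^n$ belongs to $\mathcal{U}_{f,R}$ iff there is a biholomorphism $\phi:\check{U}\rightarrow\hat{U}\subset U$, where $\hat{U}$ is a domain and $\check{U}$ is a Runge domain in $\mathbf{C}^n$ with $U_0\subset\subset\hat{U}$, and there is a domain $\check{U}_1\subset\mathbf{C}^{n-1}$ with $\check{U}\subset\check{U}_1\times\mathbf{C}$, such that: (1) $R(\phi(x),f(\phi(x)))=\tilde{H}(x)W(x)$ for $x\in\check{U}$, for some $\tilde{H}\in\mathcal{O}(\check{U})$ non-vanishing on $\overline{\phi^{-1}(U_0)}$ and some unitary polynomial $W\in\mathcal{O}(\check{U}_1)[x_n]$ with $W^{-1}(0)\subset\check{U}$; (2) $\pi(\phi^{-1}(U_0))\in\mathcal{U}_{g,S}$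 for some holomorphic $g:\check{U}_1\rightarrow\mathbf{C}^s$ and some $S\in\mathbf{C}[x',z_1,\ldots,z_s]$ obtained from $f,R,\phi,W$ as follows. Let $f\circ\phi=(f_1,\ldots,f_k)$, $\phi=(\phi_1,\ldots,\phi_n)$, $d=\deg W$. Divide by $W$: $f_j=WH_j+r_j$, $\phi_i=W\check{H}_i+\check{r}_i$ on $\check{U}$, with $H_j,\check{H}_i\in\mathcal{O}(\check{U})$ and $r_j,\check{r}_i\in\mathcal{O}(\check{U}_1)[x_n]$ of degree $<d$. Write $W=W_1^{k_1}\cdots W_{\hat{s}}^{k_{\hat{s}}}$ with optimal polynomials $W_l\in\mathcal{O}(\check{U}_1)[x_n]$ such that $\dim(W_i^{-1}(0)\cap W_j^{-1}(0))<n-1$ for $i\neq j$. Write $W_l=x_n^{p_l}+x_n^{p_l-1}a_{l,1}(x')+\ldots+a_{l,p_l}(x')$, $r_j=x_n^{d-1}b_{j,0}(x')+\ldots+b_{j,d-1}(x')$, $\check{r}_i=x_n^{d-1}c_{i,0}(x')+\ldots+c_{i,d-1}(x')$, put $A_l=(a_{l,1},\ldots,a_{l,p_l})$, $B_j=(b_{j,0},\ldots,b_{j,d-1})$, $C_i=(c_{i,0},\ldots,c_{i,d-1})$, and let $g=(A_1,\ldots,A_{\hat{s}},B_1,\ldots,B_k,C_1,\ldots,C_n):\check{U}_1\rightarrow\mathbf{C}^s$, $s$ being the total number of these coefficients. Next replace the coefficient functions $a_{l,\cdot},b_{j,\cdot},c_{i,\cdot}$ by independent variables, forming the tuple $u$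 (in the same order as in $g$); then $W_l,r_j,\check{r}_i$ become polynomials $P_l,w_j,\check{w}_i$. Put $P=P_1^{k_1}\cdots P_{\hat{s}}^{k_{\hat{s}}}$, $\alpha_j=PS_j+w_j$, $\beta_i=P\check{S}_i+\check{w}_i$ with further new variables $S_j,\check{S}_i$, and divide with remainder with respect to $x_n$: $R(\beta_1,\ldots,\beta_n,\alpha_1,\ldots,\alpha_k)=\tilde{W}P+x_n^{d-1}T_1+x_n^{d-2}T_2+\ldots+T_d$, where $T_1,\ldots,T_d$ are polynomials depending only on $u$. Put $T(u)=(T_1(u),\ldots,T_d(u))$; then $T(g(x'))=0$ for $x'\in\check{U}_1$. Finally $S\in\mathbf{C}[x',z_1,\ldots,z_s]$ is any polynomial adapted to $(g,T)$ (with $T$ viewed as the mapping $(x',u)\mapsto T(u)$). *)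

(* Defs.v *)
From HB Require Import structures.
From mathcomp Require Import all_boot all_order all_algebra.
From mathcomp.real_closed Require Import complex.
From mathcomp Require Import all_classical all_reals all_analysis.
(* mpoly's notations clash with those of MathComp-Analysis. *)
From mathcomp Require Import -(notations) mpoly.

Set Implicit Arguments.
Unset Strict Implicit.
Unset Printing Implicit Defensive.

Import Order.TTheory GRing.Theory Num.Theory.
Import numFieldNormedType.Exports.
Local Open Scope classical_set_scope.
Local Open Scope ring_scope.

(* The complex numbers.  Packaging R[i] as a numClosedFieldType gives it the
   topology of its modulus; 'rV[cplx R]_n carries the maximum norm. *)
Definition cplx (R : realType) : numClosedFieldType := R[i].
Arguments cplx : simpl never.

Section ComplexAnalysis.
Variable R : realType.
Local Notation C := (cplx R).

Definition domain n (D : set 'rV[C]_n) := [/\ open D, connected D & D !=set0].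

(* For A in an open D this says exactly that the closure of A in D is compact. *)
Definition relcompact_in n (A D : set 'rV[C]_n) :=
  compact (closure A) /\ closure A `<=` D.

(* Complex (Frechet) differentiability at each point of D; used for open D. *)
Definition holo (V W : normedModType C) (D : set V) (f : V -> W) :=
  forall x, D x -> differentiable f x.

Definition loc_unif_cvg n k (D : set 'rV[C]_n) (g : nat -> 'rV[C]_n -> 'rV[C]_k)
    (f : 'rV[C]_n -> 'rV[C]_k) :=
  forall a, D a -> exists W : set 'rV[C]_n,
    [/\ open W, W a, W `<=` D & {uniform W, g @ \oo --> f}].

Definition evalmp n (p : mpoly n C) (x : 'rV[C]_n) : C := meval (x 0) p.

Definition nash_fun n (D : set 'rV[C]_n) (f : 'rV[C]_n -> C) :=
  holo D f /\
  forall x0, D x0 -> exists W : set 'rV[C]_n,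
    [/\ open W, W x0, W `<=` D &
      exists2 P : mpoly (n + 1) C, P != 0 &
        forall x, W x -> evalmp P (row_mx x (const_mx (f x))) = 0].

Definition nash n k (D : set 'rV[C]_n) (f : 'rV[C]_n -> 'rV[C]_k) :=
  forall j : 'I_k, nash_fun D (fun x => f x 0 j).

(* Runge in the sense of density of the polynomials in O(D), uniformly on compact
   sets; D is not required to be a domain of holomorphy. *)
Definition runge_domain n (D : set 'rV[C]_n) :=
  domain D /\
  forall h : 'rV[C]_n -> C, holo D h ->
  forall K : set 'rV[C]_n, compact K -> K `<=` D ->
  forall e : C, 0 < e ->
  exists p : mpoly n C, forall x, K x -> `|h x - evalmp p x| < e.

Definition biholomorphism n (D E : set 'rV[C]_n) (phi : 'rV[C]_n -> 'rV[C]_n) :=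
  [/\ holo D phi, phi @` D = E &
    exists psi : 'rV[C]_n -> 'rV[C]_n,
      holo E psi /\ forall x, D x -> psi (phi x) = x].

Definition path_in n (V : set 'rV[C]_n) (c : R -> 'rV[C]_n) :=
  {within `[0, 1], continuous c} /\ c @` `[0, 1] `<=` V.

Definition simply_connected n (V : set 'rV[C]_n) :=
  (forall x y, V x -> V y ->
     exists c, [/\ path_in V c, c 0 = x & c 1 = y]) /\
  (forall c, path_in V c -> c 0 = c 1 ->
     exists H : R * R -> 'rV[C]_n,
       [/\ {within `[0, 1] `*` `[0, 1], continuous H},
           H @` (`[0, 1] `*` `[0, 1]) `<=` V,
           forall t, 0 <= t <= 1 -> H (0, t) = c t /\ H (1, t) = c 0 &
           forall s, 0 <= s <= 1 -> H (s, 0) = c 0 /\ H (s, 1) = c 0]).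

Section AnalyticSets.
Variable m : nat.
Local Notation V := 'rV[C]_m.
Implicit Types (Om A T : set V) (a b : V).

Definition analytic Om A :=
  A `<=` Om /\
  forall a, Om a -> exists (W : set V) (r : nat) (h : V -> 'rV[C]_r),
    [/\ open W, W a, W `<=` Om, holo W h &
        A `&` W = [set x | W x /\ h x = 0]].

(* Near a, the set A is the zero set of the submersion h : W -> C^(m - p). *)
Definition local_equation A p a (W : set V) (h : V -> 'rV[C]_(m - p)) :=
  [/\ open W, W a, holo W h,
      A `&` W = [set x | W x /\ h x = 0] &
      forall x, A x -> W x -> forall y, exists v, 'd h x v = y].

Definition regular_dim A p a :=
  [/\ A a, (p <= m)%N & exists W h, @local_equation A p a W h].

Definition regular A a := exists p, regular_dim A p a.

Definition submanifold Om p T :=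
  T `<=` Om /\ forall a, T a -> regular_dim T p a.

Definition tangent A a (v : V) :=
  exists p W h, [/\ regular_dim A p a, @local_equation A p a W h & 'd h a v = 0].

Definition transversal A T a :=
  forall v : V, exists u w, [/\ tangent A a u, tangent T a w & v = u + w].

(* dim_a A, the upper limit of the dimensions of the regular points near a. *)
Definition dim_at A a p :=
  (forall W, open W -> W a -> exists2 b, W b & regular_dim A p b) /\
  (exists W, [/\ open W, W a &
     forall b q, W b -> regular_dim A q b -> (q <= p)%N]).

Definition pure_dim A p := forall a, A a -> dim_at A a p.

Definition dim_lt A p := forall a q, A a -> dim_at A a q -> (q < p)%N.

Definition irreducible Om A :=
  [/\ analytic Om A, A !=set0 &
      forall A1 A2, analytic Om A1 -> analytic Om A2 ->
        A = A1 `|` A2 -> A = A1 \/ A = A2].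

Definition irr_component Om A B :=
  [/\ irreducible Om B, B `<=` A &
      forall B', irreducible Om B' -> B' `<=` A -> B `<=` B' -> B' = B].

(* The formal sum of the alpha_j C_j is encoded by its multiplicity function:
   alpha_j at C_j and 0 at the sets which do not occur. *)
Definition chain := set V -> nat.
Implicit Types Z : chain.

Definition chain_comps Z : set (set V) := [set B | Z B <> 0%N].

Definition chain_supp Z : set V := [set x | exists2 B, chain_comps Z B & B x].

Definition positive_chain Om p Z :=
  (forall B, chain_comps Z B -> irreducible Om B /\ pure_dim B p) /\
  (forall a, Om a -> exists W : set V,
     [/\ open W, W a & finite_set [set B | chain_comps Z B /\ B `&` W !=set0]]).

Definition set_chain Om A : chain :=
  fun B => if `[< irr_component Om A B >] then 1%N else 0%N.

(* The multiplicity k of the intersection product B . T at an isolated point b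
   of the intersection of sets of complementary dimensions: as in Draper and
   Chirka it is the sheet number at (b, b) of the projection of B x T along the
   diagonal, (x, y) |-> x - y, which is an analytic cover near (b, b) with
   critical set sigma. *)
Definition inter_mult (B T : set V) b (k : nat) :=
  exists (N : set (V * V)) (N' sigma : set V),
  let E := [set z | [/\ B z.1, T z.2 & N z]] in
  [/\ [/\ open N, N (b, b), open N' & N' 0],
      [/\ E (b, b), forall z, E z -> z.1 - z.2 = 0 -> z = (b, b),
          forall z, E z -> N' (z.1 - z.2) &
          forall K, compact K -> K `<=` N' ->
            compact [set z | E z /\ K (z.1 - z.2)]],
      analytic N' sigma /\ interior sigma = set0 &
      forall c, N' c -> ~ sigma c -> ([set z | E z /\ z.1 - z.2 = c] #= `I_k)%card].

Definition inter_deg Z T (d : nat) :=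
  finite_set (chain_supp Z `&` T) /\
  exists mu : set V -> V -> nat,
    (forall B b, chain_comps Z B -> B b -> T b -> inter_mult B T b (mu B b)) /\
    d = (\sum_(b \in chain_supp Z `&` T)
         \sum_(B \in [set B | chain_comps Z B /\ B b]) Z B * mu B b)%N.

Definition sets_cvg Om (Y_ : nat -> set V) (Y : set V) :=
  (forall a, Y a ->
     exists2 a_ : nat -> V, (forall nu, Y_ nu (a_ nu)) & a_ @ \oo --> a) /\
  (forall K, compact K -> K `<=` Om -> K `&` Y = set0 ->
     \forall nu \near \oo, K `&` Y_ nu = set0).

Definition chain_cvg Om p (Z_ : nat -> chain) Z :=
  [/\ forall nu, positive_chain Om p (Z_ nu), positive_chain Om p Z,
      sets_cvg Om (fun nu => chain_supp (Z_ nu)) (chain_supp Z) &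
      forall a T, regular (chain_supp Z) a -> submanifold Om (m - p) T ->
        T a -> transversal (chain_supp Z) T a -> relcompact_in T Om ->
        chain_supp Z `&` closure T = [set a] ->
        exists2 d, inter_deg Z T d &
          \forall nu \near \oo, inter_deg (Z_ nu) T d].

Definition pure_analytic Om p A := analytic Om A /\ pure_dim A p.

Definition sets_chain_cvg Om p (A_ : nat -> set V) A :=
  [/\ forall nu, pure_analytic Om p (A_ nu), pure_analytic Om p A &
      chain_cvg Om p (fun nu => set_chain Om (A_ nu)) (set_chain Om A)].

End AnalyticSets.

(* Nu is the neighbourhood of the graph of f on which Q is defined. *)
Definition solves n k q (Nu : set 'rV[C]_(n + k)) (Q : 'rV[C]_(n + k) -> 'rV[C]_q)
    (D : set 'rV[C]_n) (f : 'rV[C]_n -> 'rV[C]_k) :=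
  forall x, D x -> Nu (row_mx x (f x)) /\ Q (row_mx x (f x)) = 0.

Definition zeros_along n k (P : mpoly (n + k) C) (D : set 'rV[C]_n)
    (f : 'rV[C]_n -> 'rV[C]_k) : set 'rV[C]_n :=
  [set x | D x /\ evalmp P (row_mx x (f x)) = 0].

Definition adapted n k q (U : set 'rV[C]_n.+1) (f : 'rV[C]_n.+1 -> 'rV[C]_k)
    (Nu : set 'rV[C]_(n.+1 + k)) (Q : 'rV[C]_(n.+1 + k) -> 'rV[C]_q)
    (P : mpoly (n.+1 + k) C) :=
  (exists2 x, U x & evalmp P (row_mx x (f x)) <> 0) /\
  forall Ut U0 : set 'rV[C]_n.+1,
    open Ut -> open U0 -> Ut `<=` U -> relcompact_in U0 Ut ->
    (exists g : nat -> 'rV[C]_n.+1 -> 'rV[C]_k,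
       [/\ forall nu, nash Ut (g nu), loc_unif_cvg Ut g f &
           sets_chain_cvg Ut n (fun nu => zeros_along P Ut (g nu))
             (zeros_along P Ut f)]) ->
    exists f_ : nat -> 'rV[C]_n.+1 -> 'rV[C]_k,
      [/\ forall nu, nash U0 (f_ nu), {uniform U0, f_ @ \oo --> f} &
          forall nu, solves Nu Q U0 (f_ nu)].

(* Coefficients are listed from the highest power down:
   x_n^(d-1) b_0 + ... + b_(d-1). *)
Definition lowpoly (K : nzRingType) d (b : 'rV[K]_d) : {poly K} :=
  \sum_(i < d) b 0 i *: 'X^(d - i.+1).

Definition unipoly (K : nzRingType) d (a : 'rV[K]_d) : {poly K} :=
  'X^d + lowpoly a.

(* disc p = (-1)^(d(d-1)/2) Res(p, p') for p monic of degree d. *)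
Definition discr (K : comNzRingType) d (a : 'rV[K]_d) : K :=
  (-1) ^+ 'C(d, 2) * resultant (unipoly a) (unipoly a)^`().

(* The coefficients are those of W_1, ..., W_sh, of r_1, ..., r_k and of
   the remainders of the n components of phi, in this order; e_l is the exponent
   of W_l.  K is either C or a ring of polynomials containing the variables. *)
Section Coefficients.
Variables (sh : nat) (p e : 'I_sh -> nat) (k n d : nat).

Definition ncoef := (\sum_(l < sh) p l + (k * d + n * d))%N.

Definition pack_coef (K : nzRingType) (A : forall l, 'rV[K]_(p l))
    (B : 'M[K]_(k, d)) (D : 'M[K]_(n, d)) : 'rV[K]_ncoef :=
  row_mx (\mxrow_(l < sh) A l) (row_mx (mxvec B) (mxvec D)).

Definition coefA (K : nzRingType) (u : 'rV[K]_ncoef) l : 'rV[K]_(p l) :=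
  submxrow (lsubmx u) l.
Definition coefB (K : nzRingType) (u : 'rV[K]_ncoef) : 'M[K]_(k, d) :=
  vec_mx (lsubmx (rsubmx u)).
Definition coefC (K : nzRingType) (u : 'rV[K]_ncoef) : 'M[K]_(n, d) :=
  vec_mx (rsubmx (rsubmx u)).

(* The variables u, then S_1, ..., S_k and those of the components of phi. *)
Local Notation M := (mpoly (ncoef + (k + n)) C).
Definition var (i : 'I_(ncoef + (k + n))) : M := mpolyX C (mnm1 i).
Definition uvars : 'rV[M]_ncoef := \row_i var (lshift (k + n) i).

Definition genP : {poly M} := \prod_(l < sh) unipoly (coefA uvars l) ^+ e l.
Definition alpha (j : 'I_k) : {poly M} :=
  genP * (var (rshift ncoef (lshift n j)))%:P + lowpoly (row j (coefB uvars)).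
Definition beta (i : 'I_n) : {poly M} :=
  genP * (var (rshift ncoef (rshift k i)))%:P + lowpoly (row i (coefC uvars)).

Definition lift_u (t : mpoly ncoef C) : M :=
  mmap (@mpolyC _ C) (fun i => var (lshift (k + n) i)) t.

(* R(beta, alpha) = Wt P + x_n^(d-1) T_1 + ... + T_d with T_i in C[u]. *)
Definition remainder_coefs (P : mpoly (n + k) C) (T : 'I_d -> mpoly ncoef C) :=
  exists Wt : {poly M},
    mmap (fun c : C => (mpolyC _ c)%:P)
      (fun v : 'I_(n + k) => match fintype.split v with inl i => beta i | inr j => alpha j end) P
    = Wt * genP + lowpoly (\row_(i < d) lift_u (T i)).

End Coefficients.

Definition proj n (x : 'rV[C]_n.+1) : 'rV[C]_n := col' ord_max x.

Definition in_family1 k (U : set 'rV[C]_1) (f : 'rV[C]_1 -> 'rV[C]_k)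
    (P : mpoly (1 + k) C) (U0 : set 'rV[C]_1) :=
  open U0 /\
  exists V : set 'rV[C]_1,
    [/\ open V, V `<=` U, simply_connected V & relcompact_in U0 V].

(* "fam" is the family in dimension n+1; the result is that in dimension n+2. *)
Definition in_family_step n
    (fam : forall k, set 'rV[C]_n.+1 -> ('rV[C]_n.+1 -> 'rV[C]_k) ->
                     mpoly (n.+1 + k) C -> set 'rV[C]_n.+1 -> Prop)
    k (U : set 'rV[C]_n.+2) (f : 'rV[C]_n.+2 -> 'rV[C]_k)
    (P : mpoly (n.+2 + k) C) (U0 : set 'rV[C]_n.+2) :=
  open U0 /\
  exists (Uc Uh : set 'rV[C]_n.+2) (phi : 'rV[C]_n.+2 -> 'rV[C]_n.+2)
         (U1 : set 'rV[C]_n.+1),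
  let V0 := [set x | Uc x /\ U0 (phi x)] in
  [/\ [/\ domain Uh, Uh `<=` U, runge_domain Uc, biholomorphism Uc Uh phi &
          relcompact_in U0 Uh],
      domain U1 /\ (forall x, Uc x -> U1 (proj x)) &
      exists (d : nat) (w : 'rV[C]_n.+1 -> 'rV[C]_d),
      let W x := (unipoly (w (proj x))).[x 0 ord_max] in
      [/\ holo U1 w, forall x, U1 (proj x) -> W x = 0 -> Uc x,
          exists H : 'rV[C]_n.+2 -> C,
            [/\ holo Uc H, forall x, closure V0 x -> H x <> 0 &
                forall x, Uc x ->
                  evalmp P (row_mx (phi x) (f (phi x))) = H x * W x] &
          exists (Hf : 'rV[C]_n.+2 -> 'rV[C]_k) (B : 'rV[C]_n.+1 -> 'M[C]_(k, d))
                 (Hphi : 'rV[C]_n.+2 -> 'rV[C]_n.+2)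
                 (D : 'rV[C]_n.+1 -> 'M[C]_(n.+2, d))
                 (sh : nat) (p e : 'I_sh -> nat)
                 (A : forall l, 'rV[C]_n.+1 -> 'rV[C]_(p l))
                 (T : 'I_d -> mpoly (ncoef p k n.+2 d) C)
                 (S : mpoly (n.+1 + ncoef p k n.+2 d) C),
          let g x' := pack_coef (fun l => A l x') (B x') (D x') in
          let zeroA l := [set x : 'rV[C]_n.+2 |
            U1 (proj x) /\ (unipoly (A l (proj x))).[x 0 ord_max] = 0] in
          [/\ [/\ holo Uc Hf, holo U1 B & forall x, Uc x -> forall j,
                 f (phi x) 0 j = W x * Hf x 0 j
                   + (lowpoly (row j (B (proj x)))).[x 0 ord_max]],
              [/\ holo Uc Hphi, holo U1 D & forall x, Uc x -> forall i,
                 phi x 0 i = W x * Hphi x 0 i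
                   + (lowpoly (row i (D (proj x)))).[x 0 ord_max]],
              [/\ forall l, (0 < e l)%N,
                  forall l, holo U1 (A l) /\
                    (exists2 x', U1 x' & discr (A l x') <> 0),
                  forall l l', l != l' ->
                    dim_lt (zeroA l `&` zeroA l') n.+1 &
                  forall x', U1 x' ->
                    unipoly (w x') = \prod_(l < sh) unipoly (A l x') ^+ e l],
              remainder_coefs e P T &
              adapted U1 g setT
                (fun y => \row_(i < d) evalmp (T i) (rsubmx y)) S /\
              fam _ U1 g S (@proj n.+1 @` V0)]]].

(* The dimension of the ambient space C^(n+1) of U is n+1. *)
Fixpoint in_family n : forall k, set 'rV[C]_n.+1 -> ('rV[C]_n.+1 -> 'rV[C]_k) ->
    mpoly (n.+1 + k) C -> set 'rV[C]_n.+1 -> Prop :=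
  match n with
  | 0 => in_family1
  | n'.+1 => in_family_step (@in_family n')
  end.

End ComplexAnalysis.

(* Main.v *)
(* Induction on the dimension. For n = 1, Runge's theorem and interpolation at the zeros of R(x, f(x)) give rational
   maps close to f for which R(x, g(x)) has exactly the same zeros, and adaptedness applies. In the inductive step the
   coefficients g of the W_l and of the remainders satisfy T(g) = 0, and the induction hypothesis gives Nash g^nu -> g with
   T(g^nu) = 0. In the division formulas replace g by g^nu and the quotients H by polynomials, which is possible since the
   domain is Runge: this gives phi^nu -> phi and F^nu -> f o phi with R(phi^nu, F^nu) = (unit) W^nu. The map
   phi^-1 o phi^nu is close to the identity, so phi^nu is invertible and f^nu = F^nu o (phi^nu)^-1 is defined; it is Nash because
   n + 1 polynomials in n variables and algebraic functions are algebraically dependent (a count of monomials). The zero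
   set of R(x, f^nu(x)) is that of W^nu transported by phi^nu, hence of a monic polynomial whose discriminant does not vanish
   identically. Such zero sets converge as chains: their regular points are simple zeros, so all multiplicities are one
   and the degrees come from the implicit function theorem. So adaptedness of R applies to the f^nu. *)
From HB Require Import structures.
From Pilot Require Import Defs.
From mathcomp Require Import all_boot all_order all_algebra.
From mathcomp.real_closed Require Import complex.
From mathcomp Require Import all_classical all_reals all_analysis.
From mathcomp Require Import -(notations) mpoly.
From mathcomp Require Import ring lra zify.
Import Pilot.Defs.
Set Implicit Arguments.
Unset Strict Implicit.
Unset Printing Implicit Defensive.
Import Order.TTheory GRing.Theory Num.Theory.
Import numFieldNormedType.Exports.
Local Open Scope classical_set_scope.
Local Open Scope ring_scope.

Local Notation Re := complex.Re.
Local Notation Im := complex.Im.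
Local Notation min := Order.min.
Local Notation nmod := normedModType.
Local Notation hol f x := (differentiable f x).
Local Notation hol_cst := differentiable_cst.
Local Notation holD := differentiableD.
Local Notation holM := differentiableM.
Local Notation holB := differentiableB.
Local Notation diff_compo f g := (@differentiable_comp _ _ _ _ f g).
Local Notation diff_cont := differentiable_continuous.
Local Ltac clra := clear; lra.

(** * Real-valued norms and calculus with explicit bounds *)

Section RealNorm.
Variable R : realType. Local Notation C := (cplx R).

(** Irreducible components are global, while only the local form of a hypersurface is under control.
    They are therefore described from inside: the smooth zeros fall into minimal relatively clopen
    classes, and a component is the closure of one class. Such a closure is analytic because, where
    the discriminant does not vanish, the product of [t - z] over the roots z of one class is
    holomorphic in t and the parameters, and Riemann's theorem extends it. The record [good] keeps
    what this yields, in a form invariant under biholomorphic maps: the zero set of R(x, f^nu(x)) is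
    that of a monic polynomial only after transport.

    Convergence of sets asks for a point in every member of the sequence, so indices whose zero set
    could be empty are dropped. The induction runs on a neighbourhood of the closure of U_0, which
    leaves room for the shrinking that the inversion of phi^nu costs. The function theory rests on
    midpoint sums over squares, where [ker n], the sum of 1/w, stands in for 2 pi i. *)

Definition rc (r : R) : C := real_complex R r.

Lemma rcD a b : rc (a + b) = rc a + rc b. Proof. exact: (rmorphD (real_complex R)). Qed.
Lemma rcB a b : rc (a - b) = rc a - rc b. Proof. exact: (rmorphB (real_complex R)). Qed.
Lemma rcM a b : rc (a * b) = rc a * rc b. Proof. exact: (rmorphM (real_complex R)). Qed.
Lemma rcV a : rc a^-1 = (rc a)^-1. Proof. exact: (fmorphV (real_complex R)). Qed.
Lemma rc0 : rc 0 = 0. Proof. exact: (rmorph0 (real_complex R)). Qed.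
Lemma rc1 : rc 1 = 1. Proof. exact: (rmorph1 (real_complex R)). Qed.
Lemma rc_nat n : rc n%:R = n%:R. Proof. exact: (rmorph_nat (real_complex R)). Qed.
Lemma rc_eq0 a : (rc a == 0) = (a == 0).
Proof. by rewrite -rc0 (inj_eq (@complexI R)). Qed.
Lemma rc_le a b : (rc a <= rc b) = (a <= b). Proof. exact: lecR. Qed.
Lemma rc_lt a b : (rc a < rc b) = (a < b). Proof. exact: ltcR. Qed.
Lemma rc_ge0K (z : C) : 0 <= z -> z = rc (Re z).
Proof. by move=> z0; rewrite /rc /= (RRe_real (ger0_real z0)). Qed.
Lemma norm_rc a : `|rc a| = rc `|a|.
Proof.
by rewrite /rc; have := normc_def (real_complex R a); rewrite /= expr0n addr0 sqrtr_sqr.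
Qed.

(** The norm of a normed module over C takes values in C, where the order is partial. Its real part
    carries the same information and is open to real linear arithmetic. *)
Definition nm (V : nmod C) (x : V) : R := Re (`|x| : C).

Section Generic.
Variable V : nmod C.
Implicit Types x y z : V.

Lemma nmE x : `|x| = rc (nm x).
Proof. exact: rc_ge0K. Qed.
Lemma nm_ge0 x : 0 <= nm x.
Proof. by rewrite -rc_le -nmE rc0. Qed.
Lemma nm0 : nm (0 : V) = 0.
Proof. by apply: (@complexI R); rewrite -[LHS]/(rc _) -nmE normr0. Qed.
Lemma nm_eq0 x : (nm x == 0) = (x == 0).
Proof. by rewrite -rc_eq0 -nmE normr_eq0. Qed.
Lemma nm_gt0 x : (0 < nm x) = (x != 0).
Proof. by rewrite lt_def nm_ge0 nm_eq0 andbT. Qed.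
Lemma nmN x : nm (- x) = nm x.
Proof. by rewrite /nm normrN. Qed.
Lemma nmC x y : nm (x - y) = nm (y - x).
Proof. by rewrite -nmN opprB. Qed.
Lemma nmD x y : nm (x + y) <= nm x + nm y.
Proof. by rewrite -rc_le rcD -!nmE ler_normD. Qed.
Lemma nmB x y : nm (x - y) <= nm x + nm y.
Proof. by rewrite -[nm y]nmN nmD. Qed.
Lemma nm_tri z x y : nm (x - y) <= nm (x - z) + nm (z - y).
Proof. by rewrite -[x - y](subrKA z) nmD. Qed.
Lemma nm_sub x y : nm x - nm y <= nm (x - y).
Proof. by rewrite lerBlDr -[X in nm X <= _](subrK y) nmD. Qed.
Lemma nmZ (a : C) x : nm (a *: x) = nm a * nm x.
Proof. by apply: (@complexI R); rewrite -![LHS]/(rc _) -nmE normrZ !nmE -rcM. Qed.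
Lemma nm_sum (I : Type) (r : seq I) (P : pred I) (F : I -> V) :
 nm (\sum_(i <- r | P i) F i) <= \sum_(i <- r | P i) nm (F i).
Proof.
elim/big_ind2: _ => [|x1 x2 y1 y2 h1 h2|//]; first by rewrite nm0.
by rewrite (le_trans (nmD _ _)) // lerD.
Qed.

End Generic.

Lemma nmM (a b : C) : nm (a * b) = nm a * nm b.
Proof. exact: (@nmZ C). Qed.
Lemma nm1 : nm (1 : C) = 1.
Proof. by rewrite /nm normr1. Qed.
Lemma nmX (a : C) n : nm (a ^+ n) = nm a ^+ n.
Proof. by elim: n => [|n IH]; rewrite ?expr0 ?nm1 // !exprS nmM IH. Qed.
Lemma nmV (a : C) : nm a^-1 = (nm a)^-1.
Proof.
have [->|a0] := eqVneq a 0; first by rewrite invr0 nm0 invr0.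
by apply: (mulfI (x := nm a)); rewrite ?nm_eq0 // -nmM !mulfV ?nm1 // nm_eq0.
Qed.
Lemma nm_rc a : nm (rc a) = `|a|.
Proof. by rewrite /nm norm_rc. Qed.
Lemma nm_nat n : nm (n%:R : C) = n%:R.
Proof. by rewrite -rc_nat nm_rc ger0_norm. Qed.
Lemma nm_i : nm ('i%C : C) = 1.
Proof. by rewrite /nm normc_def /= expr0n add0r expr1n sqrtr1. Qed.
Lemma Re_le_nm (z : C) : `|Re z| <= nm z.
Proof. by rewrite -rc_le -nmE; exact: normc_ge_Re. Qed.
Lemma Im_le_nm (z : C) : `|Im z| <= nm z.
Proof.
have <- : Re (- ('i%C * z)) = Im z.
 by case: z => a b /=; rewrite mul0r mul1r sub0r opprK.
by rewrite (le_trans (Re_le_nm _)) // nmN nmM nm_i mul1r.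
Qed.
Lemma nm_ReIm (z : C) : nm z <= `|Re z| + `|Im z|.
Proof.
rewrite [z in nm z]complexE (le_trans (nmD _ _)) // nmM nm_i mul1r.
by rewrite -![real_complex_def _ _]/(rc _) !nm_rc.
Qed.

Lemma nbhs_rP (V : nmod C) (x : V) (A : set V) :
 nbhs x A <-> exists2 e : R, 0 < e & forall y, nm (y - x) < e -> A y.
Proof.
split.
 move=> /nbhs_ballP[e /= e0 h]; exists (Re e).
  by rewrite -rc_lt rc0 -rc_ge0K // ltW.
 move=> y xy; apply: h; rewrite -ball_normE /= distrC nmE (rc_ge0K (ltW e0)).
 by rewrite rc_lt.
move=> [e e0 h]; apply/nbhs_ballP; exists (rc e); first by rewrite /= -rc0 rc_lt.
by move=> y; rewrite -ball_normE /= distrC nmE rc_lt; exact: h.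
Qed.

Lemma open_rP (V : nmod C) (A : set V) :
 open A <-> forall x, A x -> exists2 e : R, 0 < e & forall y, nm (y - x) < e -> A y.
Proof.
rewrite openE; split=> h x Ax; first by apply/nbhs_rP; exact: h.
by rewrite /interior; apply/nbhs_rP; exact: h.
Qed.

Lemma cvg_rP (V : nmod C) (u : nat -> V) (l : V) :
 u @ \oo --> l <->
 forall e : R, 0 < e -> exists N, forall n, (N <= n)%N -> nm (u n - l) < e.
Proof.
split=> [h e e0|h A /nbhs_rP[e e0 eA]].
 have : nbhs l [set y | nm (y - l) < e] by apply/nbhs_rP; exists e.
 by move/h => [N _ NP]; exists N => n /NP.
have [N NP] := h e e0; exists N => // n /= Nn; exact/eA/NP.
Qed.

Lemma near_oo_rP (P : nat -> Prop) :
 (\forall n \near \oo, P n) <-> exists N, forall n, (N <= n)%N -> P n.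
Proof.
split=> [[N _ h]|[N h]]; first by exists N => n /h.
by exists N => // n /= /h.
Qed.

Lemma uniform_rP (U : choiceType) (V : nmod C) (W : set U)
  (g : nat -> U -> V) (f : U -> V) :
 {uniform W, g @ \oo --> f} <->
 forall e : R, 0 < e -> exists N, forall n, (N <= n)%N ->
  forall x, W x -> nm (g n x - f x) < e.
Proof.
split.
 move=> h e e0.
 have : nbhs (f : {uniform` W -> V}) [set h | forall x, W x -> nm (h x - f x) < e].
  apply/uniform_nbhs; exists [set xy : V * V | `|xy.1 - xy.2| < rc e]; split.
   apply: (@filterS _ _ _ [set xy | ball xy.1 (rc e) xy.2]).
    by move=> xy; rewrite -ball_normE.
   by rewrite -entourage_ballE; exists (rc e) => //=; rewrite -rc0 rc_lt.
  by move=> k hk x Wx; have := hk x Wx; rewrite /= nmE rc_lt nmC.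
 move=> nb; have [N _ NP] := h _ nb; exists N => n Nn; exact: (NP n Nn).
move=> h A nA; have [E [entE EA]] := (uniform_nbhs (f : {uniform` W -> V}) A).1 nA.
move: entE; rewrite -entourage_ballE => -[e /= e0 eE].
have := h (Re e); rewrite -rc_lt rc0 -rc_ge0K ?ltW // => /(_ e0)[N NP].
exists N => // n /= Nn; apply: EA => x Wx; apply: eE => /=.
rewrite -ball_normE /= (rc_ge0K (ltW e0)) nmE rc_lt nmC; exact: NP.
Qed.

Lemma continuous_rP (V W : nmod C) (f : V -> W) x :
 {for x, continuous f} <->
 forall e : R, 0 < e -> exists2 d : R, 0 < d &
  forall y, nm (y - x) < d -> nm (f y - f x) < e.
Proof.
split=> [h e e0|h A /nbhs_rP[e e0 eA]].
 have : nbhs (f x) [set z | nm (z - f x) < e] by apply/nbhs_rP; exists e.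
 by move/h/nbhs_rP.
apply/nbhs_rP; have [d d0 dP] := h e e0; exists d => // y /dP; exact: eA.
Qed.

End RealNorm.

Section Differential.
Variable R : realType. Local Notation C := (cplx R).
Variables V W : nmod C.

Lemma diff_rP (f : V -> W) x : hol f x ->
 forall e : R, 0 < e -> exists2 d : R, 0 < d &
  forall h, nm h < d -> nm (f (x + h) - f x - 'd f x h) <= e * nm h.
Proof.
move=> /diff_locally /eqaddoP df e e0.
have /df /nbhs_rP[d d0 dP] : 0 < rc e by rewrite -rc0 rc_lt.
exists d => // h hd.
have := dP h; rewrite subr0 => /(_ hd).
rewrite /= !fctE /= !nmE -rcM rc_le.
by rewrite [h + x]addrC opprD addrA.
Qed.

Lemma linear_cont (f : {linear V -> W}) (K : R) :
 (forall v, nm (f v) <= K * nm v) -> continuous f.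
Proof.
move=> fK x; apply/continuous_rP => e e0.
have K1 : 0 < `|K| + 1 by rewrite ltr_wpDl.
exists (e / (`|K| + 1)); first by rewrite divr_gt0.
move=> y yx; rewrite -linearB (le_lt_trans (fK _)) //.
rewrite ltr_pdivlMr // in yx; apply: le_lt_trans yx.
rewrite mulrC ler_wpM2l ?nm_ge0 //.
by rewrite (le_trans (ler_norm K)) // lerDl.
Qed.

Lemma cont_linear (f : {linear V -> W}) : continuous f ->
 exists2 K : R, 0 < K & forall v, nm (f v) <= K * nm v.
Proof.
move=> /linear_lipschitz[k k0 kP]; exists (Re k).
 by rewrite -rc_lt -rc_ge0K ?rc0 // ltW.
by move=> v; rewrite -rc_le rcM -!nmE -rc_ge0K // ltW.
Qed.

Lemma diff_bound (f : V -> W) x : hol f x ->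
 exists2 K : R, 0 < K & forall v, nm ('d f x v) <= K * nm v.
Proof. by move=> /diff_continuous; exact: cont_linear. Qed.

(** The spaces are arbitrary normed modules, so the continuity of [L] has to come from the bound
    [K]; the second hypothesis then identifies [L] as the differential. *)
Lemma rP_diff (f : V -> W) x (L : {linear V -> W}) (K : R) :
 (forall v, nm (L v) <= K * nm v) ->
 (forall e : R, 0 < e -> exists2 d : R, 0 < d &
  forall h, nm h < d -> nm (f (x + h) - f x - L h) <= e * nm h) ->
 hol f x /\ 'd f x = L :> (V -> W).
Proof.
move=> /linear_cont Lc h.
have hL : f \o shift x = cst (f x) + L +o_ 0 id.
 apply/eqaddoP => e e0; apply/nbhs_rP.
 have e0' : 0 < Re e by rewrite -rc_lt -rc_ge0K ?rc0 // ltW.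
 have [d d0 dP] := h _ e0'; exists d => // y; rewrite subr0 => /dP.
 rewrite -rc_le rcM -!nmE -rc_ge0K /=; last exact: ltW.
 rewrite -[X in _ -> `|X| <= _]/(f (y + x) - (f x + L y)).
 by rewrite [y + x]addrC opprD addrA.
have dE := diff_unique Lc hL; split=> //.
by apply/diff_locallyP; rewrite dE.
Qed.

End Differential.

Section Complete.
Variable R : realType. Local Notation C := (cplx R).

Lemma cauchy_real (u : nat -> R) :
 (forall e : R, 0 < e -> exists N, forall m n, (N <= m)%N -> (N <= n)%N -> `|u m - u n| < e) ->
 exists l, forall e : R, 0 < e -> exists N, forall n, (N <= n)%N -> `|u n - l| < e.
Proof.
move=> h; have : cvg (u @ \oo).
 apply/cauchy_cvgP/cauchy_exP => e /h[N NP]; exists (u N), N => // n /= Nn.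
 by rewrite -ball_normE /=; exact: NP.
move=> /cvgrPdist_lt uP; exists (lim (u @ \oo)) => e /uP[N _ NP]; exists N => n /NP.
by rewrite distrC.
Qed.

Lemma cauchy_cplx (u : nat -> C) :
 (forall e : R, 0 < e -> exists N, forall m n, (N <= m)%N -> (N <= n)%N -> nm (u m - u n) < e) ->
 exists l : C, u @ \oo --> l.
Proof.
move=> h.
have [a aP] : exists a, forall e : R, 0 < e -> exists N, forall n, (N <= n)%N -> `|Re (u n) - a| < e.
 apply: cauchy_real => e /h[N NP]; exists N => m n /NP/[apply].
 by apply: le_lt_trans; rewrite (le_trans _ (Re_le_nm _)) // raddfB.
have [b bP] : exists a, forall e : R, 0 < e -> exists N, forall n, (N <= n)%N -> `|Im (u n) - a| < e.
 apply: cauchy_real => e /h[N NP]; exists N => m n /NP/[apply].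
 by apply: le_lt_trans; rewrite (le_trans _ (Im_le_nm _)) // raddfB.
exists (Complex a b); apply/cvg_rP => e e0.
have e2 : 0 < e / 2 by lra.
have [N1 N1P] := aP _ e2; have [N2 N2P] := bP _ e2.
exists (maxn N1 N2) => n; rewrite geq_max => /andP[/N1P h1 /N2P h2].
apply: (le_lt_trans (nm_ReIm _)).
have -> : Re (u n - Complex a b) = Re (u n) - a by case: (u n).
have -> : Im (u n - Complex a b) = Im (u n) - b by case: (u n).
lra.
Qed.

Section Mx.
Variables m n : nat.
Implicit Types A : 'M[C]_(m, n).

Lemma nm_mxij A i j : nm (A i j) <= nm A.
Proof.
rewrite -rc_le -!nmE; have -> : `|A| = mx_norm A by [].
rewrite mx_normE -[leLHS]nngE num_le.
exact: (@le_bigmax _ _ _ 0%:nng%R (fun ij : 'I_m * 'I_n => `|A ij.1 ij.2|%:nng) (i, j)).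
Qed.

Lemma nm_mx_le A (r : R) : 0 <= r -> (forall i j, nm (A i j) <= r) -> nm A <= r.
Proof.
move=> r0 h; rewrite -rc_le -nmE.
have [->|] := eqVneq `|A| 0; first by rewrite -rc0 rc_le.
have -> : `|A| = mx_norm A by [].
by move=> /mx_norm_neq0[[i j]] /= ->; rewrite nmE rc_le.
Qed.

Lemma nm_mx_lt A (r : R) : 0 < r -> (forall i j, nm (A i j) < r) -> nm A < r.
Proof.
move=> r0 h; rewrite -rc_lt -nmE.
have [->|] := eqVneq `|A| 0; first by rewrite -rc0 rc_lt.
have -> : `|A| = mx_norm A by [].
by move=> /mx_norm_neq0[[i j]] /= ->; rewrite nmE rc_lt.
Qed.

Lemma cauchy_mx (u : nat -> 'M[C]_(m, n)) :
 (forall e : R, 0 < e -> exists N, forall p q, (N <= p)%N -> (N <= q)%N -> nm (u p - u q) < e) ->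
 exists l : 'M[C]_(m, n), u @ \oo --> l.
Proof.
move=> h.
have /choice[l lP] : forall ij : 'I_m * 'I_n, exists l : C, (fun p => u p ij.1 ij.2) @ \oo --> l.
 move=> [i j]; apply: cauchy_cplx => e /h[N NP]; exists N => p q /NP/[apply].
 by apply: le_lt_trans => /=; have := nm_mxij (u p - u q) i j; rewrite !mxE.
exists (\matrix_(i, j) l (i, j)); apply/cvg_rP => e e0.
have /choice[N NP] : forall ij, exists N, forall p, (N <= p)%N -> nm (u p ij.1 ij.2 - l ij) < e.
 by move=> ij; have /cvg_rP/(_ e e0) := lP ij.
exists (\max_ij N ij) => p Np; apply: nm_mx_lt => // i j; rewrite !mxE.
by apply: (NP (i, j)); apply: leq_trans Np; exact: (leq_bigmax (i, j)).
Qed.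

End Mx.
End Complete.

Section Compact.
Variable R : realType. Local Notation C := (cplx R).

Lemma nm_continuous (V : nmod C) : continuous (@nm R V).
Proof.
move=> z A /nbhs_ballP[e /= e0 eA]; apply/(@nbhs_rP R V z (@nm R V @^-1` A)); exists e => // y yz; apply: eA => /=.
rewrite -ball_normE /= ltr_norml.
have := nm_sub y z; have := nm_sub z y; rewrite [nm (z - y)]nmC => h1 h2.
by apply/andP; split; lra.
Qed.

Lemma ball_compact_cplx (r : R) : compact [set z : C | nm z <= r].
Proof.
have cK : compact ((fun p : R * R => (Complex p.1 p.2 : C)) @` (`[- r, r] `*` `[- r, r])).
 apply: continuous_compact; last by apply: compact_setX; exact: segment_compact.
 apply: continuous_subspaceT => -[a b] A nA.
 have [e e0 eA] := (@nbhs_rP R C _ A).1 nA.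
 have e2 : 0 < e / 2 by lra.
 exists ([set x | `|a - x| < e / 2], [set x | `|b - x| < e / 2]).
  by split; apply/nbhs_ballP; exists (e / 2) => //= x; rewrite -ball_normE.
 move=> [x y] /= [xa yb]; apply: eA; apply: (le_lt_trans (nm_ReIm _)) => /=.
 by rewrite distrC [X in _ + X]distrC; lra.
apply: subclosed_compact cK _.
 apply: (@closed_comp _ _ (@nm R C) [set x | x <= r]).
  by move=> z _; exact: nm_continuous.
 exact: closed_le.
move=> z /= zr; exists (Re z, Im z); last by case: z {zr}.
have := le_trans (Re_le_nm z) zr; have := le_trans (Im_le_nm z) zr.
by rewrite /= !in_itv /= !ler_norml => -> ->.
Qed.

Lemma closed_rball (V : nmod C) (a : V) (r : R) : closed [set x | nm (x - a) <= r].
Proof.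
apply: (@closed_comp _ _ (fun x : V => nm (x - a)) [set x | x <= r]); last exact: closed_le.
move=> z _; apply: (@continuous_comp _ _ _ (fun x => x - a) (@nm R V)).
 by apply: cvgB; [exact: cvg_id|exact: cvg_cst].
exact: nm_continuous.
Qed.

Lemma open_rball (V : nmod C) (a : V) (r : R) : open [set x | nm (x - a) < r].
Proof.
apply/open_rP => x /= xa; exists (r - nm (x - a)); first by rewrite subr_gt0.
by move=> y yx; rewrite (le_lt_trans (nm_tri x _ _)) //; lra.
Qed.

Lemma ball_compact n (r : R) : compact [set z : 'rV[C]_n | nm z <= r].
Proof.
have [r0|r0] := ltP r 0.
 rewrite (_ : mkset _ = set0); first exact: compact0.
 by rewrite predeqE => x; split=> //= xr; have := nm_ge0 x; lra.
rewrite (_ : mkset _ = [set v : 'rV[C]_n | forall i, [set z : C | nm z <= r] (v ord0 i)]).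
 by apply: (@rV_compact C n (fun=> [set z : C | nm z <= r])) => i; exact: ball_compact_cplx.
rewrite predeqE => x; split=> /= h; first by move=> i; exact: le_trans (nm_mxij _ _ _) h.
by apply: nm_mx_le => // i j; rewrite (ord1 i).
Qed.

Lemma bounded_closed_cpt n (A : set 'rV[C]_n) (r : R) :
 closed A -> (forall x, A x -> nm x <= r) -> compact A.
Proof. by move=> cA h; apply: (subclosed_compact cA (@ball_compact n r)). Qed.

Lemma compact_is_closed (V : nmod C) (K : set V) : compact K -> closed K.
Proof. exact: compact_closed (@norm_hausdorff _ _). Qed.

(** The form in which compactness is used for sequences: a threshold valid near each point gives one
    valid on all of [K], by the covering property for the filter at infinity. *)
Lemma compact_eventually (V : nmod C) (K : set V) (P : nat -> V -> Prop) :
 compact K ->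
 (forall x, K x -> exists2 e : R, 0 < e & exists N, forall n, (N <= n)%N ->
   forall y, nm (y - x) < e -> P n y) ->
 exists N, forall n, (N <= n)%N -> forall y, K y -> P n y.
Proof.
move=> /compact_near_coveringP cK h.
have [//|N _ NP] := cK nat \oo P _ _; last by exists N => n /NP.
move=> x Kx; have [e e0 [N NP]] := h x Kx.
exists ([set y | nm (y - x) < e], [set n | (N <= n)%N]).
 by split; [apply/nbhs_rP; exists e|exists N].
by move=> [y n] /= [? ?]; exact: NP.
Qed.

Lemma arch_inv (e : R) : 0 < e -> exists N : nat, forall n, (N <= n)%N -> n.+1%:R^-1 < e.
Proof.
move=> e0; have [N /andP[_ Ne]] : exists N : nat, (0%N <= N)%N && (e^-1 < N%:R).
 by exists (Num.bound e^-1); rewrite leq0n /=; apply: archi_boundP; rewrite invr_ge0 ltW.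
exists N => n Nn; rewrite invf_plt ?posrE ?ltr0n //.
by apply: lt_le_trans Ne _; rewrite ler_nat (leq_trans Nn).
Qed.

Lemma compact_radius (V : nmod C) (K : set V) (P : R -> V -> Prop) :
 compact K ->
 (forall x, K x -> exists2 e : R, 0 < e & forall d, 0 < d -> d < e ->
   forall y, nm (y - x) < e -> P d y) ->
 exists2 e : R, 0 < e & forall d, 0 < d -> d < e -> forall y, K y -> P d y.
Proof.
move=> cK h.
have [|N NP] := @compact_eventually _ K
  (fun n y => forall d, 0 < d -> d < n.+1%:R^-1 -> P d y) cK.
 move=> x /h[e e0 eP]; exists e => //; have [N NP] := arch_inv e0; exists N => n Nn y yx d d0 dn.
 by apply: eP => //; apply: lt_trans dn _; exact: NP.
exists N.+1%:R^-1; first by rewrite invr_gt0.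
by move=> d d0 dN y Ky; exact: (NP N).
Qed.

Lemma compact_upper (V W : nmod C) (K : set V) (f : V -> W) :
 compact K -> (forall x, K x -> {for x, continuous f}) ->
 exists2 M : R, 0 < M & forall x, K x -> nm (f x) <= M.
Proof.
move=> cK fc; have [|N NP] := @compact_eventually _ K (fun n y => nm (f y) <= n%:R) cK.
 move=> x /fc /continuous_rP/(_ 1 ltr01)[e e0 eP]; exists e => //.
 exists (Num.bound (nm (f x) + 1)) => n Nn y /eP fxy.
 have h1 := nm_sub (f y) (f x).
 have h2 : nm (f x) + 1 < n%:R.
  apply: lt_le_trans (archi_boundP _) _; first by rewrite addr_ge0 ?nm_ge0.
  by rewrite ler_nat.
 lra.
exists N.+1%:R; first by rewrite ltr0n.
exact: (NP N.+1 (leqnSn N)).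
Qed.

Lemma compact_lower (V W : nmod C) (K : set V) (f : V -> W) :
 compact K -> (forall x, K x -> {for x, continuous f}) -> (forall x, K x -> f x != 0) ->
 exists2 c : R, 0 < c & forall x, K x -> c <= nm (f x).
Proof.
move=> cK fc f0; have [|e e0 eP] := @compact_radius _ K (fun d y => d <= nm (f y)) cK.
 move=> x Kx; have fx0 : 0 < nm (f x) by rewrite nm_gt0 f0.
 have := fc _ Kx; move=> /continuous_rP/(_ (nm (f x) / 2)) [|e e0 eP]; first by lra.
 exists (min e (nm (f x) / 2)); first by rewrite lt_min e0 /=; lra.
 move=> d d0; rewrite lt_min => /andP[de df] y; rewrite lt_min => /andP[/eP ye _].
 have := nm_sub (f x) (f y); rewrite [nm (f x - f y)]nmC; lra.
by exists (e / 2); [lra|move=> x Kx; apply: eP => //; lra].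
Qed.

End Compact.

Section MeanValue.
Variable R : realType. Local Notation C := (cplx R).

(** A supremum argument in place of an integral. The times at which the bound with slope [K + e]
    holds contain their supremum s, because the local estimate at s reaches back; if s were less
    than 1, the same estimate would push past it. *)
Lemma real_path_lipschitz (W : nmod C) (phi : R -> W) (K : R) :
 (forall t, 0 <= t <= 1 -> forall e : R, 0 < e -> exists2 d : R, 0 < d &
   forall s, 0 <= s <= 1 -> `|s - t| < d -> nm (phi s - phi t) <= (K + e) * `|s - t|) ->
 nm (phi 1 - phi 0) <= K.
Proof.
move=> h; apply/ler_addgt0Pr => e e0.
pose S := [set t : R | 0 <= t <= 1 /\ nm (phi t - phi 0) <= (K + e) * t].
have S0 : S 0 by split; [lra|rewrite subrr nm0 mulr0].
have supS : has_sup S by split; [exists 0|exists 1 => t [/andP[]]].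
pose s := sup S.
have s01 : 0 <= s <= 1.
 apply/andP; split; first by apply: sup_upper_bound.
 by apply: ge_sup; [exists 0|move=> t [/andP[]]].
have [d d0 dP] := h _ s01 _ e0.
have Ss : S s.
 split=> //; have [t St ts] := sup_adherent d0 supS; have [t01 tP] := St.
 have ts2 : s - d < t := ts.
 have ts' : t <= s by apply: sup_upper_bound.
 have std : `|t - s| < d by rewrite distrC ger0_norm; lra.
 have := dP t t01 std; rewrite distrC ger0_norm ?subr_ge0 // => h1.
 rewrite (le_trans (nm_tri (phi t) _ _)) // nmC.
 by apply: (le_trans (lerD h1 tP)); lra.
have [s1|s1] := leP 1 s.
 have e1 : s = 1 by lra.
 by case: Ss => _; rewrite e1 mulr1.
have [t [st t1 td]] : exists t, [/\ s < t, t <= 1 & t <= s + d / 2].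
 exists (min 1 (s + d / 2)); split; last 2 first.
 - by rewrite ge_min lexx.
 - by rewrite ge_min lexx orbT.
 - by rewrite lt_min s1 /=; lra.
suff St : S t by have := sup_upper_bound supS St; rewrite -/s; lra.
have t01 : 0 <= t <= 1 by lra.
split=> //; have std : `|t - s| < d by rewrite ger0_norm; lra.
have := dP t t01 std; rewrite ger0_norm; last by lra.
case: Ss => _ h2 h1; rewrite (le_trans (nm_tri (phi s) _ _)) //.
by apply: (le_trans (lerD h1 h2)); lra.
Qed.

Lemma mean_value (V W : nmod C) (f : V -> W) (a b : V) (K : R) :
 (forall t, 0 <= t <= 1 -> hol f (a + rc t *: (b - a)) /\
   nm ('d f (a + rc t *: (b - a)) (b - a)) <= K) ->
 nm (f b - f a) <= K.
Proof.
move=> h; pose phi (t : R) := f (a + rc t *: (b - a)).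
have -> : f b = phi 1 by rewrite /phi rc1 scale1r subrKC.
have -> : f a = phi 0 by rewrite /phi rc0 scale0r addr0.
apply: real_path_lipschitz => t /h[df dK] e e0.
have ba := nm_ge0 (b - a).
have e1 : 0 < e / (nm (b - a) + 1) by rewrite divr_gt0 // ltr_wpDl.
have [d d0 dP] := diff_rP df e1.
have d1 : 0 < d / (nm (b - a) + 1) by rewrite divr_gt0 // ltr_wpDl.
exists (d / (nm (b - a) + 1)) => // s _ st.
have hE : nm (rc (s - t) *: (b - a)) = `|s - t| * nm (b - a) by rewrite nmZ nm_rc.
have lt1 : nm (rc (s - t) *: (b - a)) < d.
 rewrite hE; move: st; rewrite ltr_pdivlMr ?ltr_wpDl // => st; apply: le_lt_trans st.
 by rewrite ler_wpM2l // lerDl.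
have hx : a + rc t *: (b - a) + rc (s - t) *: (b - a) = a + rc s *: (b - a).
 by rewrite -addrA -scalerDl -rcD [t + _]addrC subrK.
have := dP _ lt1; rewrite hx linearZ /=.
rewrite -/(phi s) -/(phi t) hE => h1.
have h2 : nm (rc (s - t) *: 'd f (a + rc t *: (b - a)) (b - a)) <= `|s - t| * K.
 by rewrite nmZ nm_rc ler_wpM2l.
have h3 := nm_sub (phi s - phi t) (rc (s - t) *: 'd f (a + rc t *: (b - a)) (b - a)).
have h4 : e / (nm (b - a) + 1) * (`|s - t| * nm (b - a)) <= e * `|s - t|.
 rewrite mulrCA mulrC ler_wpM2r //.
 rewrite -[leRHS]mulr1 -mulrA ler_pM2l //.
 by rewrite mulrC ler_pdivrMr ?ltr_wpDl // mul1r lerDl.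
lra.
Qed.

Lemma ball_segment (V : nmod C) (c a b : V) (r t : R) : 0 <= t <= 1 ->
 nm (a - c) < r -> nm (b - c) < r -> nm (a + rc t *: (b - a) - c) < r.
Proof.
move=> /andP[t0 t1] ac bc.
have -> : a + rc t *: (b - a) - c = rc (1 - t) *: (a - c) + rc t *: (b - c).
 have -> : b - a = (b - c) - (a - c) by rewrite opprB addrA subrK.
 by rewrite addrAC rcB rc1 scalerBl scale1r scalerBr addrA addrAC.
apply: (le_lt_trans (nmD _ _)); rewrite !nmZ !nm_rc !ger0_norm ?subr_ge0 //.
have [xy|/ltW xy] := leP (nm (a - c)) (nm (b - c)).
 have : (1 - t) * nm (a - c) <= (1 - t) * nm (b - c) by rewrite ler_wpM2l ?subr_ge0.
 lra.
have : t * nm (b - c) <= t * nm (a - c) by rewrite ler_wpM2l.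
lra.
Qed.

End MeanValue.

(** * Cauchy's theory by midpoint sums over squares *)

Section MidpointSums.
Variable R : realType. Local Notation C := (cplx R).
Implicit Types (f g : C -> C) (a b c : C).

Definition ii : C := Complex 0 1.

(** The midpoint rule with 2^n equal steps for the integral of [f] from [a] to [b]. No limit is
    taken in the definition; integral theorems become statements about large n. *)
Fixpoint seg n f a b : C :=
 if n is n'.+1 then seg n' f a ((a + b) / 2) + seg n' f ((a + b) / 2) b
 else (b - a) * f ((a + b) / 2).

Definition on_seg a b w := exists2 t : R, 0 <= t <= 1 & w = a + rc t * (b - a).

Lemma two_neq0 : (2 : C) != 0. Proof. by rewrite pnatr_eq0. Qed.

Lemma on_seg_half1 a b w : on_seg a ((a + b) / 2) w -> on_seg a b w.
Proof.
move=> [t t01 ->]; exists (t / 2); first by lra.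
have := two_neq0; rewrite rcM rcV rc_nat => h; by field.
Qed.

Lemma on_seg_half2 a b w : on_seg ((a + b) / 2) b w -> on_seg a b w.
Proof.
move=> [t t01 ->]; exists ((1 + t) / 2); first by lra.
have := two_neq0; rewrite rcM rcV rc_nat rcD rc1 => h; by field.
Qed.

Lemma on_seg_mid a b : on_seg a b ((a + b) / 2).
Proof.
exists (2^-1); first by lra.
have := two_neq0; rewrite rcV rc_nat => h; by field.
Qed.

Lemma seg_anti n f a b : seg n f b a = - seg n f a b.
Proof.
elim: n a b => [|n IH] a b /=; first by rewrite [b + a]addrC -mulNr opprB.
by rewrite [b + a]addrC (IH ((a + b) / 2) b) (IH a ((a + b) / 2)); ring.
Qed.

Lemma eq_seg n f g a b : (forall w, on_seg a b w -> f w = g w) -> seg n f a b = seg n g a b.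
Proof.
elim: n a b => [|n IH] a b h /=; first by rewrite h //; exact: on_seg_mid.
by rewrite (IH a) ?(IH _ b) // => w hw; apply: h; [exact: on_seg_half2|exact: on_seg_half1].
Qed.

Lemma segD n f g a b : seg n (fun w => f w + g w) a b = seg n f a b + seg n g a b.
Proof. by elim: n a b => [|n IH] a b /=; [rewrite mulrDr|rewrite !IH; ring]. Qed.

Lemma segZ n f k a b : seg n (fun w => k * f w) a b = k * seg n f a b.
Proof. by elim: n a b => [|n IH] a b /=; [rewrite mulrCA|rewrite !IH; ring]. Qed.

Lemma seg_cst n k a b : seg n (fun=> k) a b = (b - a) * k.
Proof.
elim: n a b => [//|n IH] a b /=; rewrite !IH.
have := two_neq0 => h; by field.
Qed.

Lemma seg_id n a b : seg n id a b = (b ^+ 2 - a ^+ 2) / 2.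
Proof.
have h := two_neq0; elim: n a b => [|n IH] a b /=; last by rewrite !IH; field.
by rewrite /id; field.
Qed.

Lemma seg_mul n f k a b : seg n f (k * a) (k * b) = k * seg n (fun w => f (k * w)) a b.
Proof.
have h a' b' : (k * a' + k * b') / 2 = k * ((a' + b') / 2) by ring.
by elim: n a b => [|n IH] a b /=; [rewrite h; ring|rewrite h !IH; ring].
Qed.

Lemma seg_shift n f c a b : seg n f (c + a) (c + b) = seg n (fun w => f (c + w)) a b.
Proof.
have := two_neq0 => h0.
have h a' b' : (c + a' + (c + b')) / 2 = c + (a' + b') / 2 by field.
by elim: n a b => [|n IH] a b /=; [rewrite h; congr (_ * _); ring|rewrite h !IH].
Qed.

Lemma half_len a b : nm ((a + b) / 2 - a) = nm (b - a) / 2.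
Proof.
have -> : (a + b) / 2 - a = (b - a) / 2 by have := two_neq0 => h; field.
by rewrite nmM nmV nm_nat.
Qed.

Lemma half_len2 a b : nm (b - (a + b) / 2) = nm (b - a) / 2.
Proof.
have -> : b - (a + b) / 2 = (b - a) / 2 by have := two_neq0 => h; field.
by rewrite nmM nmV nm_nat.
Qed.

Lemma seg_bound n f a b (M : R) : (forall w, on_seg a b w -> nm (f w) <= M) ->
 nm (seg n f a b) <= M * nm (b - a).
Proof.
elim: n a b => [|n IH] a b h /=.
 by rewrite nmM mulrC ler_wpM2r ?nm_ge0 // h //; exact: on_seg_mid.
apply: (le_trans (nmD _ _)).
have h1 : nm (seg n f a ((a + b) / 2)) <= M * (nm (b - a) / 2).
 by rewrite -half_len; apply: IH => w /on_seg_half1/h.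
have h2 : nm (seg n f ((a + b) / 2) b) <= M * (nm (b - a) / 2).
 by rewrite -half_len2; apply: IH => w /on_seg_half2/h.
by apply: (le_trans (lerD h1 h2)); rewrite -mulrDr -splitr.
Qed.

Lemma on_seg_dist a b w w' : on_seg a b w -> on_seg a b w' -> nm (w - w') <= nm (b - a).
Proof.
move=> [t t01 ->] [s s01 ->].
have -> : a + rc t * (b - a) - (a + rc s * (b - a)) = rc (t - s) * (b - a) by rewrite rcB; ring.
rewrite nmM nm_rc ler_piMl ?nm_ge0 // ler_norml; apply/andP; split; lra.
Qed.

(** On each of the 2^n pieces, of length |b - a| / 2^n, refining changes the sum by at most L times
    the square of that length. *)
Lemma seg_lip n k f a b (L : R) : 0 <= L ->
 (forall w w', on_seg a b w -> on_seg a b w' -> nm (f w - f w') <= L * nm (w - w')) ->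
 nm (seg (n + k) f a b - seg n f a b) <= L * nm (b - a) ^+ 2 / 2 ^+ n.
Proof.
move=> L0; elim: n a b => [|n IH] a b h.
 have -> : seg (0 + k) f a b - seg 0 f a b = seg k (fun w => f w - f ((a + b) / 2)) a b.
  by rewrite segD seg_cst mulrN.
 rewrite expr0 divr1 expr2 mulrA; apply: seg_bound => w hw.
 apply: (le_trans (h _ _ hw (on_seg_mid _ _))); rewrite ler_wpM2l //.
 exact: on_seg_dist hw (on_seg_mid _ _).
rewrite addSn /=.
rewrite opprD addrACA (le_trans (nmD _ _)) //.
have h1 : nm (seg (n + k) f a ((a + b) / 2) - seg n f a ((a + b) / 2)) <= L * (nm (b - a) / 2) ^+ 2 / 2 ^+ n.
 by rewrite -half_len; apply: IH => w w' /on_seg_half1 hw /on_seg_half1 hw'; exact: h.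
have h2 : nm (seg (n + k) f ((a + b) / 2) b - seg n f ((a + b) / 2) b) <= L * (nm (b - a) / 2) ^+ 2 / 2 ^+ n.
 by rewrite -half_len2; apply: IH => w w' /on_seg_half2 hw /on_seg_half2 hw'; exact: h.
apply: (le_trans (lerD h1 h2)); rewrite le_eqVlt; apply/orP; left; apply/eqP.
have h3 : (2 : R) ^+ n != 0 by rewrite expf_neq0 // pnatr_eq0.
by rewrite [2 ^+ n.+1]exprS; field; rewrite h3.
Qed.

Definition sgb (s : bool) : C := if s then 1 else -1.
Definition cor (s t : bool) : C := sgb s + ii * sgb t.

(** The counterclockwise boundary sum over the square with centre [c] and half side [r], starting at
    the lower left corner. *)
Definition bd n f c r : C :=
 seg n f (c + r * cor false false) (c + r * cor true false) +
 seg n f (c + r * cor true false) (c + r * cor true true) +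
 seg n f (c + r * cor true true) (c + r * cor false true) +
 seg n f (c + r * cor false true) (c + r * cor false false).

Definition sum4 (F : bool -> bool -> C) :=
 F true true + F true false + F false true + F false false.

(** An exact identity without any limit: one level of subdivision of the edges produces the outer
    edges of the four quarter squares, and their inner edges are run through twice in opposite
    directions. *)
Lemma bd_split n f c r :
 bd n.+1 f c r = sum4 (fun s t => bd n f (c + r / 2 * cor s t) (r / 2)).
Proof.
have := two_neq0 => h.
rewrite /sum4 /bd /=.
pose P (x y : C) := c + r * (x + ii * y).
have e1 s t s' t' : c + r / 2 * cor s t + r / 2 * cor s' t' =
  P ((sgb s + sgb s') / 2) ((sgb t + sgb t') / 2).
 by rewrite /P /cor; field.
have e2 s t s' t' : (c + r * cor s t + (c + r * cor s' t')) / 2 =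
  P ((sgb s + sgb s') / 2) ((sgb t + sgb t') / 2).
 by rewrite /P /cor; field.
have e3 s t : c + r * cor s t = P (sgb s) (sgb t) by [].
rewrite !e1 !e2 !e3 /sgb.
have -> : (1 + 1) / 2 = 1 :> C by field.
have -> : (1 + -1) / 2 = 0 :> C by field.
have -> : (-1 + 1) / 2 = 0 :> C by field.
have -> : (-1 + -1) / 2 = -1 :> C by field.
rewrite (seg_anti n f (P 1 0) (P 0 0)) (seg_anti n f (P 0 1) (P 0 0)).
rewrite (seg_anti n f (P 0 (-1)) (P 0 0)) (seg_anti n f (P (-1) 0) (P 0 0)).
ring.
Qed.

Lemma bdD n f g c r : bd n (fun w => f w + g w) c r = bd n f c r + bd n g c r.
Proof. by rewrite /bd !segD; ring. Qed.

Lemma bdZ n f k c r : bd n (fun w => k * f w) c r = k * bd n f c r.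
Proof. by rewrite /bd !segZ; ring. Qed.

(** The midpoint rule is exact on affine functions, and these have a primitive. *)
Lemma bd_affine n c r (k l : C) : bd n (fun w => k + l * w) c r = 0.
Proof. by have h := two_neq0; rewrite bdD bdZ /bd !seg_cst !seg_id; field. Qed.

Definition sq c (r : R) w := `|Re (w - c)| <= r /\ `|Im (w - c)| <= r.

Lemma sq_norm c r w : sq c r w -> nm (w - c) <= 2 * r.
Proof. by move=> [h1 h2]; apply: (le_trans (nm_ReIm _)); lra. Qed.

Lemma norm_sq c r w : nm (w - c) <= r -> sq c r w.
Proof. by move=> h; split; apply: le_trans h; [exact: Re_le_nm|exact: Im_le_nm]. Qed.

Definition sgr (s : bool) : R := if s then 1 else -1.

Lemma cor_coord c (r : R) s t (x : R) :
 Re (c + rc r * cor s t) = Re c + r * sgr s /\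
 Im (c + rc r * cor s t) = Im c + r * sgr t.
Proof. by case: c => a b; case: s; case: t => /=; split; ring. Qed.

Lemma sq_sub c (r : R) s t w : sq (c + rc r * cor s t) r w ->
 (- r <= Re (w - c) - r * sgr s <= r) /\ (- r <= Im (w - c) - r * sgr t <= r).
Proof.
have [h1 h2] := cor_coord c r s t 0.
rewrite /sq !raddfB /= h1 h2 !ler_norml !opprD !addrA => -[H1 H2].
by split.
Qed.

(** The part of the closed square outside the open inscribed disc. It contains the boundary and is
    described by two inequalities instead of four edges. *)
Definition side c (r : R) w := sq c r w /\ r <= nm (w - c).

Lemma bd_side c (r : R) (s t s' t' : bool) w : 0 <= r -> (s == s') || (t == t') ->
 on_seg (c + rc r * cor s t) (c + rc r * cor s' t') w -> side c r w.
Proof.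
move=> r0 st [l l01 ->].
have -> : c + rc r * cor s t + rc l * (c + rc r * cor s' t' - (c + rc r * cor s t))
  = c + rc r * (Complex ((1 - l) * sgr s + l * sgr s') ((1 - l) * sgr t + l * sgr t') : C).
 have -> : (Complex ((1 - l) * sgr s + l * sgr s') ((1 - l) * sgr t + l * sgr t') : C) =
   (1 - rc l) * cor s t + rc l * cor s' t'.
  by case: s st; case: t => _; case: s'; case: t'; apply/eqP; rewrite eq_complex /=; apply/andP; split; apply/eqP; ring.
 ring.
rewrite /side /sq addrAC subrr add0r.
set x := _ + l * sgr s'; set y := _ + l * sgr t'.
have -> : Re (rc r * (Complex x y : C)) = r * x by rewrite /=; ring.
have -> : Im (rc r * (Complex x y : C)) = r * y by rewrite /=; ring.
have x1 : `|x| <= 1 by rewrite /x ler_norml; case: (s); case: (s') => /=; lra.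
have y1 : `|y| <= 1 by rewrite /y ler_norml; case: (t); case: (t') => /=; lra.
split; first by split; rewrite normrM ger0_norm // ler_piMr.
rewrite nmM nm_rc ger0_norm // ler_peMr //.
case/orP: st => /eqP e; subst.
 apply: le_trans (Re_le_nm _); rewrite /= /x.
 have -> : (1 - l) * sgr s' + l * sgr s' = sgr s' by ring.
 by case: (s'); rewrite /= ?normrN normr1.
apply: le_trans (Im_le_nm _); rewrite /= /y.
have -> : (1 - l) * sgr t' + l * sgr t' = sgr t' by ring.
by case: (t'); rewrite /= ?normrN normr1.
Qed.

Lemma eq_bd n f g c (r : R) : 0 <= r -> (forall w, side c r w -> f w = g w) ->
 bd n f c (rc r) = bd n g c (rc r).
Proof.
move=> r0 h; rewrite /bd; congr (_ + _ + _ + _); apply: eq_seg => w hw; apply: h;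
 by apply: bd_side hw.
Qed.

Lemma bd_edge n f c (r M : R) s t s' t' : 0 <= r -> (s == s') || (t == t') ->
 (forall w, side c r w -> nm (f w) <= M) -> 0 <= M ->
 nm (seg n f (c + rc r * cor s t) (c + rc r * cor s' t')) <= 2 * r * M.
Proof.
move=> r0 st h M0.
apply: (@le_trans _ _ (M * nm ((c + rc r * cor s' t') - (c + rc r * cor s t)))).
 by apply: seg_bound => w hw; apply: h; exact: bd_side hw.
rewrite [leRHS]mulrC ler_wpM2l //.
have -> : c + rc r * cor s' t' - (c + rc r * cor s t) = rc r * (cor s' t' - cor s t) by ring.
rewrite nmM nm_rc ger0_norm // mulrC ler_wpM2r //.
have -> : cor s' t' - cor s t = (sgb s' - sgb s) + ii * (sgb t' - sgb t) by rewrite /cor; ring.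
have i1 : nm ii = 1 by exact: nm_i.
case/orP: st => /eqP e; subst; rewrite subrr ?mulr0 ?addr0 ?add0r ?nmM ?i1 ?mul1r;
 apply: (le_trans (nmB _ _)).
 by case: (t'); case: (t); rewrite /sgb ?nmN nm1.
by case: (s'); case: (s); rewrite /sgb ?nmN nm1.
Qed.

(** The perimeter is 8 r. *)
Lemma bd_bound n f c (r M : R) : 0 <= r -> 0 <= M ->
 (forall w, side c r w -> nm (f w) <= M) -> nm (bd n f c (rc r)) <= 8 * r * M.
Proof.
move=> r0 M0 h; rewrite /bd.
apply: (le_trans (nmD _ _)); apply: (@le_trans _ _ ((2 * r * M + 2 * r * M + 2 * r * M) + 2 * r * M)).
 apply: lerD; last exact: bd_edge.
 apply: (le_trans (nmD _ _)); apply: lerD; last exact: bd_edge.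
 by apply: (le_trans (nmD _ _)); apply: lerD; exact: bd_edge.
lra.
Qed.

End MidpointSums.

(** * Goursat's theorem *)

Section Goursat.
Variable R : realType. Local Notation C := (cplx R).
Implicit Types (f g : C -> C) (c : C).

Definition van (u : nat -> C) := forall e : R, 0 < e -> exists N, forall n, (N <= n)%N -> nm (u n) < e.

Lemma vanD u v : van u -> van v -> van (fun n => u n + v n).
Proof.
move=> hu hv e e0; have e2 : 0 < e / 2 by lra.
have [N NP] := hu _ e2; have [M MP] := hv _ e2; exists (maxn N M) => n.
rewrite geq_max => /andP[/NP h1 /MP h2]; apply: (le_lt_trans (nmD _ _)); lra.
Qed.

Lemma van_shift u k : van (fun n => u (n + k)%N) -> van u.
Proof.
move=> h e /h[N NP]; exists (N + k)%N => n Nn.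
have kn : (k <= n)%N by apply: leq_trans Nn; rewrite leq_addl.
by rewrite -(subnK kn); apply: NP; rewrite leq_subRL // addnC.
Qed.

Lemma shift_van u k : van u -> van (fun n => u (n + k)%N).
Proof. by move=> h e /h[N NP]; exists N => n Nn; apply: NP; rewrite (leq_trans Nn) // leq_addr. Qed.

Lemma eq_van u v : u =1 v -> van v -> van u.
Proof. by move=> uv h e /h[N NP]; exists N => n /NP; rewrite uv. Qed.

Lemma van_sum4 (F : nat -> bool -> bool -> C) :
 (forall s t, van (fun n => F n s t)) -> van (fun n => sum4 (F n)).
Proof.
move=> h; rewrite /sum4; apply: (@vanD (fun n => F n true true + F n true false + F n false true)) => //.
by apply: (@vanD (fun n => F n true true + F n true false)) => //; exact: vanD.
Qed.

Lemma vanZ u k : van u -> van (fun n => k * u n).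
Proof.
move=> h e e0.
have k1 : 0 < nm k + 1 by rewrite ltr_wpDl ?nm_ge0.
have [|N NP] := h (e / (nm k + 1)); first by rewrite divr_gt0.
exists N => n /NP; rewrite ltr_pdivlMr // => h1; rewrite nmM.
apply: le_lt_trans h1; rewrite mulrC ler_wpM2l ?nm_ge0 //; lra.
Qed.

(** The sums are not known to converge, so being large means reaching [e] for infinitely many n. If
    no quarter inherited this with e / 4, all four sums would eventually stay below e / 4, and by
    [bd_split] their total below [e]. *)
Lemma nested_squares f c (r e : R) : 0 < r ->
 (forall N, exists2 n, (N <= n)%N & e <= nm (bd n f c (rc r))) ->
 exists s t, forall N, exists2 n, (N <= n)%N &
  e / 4 <= nm (bd n f (c + rc (r / 2) * cor R s t) (rc (r / 2))).
Proof.
move=> r0 h; apply: contrapT => nh.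
have hN s t : exists N, forall n, (N <= n)%N ->
  nm (bd n f (c + rc (r / 2) * cor R s t) (rc (r / 2))) < e / 4.
 apply: contrapT => nN; apply: nh; exists s, t => N.
 apply: contrapT => nn; apply: nN; exists N => n Nn.
 by rewrite ltNge; apply/negP => hn; apply: nn; exists n.
have [N1 P1] := hN true true; have [N2 P2] := hN true false.
have [N3 P3] := hN false true; have [N4 P4] := hN false false.
have [[|n]] := h (N1 + N2 + N3 + N4).+1 => // Nn.
rewrite leNgt => /negP; apply; rewrite bd_split /sum4.
have -> : rc r / 2 = rc (r / 2) by rewrite rcM rcV rc_nat.
have p1 := P1 n; have p2 := P2 n; have p3 := P3 n; have p4 := P4 n.
have {}p1 := p1 ltac:(lia); have {}p2 := p2 ltac:(lia).
have {}p3 := p3 ltac:(lia); have {}p4 := p4 ltac:(lia).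
apply: (le_lt_trans (nmD _ _)).
have q1 := nmD (bd n f (c + rc (r / 2) * cor R true true) (rc (r / 2)) +
  bd n f (c + rc (r / 2) * cor R true false) (rc (r / 2)))
  (bd n f (c + rc (r / 2) * cor R false true) (rc (r / 2))).
have q2 := nmD (bd n f (c + rc (r / 2) * cor R true true) (rc (r / 2)))
  (bd n f (c + rc (r / 2) * cor R true false) (rc (r / 2))).
lra.
Qed.

Lemma sq_half c (r : R) s t w : 0 < r -> sq (c + rc (r / 2) * cor R s t) (r / 2) w -> sq c r w.
Proof.
by move=> r0 /sq_sub[h1 h2]; rewrite /sq !ler_norml; case: s h1; case: t h2 => /=; lra.
Qed.

Lemma pow2_small (a e : R) : 0 <= a -> 0 < e -> exists k, a / 2 ^+ k < e.
Proof.
move=> a0 e0; have ae : 0 <= a / e by rewrite divr_ge0 // ltW.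
exists (Num.bound (a / e)); rewrite ltr_pdivrMr ?exprn_gt0 // mulrC -ltr_pdivrMr //.
apply: lt_le_trans (archi_boundP ae) _.
by rewrite -natrX ler_nat ltnW // ltn_expl.
Qed.

Lemma diff1E (V : nmod C) (f : C -> V) c h : 'd f c h = h *: 'd f c 1.
Proof. by rewrite -linearZ /= scaler1 || (rewrite -linearZ /=; congr ('d f c _); rewrite /GRing.scale /= mulr1). Qed.

Lemma cor_norm s t : nm (cor R s t) <= 2.
Proof.
apply: (le_trans (nmD _ _)); rewrite nmM.
have -> : nm (ii R) = 1 by exact: nm_i.
by case: s; case: t; rewrite /sgb ?nmN nm1; lra.
Qed.

(** Bisection: squares with large sums shrink to a point [l], near which [f] is affine up to a small
    multiple of the side, and affine functions contribute nothing. *)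
Lemma goursat f c (r : R) : 0 < r -> (forall w, sq c r w -> hol f w) ->
 van (fun n => bd n f c (rc r)).
Proof.
move=> r0 df e e0; apply: contrapT => nN.
have h0 : forall N, exists2 n, (N <= n)%N & e <= nm (bd n f c (rc r)).
 move=> N; apply: contrapT => nn; apply: nN; exists N => n Nn.
 by rewrite ltNge; apply/negP => hn; apply: nn; exists n.
(* A triple [p] is a square with centre [p.1] and half side [p.2.1], together with the size [p.2.2]
   which its sums reach infinitely often. *)
pose st (p : C * (R * R)) := forall N, exists2 n, (N <= n)%N & p.2.2 <= nm (bd n f p.1 (rc p.2.1)).
have step (p : C * (R * R)) : exists q : C * (R * R), 0 < p.2.1 -> st p -> [/\ st q, q.2.1 = p.2.1 / 2, q.2.2 = p.2.2 / 4,
   nm (q.1 - p.1) <= p.2.1 & forall w, sq q.1 q.2.1 w -> sq p.1 p.2.1 w].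
 have [p0|p0] := ltP 0 p.2.1; last by exists p.
 have [stp|] := pselect (st p); last by exists p.
 have [s [t hst]] := nested_squares p0 stp.
 exists (p.1 + rc (p.2.1 / 2) * cor R s t, (p.2.1 / 2, p.2.2 / 4)) => _ _; split=> //=.
  rewrite addrAC subrr add0r nmM nm_rc ger0_norm; last by lra.
  have := cor_norm s t; nra.
 by move=> w; exact: sq_half.
have [nx nxP] := choice step.
pose p k := iter k nx (c, (r, e)).
have pr k : (p k).2.1 = r / 2 ^+ k /\ st (p k).
 elim: k => [|k [IH1 IH2]]; first by rewrite /p /= expr0 divr1.
 have [|//|h1 h2 _ _ _] := nxP (p k); first by rewrite IH1 divr_gt0 // exprn_gt0.
 by rewrite /p iterS -/(p k); split=> //; rewrite h2 IH1 exprS invfM mulrA mulrAC -mulrA.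
have pS k : [/\ (p k.+1).2.2 = (p k).2.2 / 4, nm ((p k.+1).1 - (p k).1) <= r / 2 ^+ k &
   forall w, sq (p k.+1).1 (p k.+1).2.1 w -> sq (p k).1 (p k).2.1 w].
 have [h1 h2] := pr k; have [|//|_ _ h3 h4 h5] := nxP (p k); first by rewrite h1 divr_gt0 // exprn_gt0.
 by rewrite -h1.
have pe k : (p k).2.2 = e / 4 ^+ k.
 elim: k => [|k IH]; first by rewrite /p /= expr0 divr1.
 by have [-> _ _] := pS k; rewrite IH exprS invfM mulrA mulrAC -mulrA.
have psub k j w : sq (p (k + j)%N).1 (p (k + j)%N).2.1 w -> sq (p k).1 (p k).2.1 w.
 by elim: j => [|j IH]; rewrite ?addn0 // addnS => /(let: And3 _ _ h := pS (k + j)%N in h w)/IH.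
have pcen k j : sq (p k).1 (p k).2.1 (p (k + j)%N).1.
 apply: (psub k j); apply: norm_sq; rewrite subrr nm0.
 by have [-> _] := pr (k + j)%N; rewrite divr_ge0 ?exprn_ge0 // ltW.
have [l lP] : exists l : C, (fun k => (p k).1) @ \oo --> l.
 apply: cauchy_cplx => e1 e10.
 have [|N hN] := @pow2_small (4 * r) e1 _ e10; first by lra.
 exists N => m n Nm Nn.
 have hm : sq (p N).1 (p N).2.1 (p m).1 by rewrite -(subnKC Nm); exact: pcen.
 have hn : sq (p N).1 (p N).2.1 (p n).1 by rewrite -(subnKC Nn); exact: pcen.
 have [prN _] := pr N; have := sq_norm hm; have := sq_norm hn; rewrite prN.
 have := nm_tri (p N).1 (p m).1 (p n).1; rewrite [nm ((p N).1 - _)]nmC.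
 rewrite -mulrA in hN; move: (r / 2 ^+ N) hN => q hN h1 h2 h3; lra.
have hl k : nm (l - (p k).1) <= 2 * (r / 2 ^+ k).
 apply/ler_addgt0Pr => e1 e10; have /cvg_rP/(_ e1 e10)[N NP] := lP.
 have := NP (N + k)%N (leq_addr _ _) => h1; have := sq_norm (pcen k N); have [-> _] := pr k => h2.
 have := nm_tri (p (N + k)%N).1 l (p k).1; rewrite [nm (l - (p (N + k)%N).1)]nmC.
 by rewrite [(k + N)%N]addnC in h2; lra.
have dl : hol f l.
 apply: df.
 have hclosed : closed [set w | sq c r w].
  rewrite (_ : mkset _ = [set w | `|Re (w - c)| <= r] `&` [set w | `|Im (w - c)| <= r]); last by [].
  have aux (F : C -> R) : (forall x y, `|F x - F y| <= nm (x - y)) -> closed [set w | `|F w| <= r].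
   move=> hF; apply: (@closed_comp _ _ (fun w => `|F w|) [set x | x <= r]); last exact: closed_le.
   move=> z _; apply/(@cvgrPdist_lt _ _ _ (nbhs z)) => e1 e10; apply/nbhs_rP; exists e1 => // y yz.
   apply: le_lt_trans yz; apply: le_trans (ler_dist_dist _ _) _.
   by rewrite nmC; exact: hF.
  apply: closedI; apply: aux => x y.
   by rewrite -raddfB /= opprB addrA subrK; exact: Re_le_nm.
  by rewrite -raddfB /= opprB addrA subrK; exact: Im_le_nm.
 apply: (closed_cvg [set w | sq c r w] hclosed _ _ lP).
 by near=> k; exact: (pcen 0 k).
(* With 33 in the denominator the sum over the k-th square is at most 8 r' times e / (33 r^2) times
   4 r', which is 32/33 of e / 4^k, hence strictly below the size e / 4^k for which the square was
   selected. *)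
have e' : 0 < e / (33 * r ^+ 2) by rewrite divr_gt0 // mulr_gt0 // exprn_gt0.
have [d d0 dP] := diff_rP dl e'.
have [|k hk] := @pow2_small (4 * r) d _ d0; first by lra.
pose r' := r / 2 ^+ k.
have r'0 : 0 < r' by rewrite divr_gt0 // exprn_gt0.
have [hr hst] := pr k; have [n _] := hst 0%N.
rewrite pe hr -/r' leNgt => /negP; apply.
pose f1 w := f l - l * 'd f l 1 + 'd f l 1 * w.
have hw w : side (p k).1 r' w -> nm (f w + (-1) * f1 w) <= e / (33 * r ^+ 2) * (4 * r').
 move=> [/sq_norm h1 _].
 have wl : nm (w - l) <= 4 * r'.
  have := nm_tri (p k).1 w l; have := hl k; rewrite [nm (l - _)]nmC -/r'; lra.
 have wd : nm (w - l) < d by apply: (le_lt_trans wl); rewrite /r' mulrA.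
 have := dP _ wd; rewrite subrKC diff1E => h2.
 have -> : f w + -1 * f1 w = f w - f l - (w - l) *: 'd f l 1.
  by rewrite /f1 /GRing.scale /=; ring.
 by apply: (le_trans h2); rewrite ler_wpM2l // ltW.
have -> : bd n f (p k).1 (rc r') = bd n (fun w => f w + (-1) * f1 w) (p k).1 (rc r').
 by rewrite bdD bdZ /f1 bd_affine mulr0 addr0.
apply: (@le_lt_trans _ _ (8 * r' * (e / (33 * r ^+ 2) * (4 * r')))).
 by apply: bd_bound hw; [exact: ltW|rewrite mulr_ge0 // ?ltW // mulr_gt0].
have -> : (4 : R) ^+ k = 2 ^+ k * 2 ^+ k by rewrite -exprMn; congr (_ ^+ _); rewrite -natrM.
have p2 : (2 : R) ^+ k != 0 by rewrite expf_neq0 // pnatr_eq0.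
have -> : 8 * r' * (e / (33 * r ^+ 2) * (4 * r')) = 32 / 33 * (e / (2 ^+ k * 2 ^+ k)).
 by rewrite /r'; field; rewrite p2 /= gt_eqF.
have : 0 < e / (2 ^+ k * 2 ^+ k) by rewrite divr_gt0 // mulr_gt0 // exprn_gt0.
lra.
Unshelve. all: by end_near.
Qed.

End Goursat.

(** * Cauchy's formula and estimates *)

Section CauchyEstimates.
Variable R : realType. Local Notation C := (cplx R).
Implicit Types (f g : C -> C) (c : C).

Lemma ii_cor s t : ii R * cor R s t = cor R (~~ t) s.
Proof. by case: s; case: t; apply/eqP; rewrite eq_complex /=; apply/andP; split; apply/eqP; ring. Qed.

Lemma ii_neq0 : ii R != 0.
Proof. by rewrite -nm_gt0 nm_i. Qed.

(* A quarter turn permutes the sides, so a homogeneous integrand contributes the same on each up to a factor. *)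
Lemma bd_turn n f (r : C) (k : C) : (forall w, f (ii R * w) = k * f w) ->
 bd n f 0 r = (1 + ii R * k + (ii R * k) ^+ 2 + (ii R * k) ^+ 3) *
  seg n f (r * cor R false false) (r * cor R true false).
Proof.
move=> hk; rewrite /bd !add0r.
have turn s t s' t' : seg n f (r * cor R (~~ t) s) (r * cor R (~~ t') s') =
  (ii R * k) * seg n f (r * cor R s t) (r * cor R s' t').
 rewrite -!ii_cor !(mulrCA r) (seg_mul n f (ii R)).
 have -> : (fun w => f (ii R * w)) = (fun w => k * f w) by apply/funext.
 by rewrite segZ mulrA.
have e1 := turn false false true false; rewrite /= in e1.
have e2 := turn true false true true; rewrite /= in e2.
have e3 := turn true true false true; rewrite /= in e3.
rewrite e3 e2 e1; ring.
Qed.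

(** The counterpart of 2 pi i at level n; up to [ker_cvg] it enters through its lower bound
    alone. *)
Definition ker n : C := bd n (fun w => w^-1) 0 1.

Lemma seg_Im n f a b (l m : R) : 0 <= l -> b - a = rc l ->
 (forall w, on_seg a b w -> m <= Im (f w)) -> l * m <= Im (seg n f a b).
Proof.
elim: n a b l => [|n IH] a b l l0 ba h.
 have := h _ (on_seg_mid a b); rewrite /= ba => hm.
 have -> : Im (rc l * f ((a + b) / 2)) = l * Im (f ((a + b) / 2)).
  by case: (f _) => x y /=; ring.
 by rewrite ler_wpM2l.
have h2 := two_neq0 R.
have l2 : 0 <= l / 2 by lra.
rewrite /= raddfD /=.
have -> : l * m = l / 2 * m + l / 2 * m by field.
apply: lerD; apply: IH => //.
- have -> : (a + b) / 2 - a = (b - a) / 2 by field.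
 by rewrite ba rcM rcV rc_nat.
- by move=> w /on_seg_half1/h.
- have -> : b - (a + b) / 2 = (b - a) / 2 by field.
 by rewrite ba rcM rcV rc_nat.
- by move=> w /on_seg_half2/h.
Qed.

Lemma Im_inv (x y : R) : Im ((Complex x y : C)^-1) = - y / (x ^+ 2 + y ^+ 2).
Proof. by rewrite mulNr. Qed.

(** A quarter turn shows that the four sides contribute equally. On the lower side, of length 2, the
    imaginary part of 1/w is at least 1/2, so each side gives at least 1. *)
Lemma ker_lower n : 4 <= nm (ker n).
Proof.
have -> : ker n = 4 * seg n (fun w => w^-1) (cor R false false) (cor R true false).
 have iiV : (ii R)^-1 = - ii R.
  by apply/eqP; rewrite eq_complex /=; apply/andP; split; apply/eqP; field.
 rewrite /ker (@bd_turn _ _ _ (- ii R)); last by move=> w; rewrite invfM iiV.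
 rewrite !mul1r; congr (_ * _).
 have -> : ii R * - ii R = 1 by rewrite -iiV mulfV // ii_neq0.
 by rewrite !expr1n; ring.
apply: le_trans (Im_le_nm _).
have -> : Im ((4 : C) * seg n (fun w => w^-1) (cor R false false) (cor R true false)) =
  4 * Im (seg n (fun w => w^-1) (cor R false false) (cor R true false)).
 by rewrite -(rc_nat R 4); case: (seg _ _ _ _) => x y /=; ring.
apply: le_trans (ler_norm _).
have := @seg_Im n (fun w => w^-1) (cor R false false) (cor R true false) 2 (2^-1) _ _ _.
move=> h; have {}h := h ltac:(lra); suff : 2 * 2^-1 <= Im (seg n (fun w : C => w^-1) (cor R false false) (cor R true false)) by lra.
apply: h; first by apply/eqP; rewrite eq_complex /=; apply/andP; split; apply/eqP; ring.
move=> w [t t01 ->].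
have -> : cor R false false + rc t * (cor R true false - cor R false false) = Complex (2 * t - 1) (-1).
 by apply/eqP; rewrite eq_complex /=; apply/andP; split; apply/eqP; ring.
rewrite Im_inv opprK; have h : 0 < (2 * t - 1) ^+ 2 + (-1) ^+ 2 :> R by rewrite ltr_wpDl ?sqr_ge0 // sqrrN expr1n.
rewrite div1r lef_pV2 ?posrE //.
rewrite sqrrN expr1n; nra.
Qed.

Lemma bd_shift n f c r : bd n f c r = bd n (fun w => f (c + w)) 0 r.
Proof. by rewrite /bd !(seg_shift n f c) !add0r. Qed.

Lemma bd_scale n f (r : C) : bd n f 0 r = r * bd n (fun w => f (r * w)) 0 1.
Proof. by rewrite /bd !add0r !(seg_mul n f r) !mul1r; ring. Qed.

Lemma bd_inv n c r : r != 0 -> bd n (fun w => (w - c)^-1) c r = ker n.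
Proof.
move=> r0; rewrite bd_shift bd_scale -bdZ /ker; congr (bd _ _ _ _).
apply/funext => w /=; have -> : c + r * w - c = r * w by ring.
by rewrite invfM mulVKf.
Qed.

(** A quarter turn multiplies the inverse square by -1, so the four sides carry the weights 1, -i,
    -1, i and cancel. *)
Lemma bd_inv2 n c r : bd n (fun w => (w - c)^-2) c r = 0.
Proof.
rewrite bd_shift (@bd_turn _ _ _ (-1)); last first.
 move=> w; have -> : c + ii R * w - c = ii R * w by ring.
 have -> : c + w - c = w by ring.
 rewrite exprMn invfM; congr (_ * _).
 by rewrite (_ : ii R ^+ 2 = -1) ?invrN1 //; exact: sqr_i.
have -> : ii R * -1 = - ii R by ring.
have i2 : ii R ^+ 2 = -1 by exact: sqr_i.
have -> : 1 + - ii R + (- ii R) ^+ 2 + (- ii R) ^+ 3 = 0.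
 by rewrite sqrrN [(- ii R) ^+ 3]exprSr sqrrN i2; ring.
by rewrite mul0r.
Qed.

(** Two subdivisions give sixteen squares. The four at the centre form the square of half side r /
    2; the other twelve avoid [c], and Goursat's theorem applies to each of them. *)
Lemma annulus_step g c (r : R) : 0 < r ->
 (forall w, sq c r w -> w != c -> hol g w) ->
 van (fun n => bd n.+1 g c (rc r) - bd n g c (rc (r / 2))).
Proof.
move=> r0 dg; apply: (@van_shift _ _ 1).
pose F n s t s' t' := bd n g (c + rc (r / 2) * cor R s t + rc (r / 2 / 2) * cor R s' t') (rc (r / 2 / 2)).
have r2 : rc r / 2 = rc (r / 2) by rewrite rcM rcV rc_nat.
have r4 : rc (r / 2) / 2 = rc (r / 2 / 2) by rewrite !rcM !rcV !rc_nat.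
have e1 n : bd n.+2 g c (rc r) = sum4 (fun s t => sum4 (fun s' t' => F n s t s' t')).
 by rewrite /sum4 bd_split /sum4 !bd_split /sum4 r2 r4.
have e2 n : bd n.+1 g c (rc (r / 2)) = sum4 (fun s t => F n s t (~~ s) (~~ t)).
 rewrite bd_split r4 /sum4 /F;
 have h s t : c + rc (r / 2) * cor R s t + rc (r / 2 / 2) * cor R (~~ s) (~~ t) = c + rc (r / 2 / 2) * cor R s t.
  have -> : cor R (~~ s) (~~ t) = - cor R s t by case: s; case: t; rewrite /cor /sgb /=; ring.
  by have h2 := two_neq0 R; rewrite -r4; field.
 by have := h true true; have := h true false; have := h false true; have := h false false => /= -> -> -> ->.
have vF s t s' t' : (s == s') || (t == t') -> van (fun n => F n s t s' t').
 move=> st; apply: goursat; first by lra.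
 move=> w hw.
 have [h3 h4] := cor_coord c (r / 2) s t 0.
 have e3 : Re (w - (c + rc (r / 2) * cor R s t)) = Re (w - c) - r / 2 * sgr R s.
  by rewrite raddfB /= h3 raddfB /=; ring.
 have e4 : Im (w - (c + rc (r / 2) * cor R s t)) = Im (w - c) - r / 2 * sgr R t.
  by rewrite raddfB /= h4 raddfB /=; ring.
 have [h1 h2] := sq_sub hw; rewrite e3 e4 in h1 h2.
 apply: dg.
  by rewrite /sq !ler_norml; move: h1 h2; case: (s); case: (t); case: (s'); case: (t') => /=; lra.
 apply/eqP => wc; move: h1 h2 st; rewrite wc subrr /=.
 by case: (s); case: (t); case: (s'); case: (t') => //=; lra.
apply: (@eq_van _ _ (fun n =>
 sum4 (fun s t => F n s t s t + F n s t (~~ s) t + F n s t s (~~ t)))).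
 by move=> n; rewrite addn1 e1 e2 /sum4 /=; ring.
apply: van_sum4 => s t; apply: vanD; first apply: vanD; apply: vF; rewrite eqxx ?orbT //.
Qed.

(** Repeated halving changes the sums by something that vanishes, and on a small square the growth
    condition, weaker than boundedness of [g], beats the perimeter. *)
Lemma annulus_van g c (r : R) : 0 < r ->
 (forall w, sq c r w -> w != c -> hol g w) ->
 (forall e : R, 0 < e -> exists2 d : R, 0 < d & forall rho, 0 < rho -> rho < d ->
   forall w, side c rho w -> nm (g w) * rho <= e) ->
 van (fun n => bd n g c (rc r)).
Proof.
move=> r0 dg sm.
have it k : van (fun n => bd (n + k) g c (rc r) - bd n g c (rc (r / 2 ^+ k))).
 elim: k => [|k IH].
  by move=> e e0; exists 0%N => n _; rewrite addn0 expr0 divr1 subrr nm0.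
 have rk : 0 < r / 2 ^+ k by rewrite divr_gt0 // exprn_gt0.
 have rkr : r / 2 ^+ k <= r by rewrite ler_piMr ?(ltW r0) // invf_le1 ?exprn_gt0 // exprn_ege1 // ler1n.
 have st : van (fun n => bd n.+1 g c (rc (r / 2 ^+ k)) - bd n g c (rc (r / 2 ^+ k / 2))).
  by apply: annulus_step => // w [h1 h2]; apply: dg; split; apply: le_trans rkr.
 apply: eq_van (vanD (shift_van 1 IH) st) => n.
 have -> : r / 2 ^+ k.+1 = r / 2 ^+ k / 2 by rewrite exprS invfM mulrA mulrAC.
 rewrite addn1 addnS addSn; by rewrite addrA subrK.
move=> e e0; have e16 : 0 < e / 32 by lra.
have [d d0 dP] := sm _ e16; have [k hk] := pow2_small (ltW r0) d0.
have rk : 0 < r / 2 ^+ k by rewrite divr_gt0 // exprn_gt0.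
have e2 : 0 < e / 2 by lra.
have [N NP] := it k _ e2; exists (N + k)%N => n Nn.
have kn : (k <= n)%N by apply: leq_trans Nn; rewrite leq_addl.
have := NP (n - k)%N; rewrite subnK // leq_subRL // addnC => /(_ Nn) h1.
have h2 : nm (bd (n - k) g c (rc (r / 2 ^+ k))) <= e / 4.
 have -> : e / 4 = 8 * (r / 2 ^+ k) * (e / 32 / (r / 2 ^+ k)).
  by move: (r / 2 ^+ k) rk => q rk; field; rewrite gt_eqF.
 apply: bd_bound; first exact: ltW.
  by rewrite divr_ge0 // ltW.
 by move=> w hw; rewrite ler_pdivlMr //; exact: dP.
have := nm_sub (bd n g c (rc r)) (bd (n - k) g c (rc (r / 2 ^+ k))).
lra.
Qed.

Lemma diff_subc (c w : C) : hol (fun w : C => w - c) w.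
Proof. by apply: holB => //; exact: hol_cst. Qed.

Lemma side_neq c (r : R) w : 0 < r -> side c r w -> w - c != 0.
Proof. by move=> r0 [_ h]; rewrite -nm_gt0; apply: lt_le_trans h. Qed.

(** Cauchy's formula at the centre: the difference quotient of [f] at [c] is bounded near [c], so
    its sums vanish in the limit, and what remains is [f c] times the sum of 1 / (w - c). *)
Lemma mean_value_bd f c (r : R) : 0 < r -> (forall w, sq c r w -> hol f w) ->
 van (fun n => bd n (fun w => f w / (w - c)) c (rc r) - f c * ker n).
Proof.
move=> r0 df; pose g w := (f w - f c) / (w - c).
apply: (@eq_van _ _ (fun n => bd n g c (rc r))).
 move=> n; have -> : bd n (fun w => f w / (w - c)) c (rc r) =
   bd n (fun w => g w + f c * (w - c)^-1) c (rc r).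
  by congr (bd _ _ _ _); apply/funext => w; rewrite /g; ring.
 by rewrite bdD bdZ bd_inv ?addrK // rc_eq0 gt_eqF.
apply: (annulus_van r0) => [w sw wc|e e0].
 apply: holM.
  by apply: holB; [exact: df|exact: hol_cst].
 by apply: differentiableV; [exact: diff_subc|rewrite subr_eq0].
have dc : hol f c by apply: df; apply: norm_sq; rewrite subrr nm0 ltW.
have [K K0 KP] := diff_bound dc; have [d d0 dP] := diff_rP dc (@ltr01 R).
have K1 : 0 < K + 1 by lra.
exists (min (d / 2) (e / (K + 1))).
 by rewrite lt_min !divr_gt0.
move=> rho rho0; rewrite lt_min => /andP[h1 h2] w hw.
have [hs hr] := hw; have := sq_norm hs => h3.
have wn := side_neq rho0 hw.
have wn0 : 0 < nm (w - c) by rewrite nm_gt0.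
have h4 : nm (w - c) < d by lra.
have := dP _ h4; rewrite subrKC => h5.
have h6 : nm (f w - f c) <= (K + 1) * nm (w - c).
 have := nm_sub (f w - f c) ('d f c (w - c)); have := KP (w - c); lra.
have -> : nm (g w) = nm (f w - f c) / nm (w - c) by rewrite /g nmM nmV.
apply: (@le_trans _ _ ((K + 1) * rho)); last by rewrite mulrC -ler_pdivlMr // ltW.
by rewrite ler_wpM2r ?ler_pdivrMr // ltW.
Qed.

(** As for the value at the centre, after subtracting the first order Taylor polynomial: its
    constant term meets [bd_inv2], its linear term meets [bd_inv], and the remainder over (w - c)^2
    is o(1 / |w - c|). *)
Lemma derivative_bd f c (r : R) : 0 < r -> (forall w, sq c r w -> hol f w) ->
 van (fun n => bd n (fun w => f w / (w - c) ^+ 2) c (rc r) - 'd f c 1 * ker n).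
Proof.
move=> r0 df; pose k := 'd f c 1; pose g w := (f w - f c - k * (w - c)) / (w - c) ^+ 2.
apply: (@eq_van _ _ (fun n => bd n g c (rc r))).
 move=> n; have -> : bd n (fun w => f w / (w - c) ^+ 2) c (rc r) =
   bd n (fun w => g w + (f c * (w - c)^-2 + k * (w - c)^-1)) c (rc r).
  apply: eq_bd => [|w hw]; first exact: ltW.
  by have h := side_neq r0 hw; rewrite /g; field.
 by rewrite bdD (@bdD _ _ (fun w => f c * (w - c)^-2)) !bdZ bd_inv2 bd_inv ?rc_eq0 ?gt_eqF // mulr0 add0r addrK.
apply: (annulus_van r0) => [w sw wc|e e0].
 apply: holM.
  apply: holB; first by apply: holB; [exact: df|exact: hol_cst].
  by apply: holM; [exact: hol_cst|exact: diff_subc].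
 apply: differentiableV; last by rewrite expf_neq0 // subr_eq0.
 have -> : (fun w => (w - c) ^+ 2) = (fun w => (w - c) * (w - c)) by apply/funext => z; rewrite expr2.
 by apply: holM; exact: diff_subc.
have dc : hol f c by apply: df; apply: norm_sq; rewrite subrr nm0 ltW.
have [d d0 dP] := diff_rP dc e0.
exists (d / 2); first by lra.
move=> rho rho0 h1 w hw.
have [hs hr] := hw; have := sq_norm hs => h3.
have wn := side_neq rho0 hw.
have wn0 : 0 < nm (w - c) by rewrite nm_gt0.
have h4 : nm (w - c) < d by lra.
have := dP _ h4; rewrite subrKC diff1E => h5.
have -> : nm (g w) = nm (f w - f c - (w - c) *: k) / nm (w - c) ^+ 2.
 by rewrite /g nmM nmV nmX [k * _]mulrC.
apply: (@le_trans _ _ (e * nm (w - c) / nm (w - c) ^+ 2 * nm (w - c))).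
 apply: ler_pM => //; first by rewrite divr_ge0 ?nm_ge0 // exprn_ge0 // nm_ge0.
  exact: ltW.
 by rewrite ler_wpM2r // invr_ge0 exprn_ge0 // nm_ge0.
rewrite le_eqVlt; apply/orP; left; apply/eqP; field; exact: lt0r_neq0.
Qed.

Lemma lim_bound (u : nat -> C) (k : C) (M : R) : (forall n, nm (u n) <= M) ->
 van (fun n => u n - k * ker n) -> nm k <= M / 4.
Proof.
move=> hu v; apply/ler_addgt0Pr => e e0; have e4 : 0 < 4 * e by lra.
have [N NP] := v _ e4; have := NP N (leqnn N) => h1.
have h2 := ker_lower N; have h3 := hu N; have h4 := nm_sub (k * ker N) (u N).
rewrite nmC in h4; rewrite nmM in h4.
have : nm k * 4 <= nm k * nm (ker N) by rewrite ler_wpM2l ?nm_ge0.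
lra.
Qed.

(** The factor 2 is 8 r times M / r, divided by the lower bound 4 of the kernel. The exact constant
    1 would require the limit of the sums; any fixed constant serves the arguments below. *)
Lemma mean_bound f c (r M : R) : 0 < r -> (forall w, sq c r w -> hol f w) ->
 (forall w, side c r w -> nm (f w) <= M) -> nm (f c) <= 2 * M.
Proof.
move=> r0 df fM.
have M0 : 0 <= M.
 apply: le_trans (nm_ge0 (f (c + rc r))) _; apply: fM.
 have e1 : c + rc r - c = rc r by rewrite addrAC subrr add0r.
 split; last by rewrite e1 nm_rc ler_norm.
 by apply: norm_sq; rewrite e1 nm_rc gtr0_norm.
apply: (@le_trans _ _ (8 * r * (M / r) / 4)); last first.
 by rewrite le_eqVlt; apply/orP; left; apply/eqP; field; rewrite gt_eqF.
apply: lim_bound (mean_value_bd r0 df) => n; apply: bd_bound; [exact: ltW|by rewrite divr_ge0 // ltW|].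
move=> w hw; rewrite nmM nmV; have [_ h] := hw.
apply: ler_pM; rewrite ?nm_ge0 ?invr_ge0 ?nm_ge0 ?fM //.
by rewrite lef_pV2 ?posrE // (lt_le_trans r0).
Qed.

Lemma deriv_bound1 f c (r M : R) : 0 < r -> (forall w, nm (w - c) < r -> hol f w) ->
 (forall w, nm (w - c) < r -> nm (f w) <= M) -> nm ('d f c 1) <= 8 * M / r.
Proof.
move=> r0 df fM.
have M0 : 0 <= M by apply: le_trans (fM c _); rewrite ?nm_ge0 // subrr nm0.
have r4 : 0 < r / 4 by lra.
have sub w : sq c (r / 4) w -> nm (w - c) < r by move=> /sq_norm; lra.
apply: (@le_trans _ _ (8 * (r / 4) * (M / (r / 4) ^+ 2) / 4)); last first.
 by rewrite le_eqVlt; apply/orP; left; apply/eqP; field; rewrite gt_eqF.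
have df' : forall w, sq c (r / 4) w -> hol f w by move=> w /sub/df.
apply: lim_bound (derivative_bd r4 df') => n; apply: bd_bound; [exact: ltW| |].
 by rewrite divr_ge0 // exprn_ge0 // ltW.
move=> w hw; rewrite nmM nmV nmX; have [/sub hs h] := hw.
apply: ler_pM; rewrite ?nm_ge0 ?invr_ge0 ?exprn_ge0 ?nm_ge0 ?fM //.
rewrite lef_pV2 ?posrE ?exprn_gt0 ?(lt_le_trans r4 h) //.
by rewrite lerXn2r ?nnegrE ?nm_ge0 // ltW.
Qed.

End CauchyEstimates.

(** * Estimates for holomorphic maps between normed modules *)

Section Holomorphy.
Variable R : realType. Local Notation C := (cplx R).

Lemma subrACA (V : zmodType) (a b c d : V) : (a - b) - (c - d) = (a - c) - (b - d).
Proof. by rewrite opprD addrACA -opprD. Qed.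

Lemma diffB_at (V W : nmod C) (f g : V -> W) x v : hol f x -> hol g x ->
 'd (fun z => f z - g z) x v = 'd f x v - 'd g x v.
Proof.
move=> df dg; have h := @diffB _ V W f g x df dg.
exact: (congr1 (fun F : V -> W => F v) h).
Qed.

Lemma diff_linear_at (V W : nmod C) (L : {linear V -> W}) x v : continuous L ->
 'd L x v = L v.
Proof. by move=> Lc; rewrite (diff_lin x Lc). Qed.

Lemma diffBL_at (V W : nmod C) (f : V -> W) (L : {linear V -> W}) x v : continuous L ->
 hol f x -> 'd (fun z => f z - L z) x v = 'd f x v - L v.
Proof.
move=> Lc df; have dL : hol L x by exact: linear_differentiable.
exact: etrans (diffB_at v df dL) (congr1 (fun w => 'd f x v - w) (diff_linear_at x v Lc)).
Qed.

Section Lines.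
Variables V W : nmod C.

Lemma diff_line (f : V -> W) (a v : V) (s : C) : hol f (a + s *: v) ->
 hol (fun s : C => f (a + s *: v)) s /\
 'd (fun s : C => f (a + s *: v)) s 1 = 'd f (a + s *: v) v.
Proof.
move=> df; have [K K0 KP] := diff_bound df.
have linP : linear (fun h : C => h *: 'd f (a + s *: v) v).
 by move=> k x y; rewrite scalerDl scalerA.
pose LM := GRing.isLinear.Build _ _ _ _ _ linP.
pose L : {linear C -> W} := HB.pack (fun h : C => h *: 'd f (a + s *: v) v) LM.
have [] := @rP_diff R C W (fun s : C => f (a + s *: v)) s L (nm ('d f (a + s *: v) v)).
- by move=> h; rewrite /= nmZ mulrC.
- move=> e e0; have v1 : 0 < nm v + 1 by rewrite ltr_wpDl ?nm_ge0.
 have e1 : 0 < e / (nm v + 1) by rewrite divr_gt0.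
 have [d d0 dP] := diff_rP df e1; exists (d / (nm v + 1)); first by rewrite divr_gt0.
 move=> h; rewrite ltr_pdivlMr // => hd.
 have hv : nm (h *: v) <= nm h * (nm v + 1).
  by rewrite nmZ ler_wpM2l ?nm_ge0 //; lra.
 have := dP (h *: v) (le_lt_trans hv hd).
 rewrite linearZ /= scalerDl addrA => hh; apply: (le_trans hh).
 apply: (@le_trans _ _ (e / (nm v + 1) * (nm h * (nm v + 1)))).
  by rewrite ler_wpM2l // ltW.
 by rewrite mulrCA mulrC divfK ?gt_eqF.
by move=> h1 ->; split=> //=; rewrite scale1r.
Qed.

End Lines.

(* The only two properties of the target space that the estimates use; they hold for C and for matrices. *)
Definition cauchy_target (W : nmod C) :=
 (forall (V : nmod C) (f : V -> W) (a v : V) (r M : R), 0 < r ->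
   (forall x, nm (x - a) < r -> hol f x) ->
   (forall x, nm (x - a) < r -> nm (f x) <= M) ->
   nm ('d f a v) <= 8 * M / r * nm v) /\
 (forall u : nat -> W,
   (forall e : R, 0 < e -> exists N, forall m n, (N <= m)%N -> (N <= n)%N -> nm (u m - u n) < e) ->
   exists l : W, u @ \oo --> l).

Lemma cauchy_targetC : cauchy_target C.
Proof.
split; last by move=> u; exact: cauchy_cplx.
move=> V f a v r M r0 df fM; have [->|v0] := eqVneq v 0.
 by rewrite linear0 !nm0 mulr0.
have nv : 0 < nm v by rewrite nm_gt0.
have [df0 <-] : hol (fun s : C => f (a + s *: v)) 0 /\ 'd (fun s : C => f (a + s *: v)) 0 1 = 'd f a v.
 by have := @diff_line V C f a v 0; rewrite scale0r addr0; apply; apply: df; rewrite subrr nm0.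
have near (s : C) : nm (s - 0) < r / nm v -> nm (a + s *: v - a) < r.
 by rewrite subr0 ltr_pdivlMr // addrAC subrr add0r nmZ.
have -> : 8 * M / r * nm v = 8 * M / (r / nm v) by field; rewrite !gt_eqF.
apply: deriv_bound1; first by rewrite divr_gt0.
 by move=> s /near/df/diff_line[].
by move=> s /near/fM.
Qed.

Section Mx.
Variables p q : nat.

Lemma diff_entry (V : nmod C) (f : V -> 'M[C]_(p, q)) x i j :
 hol f x -> hol (fun x => f x i j) x /\
 forall v, 'd (fun x => f x i j) x v = 'd f x v i j.
Proof.
move=> df; have [K K0 KP] := diff_bound df.
have linP : linear (fun h : V => 'd f x h i j : C).
 by move=> k u w; rewrite linearP !mxE.
pose LM := GRing.isLinear.Build _ _ _ _ _ linP.
pose L : {linear V -> C} := HB.pack (fun h : V => 'd f x h i j : C) LM.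
have [] := @rP_diff R V C (fun x => f x i j) x L K.
- by move=> v /=; apply: le_trans (KP v); exact: nm_mxij.
- move=> e e0; have [d d0 dP] := diff_rP df e0; exists d => // h /dP; apply: le_trans => /=.
 by have := nm_mxij (f (x + h) - f x - 'd f x h) i j; rewrite !mxE.
by move=> h1 ->.
Qed.

Lemma mx_differentiable (V : nmod C) (f : V -> 'M[C]_(p, q)) x :
 (forall i j, hol (fun x => f x i j) x) -> hol f x.
Proof.
move=> df.
have linP : linear (fun h : V => \matrix_(i, j) ('d (fun x => f x i j) x h : C)).
 by move=> k u w; apply/matrixP => i j; rewrite !mxE linearP.
pose LM := GRing.isLinear.Build _ _ _ _ _ linP.
pose L : {linear V -> 'M[C]_(p, q)} := HB.pack (fun h : V => \matrix_(i, j) ('d (fun x => f x i j) x h : C)) LM.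
have /choice[K KP] : forall ij : 'I_p * 'I_q, exists K : R, 0 < K /\
  forall v, nm ('d (fun x => f x ij.1 ij.2) x v) <= K * nm v.
 by move=> ij; have [K K0 KP] := diff_bound (df ij.1 ij.2); exists K.
have [] := @rP_diff R V _ f x L (\sum_ij K ij) => //.
- move=> v; have S0 : 0 <= \sum_ij K ij by rewrite sumr_ge0 // => ij _; have [/ltW] := KP ij.
 apply: nm_mx_le => [|i j]; first by rewrite mulr_ge0 // nm_ge0.
 rewrite mxE; have [_ h] := KP (i, j); apply: (le_trans (h v)).
 rewrite ler_wpM2r ?nm_ge0 // (bigD1 (i, j)) //= lerDl sumr_ge0 // => ij _.
 by have [/ltW] := KP ij.
- move=> e e0.
 have /choice[d dP] : forall ij : 'I_p * 'I_q, exists d : R, 0 < d /\ forall h, nm h < d ->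
   nm (f (x + h) ij.1 ij.2 - f x ij.1 ij.2 - 'd (fun x => f x ij.1 ij.2) x h) <= e * nm h.
  by move=> ij; have [d d0 dP] := diff_rP (df ij.1 ij.2) e0; exists d.
 exists (\big[min/1]_ij d ij).
  by elim/big_ind: _ => // [a b a0 b0|ij _]; [rewrite lt_min a0|have [] := dP ij].
 move=> h hd; apply: nm_mx_le => [|i j]; first by rewrite mulr_ge0 ?nm_ge0 // ltW.
 rewrite !mxE; have [_ hh] := dP (i, j); apply: hh; apply: lt_le_trans hd _.
 exact: bigmin_le_cond.
Qed.

Lemma cauchy_target_mx : cauchy_target 'M[C]_(p, q).
Proof.
split; last by move=> u; exact: cauchy_mx.
move=> V f a v r M r0 df fM.
have a0 : nm (a - a) < r by rewrite subrr nm0.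
have M0 : 0 <= M by apply: le_trans (fM a a0); exact: nm_ge0.
apply: nm_mx_le => [|i j].
 by rewrite mulr_ge0 ?nm_ge0 // divr_ge0 ?(ltW r0) // mulr_ge0.
have [_ <-] := diff_entry i j (df _ a0).
have [h _] := cauchy_targetC; apply: h => // x /[dup] xa.
 by move=> /df/(diff_entry i j)[].
by move=> /fM; apply: le_trans; exact: nm_mxij.
Qed.

End Mx.

(** Two applications of the Lipschitz estimate [cauchy_lip]: to [f] at radius r, then at radius r /
    4 to its difference quotients, which are bounded by 16 M / r per unit of direction. *)
Definition lip2 (M r : R) := 16 * (16 * M / r) / (r / 4).

Lemma lip2_ge0 M r : 0 <= M -> 0 < r -> 0 <= lip2 M r.
Proof.
move=> M0 r0; apply: divr_ge0; last by rewrite divr_ge0 ?ler0n // ltW.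
by apply: mulr_ge0; rewrite ?ler0n // divr_ge0 ?mulr_ge0 ?ler0n // ltW.
Qed.

Lemma lip2_gt0 M r : 0 < M -> 0 < r -> 0 < lip2 M r.
Proof.
move=> M0 r0; apply: divr_gt0; last by rewrite divr_gt0 ?ltr0n.
by apply: mulr_gt0; rewrite ?ltr0n // divr_gt0 ?mulr_gt0 ?ltr0n.
Qed.

Section Estimates.
Variables V W : nmod C.
Hypothesis hW : cauchy_target W.
Implicit Types (f : V -> W) (a x y v : V).

Lemma cauchy_lip f a (r M : R) : 0 < r ->
 (forall x, nm (x - a) < r -> hol f x) ->
 (forall x, nm (x - a) < r -> nm (f x) <= M) ->
 forall x y, nm (x - a) < r / 2 -> nm (y - a) < r / 2 ->
 nm (f x - f y) <= 16 * M / r * nm (x - y).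
Proof.
move=> r0 df fM x y xa ya; apply: mean_value => t t01.
have h1 := ball_segment t01 ya xa; set z := _ + _ *: _ in h1 *.
have za : nm (z - a) < r by lra.
split; first exact: df.
have -> : 16 * M / r = 8 * M / (r / 2) by field; rewrite gt_eqF.
have [h _] := hW; apply: h => [|w wz|w wz]; first lra.
 by apply: df; have := nm_tri z w a; lra.
by apply: fM; have := nm_tri z w a; lra.
Qed.

Lemma locally_bounded f a : hol f a ->
 exists2 r : R, 0 < r & exists2 M : R, 0 < M & forall x, nm (x - a) < r -> nm (f x) <= M.
Proof.
move=> /diff_cont/continuous_rP/(_ 1 ltr01)[r r0 rP].
exists r => //; exists (nm (f a) + 1); first by rewrite ltr_wpDl ?nm_ge0.
by move=> x /rP; have := nm_sub (f x) (f a); lra.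
Qed.

(** The difference quotients of [f] in direction [v] are holomorphic and bounded independently of
    the step, so their Lipschitz estimate survives as the step tends to 0. The step [s] is chosen so
    small that both quotients are within e / 2 of the derivatives. *)
Lemma deriv_lip f a (r M : R) : 0 < r ->
 (forall x, nm (x - a) < r -> hol f x) ->
 (forall x, nm (x - a) < r -> nm (f x) <= M) ->
 forall x y v, nm (x - a) < r / 8 -> nm (y - a) < r / 8 ->
 nm ('d f x v - 'd f y v) <= lip2 M r * nm v * nm (x - y).
Proof.
move=> r0 df fM x y v xa ya.
have [->|v0] := eqVneq v 0; first by rewrite (linear0 ('d f x)) (linear0 ('d f y)) subrr !nm0 mulr0 mul0r.
have nv : 0 < nm v by rewrite nm_gt0.
apply/ler_addgt0Pr => e e0.
have e3 : 0 < e / 2 / nm v by rewrite !divr_gt0.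
have r8 : r / 8 < r by lra.
have [d d0 dP] := diff_rP (df _ (lt_trans xa r8)) e3.
have [d' d'0 dP'] := diff_rP (df _ (lt_trans ya r8)) e3.
pose s : R := min (min d d') (r / 4) / nm v / 2.
have m0 : 0 < min (min d d') (r / 4) by rewrite !lt_min d0 d'0 /=; lra.
have s0 : 0 < s by rewrite !divr_gt0.
have sv : nm (rc s *: v) < min (min d d') (r / 4).
 rewrite nmZ nm_rc gtr0_norm // /s mulrAC divfK ?gt_eqF //; lra.
have [svd svd' sr] : [/\ nm (rc s *: v) < d, nm (rc s *: v) < d' & nm (rc s *: v) < r / 4].
 by move: sv; rewrite !lt_min => /andP[/andP[]].
have cs : rc s != 0 by rewrite rc_eq0 gt_eqF.
pose g z := (rc s)^-1 *: (f (z + rc s *: v) - f z).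
have close z dd : nm (rc s *: v) < dd -> (forall h, nm h < dd -> nm (f (z + h) - f z - 'd f z h) <= e / 2 / nm v * nm h) ->
  nm (g z - 'd f z v) <= e / 2.
 move=> h1 /(_ _ h1) h2.
 have -> : g z - 'd f z v = (rc s)^-1 *: (f (z + rc s *: v) - f z - 'd f z (rc s *: v)).
  by rewrite linearZ /= [in RHS]scalerBr scalerA mulVf // scale1r.
 rewrite nmZ nmV nm_rc gtr0_norm // mulrC ler_pdivrMr //.
 apply: (le_trans h2); rewrite nmZ nm_rc gtr0_norm //.
 by rewrite mulrCA mulrC divfK ?gt_eqF.
have gx := close _ _ svd dP; have gy := close _ _ svd' dP'.
have inr z : nm (z - a) < r / 4 -> nm (z + rc s *: v - a) < r / 2.
 by move=> za; rewrite addrAC; apply: le_lt_trans (nmD _ _) _; lra.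
have gd z : nm (z - a) < r / 4 -> hol g z.
 move=> za; rewrite /g; apply: (@differentiableZ _ _ _ (fun z => f (z + rc s *: v) - f z)).
 apply: holB; last by apply: df; lra.
 apply: (diff_compo (fun z => z + rc s *: v) f).
  by apply: holD => //; exact: hol_cst.
 by apply: df; have := inr z za; lra.
have gM z : nm (z - a) < r / 4 -> nm (g z) <= 16 * M / r * nm v.
 move=> za; rewrite /g nmZ nmV nm_rc gtr0_norm // mulrC ler_pdivrMr //.
 have := cauchy_lip r0 df fM (inr _ za); move=> /(_ z) h.
 have z2 : nm (z - a) < r / 2 by lra.
 apply: (le_trans (h z2)); rewrite addrAC subrr add0r nmZ nm_rc gtr0_norm //.
 by rewrite [s * _]mulrC mulrA.
have r4 : 0 < r / 4 by lra.
have := @cauchy_lip g a (r / 4) _ r4 gd gM x y; have -> : r / 4 / 2 = r / 8 by field.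
move=> /(_ xa ya) h.
have e1 : 16 * (16 * M / r * nm v) / (r / 4) * nm (x - y) =
  lip2 M r * nm v * nm (x - y) by rewrite /lip2; field; rewrite gt_eqF.
rewrite e1 in h.
have -> : 'd f x v - 'd f y v = (g x - g y) - ((g x - 'd f x v) - (g y - 'd f y v)).
 by rewrite [_ - (g y - _)]subrACA subKr.
clear -h gx gy.
have := nmB (g x - g y) ((g x - 'd f x v) - (g y - 'd f y v)).
have := nmB (g x - 'd f x v) (g y - 'd f y v).
lra.
Qed.

Lemma taylor2 f a (r M : R) : 0 < r ->
 (forall x, nm (x - a) < r -> hol f x) ->
 (forall x, nm (x - a) < r -> nm (f x) <= M) ->
 forall x h, nm (x - a) < r / 8 -> nm (x + h - a) < r / 8 ->
 nm (f (x + h) - f x - 'd f x h) <= lip2 M r * nm h ^+ 2.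
Proof.
move=> r0 df fM x h xa xha.
have [L LE] : exists L : {linear V -> W}, forall v, 'd f x v = L v by exists ('d f x).
have r8 : r / 8 < r by lra.
have a0 : nm (a - a) < r by rewrite subrr nm0.
have M0 : 0 <= M by apply: le_trans (fM a a0); exact: nm_ge0.
have Lc : continuous L.
 have [K _ KP] := diff_bound (df x (lt_trans xa r8)).
 by apply: (@linear_cont R V W L K) => v; rewrite -LE.
rewrite LE.
pose g z := f z - L z.
have -> : f (x + h) - f x - L h = g (x + h) - g x.
 by rewrite /g linearD /= subrACA [L x + _]addrC addrK.
have ex : x + h - x = h by rewrite addrAC subrr add0r.
apply: mean_value => t t01; rewrite ex.
have := ball_segment t01 xa xha; rewrite ex.
set z := x + _ => za.
have dz : hol f z by apply: df; lra.
have dL : hol L z by exact: linear_differentiable.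
split; first exact: holB.
have -> : 'd g z h = 'd f z h - 'd f x h.
 rewrite LE.
 exact: (diffBL_at h Lc dz).
apply: (le_trans (deriv_lip r0 df fM _ za xa)).
rewrite [nm h ^+ 2]expr2 mulrA; apply: ler_wpM2l.
 apply: mulr_ge0; last exact: nm_ge0.
 exact: lip2_ge0.
rewrite /z addrAC subrr add0r nmZ nm_rc ler_piMl ?nm_ge0 //.
by rewrite ler_norml; lra.
Qed.

(** Weierstrass's theorem. The Cauchy estimates for F_n - F_m make the differentials at [a] a Cauchy
    sequence in operator norm; their pointwise limit is linear, and three errors of e / 3 show that
    it is the differential of the limit. *)
Lemma deriv_cvg (F : nat -> V -> W) f a (r : R) : 0 < r ->
 (forall n x, nm (x - a) < r -> hol (F n) x) ->
 (forall e : R, 0 < e -> exists N, forall n, (N <= n)%N -> forall x, nm (x - a) < r -> nm (F n x - f x) < e) ->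
 hol f a /\ forall e : R, 0 < e -> exists N, forall n, (N <= n)%N -> forall v, nm ('d (F n) a v - 'd f a v) <= e * nm v.
Proof.
move=> r0 dF Ff.
have a0 : nm (a - a) < r by rewrite subrr nm0.
have dFa n : hol (F n) a by exact: dF.
have cau (e : R) : 0 < e -> exists N, forall n m, (N <= n)%N -> (N <= m)%N ->
  (forall v, nm ('d (F n) a v - 'd (F m) a v) <= e * nm v) /\ forall x, nm (x - a) < r / 2 -> nm ((F n x - F m x) - (F n a - F m a)) <= e * nm (x - a).
 move=> e0; have e1 : 0 < e * r / 32 by rewrite !divr_gt0 // mulr_gt0.
 have [N NP] := Ff _ e1; exists N => n m Nn Nm.
 have bnd x : nm (x - a) < r -> nm (F n x - F m x) <= e * r / 16.
  move=> xa; have := NP _ Nn _ xa; have := NP _ Nm _ xa.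
  by have := nm_tri (f x) (F n x) (F m x); rewrite [nm (f x - _)]nmC; lra.
 have dd x : nm (x - a) < r -> hol (fun x => F n x - F m x) x.
  by move=> xa; apply: holB; exact: dF.
 split=> [v|x xa].
  have -> : 'd (F n) a v - 'd (F m) a v = 'd (fun x => F n x - F m x) a v.
   exact: esym (diffB_at v (dFa n) (dFa m)).
  have [h _] := hW; have := h V _ a v r _ r0 dd bnd.
  move=> hh; apply: (le_trans hh); rewrite ler_wpM2r ?nm_ge0 //.
  rewrite ler_pdivrMr //; lra.
 have a2 : nm (a - a) < r / 2 by rewrite subrr nm0; lra.
 have := cauchy_lip r0 dd bnd xa a2 => h; apply: (le_trans h).
 by rewrite ler_wpM2r ?nm_ge0 // ler_pdivrMr //; lra.
have cauv v : forall e : R, 0 < e -> exists N, forall n m, (N <= n)%N -> (N <= m)%N -> nm ('d (F n) a v - 'd (F m) a v) < e.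
 move=> e e0; have v1 : 0 < nm v + 1 by rewrite ltr_wpDl ?nm_ge0.
 have [|N NP] := cau (e / (nm v + 1)); first by rewrite divr_gt0.
 exists N => n m Nn Nm; have [h _] := NP n m Nn Nm; apply: (le_lt_trans (h v)).
 rewrite mulrAC ltr_pdivrMr // ltr_pM2l //; lra.
have [_ cW] := hW.
have /choice[L0 L0P] : forall v, exists l : W, (fun n => 'd (F n) a v) @ \oo --> l.
 by move=> v; apply: cW; exact: cauv.
have linP : linear L0.
 move=> k u v; apply: (@cvg_unique _ (@norm_hausdorff _ W) ((fun n => 'd (F n) a (k *: u + v)) @ \oo)).
 - exact: L0P.
 - rewrite (_ : (fun n => _) = (fun n => k *: 'd (F n) a u + 'd (F n) a v)).
   by apply: cvgD; [apply: cvgZr; exact: L0P|exact: L0P].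
  by apply/funext => n; rewrite linearP.
pose LM := GRing.isLinear.Build _ _ _ _ _ linP.
pose L : {linear V -> W} := HB.pack L0 LM.
have lim_le (u : nat -> W) l (w : W) (B : R) N : u @ \oo --> l ->
  (forall n, (N <= n)%N -> nm (w - u n) <= B) -> nm (w - l) <= B.
 move=> /cvg_rP ul hB; apply/ler_addgt0Pr => e e0; have [N' NP'] := ul _ e0.
 have := hB (maxn N N') (leq_maxl _ _); have := NP' (maxn N N') (leq_maxr _ _).
 by have := nm_tri (u (maxn N N')) w l; lra.
have derL e : 0 < e -> exists N, forall n, (N <= n)%N -> forall v, nm ('d (F n) a v - L v) <= e * nm v.
 move=> /cau[N NP]; exists N => n Nn v; apply: (@lim_le _ _ _ _ N (L0P v)) => m Nm.
 by have [h _] := NP n m Nn Nm.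
have hd : hol f a /\ 'd f a = L :> (V -> W); last first.
 case: hd => df dE; split; first exact: df.
 move=> e /derL[N NP]; exists N => n /NP h v.
 have e1 : 'd f a v = L v := congr1 (fun G : V -> W => G v) dE.
 by rewrite [X in nm (_ - X)]e1; exact: h.
have [N1 N1P] := derL 1 ltr01.
have [K K0 KP] := diff_bound (dFa N1).
apply: (@rP_diff R V W f a L (K + 1)).
 move=> v; have := N1P N1 (leqnn _) v; rewrite nmC mul1r => h1.
 by have := nm_sub (L v) ('d (F N1) a v); have := KP v; lra.
move=> e e0; have e3 : 0 < e / 3 by lra.
have [N NP] := cau _ e3; have [N' NP'] := derL _ e3.
pose n := maxn N N'.
have Nn : (N <= n)%N by exact: leq_maxl.
have N'n : (N' <= n)%N by exact: leq_maxr.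
have [d d0 dP] := diff_rP (dFa n) e3.
exists (min d (r / 2)); first by rewrite lt_min d0; lra.
move=> h; rewrite lt_min => /andP[hd hr].
have hE : a + h - a = h by rewrite addrAC subrr add0r.
have fcv x : nm (x - a) < r -> (fun n => F n x) @ \oo --> f x.
 by move=> xa; apply/cvg_rP => e' /Ff[M MP]; exists M => m Mm; exact: MP.
have h1 : nm ((F n (a + h) - F n a) - (f (a + h) - f a)) <= e / 3 * nm h.
 apply: (@lim_le (fun m => F m (a + h) - F m a) _ _ _ N).
  by apply: cvgB; apply: fcv => //; rewrite hE; lra.
 move=> m Nm; have [_ hh] := NP n m Nn Nm; have := hh (a + h).
 by rewrite hE subrACA => /(_ hr).
have h2 := dP _ hd.
have h3 := NP' n N'n h.
have -> : f (a + h) - f a - L h = ((F n (a + h) - F n a - 'd (F n) a h) + ('d (F n) a h - L h)) - ((F n (a + h) - F n a) - (f (a + h) - f a)).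
 by rewrite addrA subrK subrACA subrr sub0r opprB.
have t1 := nmB ((F n (a + h) - F n a - 'd (F n) a h) + ('d (F n) a h - L h)) ((F n (a + h) - F n a) - (f (a + h) - f a)).
have t2 := nmD (F n (a + h) - F n a - 'd (F n) a h) ('d (F n) a h - L h).
lra.
Qed.

(** By [taylor2] the difference quotients with steps [s n] converge to the derivative uniformly near
    [a], so Weierstrass's theorem makes the derivative holomorphic. *)
Lemma holo_derivative f a v (r : R) : 0 < r ->
 (forall x, nm (x - a) < r -> hol f x) ->
 hol (fun x => 'd f x v) a.
Proof.
move=> r0 df; have a0 : nm (a - a) < r by rewrite subrr nm0.
have [r1 r10 [M M0 fM]] := locally_bounded (df _ a0).
pose q := min r r1.
have q0 : 0 < q by rewrite lt_min r0.
have qr : q <= r by rewrite ge_min lexx.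
have qr1 : q <= r1 by rewrite ge_min lexx orbT.
have dfq x : nm (x - a) < q -> hol f x by move=> h; apply: df; lra.
have fMq x : nm (x - a) < q -> nm (f x) <= M by move=> h; apply: fM; lra.
have T := taylor2 q0 dfq fMq.
have v1 : 0 < nm v + 1 by rewrite ltr_wpDl ?nm_ge0.
pose s n : R := q / 16 / (nm v + 1) / n.+1%:R.
have s0 n : 0 < s n by rewrite !divr_gt0 // ltr0n.
have sv n : nm (rc (s n) *: v) < q / 16.
 rewrite nmZ nm_rc gtr0_norm //.
 have h1 : s n <= q / 16 / (nm v + 1).
  by rewrite /s ler_pdivrMr ?ltr0n // ler_peMr ?ler1n // !divr_ge0 // ltW.
 have h2 : q / 16 / (nm v + 1) * nm v < q / 16.
  by rewrite mulrAC ltr_pdivrMr // ltr_pM2l ?divr_gt0 //; lra.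
 by apply: le_lt_trans h2; rewrite ler_wpM2r ?nm_ge0.
pose F n x := (rc (s n))^-1 *: (f (x + rc (s n) *: v) - f x).
have shift x n : nm (x - a) < q / 16 -> nm (x + rc (s n) *: v - a) < q / 8.
 by move=> xa; rewrite addrAC; apply: le_lt_trans (nmD _ _) _; have := sv n; lra.
have q16 : 0 < q / 16 by lra.
have [] := @deriv_cvg F (fun x => 'd f x v) a _ q16 => //.
 move=> n x xa; apply: (@differentiableZ _ _ _ (fun z => f (z + rc (s n) *: v) - f z)).
 apply: holB; last by apply: dfq; lra.
 apply: (diff_compo (fun z => z + rc (s n) *: v) f).
  by apply: holD => //; exact: hol_cst.
 by apply: dfq; have := shift x n xa; lra.
move=> e e0; pose K := lip2 M q * (nm v + 1) ^+ 2 * (q / 16 / (nm v + 1)).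
have K0 : 0 < K.
 by apply: mulr_gt0; [apply: mulr_gt0; [exact: lip2_gt0|exact: exprn_gt0]|rewrite !divr_gt0].
have eK : 0 < e / K by rewrite divr_gt0.
have [N NP] := arch_inv eK; exists N => n /NP.
rewrite ltr_pdivlMr // => h x xa.
have cs : rc (s n) != 0 by rewrite rc_eq0 gt_eqF.
have -> : F n x - 'd f x v = (rc (s n))^-1 *: (f (x + rc (s n) *: v) - f x - 'd f x (rc (s n) *: v)).
 by rewrite linearZ /= [in RHS]scalerBr scalerA mulVf // scale1r.
rewrite nmZ nmV nm_rc gtr0_norm // mulrC ltr_pdivrMr //.
have x8 : nm (x - a) < q / 8 by lra.
apply: (le_lt_trans (T x _ x8 (shift x n xa))).
rewrite nmZ nm_rc gtr0_norm // exprMn.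
apply: (@le_lt_trans _ _ (n.+1%:R^-1 * K * s n)); last by rewrite ltr_pM2r.
have -> : n.+1%:R^-1 * K * s n = lip2 M q * (s n ^+ 2 * (nm v + 1) ^+ 2).
 rewrite /K /s; field; rewrite !gt_eqF //=.
rewrite ler_wpM2l ?lip2_ge0 ?(ltW M0) //.
apply: ler_wpM2l; first by rewrite exprn_ge0 // ltW.
by apply: lerXn2r; rewrite ?nnegrE ?nm_ge0 ?(ltW v1) // lerDl.
Qed.

End Estimates.

End Holomorphy.

(** * Difference quotients, zeros and removable singularities *)

Section Quotient.
Variable R : realType. Local Notation C := (cplx R).

Definition der (f : C -> C) (z l : C) := forall e : R, 0 < e -> exists2 d : R, 0 < d &
 forall h, nm h < d -> nm (f (z + h) - f z - h * l) <= e * nm h.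

Lemma linear_mulr (l : C) : linear (fun h : C => h * l).
Proof. by move=> k u w; rewrite /GRing.scale /=; ring. Qed.

Lemma der_diff f z l : der f z l -> hol f z /\ 'd f z 1 = l.
Proof.
move=> h; pose LM := GRing.isLinear.Build _ _ _ _ _ (linear_mulr l).
pose L : {linear C -> C} := HB.pack (fun h : C => h * l) LM.
have [] := @rP_diff R C C f z L (nm l) _ h.
 by move=> v; rewrite /= nmM mulrC.
by move=> h1 ->; split=> //=; rewrite mul1r.
Qed.

Lemma diff_der f z : hol f z -> der f z ('d f z 1).
Proof.
move=> df e e0; have [d d0 dP] := diff_rP df e0; exists d => // h /dP.
by rewrite [X in nm (_ - X)]diff1E.
Qed.

Lemma derD f g z k l : der f z k -> der g z l -> der (fun z => f z + g z) z (k + l).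
Proof.
move=> hf hg e e0; have e2 : 0 < e / 2 by lra.
have [d d0 dP] := hf _ e2; have [d' d'0 dP'] := hg _ e2.
exists (min d d'); first by rewrite lt_min d0.
move=> h; rewrite lt_min => /andP[/dP h1 /dP' h2].
have -> : f (z + h) + g (z + h) - (f z + g z) - h * (k + l) =
 (f (z + h) - f z - h * k) + (g (z + h) - g z - h * l) by ring.
by apply: (le_trans (nmD _ _)); lra.
Qed.

Lemma derZ f z k c : der f z k -> der (fun z => c * f z) z (c * k).
Proof.
move=> hf e e0; have c1 : 0 < nm c + 1 by rewrite ltr_wpDl ?nm_ge0.
have [|d d0 dP] := hf (e / (nm c + 1)); first by rewrite divr_gt0.
exists d => // h /dP; rewrite mulrAC ler_pdivlMr // => hh.
have -> : c * f (z + h) - c * f z - h * (c * k) = c * (f (z + h) - f z - h * k) by ring.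
rewrite nmM; apply: le_trans hh; rewrite mulrC ler_wpM2l ?nm_ge0 //; lra.
Qed.

Lemma der_cst c z : der (fun=> c) z 0.
Proof.
move=> e e0; exists 1 => // h _; rewrite subrr mulr0 subr0 nm0 mulr_ge0 ?nm_ge0 //; exact: ltW.
Qed.

Lemma der_sq a z : der (fun z => (z - a) * (z - a)) z (2 * (z - a)).
Proof.
move=> e e0; exists e => // h /ltW he.
have -> : (z + h - a) * (z + h - a) - (z - a) * (z - a) - h * (2 * (z - a)) = h * h by ring.
by rewrite nmM ler_wpM2r // nm_ge0.
Qed.

Lemma der_aff a z : der (fun z => z - a) z 1.
Proof.
move=> e e0; exists e => // h /ltW he.
have -> : (z + h - a) - (z - a) - h * 1 = 0 by ring.
by rewrite nm0 mulr_ge0 ?nm_ge0 // ltW.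
Qed.

Lemma der_mean (g : C -> C) (a h : C) (K : R) :
 (forall t : R, 0 <= t <= 1 -> exists2 l, der g (a + rc t * h) l & nm l <= K) ->
 nm (g (a + h) - g a) <= K * nm h.
Proof.
move=> H; apply: mean_value => t /H[l hl lK].
have e1 : a + rc t *: (a + h - a) = a + rc t * h.
 have -> : a + h - a = h by ring.
 by [].
rewrite e1; have [dg gE] := der_diff hl; split=> //.
have -> : a + h - a = h by ring.
rewrite [X in nm X](diff1E g) [X in nm (_ *: X)]gE -[X in nm X]/(h * l).
by rewrite nmM mulrC ler_wpM2r // nm_ge0.
Qed.

(* Taylor's formula to order two at a gives the differentiability of the difference quotient at a. *)
Lemma quotient_der (f f1 : C -> C) (a f2 : C) (r : R) : 0 < r ->
 (forall z, nm (z - a) < r -> der f z (f1 z)) -> der f1 a f2 ->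
 der (fun z => if z == a then f1 a else (f z - f a) / (z - a)) a (f2 / 2).
Proof.
move=> r0 df df1 e e0; have [d d0 dP] := df1 _ e0.
exists (min d r); first by rewrite lt_min d0.
move=> h; rewrite lt_min => /andP[hd hr].
have [->|h0] := eqVneq h 0; first by rewrite addr0 subrr mul0r subr0 nm0 mulr0.
have ah : (a + h == a) = false by apply/negbTE; rewrite -subr_eq0 addrAC subrr add0r.
rewrite ah eqxx.
have -> : a + h - a = h by ring.
pose g z := f z + ((- f1 a) * (z - a) + (- (f2 / 2)) * ((z - a) * (z - a))).
have -> : (f (a + h) - f a) / h - f1 a - h * (f2 / 2) = (g (a + h) - g a) / h.
 by rewrite /g; have := two_neq0 R => h2; field; rewrite h0.
rewrite nmM nmV ler_pdivrMr ?nm_gt0 //.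
apply: der_mean => t t01.
have th : nm (rc t * h) <= nm h.
 by rewrite nmM nm_rc ler_piMl ?nm_ge0 // ler_norml; lra.
set z := a + _; have ez : z - a = rc t * h by rewrite /z; ring.
have za : nm (z - a) < r by rewrite ez; lra.
exists (f1 z + (- f1 a * 1 + - (f2 / 2) * (2 * (z - a)))).
 apply: derD; first exact: df.
 by apply: derD; apply: derZ; [exact: der_aff|exact: der_sq].
have := dP (rc t * h) (le_lt_trans th hd); rewrite -/z => hh.
have -> : f1 z + (- f1 a * 1 + - (f2 / 2) * (2 * (z - a))) = f1 z - f1 a - rc t * h * f2.
 by rewrite ez; have := two_neq0 R => h2; field.
by apply: (le_trans hh); rewrite ler_wpM2l // ltW.
Qed.

Lemma der_local f g z l (r : R) : 0 < r -> (forall w, nm (w - z) < r -> f w = g w) -> der f z l -> der g z l.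
Proof.
move=> r0 fg h e e0; have [d d0 dP] := h _ e0.
exists (min d r); first by rewrite lt_min d0.
move=> w; rewrite lt_min => /andP[/dP h1 wr].
by rewrite -!fg ?subrr ?nm0 // addrAC subrr add0r.
Qed.

(** Only the centre needs an argument: the derivative of [f] is itself differentiable at [a], and
    [quotient_der] gives the quotient the derivative f''(a) / 2 there. *)
Lemma quotient_holo (f : C -> C) (a : C) (r : R) : 0 < r ->
 (forall z, nm (z - a) < r -> hol f z) ->
 forall z, nm (z - a) < r ->
 hol (fun z => if z == a then 'd f a 1 else (f z - f a) / (z - a)) z.
Proof.
move=> r0 df z za.
have [->{z za}|zna] := eqVneq z a; last first.
 pose q' z := (f z - f a) / (z - a).
 have dq' : hol q' z.
  apply: holM; first by apply: holB; [exact: df|exact: hol_cst].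
  by apply: differentiableV; [exact: diff_subc|rewrite subr_eq0].
 have zp : 0 < nm (z - a) by rewrite nm_gt0 subr_eq0.
 suff h : der (fun z => if z == a then 'd f a 1 else q' z) z ('d q' z 1) by have [] := der_diff h.
 apply: der_local zp _ (diff_der dq') => w wz; rewrite ifN //.
 by apply/eqP => wa; move: wz; rewrite wa nmC ltxx.
have dda : hol (fun x => 'd f x 1) a := @holo_derivative R C C (cauchy_targetC R) f a 1 r r0 df.
suff h : der (fun z => if z == a then 'd f a 1 else (f z - f a) / (z - a)) a ('d (fun x => 'd f x 1) a 1 / 2).
 by have [] := der_diff h.
apply: (@quotient_der f (fun x => 'd f x 1) a _ r r0); last exact: diff_der.
by move=> w /df/diff_der.
Qed.

End Quotient.

Section Zeros.
Variable R : realType. Local Notation C := (cplx R).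
Implicit Types (f g : C -> C) (a c : C).

Lemma rball_compact_cplx a (r : R) : compact [set z : C | nm (z - a) <= r].
Proof.
apply: (subclosed_compact _ (@ball_compact_cplx R (r + nm a))); first exact: closed_rball.
by move=> z /= zr; rewrite -[z](subrK a) (le_trans (nmD _ _)) // lerD2r.
Qed.

(** Divide by z - a as long as the quotient vanishes at [a]. If this never stops, then f = (z - a)^k
    q_k for every k. For |z - a| < r / 16 bound q_k at z from the boundary of the square of half
    side r / 4 around z, where |w - a| is at least 3 r / 16; this gives |f z| at most 2 M / 3^k for
    all k. *)
Lemma zero_dichotomy f a (r : R) : 0 < r ->
 (forall z, nm (z - a) < r -> hol f z) ->
 (forall z, nm (z - a) < r / 16 -> f z = 0) \/
 exists k g, [/\ forall z, nm (z - a) < r -> hol g z, g a != 0 &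
  forall z, nm (z - a) < r -> f z = (z - a) ^+ k * g z].
Proof.
move=> r0 df; have [|ne] := pselect (exists k g, [/\ forall z, nm (z - a) < r -> hol g z, g a != 0 &
  forall z, nm (z - a) < r -> f z = (z - a) ^+ k * g z]); [by right|left].
have hq k : exists2 q, forall z, nm (z - a) < r -> hol q z &
  forall z, nm (z - a) < r -> f z = (z - a) ^+ k * q z.
 elim: k => [|k [q dq fq]]; first by exists f => // z _; rewrite expr0 mul1r.
 have qa : q a = 0 by apply/eqP/negPn/negP => qa; apply: ne; exists k, q.
 exists (fun z => if z == a then 'd q a 1 else (q z - q a) / (z - a)); first exact: quotient_holo.
 move=> z za; rewrite fq //; have [->|zna] := eqVneq z a.
  by rewrite qa subrr exprS mul0r !mulr0 mul0r.
 by rewrite qa subr0 exprS -mulrA mulrCA; congr (_ * _); rewrite mulrC divfK // subr_eq0.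
have [M M0 fM] : exists2 M : R, 0 < M & forall z, nm (z - a) <= 9 * r / 16 -> nm (f z) <= M.
 apply: (compact_upper (rball_compact_cplx (a := a) (r := 9 * r / 16))) => z /= za.
 by apply: diff_cont; apply: df; lra.
move=> z za; apply/eqP; rewrite -nm_eq0; apply/negPn/negP => fz0.
have fz : 0 < nm (f z) by rewrite lt_def fz0 nm_ge0.
have [k hk] : exists k, 2 * M / 2 ^+ k < nm (f z) by apply: pow2_small => //; lra.
have [q dq fq] := hq k.
have r4 : 0 < r / 4 by lra.
have zr : nm (z - a) < r by lra.
have p0 : 0 < (3 * r / 16) ^+ k by rewrite exprn_gt0 // divr_gt0 // mulr_gt0.
have : nm (q z) <= 2 * (M / (3 * r / 16) ^+ k).
 apply: (@mean_bound R q z (r / 4)) => // [w /sq_norm wz|w [/sq_norm wz wz']].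
  by apply: dq; have := nm_tri z w a; lra.
 have wa : nm (w - a) <= 9 * r / 16 by have := nm_tri z w a; lra.
 have wa' : 3 * r / 16 <= nm (w - a).
  by have := nm_tri a w z; rewrite [nm (a - z)]nmC; lra.
 rewrite ler_pdivlMr //.
 have wr : nm (w - a) < r by lra.
 have := fM _ wa; rewrite fq // nmM nmX mulrC; apply: le_trans.
 by rewrite ler_wpM2l ?nm_ge0 //; apply: lerXn2r; rewrite ?nnegrE ?nm_ge0 //; lra.
move=> qz; move: hk; rewrite fq // nmM nmX ltNge => /negP; apply.
apply: (@le_trans _ _ ((r / 16) ^+ k * (2 * (M / (3 * r / 16) ^+ k)))).
 apply: ler_pM => //; rewrite ?exprn_ge0 ?nm_ge0 //.
 by apply: lerXn2r; rewrite ?nnegrE ?nm_ge0 //; lra.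
have -> : (r / 16) ^+ k * (2 * (M / (3 * r / 16) ^+ k)) = 2 * M / 3 ^+ k.
 have -> : 3 * r / 16 = 3 * (r / 16) by rewrite mulrA.
 have r16 : (r / 16) ^+ k != 0 by rewrite expf_neq0 // mulf_neq0 ?gt_eqF ?invr_gt0.
 have p3 : (3 : R) ^+ k != 0 by rewrite expf_neq0 // pnatr_eq0.
 by rewrite (exprMn k 3 (r / 16)); move: ((r / 16) ^+ k) (3 ^+ k) r16 p3 => u w u0 w0; field; rewrite ?u0 ?w0.
rewrite ler_wpM2l //; first by lra.
rewrite lef_pV2 ?posrE ?exprn_gt0 //; apply: lerXn2r; rewrite ?nnegrE //; lra.
Qed.

Lemma isolated_zero f a (r : R) : 0 < r ->
 (forall z, nm (z - a) < r -> hol f z) ->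
 (forall z, nm (z - a) < r / 16 -> f z = 0) \/
 exists2 d : R, 0 < d & forall z, nm (z - a) < d -> z != a -> f z != 0.
Proof.
move=> r0 df; have [|[k [g [dg ga fg]]]] := zero_dichotomy r0 df; [by left|right].
have a0 : nm (a - a) < r by rewrite subrr nm0.
have ga' : 0 < nm (g a) by rewrite nm_gt0.
have /continuous_rP/(_ _ ga')[d d0 dP] := diff_cont (dg _ a0).
exists (min d r); first by rewrite lt_min d0.
move=> z; rewrite lt_min => /andP[/dP zd zr] za; rewrite fg // mulf_neq0 ?expf_neq0 ?subr_eq0 //.
rewrite -nm_gt0; have := nm_sub (g a) (g z); rewrite [nm (g a - _)]nmC; lra.
Qed.

(** [mean_bound] applied to 1 / f. *)
Lemma min_principle f c (r m : R) : 0 < r -> 0 < m -> (forall w, sq c r w -> hol f w) ->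
 (forall w, sq c r w -> f w != 0) -> (forall w, side c r w -> m <= nm (f w)) ->
 m <= 2 * nm (f c).
Proof.
move=> r0 m0 df f0 fm.
have cs : sq c r c by apply: norm_sq; rewrite subrr nm0 ltW.
have fc : 0 < nm (f c) by rewrite nm_gt0 f0.
have : nm ((fun z => (f z)^-1) c) <= 2 * m^-1.
 apply: (@mean_bound R (fun z => (f z)^-1) c r m^-1 r0) => w hw.
  by apply: differentiableV; [exact: df|exact: f0].
 by rewrite nmV lef_pV2 ?posrE ?fm // (lt_le_trans m0) // fm.
by rewrite nmV -[2 * _]invrK lef_pV2 ?posrE ?invr_gt0 ?mulr_gt0 ?invr_gt0 // invfM invrK mulrC ler_pdivrMr // mulrC.
Qed.

(** The function (z - a)^2 f(z) extends by 0 with derivative 0 at [a], so it can be divided by z - a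
    twice. *)
Lemma removable f a (r M : R) : 0 < r ->
 (forall z, nm (z - a) < r -> z != a -> hol f z) ->
 (forall z, nm (z - a) < r -> z != a -> nm (f z) <= M) ->
 exists2 g, forall z, nm (z - a) < r -> hol g z &
  forall z, nm (z - a) < r -> z != a -> g z = f z.
Proof.
move=> r0 df fM; pose h z := (z - a) * (z - a) * f z.
have dh z : nm (z - a) < r -> z != a -> hol h z.
 move=> zr za; apply: holM; last exact: df.
 by apply: holM; exact: diff_subc.
have ha : der h a 0.
 move=> e e0; have M1 : 0 < `|M| + 1 by rewrite ltr_wpDl.
 exists (min r (e / (`|M| + 1))); first by rewrite lt_min r0 divr_gt0.
 move=> w; rewrite lt_min ltr_pdivlMr // => /andP[wr we].
 have [->|w0] := eqVneq w 0; first by rewrite addr0 subrr mul0r subrr nm0 mulr0.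
 have e1 : a + w - a = w by ring.
 have -> : h (a + w) - h a - w * 0 = w * f (a + w) * w by rewrite /h e1; ring.
 rewrite nmM ler_wpM2r ?nm_ge0 // nmM; apply/ltW; apply: le_lt_trans we.
 rewrite ler_wpM2l ?nm_ge0 //; apply: (@le_trans _ _ M).
  by apply: fM; rewrite ?e1 // -subr_eq0 e1.
 by apply: (le_trans (ler_norm M)); rewrite lerDl.
have [dha hda] := der_diff ha.
have {}dh z : nm (z - a) < r -> hol h z.
 by have [->|za zr] := eqVneq z a; [|exact: dh].
pose q z := if z == a then 'd h a 1 else (h z - h a) / (z - a).
have dq z : nm (z - a) < r -> hol q z := @quotient_holo R h a r r0 dh z.
pose g z := if z == a then 'd q a 1 else (q z - q a) / (z - a).
exists g; first exact: (quotient_holo r0 dq).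
move=> z zr za; rewrite /g (negbTE za).
have -> : q a = 0 by rewrite /q eqxx hda.
rewrite /q (negbTE za) /h subrr !mul0r !subr0.
by field; rewrite subr_eq0.
Qed.

End Zeros.

(** * The identity theorem and Riemann's extension theorem *)

Section Identity.
Variable R : realType. Local Notation C := (cplx R).
Variable V : nmod C.

Lemma convex_connected (D : set V) :
 (forall a b (t : R), D a -> D b -> 0 <= t <= 1 -> D (a + rc t *: (b - a))) -> connected D.
Proof.
move=> cD; have [->|/set0P[a Da]] := eqVneq D set0; first exact: connected0.
have -> : D = \bigcup_(b in D) ((fun t : R => a + rc t *: (b - a)) @` `[0, 1]).
 apply/seteqP; split=> [b Db|x [b Db [t /=]]].
  by exists b => //; exists 1; rewrite ?rc1 ?scale1r ?subrKC //= in_itv /= lexx ler01.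
 by rewrite in_itv /= => t01 <-; exact: cD.
apply: bigcup_connected.
 by exists a => b Db; exists 0; rewrite ?rc0 ?scale0r ?addr0 //= in_itv /= lexx ler01.
move=> b Db; apply: connected_continuous_connected; first exact: segment_connected.
apply: continuous_subspaceT => t A nA.
have [e e0 eA] := (@nbhs_rP R V _ A).1 nA.
have ba : 0 < nm (b - a) + 1 by rewrite ltr_wpDl ?nm_ge0.
apply/nbhs_ballP; exists (e / (nm (b - a) + 1)); first by rewrite /= divr_gt0.
move=> s; rewrite -ball_normE /= ltr_pdivlMr // => st; apply: eA.
rewrite opprD addrACA subrr add0r -scalerBl -rcB nmZ nm_rc distrC.
by apply: le_lt_trans st; rewrite ler_wpM2l //; lra.
Qed.

Lemma rball_connected (a : V) (r : R) : connected [set x | nm (x - a) < r].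
Proof. by apply: convex_connected => x y t /= xa ya t01; exact: ball_segment. Qed.

(** On the complex line through [p] and [x] the zeros of [f] accumulate at [p], so the one-variable
    dichotomy makes [f] vanish there. The proportion 1/16 does not depend on how small the ball of
    known zeros is, which is what makes the next set closed. *)
Lemma identity_step (f : V -> C) (p : V) (r : R) : 0 < r ->
 (forall x, nm (x - p) < r -> hol f x) ->
 (exists2 e : R, 0 < e & forall x, nm (x - p) < e -> f x = 0) ->
 forall x, nm (x - p) < r / 16 -> f x = 0.
Proof.
move=> r0 df [e e0 fe] x xp; have [->|xnp] := eqVneq x p; first by apply: fe; rewrite subrr nm0.
pose v := x - p; have v0 : 0 < nm v by rewrite nm_gt0 subr_eq0.
have near (s : C) : nm (s - 0) < r / nm v -> nm (p + s *: v - p) < r.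
 by rewrite subr0 ltr_pdivlMr // addrAC subrr add0r nmZ.
have rv : 0 < r / nm v by rewrite divr_gt0.
have [|h|[d d0 dP]] := @isolated_zero R (fun s : C => f (p + s *: v)) 0 _ rv.
- by move=> s /near/df/diff_line[].
- have := h 1; rewrite scale1r /v subrKC; apply.
 by rewrite subr0 nm1 mulrAC ltr_pdivlMr // mul1r.
pose t : R := min (d / 2) (e / 2 / nm v).
have t0 : 0 < t by rewrite lt_min !divr_gt0.
have td : t <= d / 2 by rewrite ge_min lexx.
have te : t <= e / 2 / nm v by rewrite ge_min lexx orbT.
have := dP (rc t); rewrite subr0 nm_rc gtr0_norm // rc_eq0 gt_eqF // => /(_ _ isT)/eqP h.
exfalso; apply: h; first by lra.
apply: fe; rewrite addrAC subrr add0r nmZ nm_rc gtr0_norm //.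
by move: te; rewrite ler_pdivlMr //; lra.
Qed.

Lemma identity_connected (f : V -> C) (D : set V) (x0 : V) : open D -> connected D ->
 (forall x, D x -> hol f x) -> D x0 ->
 (exists2 e : R, 0 < e & forall x, nm (x - x0) < e -> f x = 0) ->
 forall x, D x -> f x = 0.
Proof.
move=> oD cD df Dx0 fx0.
pose Z (x : V) := exists2 e : R, 0 < e & forall y, nm (y - x) < e -> f y = 0.
have oZ : open Z.
 apply/open_rP => x [e e0 he]; exists (e / 2); first lra.
 move=> y yx; exists (e / 2); first lra.
 by move=> z zy; apply: he; have := nm_tri y z x; lra.
suff <- : D `&` Z = D by move=> x [_ [e e0 he]]; apply: he; rewrite subrr nm0.
apply: cD; first by exists x0.
- by exists Z.
exists (closure Z); first exact: closed_closure.
apply/seteqP; split=> x [Dx Zx]; split=> //; first exact: subset_closure.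
have /open_rP/(_ x Dx)[r r0 rD] := oD.
have [y [Zy /= yx]] : Z `&` [set y | nm (y - x) < r / 64] !=set0.
 by apply: Zx; apply/nbhs_rP; exists (r / 64); first lra.
exists (r / 64); first lra.
move=> z zx; have r2 : 0 < r / 2 by lra.
apply: (@identity_step f y (r / 2) r2) => //.
 by move=> w wy; apply/df/rD; have := nm_tri y w x; lra.
by have := nm_tri x z y; rewrite [nm (x - y)]nmC; lra.
Qed.

End Identity.

Section RiemannExtension.
Variable R : realType. Local Notation C := (cplx R).

(** By the identity theorem the zeros of [d] are isolated. The extensions around the single zeros
    are chosen separately and glued by taking, at each zero z, the value at z of its own
    extension. *)
Lemma removable_set (d f : C -> C) (a s0 : C) (r M : R) : 0 < r ->
 (forall z, nm (z - a) < r -> hol d z) ->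
 nm (s0 - a) < r -> d s0 != 0 ->
 (forall z, nm (z - a) < r -> d z != 0 -> hol f z) ->
 (forall z, nm (z - a) < r -> d z != 0 -> nm (f z) <= M) ->
 exists2 g, forall z, nm (z - a) < r -> hol g z &
  forall z, nm (z - a) < r -> d z != 0 -> g z = f z.
Proof.
move=> r0 dd s0a ds0 df fM.
have iso z : nm (z - a) < r -> exists2 e : R, 0 < e &
  forall w, nm (w - z) < e -> nm (w - a) < r /\ (w != z -> d w != 0).
 move=> za; have e0 : 0 < r - nm (z - a) by lra.
 have sub w : nm (w - z) < r - nm (z - a) -> nm (w - a) < r.
  by have := nm_tri z w a; lra.
 have [w /sub/dd//|h|[e e1 he]] := @isolated_zero R d z _ e0.
  exfalso; move/eqP: ds0; apply.
  apply: (@identity_connected R C d [set w | nm (w - a) < r] z) => //.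
  - exact: open_rball.
  - exact: rball_connected.
  - by exists ((r - nm (z - a)) / 16) => //; lra.
 exists (min e (r - nm (z - a))); first by rewrite lt_min e1.
 by move=> w; rewrite lt_min => /andP[we /sub wa]; split=> // wz; apply: he.
have hg z : exists g : C -> C, nm (z - a) < r -> exists2 e : R, 0 < e &
  forall w, nm (w - z) < e -> [/\ nm (w - a) < r, hol g w & w != z -> d w != 0 /\ g w = f w].
 have [za|za] := ltP (nm (z - a)) r; last by exists f => h; lra.
 have [e e0 he] := iso z za.
 have [w /he[wa h] wz|w /he[wa h] wz|g dg gf] := @removable R f z e M e0.
 - by apply: df => //; exact: h.
 - by apply: fM => //; exact: h.
 exists g => _; exists e => // w we; have [wa h] := he w we.
 by split=> // [|wz]; [exact: dg|split; [exact: h|exact: gf]].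
have [g gP] := choice hg.
exists (fun z => if d z != 0 then f z else g z z); last by move=> z _ ->.
move=> z za; have [e e0 he] := gP z za.
have [_ dgz _] := he z ltac:(by rewrite subrr nm0).
suff h : der (fun z => if d z != 0 then f z else g z z) z ('d (g z) z 1) by have [] := der_diff h.
have [dz|dz] := boolP (d z != 0); last first.
 apply: der_local e0 _ (diff_der dgz) => w /he[_ _ hw].
 by have [->|/hw[-> ->//]] := eqVneq w z; rewrite (negbTE dz).
have /continuous_rP/(_ (nm (d z))) : {for z, continuous d} by apply: diff_cont; exact: dd.
rewrite nm_gt0 => /(_ dz)[e1 e10 he1].
have gz : g z z = f z.
 apply/eqP; rewrite -subr_eq0 -nm_eq0 eq_le nm_ge0 andbT; apply/ler_addgt0Pr => k k0.
 have k2 : 0 < k / 2 by lra.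
 have /continuous_rP/(_ _ k2)[a1 a10 h1] := diff_cont dgz.
 have /continuous_rP/(_ _ k2)[a2 a20 h2] := diff_cont (df z za dz).
 pose t : R := min (min a1 a2) e / 2.
 have m0 : 0 < min (min a1 a2) e by rewrite !lt_min a10 a20.
 have : nm (z + rc t - z) < min (min a1 a2) e.
  by rewrite addrAC subrr add0r nm_rc gtr0_norm /t; lra.
 rewrite !lt_min => /andP[/andP[/h1 q1 /h2 q2] /he[_ _]].
 have : z + rc t != z by rewrite -subr_eq0 addrAC subrr add0r rc_eq0 gt_eqF // /t; lra.
 move=> tz /(_ tz)[_ q3]; rewrite q3 in q1.
 have := nm_tri (f (z + rc t)) (g z z) (f z); rewrite [nm (g z z - f (z + rc t))]nmC; lra.
apply: der_local e0 _ (diff_der dgz) => w /he[_ _ hw].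
by have [->|/hw[-> ->//]] := eqVneq w z; rewrite dz.
Qed.

(** A rate of convergence, hence convergence uniform in any parameter on which [L] does not depend.
    Holomorphy is asked on [side] alone, so the integrand may be singular at the centre. *)
Lemma bd_lip n k (f : C -> C) c (r L : R) : 0 <= r -> 0 <= L ->
 (forall w, side c r w -> hol f w /\ nm ('d f w 1) <= L) ->
 nm (bd (n + k) f c (rc r) - bd n f c (rc r)) <= 16 * L * r ^+ 2 / 2 ^+ n.
Proof.
move=> r0 L0 h.
have edge s t s' t' : (s == s') || (t == t') ->
  nm (seg (n + k) f (c + rc r * cor R s t) (c + rc r * cor R s' t') -
      seg n f (c + rc r * cor R s t) (c + rc r * cor R s' t')) <= L * (2 * r) ^+ 2 / 2 ^+ n.
 move=> st; set p := c + _; set q := c + rc r * cor R s' t'.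
 have pq : nm (q - p) <= 2 * r.
  have := @bd_edge R 0 (fun=> 1) c r 1 s t s' t' r0 st; rewrite seg_cst mulr1 mulr1.
  by apply=> // w _; rewrite nm1.
 apply: (@le_trans _ _ (L * nm (q - p) ^+ 2 / 2 ^+ n)); last first.
  rewrite ler_wpM2r ?invr_ge0 ?exprn_ge0 // ler_wpM2l //.
  by apply: lerXn2r; rewrite ?nnegrE ?nm_ge0 // mulr_ge0.
 apply: seg_lip => // w w' [x x01 ->] [y y01 ->].
 apply: mean_value => z z01.
 set u := _ + _ *: _.
 have /h[du dL] : side c r u.
  apply: (bd_side r0 st); exists (y + z * (x - y)); first by nra.
  by rewrite /u -/p -/q rcD rcM rcB /GRing.scale /=; ring.
 split=> //; rewrite [X in nm X](diff1E f) nmZ mulrC.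
 by rewrite ler_wpM2r ?nm_ge0.
rewrite /bd.
set A1 := seg (n + k) _ _ _; set A2 := seg (n + k) _ _ _; set A3 := seg (n + k) _ _ _; set A4 := seg (n + k) _ _ _.
set E1 := seg n _ _ _; set E2 := seg n _ _ _; set E3 := seg n _ _ _; set E4 := seg n _ _ _.
have e1 : nm (A1 - E1) <= L * (2 * r) ^+ 2 / 2 ^+ n by exact: edge.
have e2 : nm (A2 - E2) <= L * (2 * r) ^+ 2 / 2 ^+ n by exact: edge.
have e3 : nm (A3 - E3) <= L * (2 * r) ^+ 2 / 2 ^+ n by exact: edge.
have e4 : nm (A4 - E4) <= L * (2 * r) ^+ 2 / 2 ^+ n by exact: edge.
have -> : A1 + A2 + A3 + A4 - (E1 + E2 + E3 + E4) = (A1 - E1) + (A2 - E2) + (A3 - E3) + (A4 - E4) by ring.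
have -> : 16 * L * r ^+ 2 / 2 ^+ n = 4 * (L * (2 * r) ^+ 2 / 2 ^+ n).
 by ring.
have t1 := nmD (A1 - E1 + (A2 - E2) + (A3 - E3)) (A4 - E4).
have t2 := nmD (A1 - E1 + (A2 - E2)) (A3 - E3).
have t3 := nmD (A1 - E1) (A2 - E2).
move: (L * _ / _) e1 e2 e3 e4 => B e1 e2 e3 e4; clear edge; lra.
Qed.

Lemma diff_shift (V : nmod C) (c x : V) : hol (fun z : V => z + c) x.
Proof. by apply: holD => //; exact: hol_cst. Qed.

Lemma diff_translate (V W : nmod C) (f : V -> W) (c x : V) :
 hol f (x + c) -> hol (fun z => f (z + c)) x.
Proof. by move=> df; apply: (diff_compo (fun z => z + c) f) => //; exact: diff_shift. Qed.

Lemma seg_holo (V : nmod C) n (F : C -> V -> C) p q x :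
 (forall w, on_seg p q w -> hol (F w) x) ->
 hol (fun y => seg n (fun w => F w y) p q) x.
Proof.
elim: n p q => [|n IH] p q h /=.
 apply: holM; first exact: hol_cst.
 by apply: h; exact: on_seg_mid.
by apply: holD; apply: IH => w hw; apply: h; [exact: on_seg_half1|exact: on_seg_half2].
Qed.

Lemma bd_holo (V : nmod C) n (F : C -> V -> C) c (r : R) x : 0 <= r ->
 (forall w, side c r w -> hol (F w) x) ->
 hol (fun y => bd n (fun w => F w y) c (rc r)) x.
Proof.
move=> r0 h; rewrite /bd.
apply: (@holD _ V C (fun y => _ + _ + _) (fun y => _)).
 apply: (@holD _ V C (fun y => _ + _) (fun y => _)).
  by apply: (@holD _ V C (fun y => _) (fun y => _)); apply: seg_holo => w hw; apply: h; exact: bd_side hw.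
 by apply: seg_holo => w hw; apply: h; exact: bd_side hw.
by apply: seg_holo => w hw; apply: h; exact: bd_side hw.
Qed.

(** A lower bound no longer suffices: the extension constructed next is a limit of sums divided by
    the limit of [ker]. *)
Lemma ker_cvg : exists2 k : C, k != 0 & van (fun n => ker R n - k).
Proof.
have dinv (w : C) : side 0 1 w -> hol (fun w : C => w^-1) w /\ nm ('d (fun w : C => w^-1) w 1) <= 32.
 move=> [_]; rewrite subr0 => w1; have w0 : w != 0 by rewrite -nm_gt0; lra.
 have far z : nm (z - w) < 2^-1 -> 2^-1 <= nm z.
  by have := nm_sub w z; rewrite [nm (w - z)]nmC; lra.
 have h2 : 0 < (2^-1 : R) by rewrite invr_gt0.
 split; first by apply: differentiableV.
 have -> : 32 = 8 * 2 / 2^-1 :> R by field.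
 apply: (@deriv_bound1 R (fun w => w^-1) w 2^-1 2 h2) => z /far hz.
  by apply: differentiableV => //; rewrite -nm_gt0; lra.
 by rewrite nmV -[leRHS]invrK lef_pV2 ?posrE //; lra.
have cau n k : nm (ker R (n + k) - ker R n) <= 16 * 32 * 1 ^+ 2 / 2 ^+ n.
 by rewrite /ker -rc1; exact: bd_lip.
have [|k kP] := @cauchy_cplx R (ker R).
 move=> e e0; have e2 : 0 < e / 2 by lra.
 have [|N hN] := @pow2_small R (16 * 32 * 1 ^+ 2) (e / 2) _ e2.
  by rewrite expr1n mulr1 mulr_ge0 ?ler0n.
 exists N => m n Nm Nn; have h1 := cau N (m - N)%N; have h2 := cau N (n - N)%N.
 rewrite subnKC // in h1; rewrite subnKC // in h2.
 have := nm_tri (ker R N) (ker R m) (ker R n); rewrite [nm (ker R N - _)]nmC.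
 move: (_ / 2 ^+ N) hN h1 h2 => B hN h1 h2; lra.
exists k; last by move=> e e0; have /cvg_rP/(_ e e0) := kP.
have /cvg_rP/(_ 1 ltr01)[N /(_ N (leqnn N)) hN] := kP.
rewrite -nm_gt0; have := ker_lower R N; have := nm_sub (ker R N) k; lra.
Qed.

(** The radius [rho] is fixed before [G], since it has to serve all clopen sets at once. Along a
    direction [v] in which [del] does not vanish identically, a small square boundary avoids the
    zeros of [del] for all x near [a]. The extension is Cauchy's integral of [G] over this boundary:
    it is holomorphic in x as a uniform limit of midpoint sums, and it agrees with [G] by the
    one-variable theorem on the line through x. *)
Lemma riemann_ext (V : nmod C) (D : set V) (del : V -> C) (a : V) : open D -> D a ->
 (forall x, D x -> hol del x) ->
 (forall rho : R, 0 < rho -> exists2 y, nm (y - a) < rho & del y != 0) ->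
 exists2 rho : R, 0 < rho & (forall x, nm (x - a) < rho -> D x) /\
 forall (G : V -> C) (M : R),
  (forall x, D x -> del x != 0 -> hol G x /\ nm (G x) <= M) ->
  exists Gh : V -> C,
   forall x, nm (x - a) < rho -> hol Gh x /\ (del x != 0 -> Gh x = G x).
Proof.
move=> oD Da dd dn.
have /open_rP/(_ a Da)[r0 r00 r0D] := oD.
have [y ya dy] := dn (r0 / 4) ltac:(lra).
pose v := y - a; have v4 : nm v < r0 / 4 by [].
have lineD (s : C) : nm (s - 0) < 4 -> D (a + s *: v).
 rewrite subr0 => s4; apply: r0D; rewrite addrAC subrr add0r nmZ.
 by have := nm_ge0 v; have := @nm_ge0 R C s; nra.
pose d0 (s : C) := del (a + s *: v).
have dd0 (s : C) : nm (s - 0) < 4 -> hol d0 s by move=> /lineD/dd/diff_line[].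
have [h|[e e0 he]] := isolated_zero (ltac:(lra) : 0 < 4 :> R) dd0.
 exfalso; move/eqP: dy; apply; have -> : del y = d0 1 by rewrite /d0 scale1r /v subrKC.
 apply: (@identity_connected R C d0 [set s : C | nm (s - 0) < 4] 0) => //.
 - exact: open_rball.
 - exact: rball_connected.
 - by rewrite /= subrr nm0.
 - by exists (4 / 16); first lra.
 - by rewrite /= subr0 nm1; lra.
pose r := min e 4 / 8.
have m0 : 0 < min e 4 by rewrite lt_min e0; lra.
have me : min e 4 <= e by rewrite ge_min lexx.
have m4 : min e 4 <= 4 by rewrite ge_min lexx orbT.
have r_gt0 : 0 < r by rewrite /r; lra.
(* A compact shell which contains the side of the square together with its r / 2 neighbourhood; the
   Cauchy estimate for the integrand needs this margin. *)
pose K := [set w : C | nm (w - 0) <= 4 * r] `&` ~` [set w : C | nm (w - 0) < r / 2].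
have cK : compact K.
 apply: subclosed_compact (rball_compact_cplx (a := 0) (r := 4 * r)) _; last by move=> w [].
 by apply: closedI; [exact: closed_rball|apply: open_closedC; exact: open_rball].
have v1 : 0 < nm v + 1 by rewrite ltr_wpDl ?nm_ge0.
have [rho1 rho10 P1] : exists2 e : R, 0 < e & forall d, 0 < d -> d < e -> forall w, K w ->
  forall x, nm (x - a) < d -> D (x + w *: v) /\ del (x + w *: v) != 0.
 apply: compact_radius cK _ => w [/= wr /negP]; rewrite -leNgt subr0 => wr'.
 have w4 : nm (w - 0) < 4 by rewrite /r in wr; lra.
 have Dw := lineD w w4.
 have dw : del (a + w *: v) != 0.
  apply: he; first by rewrite /r in wr; lra.
  by rewrite -nm_gt0; lra.
 have /open_rP/(_ _ Dw)[b b0 bD] := oD.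
 have /continuous_rP/(_ (nm (del (a + w *: v)))) : {for a + w *: v, continuous del}.
  by apply: diff_cont; exact: dd.
 rewrite nm_gt0 => /(_ dw)[b' b'0 b'P].
 have b2 : 0 < min b b' / 2 / (nm v + 1) by rewrite !divr_gt0 // lt_min b0.
 exists (min (min b b' / 2) (min b b' / 2 / (nm v + 1))).
  by rewrite lt_min b2 divr_gt0 // lt_min b0.
 move=> d dd0' ; rewrite lt_min => /andP[db _] w'; rewrite lt_min => /andP[_].
 rewrite (ltr_pdivlMr _ _ v1) => ww x xa.
 have : nm (x + w' *: v - (a + w *: v)) < min b b'.
  rewrite opprD addrACA -scalerBl; apply: (le_lt_trans (nmD _ _)); rewrite nmZ.
  by have := @nm_ge0 R C (w' - w); have := nm_ge0 v; nra.
 rewrite lt_min => /andP[/bD h1 /b'P h2]; split=> //; rewrite -nm_gt0.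
 have := nm_sub (del (a + w *: v)) (del (x + w' *: v)); rewrite [nm (_ - del (x + _))]nmC; lra.
pose rho := min (rho1 / 2) (r0 / 4).
have rho0 : 0 < rho by rewrite lt_min; apply/andP; split; lra.
have rho_1 : rho < rho1 by rewrite gt_min; apply/orP; left; lra.
have rho_r : rho <= r0 / 4 by rewrite ge_min lexx orbT.
have inD x (w : C) : nm (x - a) < rho -> nm (w - 0) < 2 -> D (x + w *: v).
 rewrite subr0 => xa w2; apply: r0D; rewrite addrAC; apply: (le_lt_trans (nmD _ _)).
 by rewrite nmZ; have := nm_ge0 v; have := nm_ge0 w; nra.
have PK x (w : C) : nm (x - a) < rho -> K w -> D (x + w *: v) /\ del (x + w *: v) != 0.
 by move=> xa Kw; apply: (P1 rho).
exists rho => //; split.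
 by move=> x xa; have := inD x 0 xa; rewrite scale0r addr0 subrr nm0; apply.
move=> G M GP.
have Kr : K (rc r).
 split; rewrite /= subr0 nm_rc gtr0_norm //; first lra.
 by apply/negP; rewrite -leNgt; lra.
have M0 : 0 <= M.
 have a0 : nm (a - a) < rho by rewrite subrr nm0.
 have [D1 dr] := PK a (rc r) a0 Kr.
 by have [_] := GP _ D1 dr; apply: le_trans; exact: nm_ge0.
have sideK w z : side 0 r w -> nm (z - w) < r / 2 -> K z.
 move=> [/sq_norm ws wr] zw; rewrite subr0 in ws wr; split=> /=; rewrite subr0.
  by have := nm_sub z w; lra.
 by apply/negP; rewrite -leNgt; have := nm_sub w z; rewrite [nm (w - z)]nmC; lra.
have K0 w : K w -> r / 2 <= nm w by move=> [_ /= /negP]; rewrite -leNgt subr0.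
pose F x (w : C) := G (x + w *: v) / w.
have dF x w : nm (x - a) < rho -> K w -> hol (F x) w /\ nm (F x w) <= M / (r / 2).
 move=> xa Kw; have [D1 dl] := PK x w xa Kw; have [dG GM] := GP _ D1 dl.
 have w0 := K0 _ Kw; have wp : 0 < nm w by lra.
 split.
  apply: holM; first by have [] := diff_line dG.
  by apply: differentiableV => //; rewrite -nm_gt0.
 rewrite nmM nmV; apply: ler_pM; rewrite ?nm_ge0 ?invr_ge0 ?nm_ge0 //.
 by rewrite lef_pV2 ?posrE //; lra.
have dFL x w : nm (x - a) < rho -> side 0 r w -> hol (F x) w /\ nm ('d (F x) w 1) <= 8 * (M / (r / 2)) / (r / 2).
 move=> xa sw; have Kw : K w by apply: (sideK w) => //; rewrite subrr nm0; move: r_gt0; clra.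
 split; first by have [] := dF x w xa Kw.
 apply: deriv_bound1 => [|z zw|z zw]; first lra.
  by have [] := dF x z xa (sideK _ _ sw zw).
 by have [] := dF x z xa (sideK _ _ sw zw).
set L := 8 * (M / (r / 2)) / (r / 2) in dFL.
have r20 : 0 <= r / 2 by lra.
have L0 : 0 <= L by apply: divr_ge0 => //; apply: mulr_ge0; [exact: ler0n|exact: divr_ge0].
pose N n x := bd n (F x) 0 (rc r).
have cau x n k : nm (x - a) < rho -> nm (N (n + k)%N x - N n x) <= 16 * L * r ^+ 2 / 2 ^+ n.
 move=> xa; apply: (@bd_lip n k (F x) 0 r L (ltW r_gt0) L0) => w sw; exact: dFL.
have small e1 : 0 < e1 -> exists n, 16 * L * r ^+ 2 / 2 ^+ n < e1.
 move=> e10; apply: pow2_small => //; apply: mulr_ge0; last by apply: exprn_ge0; exact: ltW.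
 by apply: mulr_ge0 => //; exact: ler0n.
have /choice[Nl NlP] : forall x, exists l : C, nm (x - a) < rho -> (fun n => N n x) @ \oo --> l.
 move=> x; have [xa|xa] := ltP (nm (x - a)) rho; last by exists 0.
 have [|l lP] := @cauchy_cplx R (fun n => N n x); last by exists l.
 move=> e1 e10; have [n0 hn0] := small (e1 / 2) ltac:(by rewrite divr_gt0); exists n0 => p q np nq.
 have h1 := cau x n0 (p - n0)%N xa; have h2 := cau x n0 (q - n0)%N xa.
 rewrite subnKC // in h1; rewrite subnKC // in h2.
 have := nm_tri (N n0 x) (N p x) (N q x); rewrite [nm (N n0 x - _)]nmC.
 move: (_ / 2 ^+ n0) hn0 h1 h2 => B; clra.
have unif e1 : 0 < e1 -> exists n0, forall n, (n0 <= n)%N -> forall x, nm (x - a) < rho -> nm (N n x - Nl x) < e1.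
 move=> e10; have [n0 hn0] := small (e1 / 3) ltac:(by rewrite divr_gt0); exists n0 => n nn x xa.
 have e13 : 0 < e1 / 3 by rewrite divr_gt0.
 have /cvg_rP/(_ _ e13)[n1 hn1] := NlP x xa.
 have h1 := cau x n0 (n - n0)%N xa; have h2 := cau x n0 n1 xa.
 have h3 := hn1 (n0 + n1)%N (leq_addl _ _).
 rewrite subnKC // in h1.
 have t1 := nm_tri (N n0 x) (N n x) (Nl x).
 have t2 := nm_tri (N (n0 + n1)%N x) (N n0 x) (Nl x); rewrite [nm (N n0 x - N (n0 + n1)%N x)]nmC in t2.
 move: (_ / 2 ^+ n0) hn0 h1 h2 h3 t1 t2 => B; clra.
have [kap kap0 kapP] := ker_cvg.
have dN n x : nm (x - a) < rho -> hol (N n) x.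
 move=> xa; rewrite /N; apply: (@bd_holo V n (fun w y => G (y + w *: v) / w)); first exact: ltW.
 move=> w sw; have Kw : K w by apply: (sideK w) => //; rewrite subrr nm0; move: r_gt0; clra.
 have [D1 dl] := PK x w xa Kw; have [dG _] := GP _ D1 dl.
 apply: holM; last exact: hol_cst.
 exact: (@diff_translate V C G (w *: v) x dG).
have dNl x : nm (x - a) < rho -> hol Nl x.
 move=> xa; have e1 : 0 < rho - nm (x - a) by rewrite subr_gt0.
 have sub z : nm (z - x) < rho - nm (x - a) -> nm (z - a) < rho.
  by have := nm_tri x z a; clra.
 have [||dNx _] := @deriv_cvg R V C (cauchy_targetC R) N Nl x _ e1; last exact: dNx.
  by move=> n z /sub; exact: dN.
 by move=> e2 /unif[n0 hn0]; exists n0 => n /hn0 h z /sub; exact: h.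
exists (fun x => Nl x * kap^-1) => x xa; split.
 by apply: holM; [exact: dNl|exact: hol_cst].
move=> dx.
have r2 : 4 * r <= 2 by rewrite /r; lra.
have line2 (s : C) : nm (s - 0) < 4 * r -> D (x + s *: v) by move=> s2; apply: inD => //; lra.
have [|||||g dg gG] := @removable_set (fun s => del (x + s *: v)) (fun s => G (x + s *: v)) 0 (rc r) (4 * r) M ltac:(move: r_gt0; clra).
- by move=> s /line2/dd/diff_line[].
- by rewrite subr0 nm_rc gtr0_norm; move: r_gt0; clra.
- by have [] := PK x (rc r) xa Kr.
- by move=> s /line2 Ds ds; have [/diff_line[]] := GP _ Ds ds.
- by move=> s /line2 Ds ds; have [] := GP _ Ds ds.
have g0 : g 0 = G x.
 by rewrite gG ?scale0r ?addr0 // subrr nm0; move: r_gt0; clra.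
have sqr w : sq 0 r w -> nm (w - 0) < 4 * r by move=> /sq_norm; move: r_gt0; clra.
have v1' := @mean_value_bd R g 0 r r_gt0 (fun w sw => dg w (sqr w sw)).
have NE n : N n x = bd n (fun w => g w / (w - 0)) 0 (rc r).
 apply: eq_bd => [|w sw]; first exact: ltW.
 have Kw : K w by apply: (sideK w) => //; rewrite subrr nm0; move: r_gt0; clra.
 have [_ dl] := PK x w xa Kw.
 by rewrite /F gG ?subr0 //; have [/sq_norm] := sw; rewrite subr0; move: r_gt0; clra.
have /eqP : Nl x - g 0 * kap = 0.
 apply/eqP; rewrite -nm_eq0 eq_le nm_ge0 andbT; apply/ler_addgt0Pr => e1 e10.
 have e13 : 0 < e1 / 3 by rewrite divr_gt0.
 have [n0 h0] := unif _ e13; have [n1 h1] := v1' _ e13; have [n2 h2] := vanZ (g 0) kapP e13.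
 pose n := (n0 + n1 + n2)%N.
 have q3 := h0 n (leq_trans (leq_addr n1 n0) (leq_addr _ _)) x xa.
 have q2 := h1 n (leq_trans (leq_addl n0 n1) (leq_addr _ _)).
 have q1 := h2 n (leq_addl _ _).
 rewrite -NE in q2.
 have -> : Nl x - g 0 * kap = (Nl x - N n x) + (N n x - g 0 * ker R n) + g 0 * (ker R n - kap) by ring.
 have t1 := nmD (Nl x - N n x + (N n x - g 0 * ker R n)) (g 0 * (ker R n - kap)).
 have t2 := nmD (Nl x - N n x) (N n x - g 0 * ker R n).
 rewrite nmC in q3; clear -q1 q2 q3 t1 t2; lra.
by rewrite subr_eq0 => /eqP ->; rewrite g0 mulfK.
Qed.

End RiemannExtension.

(** * Implicit functions and roots of polynomials *)

Section FixedPoint.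
Variable R : realType. Local Notation C := (cplx R).
Variable W : nmod C.
Hypothesis hW : cauchy_target W.

Section Family.
Variables (I : Type) (B : set I) (G : I -> W -> W) (eta : R).
Hypothesis eta0 : 0 < eta.
Hypothesis GL : forall x, B x -> forall s s', nm s <= eta -> nm s' <= eta ->
 nm (G x s - G x s' - (s - s')) <= nm (s - s') / 2.
Hypothesis G0 : forall x, B x -> nm (G x 0) <= eta / 4.

(** The simplified Newton iteration, with the identity in place of the inverse derivative. The
    hypothesis [GL] makes s - G x s a contraction with factor 1/2. *)
Definition newton k x : W := iter k (fun s => s - G x s) 0.

Lemma newtonS k x : newton k.+1 x = newton k x - G x (newton k x).
Proof. by []. Qed.

Lemma newton_bound k x : B x ->
 nm (newton k x) <= 2 * nm (G x 0) /\
 nm (newton k.+1 x - newton k x) <= nm (G x 0) / 2 ^+ k.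
Proof.
move=> Bx; have g0 := nm_ge0 (G x 0); have gB := G0 Bx.
suff [h1 h2] : nm (newton k x) <= 2 * nm (G x 0) * (1 - (2 ^+ k)^-1) /\
   nm (newton k.+1 x - newton k x) <= nm (G x 0) / 2 ^+ k.
 split=> //; apply: (le_trans h1); rewrite ler_piMr ?mulr_ge0 // lerBlDr lerDl invr_ge0 exprn_ge0 //.
elim: k => [|k [IH1 IH2]].
 by rewrite /newton /= nm0 expr0 invr1 subrr mulr0 sub0r subr0 nmN mulr1.
have p0 : 0 < (2 ^+ k)^-1 :> R by rewrite invr_gt0 exprn_gt0.
have p1 : (2 ^+ k)^-1 <= 1 :> R by rewrite invf_le1 ?exprn_gt0 // exprn_ege1 // ler1n.
have p2 : (2 ^+ k.+1)^-1 = (2 ^+ k)^-1 / 2 :> R by rewrite exprS invfM mulrC.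
rewrite p2; move: (2 ^+ k)^-1 p0 p1 IH1 IH2 => p p0 p1 IH1 IH2.
have b1 : nm (newton k.+1 x) <= 2 * nm (G x 0) * (1 - p / 2).
 by have := nm_sub (newton k.+1 x) (newton k x); nra.
have c1 : nm (newton k.+1 x) <= eta by nra.
have c0 : nm (newton k x) <= eta by nra.
split=> //; have := GL Bx c1 c0.
have -> : newton k.+2 x - newton k.+1 x = - (G x (newton k.+1 x) - G x (newton k x) - (newton k.+1 x - newton k x)).
 have e : newton k.+1 x - newton k x = - G x (newton k x) by rewrite newtonS addrAC subrr add0r.
 by rewrite e newtonS addrAC subrr add0r opprK subrK.
by rewrite nmN => h; apply: (le_trans h); nra.
Qed.

Lemma newton_cauchy k j x : B x -> nm (newton (k + j) x - newton k x) <= 2 * (eta / 4 / 2 ^+ k).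
Proof.
move=> Bx; have gB := G0 Bx.
suff h : nm (newton (k + j) x - newton k x) <= 2 * (eta / 4 / 2 ^+ k) * (1 - (2 ^+ j)^-1).
 have e4 : 0 <= eta / 4 by have := eta0; lra.
 have q0 : 0 <= 2 * (eta / 4 / 2 ^+ k) by apply: mulr_ge0 => //; apply: divr_ge0 => //; exact: exprn_ge0.
 have p1 : 1 - (2 ^+ j)^-1 <= 1 :> R by rewrite lerBlDr lerDl invr_ge0 exprn_ge0.
 by apply: (le_trans h); exact: ler_piMr.
elim: j => [|j IH]; first by rewrite addn0 subrr nm0 expr0 invr1 subrr mulr0.
have [_ h] := newton_bound (k + j) Bx; rewrite addnS.
have := nm_tri (newton (k + j) x) (newton (k + j).+1 x) (newton k x).
have p2 : (2 ^+ j.+1)^-1 = (2 ^+ j)^-1 / 2 :> R by rewrite exprS invfM mulrC.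
have : nm (G x 0) / 2 ^+ (k + j) <= eta / 4 / 2 ^+ k * (2 ^+ j)^-1.
 by rewrite exprD invfM mulrA ler_wpM2r ?invr_ge0 ?exprn_ge0 // ler_wpM2r ?invr_ge0 ?exprn_ge0.
rewrite p2; move: (2 ^+ j)^-1 (eta / 4 / 2 ^+ k) IH => p q IH; move: (_ / 2 ^+ _) h => u h.
move=> h1 h2; clear -h h1 h2 IH; lra.
Qed.

(** The parameters form a bare type, so that one solution map can be taken over shifts of a set, for
    an arbitrary perturbed equation. The explicit rate of the iterates makes their convergence
    uniform in the parameter. *)
Lemma fp_family : exists sig : I -> W, forall x, B x ->
 [/\ nm (sig x) <= 2 * nm (G x 0), G x (sig x) = 0,
   forall s, nm s <= eta -> G x s = 0 -> s = sig x &
   forall k, nm (newton k x - sig x) <= 2 * (eta / 4 / 2 ^+ k)].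
Proof.
have /choice[sig sigP] : forall x, exists l : W, B x -> (fun k => newton k x) @ \oo --> l.
 move=> x; have [Bx|nB] := pselect (B x); last by exists 0.
 have [_ cW] := hW; have [|l lP] := cW (fun k => newton k x); last by exists l.
 move=> e e0; have [|N hN] := @pow2_small R (eta) e _ e0; first exact: ltW.
 exists N => m n Nm Nn.
 have h1 := newton_cauchy N (m - N) Bx; have h2 := newton_cauchy N (n - N) Bx.
 rewrite subnKC // in h1; rewrite subnKC // in h2.
 have h3 := nm_tri (newton N x) (newton m x) (newton n x); rewrite [nm (newton N x - _)]nmC in h3.
 have e4 : eta / 4 / 2 ^+ N = eta / 2 ^+ N / 4 by rewrite mulrAC.
 rewrite e4 in h1 h2; move: (eta / 2 ^+ N) hN h1 h2 => q hN h1 h2; clear -hN h1 h2 h3; lra.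
exists sig => x Bx; have gB := G0 Bx; have g0 := nm_ge0 (G x 0).
have lim k (e : R) : 0 < e -> exists n, (k <= n)%N /\ nm (newton n x - sig x) < e.
 move=> e0; have /cvg_rP/(_ e e0)[N NP] := sigP x Bx.
 by exists (maxn k N); split; [exact: leq_maxl|apply: NP; exact: leq_maxr].
have s1 : nm (sig x) <= 2 * nm (G x 0).
 apply/ler_addgt0Pr => e e0; have [n [_ h]] := lim 0%N e e0.
 have [h1 _] := newton_bound n Bx; have := nm_sub (sig x) (newton n x); rewrite nmC; lra.
have s2 : nm (sig x) <= eta by lra.
have Gsig : G x (sig x) = 0.
 apply/eqP; rewrite -nm_eq0 eq_le nm_ge0 andbT; apply/ler_addgt0Pr => e e0.
 have e5 : 0 < e / 5 by lra.
 have [k hk] := @pow2_small R eta (e / 5) (ltW eta0) e5.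
 have [n [kn hn]] := lim k _ e5.
 have [n1 n2] := newton_bound n Bx.
 have n3 : nm (newton n x) <= eta by lra.
 have n4 : nm (G x (newton n x)) <= e / 5.
  have -> : G x (newton n x) = - (newton n.+1 x - newton n x).
   by rewrite newtonS addrAC subrr add0r opprK.
  rewrite nmN; apply: (le_trans n2); apply: le_trans (ltW hk).
  apply: ler_pM => //; rewrite ?invr_ge0 ?exprn_ge0 //; first lra.
  by rewrite lef_pV2 ?posrE ?exprn_gt0 // ler_weXn2l // ler1n.
 have h := GL Bx s2 n3; rewrite [nm (sig x - newton n x)]nmC in h.
 have t1 := nm_sub (G x (sig x) - G x (newton n x)) (sig x - newton n x).
 rewrite [nm (sig x - newton n x)]nmC in t1.
 have t2 := nm_sub (G x (sig x)) (G x (newton n x)).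
 clear -h t1 t2 n4 hn e0; lra.
split=> //.
 move=> s sE Gs; apply/eqP; rewrite -subr_eq0 -nm_eq0 eq_le nm_ge0 andbT.
 have := GL Bx sE s2; rewrite Gs Gsig subrr sub0r nmN.
 have := nm_ge0 (s - sig x); lra.
move=> k; apply/ler_addgt0Pr => e e0; have [n [kn hn]] := lim k _ e0.
have := newton_cauchy k (n - k) Bx; rewrite subnKC // => h.
have := nm_tri (newton n x) (newton k x) (sig x); rewrite nmC in h.
move: (2 * _) h => q h1 h2; lra.
Qed.
End Family.

(** Each Newton iterate is holomorphic in the parameter and the convergence is uniform. The
    regularity of [G] is stated for substitutions of holomorphic maps, which is how the iterates are
    formed. *)
Lemma fp_holo (V : nmod C) (B : set V) (G : V -> W -> W) (eta : R) : 0 < eta -> open B ->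
 (forall x, B x -> forall s s', nm s <= eta -> nm s' <= eta ->
   nm (G x s - G x s' - (s - s')) <= nm (s - s') / 2) ->
 (forall x, B x -> nm (G x 0) <= eta / 4) ->
 (forall x f, B x -> hol f x -> nm (f x) <= eta -> hol (fun y => G y (f y)) x) ->
 exists sig : V -> W, forall x, B x ->
 [/\ nm (sig x) <= 2 * nm (G x 0), G x (sig x) = 0,
   forall s, nm s <= eta -> G x s = 0 -> s = sig x & hol sig x].
Proof.
move=> eta0 oB GL G0 dG; have [sig sigP] := fp_family eta0 GL G0.
exists sig => x Bx; have [h1 h2 h3 _] := sigP x Bx; split=> //.
have /open_rP/(_ x Bx)[r r0 rB] := oB.
have dn k y : B y -> hol (newton G k) y.
 move=> By; elim: k => [|k IH]; first exact: hol_cst.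
 apply: (@holB _ _ _ (newton G k) (fun z => G z (newton G k z))) => //.
 apply: dG => //; have [h _] := newton_bound GL G0 k By; have := G0 y By; lra.
have [||//] := @deriv_cvg R V W hW (newton G) sig x r r0.
 by move=> n y /rB; exact: dn.
move=> e e0; have [N hN] := @pow2_small R eta e (ltW eta0) e0; exists N => n Nn y /rB By.
have [_ _ _ h] := sigP y By; apply: (le_lt_trans (h n)); apply: le_lt_trans hN.
have -> : 2 * (eta / 4 / 2 ^+ n) = eta * (2 ^+ n)^-1 / 2 by move: (2 ^+ n)^-1 => u; field.
have : eta * (2 ^+ n)^-1 <= eta * (2 ^+ N)^-1.
 rewrite ler_wpM2l ?(ltW eta0) // lef_pV2 ?posrE ?exprn_gt0 // ler_weXn2l // ler1n //.
have : 0 < eta * (2 ^+ n)^-1 by rewrite divr_gt0 // exprn_gt0.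
move: (eta * _) (eta * _) => p q; lra.
Qed.

(** The estimate for two moving points, a consequence of [deriv_lip], is what turns the equation
    into a contraction. *)
Lemma strict_diff (V : nmod C) (F : V -> W) (b : V) (r : R) : 0 < r ->
 (forall x, nm (x - b) < r -> hol F x) ->
 forall e : R, 0 < e -> exists2 d : R, 0 < d & d <= r /\ forall x y, nm (x - b) < d -> nm (y - b) < d ->
  nm (F x - F y - 'd F b (x - y)) <= e * nm (x - y).
Proof.
move=> r0 dF e e0; have b0 : nm (b - b) < r by rewrite subrr nm0.
have [r1 r10 [M M0 FM]] := locally_bounded (dF _ b0).
pose q := min r r1.
have q0 : 0 < q by rewrite lt_min r0.
have qr : q <= r by rewrite ge_min lexx.
have qr1 : q <= r1 by rewrite ge_min lexx orbT.
have dFq x : nm (x - b) < q -> hol F x by move=> h; apply: dF; lra.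
have FMq x : nm (x - b) < q -> nm (F x) <= M by move=> h; apply: FM; lra.
have DL := deriv_lip hW q0 dFq FMq.
have l0 := lip2_gt0 M0 q0; move: (lip2 M q) l0 DL => l l0 DL.
have el : 0 < e / l by rewrite divr_gt0.
exists (min (e / l) (q / 8)); first by rewrite lt_min el; lra.
split; first by rewrite ge_min; apply/orP; right; lra.
have [L LE] : exists L : {linear V -> W}, forall v, 'd F b v = L v by exists ('d F b).
have Lc : continuous L.
 have [K _ KP] := diff_bound (dF b b0).
 by apply: (@linear_cont R V W L K) => v; rewrite -LE.
move=> x y xb yb; rewrite LE.
have -> : F x - F y - L (x - y) = (fun z => F z - L z) x - (fun z => F z - L z) y.
 by rewrite /= linearB /= subrACA.
apply: (@mean_value R V W (fun z => F z - L z) y x) => t t01; have := ball_segment t01 yb xb; set z := _ + _ *: _.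
rewrite lt_min => /andP[zb1 zb].
have dz : hol F z by apply: dFq; lra.
split; first by apply: holB => //; exact: linear_differentiable.
rewrite [X in nm X](diffBL_at (x - y) Lc dz) -LE.
have b8 : nm (b - b) < q / 8 by rewrite subrr nm0; lra.
apply: (le_trans (DL z b (x - y) zb b8)).
rewrite ltr_pdivlMr // in zb1.
have := nm_ge0 (x - y); have := nm_ge0 (z - b); nra.
Qed.

(** A bounded right inverse [Rr] of the differential takes the place of a splitting of coordinates:
    every x near [b] is corrected along the image of [Rr] to a zero of [F], uniquely among small
    corrections. The bound by [F x] says how far the zero is. *)
Lemma implicit (V : nmod C) (F : V -> W) (b : V) (r c : R) (Rr : {linear W -> V}) :
 0 < r -> (forall s, nm (Rr s) <= c * nm s) ->
 (forall x, nm (x - b) < r -> hol F x) -> F b = 0 ->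
 (forall s, 'd F b (Rr s) = s) ->
 exists (eps eta : R) (sig : V -> W), [/\ 0 < eps, 0 < eta &
  forall x, nm (x - b) < eps ->
  [/\ nm (sig x) <= 2 * nm (F x), nm (sig x) < eta, nm (x + Rr (sig x) - b) < r,
    F (x + Rr (sig x)) = 0 /\
    (forall s, nm s <= eta -> F (x + Rr s) = 0 -> s = sig x) & hol sig x]].
Proof.
move=> r0 Rc dF Fb dR.
have c1 : 0 < `|c| + 1 by rewrite ltr_wpDl.
have ec : 0 < 2^-1 / (`|c| + 1) by rewrite divr_gt0.
have [d d0 [dr dP]] := strict_diff r0 dF ec.
have Rc' s : nm (Rr s) <= (`|c| + 1) * nm s.
 apply: (le_trans (Rc s)); rewrite ler_wpM2r ?nm_ge0 //; have := ler_norm c; lra.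
(* Corrections of size at most [eta] move a point by at most d / 4, so the corrected point stays in
   the ball of the strict estimate. *)
pose eta := d / 4 / (`|c| + 1).
have eta0 : 0 < eta by rewrite !divr_gt0.
have Rs s : nm s <= eta -> nm (Rr s) <= d / 4.
 by move=> se; apply: (le_trans (Rc' s)); move: se; rewrite /eta ler_pdivlMr // mulrC.
have b0 : nm (b - b) < r by rewrite subrr nm0.
have e40 : 0 < eta / 4 by lra.
have /continuous_rP/(_ _ e40)[e1 e10 e1P] := diff_cont (dF b b0).
have [eps eps0 [epse epsd]] : exists2 eps : R, 0 < eps & eps <= e1 /\ eps <= d / 4.
 exists (min e1 (d / 4)); first by rewrite lt_min e10; lra.
 by split; rewrite ge_min lexx ?orbT.
have inb x s : nm (x - b) < eps -> nm s <= eta -> nm (x + Rr s - b) < d.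
 move=> xb /Rs sR; rewrite addrAC; apply: (le_lt_trans (nmD _ _)); lra.
have Fsmall x : nm (x - b) < eps -> nm (F x) < eta / 4.
 by move=> xb; have := e1P x (lt_le_trans xb epse); rewrite Fb subr0.
have cRr : continuous Rr by exact: linear_cont Rc.
have [|||sig sigP] := @fp_holo V [set x | nm (x - b) < eps] (fun x s => F (x + Rr s)) eta eta0 (open_rball _ _).
- move=> x /= xb s s' se se'.
 have eR : x + Rr s - (x + Rr s') = Rr (s - s') by rewrite opprD addrACA subrr add0r -linearB.
 have := dP _ _ (inb _ _ xb se) (inb _ _ xb se'); rewrite eR dR => h; apply: (le_trans h).
 apply: (@le_trans _ _ (2^-1 / (`|c| + 1) * ((`|c| + 1) * nm (s - s')))).
  by rewrite ler_wpM2l ?(ltW ec).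
 by rewrite mulrA divfK ?gt_eqF // mulrC.
- by move=> x /= xb; rewrite linear0 addr0 ltW // Fsmall.
- move=> x f /= xb df fe.
 apply: (diff_compo (fun y => y + Rr (f y)) F).
  apply: (@holD _ _ _ id (fun y => Rr (f y))) => //.
  by apply: (diff_compo f Rr) => //; exact: linear_differentiable.
 by apply: dF; apply: lt_le_trans dr; exact: inb.
exists eps, eta, sig; split=> // x xb; have [h1 h2 h3 h4] := sigP x xb.
rewrite linear0 addr0 in h1; have h5 := Fsmall x xb.
have h6 : nm (sig x) < eta by lra.
split=> //; apply: lt_le_trans dr; apply: inb => //; exact: ltW.
Qed.

End FixedPoint.

Section Coordinates.
Variable R : realType. Local Notation C := (cplx R).
Variable n : nat.
Local Notation X := 'rV[C]_n.+1.

Definition lastc (x : X) : C := x 0 ord_max.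
Definition ext (x' : 'rV[C]_n) (t : C) : X := \row_i (if unlift ord_max i is Some j then x' 0 j else t).
Definition elast : X := ext 0 1.

Lemma proj_ext x' t : proj (ext x' t) = x'.
Proof. by apply/rowP => j; rewrite /proj !mxE liftK. Qed.

Lemma lastc_ext x' t : lastc (ext x' t) = t.
Proof. by rewrite /lastc mxE unlift_none. Qed.

Lemma ext_eta (x : X) : ext (proj x) (lastc x) = x.
Proof. by apply/rowP => j; rewrite mxE; case: unliftP => [k ->|->]; rewrite ?mxE. Qed.

Lemma projE (x : X) i : proj x 0 i = x 0 (lift ord_max i).
Proof. by rewrite mxE. Qed.

Lemma projB (x y : X) : proj (x - y) = proj x - proj y.
Proof. by apply/rowP => i; rewrite !mxE. Qed.

Lemma lastcB (x y : X) : lastc (x - y) = lastc x - lastc y.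
Proof. by rewrite /lastc !mxE. Qed.

Lemma norm_proj (x : X) : nm (proj x) <= nm x.
Proof. by apply: nm_mx_le => [|i j]; rewrite ?nm_ge0 // (ord1 i) mxE; exact: nm_mxij. Qed.

Lemma norm_lastc (x : X) : nm (lastc x) <= nm x.
Proof. exact: nm_mxij. Qed.

Lemma norm_lt_coord (x : X) (r : R) : nm (proj x) < r -> nm (lastc x) < r -> nm x < r.
Proof.
move=> h1 h2; apply: nm_mx_lt => [|i j]; first exact: le_lt_trans (nm_ge0 _) h2.
rewrite (ord1 i) -[x]ext_eta mxE; case: unliftP => [k _|_] //.
by apply: le_lt_trans h1; exact: nm_mxij.
Qed.

Lemma ext_line x' t s : ext x' (t + s) = ext x' t + s *: elast.
Proof. by apply/rowP => j; rewrite !mxE; case: unliftP => [k _|_]; rewrite ?mxE ?mulr0 ?addr0 ?mulr1. Qed.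

Lemma norm_elast : nm elast = 1.
Proof.
apply/eqP; rewrite eq_le; apply/andP; split; last first.
 by have := norm_lastc elast; rewrite lastc_ext nm1.
apply: nm_mx_le => // i j; rewrite (ord1 i) mxE; case: unliftP => [k _|_]; first by rewrite mxE nm0.
by rewrite nm1.
Qed.

Lemma diff_proj (x : X) : hol (@proj R n) x.
Proof.
apply: mx_differentiable => i j; rewrite (ord1 i).
rewrite (_ : (fun x : X => proj x 0 j) = (fun x : X => x 0 (lift ord_max j) : C)).
 exact: differentiable_coord.
by apply/funext => y; rewrite projE.
Qed.

Lemma diff_lastc (x : X) : hol lastc x.
Proof. exact: differentiable_coord. Qed.

End Coordinates.

Section MonicPolynomials.
Variable R : realType. Local Notation C := (cplx R).

Lemma size_lowpoly (K : nzRingType) d (b : 'rV[K]_d) : (size (lowpoly b) <= d)%N.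
Proof.
apply: (leq_trans (size_sum _ _ _)); apply/bigmax_leqP => i _.
apply: (leq_trans (size_scale_leq _ _)); rewrite size_polyXn.
by case: i => i /= hi; lia.
Qed.

Lemma size_unipoly (K : nzRingType) d (a : 'rV[K]_d) : size (unipoly a) = d.+1.
Proof. by rewrite /unipoly size_polyDl ?size_polyXn // ltnS size_lowpoly. Qed.

Lemma monic_unipoly (K : nzRingType) d (a : 'rV[K]_d) : unipoly a \is monic.
Proof.
by rewrite monicE /unipoly lead_coefDl ?size_polyXn ?lead_coefXn // ltnS size_lowpoly.
Qed.

Lemma unipoly_eval d (a : 'rV[C]_d) t :
 (unipoly a).[t] = t ^+ d + \sum_(i < d) a 0 i * t ^+ (d - i.+1).
Proof.
rewrite /unipoly /lowpoly hornerD hornerXn horner_sum; congr (_ + _).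
by apply: eq_bigr => i _; rewrite hornerZ hornerXn.
Qed.

Lemma lowpoly_eval d (a : 'rV[C]_d) t :
 (lowpoly a).[t] = \sum_(i < d) a 0 i * t ^+ (d - i.+1).
Proof. by rewrite /lowpoly horner_sum; apply: eq_bigr => i _; rewrite hornerZ hornerXn. Qed.

Lemma unipoly_roots d (a : 'rV[C]_d) : exists rs : seq C,
 size rs = d /\ unipoly a = \prod_(z <- rs) ('X - z%:P).
Proof.
have [rs hr] := closed_field_poly_normal (unipoly a).
have ul : lead_coef (unipoly a) = 1 by apply/eqP; have := monic_unipoly a; rewrite monicE.
rewrite ul scale1r in hr; exists rs; split=> //.
have := size_unipoly a; rewrite hr size_prod_XsubC; by case.
Qed.

Lemma prod_norm (rs : seq C) (P : pred C) t :
 nm (\prod_(z <- rs | P z) (t - z)) = \prod_(z <- rs | P z) nm (t - z).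
Proof. by elim/big_ind2: _ => [|x1 x2 y1 y2 <- <-|//]; rewrite ?nm1 ?nmM. Qed.

Lemma prod_lower (rs : seq C) (P : pred C) t (e : R) : 0 < e <= 1 ->
 (forall z, z \in rs -> P z -> e <= nm (t - z)) ->
 e ^+ size rs <= nm (\prod_(z <- rs | P z) (t - z)).
Proof.
move=> /andP[e0 e1]; rewrite prod_norm; elim: rs => [|z rs IH] nz; first by rewrite big_nil expr0.
have h : e ^+ size rs <= \prod_(z <- rs | P z) nm (t - z).
 by apply: IH => y yr; apply: nz; rewrite inE yr orbT.
rewrite big_cons /=; case: ifP => Pz.
 rewrite exprS; apply: ler_pM => //; [exact: ltW|by apply: exprn_ge0; exact: ltW|].
 by apply: nz => //; exact: mem_head.
by apply: le_trans h; rewrite exprS ler_piMl // exprn_ge0 // ltW.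
Qed.

Lemma small_factor (rs : seq C) (P : pred C) t (e : R) : 0 < e <= 1 ->
 nm (\prod_(z <- rs | P z) (t - z)) < e ^+ size rs -> exists2 z, z \in rs & P z /\ nm (t - z) < e.
Proof.
move=> e01 h; apply: contrapT => nz; move: h; rewrite ltNge => /negP; apply; apply: prod_lower => // z zr Pz.
by rewrite leNgt; apply/negP => lt; apply: nz; exists z.
Qed.

Lemma unipoly_diff d (a b : 'rV[C]_d) t (r : R) : 1 <= r -> nm t <= r ->
 nm ((unipoly a).[t] - (unipoly b).[t]) <= d%:R * r ^+ d * nm (a - b).
Proof.
move=> r1 tr; rewrite !unipoly_eval opprD addrACA subrr add0r -sumrB.
apply: (le_trans (nm_sum _ _ _)).
apply: (@le_trans _ _ (\sum_(i < d) r ^+ d * nm (a - b))); last first.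
 by rewrite sumr_const card_ord -[leLHS]mulr_natl mulrA.
apply: ler_sum => i _; rewrite -mulrBl nmM mulrC nmX; apply: ler_pM; rewrite ?exprn_ge0 ?nm_ge0 //.
 apply: (@le_trans _ _ (r ^+ (d - i.+1))).
  by apply: lerXn2r; rewrite ?nnegrE ?nm_ge0 //; lra.
 by rewrite ler_weXn2l // leq_subr.
by have := nm_mxij (a - b) 0 i; rewrite !mxE.
Qed.

Lemma root_bound d (a : 'rV[C]_d) z : root (unipoly a) z -> nm z <= 1 + d%:R * nm a.
Proof.
move=> /rootP; rewrite unipoly_eval => /eqP; rewrite addr_eq0 => /eqP h.
have da : 0 <= d%:R * nm a by rewrite mulr_ge0 ?nm_ge0 // ler0n.
rewrite leNgt; apply/negP => hz; have z1 : 1 < nm z by lra.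
have d0 : (0 < d)%N.
 by case: d a h {da hz} => // a; rewrite big_ord0 oppr0 expr0 => /eqP; rewrite oner_eq0.
have : nm (z ^+ d) <= d%:R * nm a * nm z ^+ d.-1.
 rewrite h nmN; apply: (le_trans (nm_sum _ _ _)).
 apply: (@le_trans _ _ (\sum_(i < d) nm a * nm z ^+ d.-1)); last first.
  by rewrite sumr_const card_ord -[leLHS]mulr_natl mulrA.
 apply: ler_sum => i _; rewrite nmM nmX; apply: ler_pM; rewrite ?exprn_ge0 ?nm_ge0 //.
  exact: nm_mxij.
 rewrite ler_weXn2l // ?ltW //; have := ltn_ord i; lia.
rewrite nmX -{1}(prednK d0) exprS ler_pM2r ?exprn_gt0 //; lra.
Qed.

(** At a root z of one polynomial the other has a small value, and this value is the product of the
    distances from z to its roots, so one of them is small. The argument is symmetric once the roots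
    of both are bounded. *)
Lemma roots_continuous d (a : 'rV[C]_d) (e : R) : 0 < e ->
 exists2 rho : R, 0 < rho & forall b : 'rV[C]_d, nm (b - a) < rho ->
  (forall z, root (unipoly a) z -> exists2 z', root (unipoly b) z' & nm (z - z') < e) /\
  (forall z, root (unipoly b) z -> exists2 z', root (unipoly a) z' & nm (z - z') < e).
Proof.
move=> e0; pose e' := min e 1.
have e'0 : 0 < e' by rewrite lt_min e0 ltr01.
have e'1 : 0 < e' <= 1 by rewrite e'0 ge_min lexx orbT.
have e'e : e' <= e by rewrite ge_min lexx.
have da : 0 <= d%:R * nm a by rewrite mulr_ge0 ?nm_ge0 // ler0n.
pose r := 1 + d%:R * (nm a + 1).
have r1 : 1 <= r by rewrite lerDl mulr_ge0 ?ler0n // addr_ge0 ?nm_ge0.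
pose K := d%:R * r ^+ d + 1.
have K0 : 0 < K by rewrite ltr_wpDl // mulr_ge0 ?ler0n // exprn_ge0 // (le_trans _ r1).
have ed : 0 < e' ^+ d by rewrite exprn_gt0.
have near (p q : 'rV[C]_d) z : nm (q - p) < e' ^+ d / K -> nm z <= r -> root (unipoly p) z ->
  exists2 z', root (unipoly q) z' & nm (z - z') < e.
 move=> pq zr /rootP pz; have [rs [sr hr]] := unipoly_roots q.
 have h : nm (unipoly q).[z] < e' ^+ d.
  have := unipoly_diff q p r1 zr; rewrite pz subr0 => h; apply: (le_lt_trans h).
  move: pq; rewrite ltr_pdivlMr // => pq; apply: le_lt_trans pq; rewrite mulrC ler_wpM2l ?nm_ge0 //.
  by rewrite lerDl.
 have [|z' z'r [_ zz]] := @small_factor rs xpredT z e' e'1.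
  rewrite sr; move: h; rewrite hr horner_prod; congr (nm _ < _).
  by apply: eq_bigr => y _; rewrite hornerXsubC.
 by exists z'; [rewrite hr root_prod_XsubC|exact: lt_le_trans zz e'e].
exists (min 1 (e' ^+ d / K)); first by rewrite lt_min ltr01 divr_gt0.
move=> b; rewrite lt_min => /andP[b1 bK]; split=> z hz.
 apply: (near a b) => //; apply: (le_trans (root_bound hz)); rewrite lerD2l ler_wpM2l ?ler0n //; lra.
apply: (near b a) => //; first by rewrite nmC.
apply: (le_trans (root_bound hz)); rewrite lerD2l ler_wpM2l ?ler0n //.
have := nm_sub b a; lra.
Qed.

Section Eval.
Variables (n d : nat) (c : 'rV[C]_n -> 'rV[C]_d).

Definition wpol (x : 'rV[C]_n.+1) : C := (unipoly (c (proj x))).[lastc x].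

Lemma diff_sumf (V : nmod C) (I : Type) (s : seq I) (f : I -> V -> C) x :
 (forall i, hol (f i) x) -> hol (fun x => \sum_(i <- s) f i x) x.
Proof.
move=> df; elim: s => [|i s IH].
 rewrite (_ : (fun x => _) = (fun=> 0)); first exact: hol_cst.
 by apply/funext => y; rewrite big_nil.
rewrite (_ : (fun x => _) = (fun x => f i x + \sum_(j <- s) f j x)); first exact: holD.
by apply/funext => y; rewrite big_cons.
Qed.

Lemma diff_pow (V : nmod C) (f : V -> C) k x :
 hol f x -> hol (fun x => f x ^+ k) x.
Proof.
move=> df; elim: k => [|k IH].
 rewrite (_ : (fun x => _) = (fun=> 1)); first exact: hol_cst.
 by apply/funext => y; rewrite expr0.
rewrite (_ : (fun x => _) = (fun x => f x * f x ^+ k)); first exact: holM.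
by apply/funext => y; rewrite exprS.
Qed.

Lemma diff_lowpoly (V : nmod C) (b : V -> 'rV[C]_d) (f : V -> C) x :
 hol b x -> hol f x -> hol (fun x => (lowpoly (b x)).[f x]) x.
Proof.
move=> db df; rewrite (_ : (fun x => _) = (fun x => \sum_(i < d) b x 0 i * f x ^+ (d - i.+1))).
 apply: diff_sumf => i; apply: holM; last exact: diff_pow.
 by have [] := diff_entry 0 i db.
by apply/funext => y; rewrite lowpoly_eval.
Qed.

Lemma diff_unipoly (V : nmod C) (b : V -> 'rV[C]_d) (f : V -> C) x :
 hol b x -> hol f x -> hol (fun x => (unipoly (b x)).[f x]) x.
Proof.
move=> db df; rewrite (_ : (fun x => _) = (fun x => f x ^+ d + (lowpoly (b x)).[f x])).
 by apply: holD; [exact: diff_pow|exact: diff_lowpoly].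
by apply/funext => y; rewrite /unipoly hornerD hornerXn.
Qed.

Lemma diff_wpol x : hol c (proj x) -> hol wpol x.
Proof.
move=> dc; apply: (@diff_unipoly _ (fun x => c (proj x)) (@lastc R n)); last exact: diff_lastc.
by apply: (diff_compo (@proj R n) c) => //; exact: diff_proj.
Qed.

Lemma der_horner (p : {poly C}) t : der (fun t => p.[t]) t p^`().[t].
Proof.
elim/poly_ind: p => [|p k IH].
 rewrite deriv0 horner0 (_ : (fun t => _) = (fun=> 0)); first exact: der_cst.
 by apply/funext => u; rewrite horner0.
move=> e e0.
have dp : hol (fun t => p.[t]) t by have [] := der_diff IH.
have /continuous_rP/(_ (e / 2)) := diff_cont dp.
have e2 : 0 < e / 2 by lra.
move=> /(_ e2)[d1 d10 h1]; have t1 : 0 < nm t + 1 by rewrite ltr_wpDl ?nm_ge0.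
have [|d2 d20 h2] := IH (e / 2 / (nm t + 1)); first by rewrite divr_gt0.
exists (min d1 d2); first by rewrite lt_min d10.
move=> h; rewrite lt_min => /andP[hd1 /h2 q2].
have q1 := h1 (t + h); rewrite addrAC subrr add0r in q1; have {}q1 := q1 hd1.
rewrite derivD derivM derivX derivC addr0 mulr1 !hornerD !hornerM !hornerX !hornerC.
have -> : p.[t + h] * (t + h) + k - (p.[t] * t + k) - h * (p^`().[t] * t + p.[t]) =
 t * (p.[t + h] - p.[t] - h * p^`().[t]) + h * (p.[t + h] - p.[t]) by ring.
apply: (le_trans (nmD _ _)); rewrite !nmM.
have a1 : nm t * nm (p.[t + h] - p.[t] - h * p^`().[t]) <= e / 2 * nm h.
 apply: (@le_trans _ _ (nm t * (e / 2 / (nm t + 1) * nm h))).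
  by rewrite ler_wpM2l ?nm_ge0.
 rewrite mulrA ler_wpM2r ?nm_ge0 // mulrA ler_pdivrMr //.
 by rewrite mulrC ler_wpM2l ?(ltW e2) //; lra.
have a2 : nm h * nm (p.[t + h] - p.[t]) <= e / 2 * nm h.
 by rewrite mulrC ler_wpM2r ?nm_ge0 // ltW.
lra.
Qed.

Lemma diff_wpol_last x' t : hol c x' ->
 'd wpol (ext x' t) (elast R n) = (unipoly (c x'))^`().[t].
Proof.
move=> dc.
have dw : hol wpol (ext x' t + 0 *: elast R n).
 by rewrite scale0r addr0; apply: diff_wpol; rewrite proj_ext.
have [_] := diff_line dw.
have -> : (fun s : C => wpol (ext x' t + s *: elast R n)) = (fun s => (unipoly (c x')).[t + s]).
 by apply/funext => s; rewrite -ext_line /wpol proj_ext lastc_ext.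
rewrite scale0r addr0 => <-.
have h := der_horner (unipoly (c x')) t.
suff hs : der (fun s => (unipoly (c x')).[t + s]) 0 (unipoly (c x'))^`().[t] by have [] := der_diff hs.
by move=> e /h[d1 d0 dP]; exists d1 => // s /dP; rewrite add0r addr0.
Qed.

End Eval.
End MonicPolynomials.

(** * Hypersurfaces and convergence of their chains *)

Section GoodFunctions.
Variable R : realType. Local Notation C := (cplx R).
Variable m : nat.
Local Notation X := 'rV[C]_m.
Implicit Types (Om A S : set X) (F : X -> C).

Definition zeros Om F : set X := [set x | Om x /\ F x = 0].
Definition smooth Om F : set X := [set x | [/\ Om x, F x = 0 & exists v, 'd F x v != 0]].
Definition clopen_in A S := S `<=` A /\ forall x, A x -> exists2 e : R, 0 < e &
 forall y, A y -> nm (y - x) < e -> (S x <-> S y).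

(* What the theory of the irreducible components of a hypersurface uses. The points [pts] witness that
  only finitely many components meet W. *)
Record good Om F : Prop := Good {
 good_open : open Om;
 good_holo : forall x, Om x -> hol F x;
 good_dense : forall x, zeros Om F x -> forall e : R, 0 < e -> exists2 y, smooth Om F y & nm (y - x) < e;
 good_empty : forall x, Om x -> forall e : R, 0 < e -> exists2 y, nm (y - x) < e & F y != 0;
 good_local : forall a, Om a -> exists (W : set X) (pts : seq X), [/\ open W, W a, W `<=` Om &
  forall S, clopen_in (smooth Om F) S -> exists h : X -> C,
   [/\ forall x, W x -> hol h x, forall x, W x -> (closure S x <-> h x = 0) &
     (forall p, p \in pts -> ~ S p) -> forall x, W x -> ~ S x]] }.

End GoodFunctions.

(** * The hypersurface of a monic polynomial *)

Section Branches.
Variable R : realType. Local Notation C := (cplx R).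

Lemma diff_local_eq (V W : nmod C) (f g : V -> W) (x : V) (r : R) : 0 < r ->
 (forall y, nm (y - x) < r -> f y = g y) -> hol f x ->
 hol g x /\ 'd g x = 'd f x :> (V -> W).
Proof.
move=> r0 fg df; have [K K0 KP] := diff_bound df.
apply: (@rP_diff R V W g x ('d f x) K KP) => e e0.
have [d d0 dP] := diff_rP df e0; exists (min d r); first by rewrite lt_min d0.
move=> h; rewrite lt_min => /andP[/dP h1 hr].
by rewrite -!fg ?subrr ?nm0 // addrAC subrr add0r.
Qed.

Lemma diff_prodf (V : nmod C) (I : eqType) (s : seq I) (P : pred I) (f : I -> V -> C) x :
 (forall i, i \in s -> hol (f i) x) -> hol (fun y => \prod_(i <- s | P i) f i y) x.
Proof.
elim: s => [|i s IH] h.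
 rewrite (_ : (fun y => _) = (fun=> 1)); first exact: hol_cst.
 by apply/funext => y; rewrite big_nil.
have {}IH := IH (fun y ys => h y (mem_behead (s := i :: s) ys)).
have [Pi|nPi] := boolP (P i).
 rewrite (_ : (fun y => _) = (fun y => f i y * \prod_(i <- s | P i) f i y)); last first.
  by apply/funext => y; rewrite big_cons Pi.
 by apply: holM => //; apply: h; exact: mem_head.
rewrite (_ : (fun y => _) = (fun y => \prod_(i <- s | P i) f i y)) //.
by apply/funext => y; rewrite big_cons (negbTE nPi).
Qed.

(** The arithmetic of an annulus without roots: a root inside radius eta is inside eta / 4, and
    moving it by less than eta / 4 cannot bring it past radius eta. *)
Lemma ring_cases (eta a b s : R) : 0 < eta -> s < eta / 4 -> a <= s + b ->
 a < eta / 4 \/ eta < a -> b < eta / 4 \/ eta < b -> b < eta -> a < eta.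
Proof. by move=> h1 h2 h3 h4 [h5|h5] h6; lra. Qed.

Lemma seq_radius (T : eqType) (s : seq T) (P : T -> R -> Prop) :
 (forall z, z \in s -> exists2 e : R, 0 < e & forall e', 0 < e' -> e' <= e -> P z e') ->
 exists2 e : R, 0 < e & forall z, z \in s -> forall e', 0 < e' -> e' <= e -> P z e'.
Proof.
elim: s => [|z s IH] h; first by exists 1.
have [|e e0 eP] := IH; first by move=> y ys; apply: h; rewrite inE ys orbT.
have [e1 e10 e1P] := h z (mem_head _ _).
exists (min e e1); first by rewrite lt_min e0.
move=> y; rewrite inE => /orP[/eqP ->|ys] e' e'0; rewrite le_min => /andP[h1 h2]; first exact: e1P.
exact: eP.
Qed.

Lemma uniq_simple_roots (s : seq C) :
 (forall z, z \in s -> (\prod_(y <- s) ('X - y%:P))^`().[z] != 0) -> uniq s.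
Proof.
elim: s => [//|z s IH] h /=.
have dE y : (\prod_(y <- z :: s) ('X - y%:P))^`().[y] =
  (\prod_(y <- s) ('X - y%:P)).[y] + (y - z) * (\prod_(y <- s) ('X - y%:P))^`().[y].
 by rewrite big_cons derivM derivXsubC mul1r hornerD hornerM hornerXsubC.
apply/andP; split.
 apply/negP => zs; have := h z (mem_head _ _); rewrite dE subrr mul0r addr0 => /eqP; apply.
 by apply/rootP; rewrite root_prod_XsubC.
apply: IH => y ys; have := h y; rewrite inE ys orbT dE => /(_ isT).
have -> : (\prod_(y <- s) ('X - y%:P)).[y] = 0 by apply/rootP; rewrite root_prod_XsubC.
by rewrite add0r; apply: contra => /eqP ->; rewrite mulr0.
Qed.

Variables (n d : nat) (U1 : set 'rV[C]_n) (c : 'rV[C]_n -> 'rV[C]_d) (delta : 'rV[C]_n -> C).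
Hypothesis oU1 : open U1.
Hypothesis dc : forall x, U1 x -> hol c x.
Hypothesis ddelta : forall x, U1 x -> hol delta x.
Hypothesis deltaP : forall x, U1 x -> delta x != 0 ->
 forall z, root (unipoly (c x)) z -> (unipoly (c x))^`().[z] != 0.
Variable rs : 'rV[C]_d -> seq C.
Hypothesis rsP : forall a, size (rs a) = d /\ unipoly a = \prod_(z <- rs a) ('X - z%:P).

Lemma root_rs a z : root (unipoly a) z = (z \in rs a).
Proof. by have [_ ->] := rsP a; rewrite root_prod_XsubC. Qed.

Lemma uniq_rs x : U1 x -> delta x != 0 -> uniq (rs (c x)).
Proof.
move=> Ux dx; apply: uniq_simple_roots => z zr; have [_ <-] := rsP (c x).
by apply: deltaP => //; rewrite root_rs.
Qed.

Lemma wpol_ext x t : wpol c (ext x t) = (unipoly (c x)).[t].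
Proof. by rewrite /wpol proj_ext lastc_ext. Qed.

Lemma wpol_root x t : wpol c (ext x t) = 0 <-> t \in rs (c x).
Proof. by rewrite wpol_ext -root_rs; split=> [h|/rootP//]; apply/rootP. Qed.

Lemma ext_near (x y : 'rV[C]_n) (s t : C) (e : R) : nm (x - y) < e -> nm (s - t) < e ->
 nm (ext x s - ext y t) < e.
Proof.
by move=> h1 h2; apply: norm_lt_coord; rewrite ?projB ?proj_ext ?lastcB ?lastc_ext.
Qed.

Lemma norm_ext_l (x y : 'rV[C]_n) (t : C) : nm (ext x t - ext y t) = nm (x - y).
Proof.
apply/eqP; rewrite eq_le; apply/andP; split; last by have := norm_proj (ext x t - ext y t); rewrite projB !proj_ext.
apply/ler_addgt0Pr => e e0; apply/ltW; apply: ext_near; first by rewrite ltrDl.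
by rewrite subrr nm0 ltr_wpDl ?nm_ge0.
Qed.

(** The implicit function theorem for the polynomial at the point over [x0], with corrections in the
    direction of the last coordinate divided by the derivative at the root. *)
Lemma simple_root_branch (x0 : 'rV[C]_n) z : U1 x0 -> root (unipoly (c x0)) z ->
 (unipoly (c x0))^`().[z] != 0 -> forall e : R, 0 < e ->
 exists (rho eta : R) (sig : 'rV[C]_n -> C), [/\ 0 < rho, 0 < eta &
  forall x, nm (x - x0) < rho -> [/\ U1 x, hol sig x, nm (sig x - z) < e,
   root (unipoly (c x)) (sig x) & forall t, nm (t - z) <= eta -> root (unipoly (c x)) t -> t = sig x]].
Proof.
move=> Ux0 rz dz e e0.
have /open_rP/(_ x0 Ux0)[r r0 rU] := oU1.
pose b := ext x0 z; pose k := (unipoly (c x0))^`().[z].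
have projb x : nm (x - b) < r -> U1 (proj x).
 by move=> h; apply: rU; apply: le_lt_trans h; have := norm_proj (x - b); rewrite projB proj_ext.
have dw x : nm (x - b) < r -> hol (wpol c) x.
 by move=> /projb/dc; exact: diff_wpol.
have linP : linear (fun s : C => (s * k^-1) *: elast R n).
 move=> l u w; have -> : (l *: u + w) * k^-1 = l * (u * k^-1) + w * k^-1.
  by rewrite -[l *: u]/(l * u); ring.
 by rewrite scalerDl scalerA.
pose LM := GRing.isLinear.Build _ _ _ _ _ linP.
pose Rr : {linear C -> 'rV[C]_n.+1} := HB.pack (fun s : C => (s * k^-1) *: elast R n) LM.
have Rc s : nm (Rr s) <= nm k^-1 * nm s.
 by rewrite /= nmZ norm_elast mulr1 nmM mulrC.
have wb : wpol c b = 0 by rewrite wpol_ext; exact/rootP.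
have dR s : 'd (wpol c) b (Rr s) = s.
 have h1 : 'd (wpol c) b ((s * k^-1) *: elast R n) = (s * k^-1) *: 'd (wpol c) b (elast R n) by exact: linearZ.
 have h2 : (s * k^-1) *: 'd (wpol c) b (elast R n) = (s * k^-1) *: k.
  by congr (_ *: _); exact: (diff_wpol_last z (dc Ux0)).
 apply: (etrans h1); apply: (etrans h2).
 by rewrite -[LHS]/(s * k^-1 * k) -mulrA mulVf ?mulr1.
have [eps [eta [sig [eps0 eta0 sP]]]] := implicit (cauchy_targetC R) r0 Rc dw wb dR.
have k0 : 0 < nm k by rewrite nm_gt0.
pose sg x := z + sig (ext x z) * k^-1.
have /continuous_rP/(_ (e * nm k / 2)) : {for b, continuous (wpol c)}.
 by apply: diff_cont; apply: dw; rewrite subrr nm0.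
have ek : 0 < e * nm k / 2 by rewrite divr_gt0 // mulr_gt0.
move=> /(_ ek)[d1 d10 h1].
exists (min (min eps d1) r), (eta / nm k), sg; split.
- by rewrite !lt_min eps0 d10.
- by rewrite divr_gt0.
move=> x; rewrite !lt_min => /andP[/andP[xe xd] xr].
have xb : nm (ext x z - b) = nm (x - x0) by exact: norm_ext_l.
have [q1 q2 q3 [q4 q5] q6] := sP (ext x z) ltac:(by rewrite xb).
have eE s : ext x z + Rr s = ext x (z + s * k^-1) by rewrite ext_line.
split.
- exact: rU.
- apply: (@holD _ _ _ (fun=> z) (fun x => sig (ext x z) * k^-1)); first exact: hol_cst.
 apply: holM; last exact: hol_cst.
 apply: (diff_compo (fun x => ext x z) sig) => //.
 apply: mx_differentiable => i j; rewrite (ord1 i).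
 rewrite (_ : (fun x => _) = (fun x : 'rV[C]_n => if unlift ord_max j is Some j' then x 0 j' else z : C)); last first.
  by apply/funext => y; rewrite mxE.
 by case: (unlift _ _) => [j'|]; [exact: differentiable_coord|exact: hol_cst].
- rewrite /sg addrAC subrr add0r nmM nmV ltr_pdivrMr //.
 by have := h1 (ext x z); rewrite xb wb subr0 => /(_ xd); lra.
- by apply/rootP; rewrite -wpol_ext /sg -eE.
move=> t tz rt; have := q5 ((t - z) * k).
have -> : nm ((t - z) * k) = nm (t - z) * nm k by rewrite nmM.
rewrite -ler_pdivlMr // => /(_ tz); rewrite eE mulfK -?nm_gt0 // subrKC wpol_ext => /(_ (rootP rt)) hs.
by rewrite /sg -hs mulfK -?nm_gt0 // subrKC.
Qed.

(** Over a nearby x the roots are distinct, and each of them lies close to a root over [x0], hence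
    is the value of that root's branch. Both lists have d entries, so the inclusion is a
    permutation. *)
Lemma branches (x0 : 'rV[C]_n) : U1 x0 -> delta x0 != 0 -> forall e : R, 0 < e ->
 exists (rho : R) (sig : C -> 'rV[C]_n -> C), 0 < rho /\
  forall x, nm (x - x0) < rho -> [/\ U1 x, delta x != 0,
   perm_eq (rs (c x)) [seq sig z x | z <- rs (c x0)] &
   forall z, z \in rs (c x0) -> hol (sig z) x /\ nm (sig z x - z) < e].
Proof.
move=> Ux0 dx0 e e0.
have hz z : exists q : R * R * ('rV[C]_n -> C), z \in rs (c x0) -> [/\ 0 < q.1.1, 0 < q.1.2 &
  forall x, nm (x - x0) < q.1.1 -> [/\ U1 x, hol q.2 x, nm (q.2 x - z) < e,
   root (unipoly (c x)) (q.2 x) & forall t, nm (t - z) <= q.1.2 -> root (unipoly (c x)) t -> t = q.2 x]].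
 have [zr|zr] := boolP (z \in rs (c x0)); last by exists (0, 0, fun=> 0).
 rewrite -root_rs in zr.
 have [rho [eta [sig hs]]] := simple_root_branch Ux0 zr (deltaP Ux0 dx0 zr) e0.
 by exists (rho, eta, sig).
have [q qP] := choice hz.
have [r1 r10 r1P] := @seq_radius _ (rs (c x0)) (fun z e' => e' <= (q z).1.1 /\ e' <= (q z).1.2)
 ltac:(move=> z /qP[h1 h2 _]; exists (min (q z).1.1 (q z).1.2); [by rewrite lt_min h1|by move=> e' _; rewrite le_min => /andP]).
have [rc rc0 rcP] := roots_continuous (c x0) r10.
have /continuous_rP/(_ _ rc0)[r2 r20 r2P] := diff_cont (dc Ux0).
have /continuous_rP/(_ (nm (delta x0))) := diff_cont (ddelta Ux0).
rewrite nm_gt0 => /(_ dx0)[r3 r30 r3P].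
have /open_rP/(_ x0 Ux0)[r4 r40 r4U] := oU1.
exists (min (min r1 r2) (min r3 r4)), (fun z => (q z).2); split.
 by rewrite !lt_min r10 r20 r30.
move=> x; rewrite !lt_min => /andP[/andP[x1 x2] /andP[x3 x4]].
have Ux : U1 x by exact: r4U.
have dx : delta x != 0.
 rewrite -nm_gt0; have := r3P x x3; have := nm_sub (delta x0) (delta x).
 by rewrite [nm (_ - delta x)]nmC; lra.
have sg z : z \in rs (c x0) -> nm (x - x0) < (q z).1.1.
 by move=> zr; have [h _] := r1P z zr r1 r10 (lexx _); exact: lt_le_trans h.
split=> //; last first.
 by move=> z zr; have [_ _ h] := qP z zr; have [_ ? ? _ _] := h x (sg z zr).
have us := uniq_rs Ux dx.
have sub : {subset rs (c x) <= [seq (q z).2 x | z <- rs (c x0)]}.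
 move=> t; rewrite -root_rs => rt; have [_ h] := rcP _ (r2P x x2).
 have [z] := h t rt; rewrite root_rs => zr tz; apply/mapP; exists z => //.
 have [_ _ hx] := qP z zr; have [_ _ _ _ h5] := hx x (sg z zr); apply: h5 => //.
 by have [_ h2] := r1P z zr r1 r10 (lexx _); apply: ltW; exact: lt_le_trans h2.
have sz : (size [seq (q z).2 x | z <- rs (c x0)] <= size (rs (c x)))%N.
 by rewrite size_map (rsP (c x)).1 (rsP (c x0)).1.
have [_ e1] := uniq_min_size us sub sz.
exact: uniq_perm us (leq_size_uniq us sub sz) e1.
Qed.

Variable D : set 'rV[C]_n.+1.
Hypothesis oD : open D.
Hypothesis DU : forall x, D x -> U1 (proj x).
Hypothesis deltaD : forall x, D x -> forall e : R, 0 < e -> exists2 y, nm (y - proj x) < e & delta y != 0.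
Local Notation w := (wpol c).

Lemma diff_wpolD x : D x -> hol w x.
Proof. by move=> /DU/dc; exact: diff_wpol. Qed.

Lemma smooth_ext x t : D (ext x t) -> delta x != 0 -> t \in rs (c x) -> smooth D w (ext x t).
Proof.
move=> Dx dx tr; have Ux : U1 x by have := DU Dx; rewrite proj_ext.
split=> //; first exact/wpol_root.
exists (elast R n); have h := diff_wpol_last t (dc Ux).
by apply: contra_neq (deltaP Ux dx (etrans (root_rs _ _) tr)) => h0; rewrite -h0; exact: esym h.
Qed.

Lemma dense_generic x : D x -> w x = 0 -> forall e : R, 0 < e ->
 exists y, [/\ D y, nm (y - x) < e, delta (proj y) != 0 & lastc y \in rs (c (proj y))].
Proof.
move=> Dx wx e e0; have Ux := DU Dx.
have /open_rP/(_ x Dx)[r r0 rD] := oD.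
have m0 : 0 < min e r by rewrite lt_min e0.
have [rc rc0 rcP] := roots_continuous (c (proj x)) m0.
have /continuous_rP/(_ _ rc0)[r2 r20 r2P] := diff_cont (dc Ux).
have [|x' x'x dx'] := deltaD Dx (e := min r2 (min e r)); first by rewrite lt_min r20.
move: x'x; rewrite lt_min => /andP[x2 xm].
have [h _] := rcP _ (r2P x' x2); have [|t] := h (lastc x); first exact/rootP.
rewrite root_rs => tr tx.
have : nm (ext x' t - x) < min e r.
 by rewrite -[x in _ - x]ext_eta; apply: ext_near => //; rewrite nmC.
rewrite lt_min => /andP[ye yr]; exists (ext x' t); rewrite proj_ext lastc_ext; split=> //.
exact: rD.
Qed.

(** For a clopen set S of smooth points, the product of t - z over the roots z close to the last
    coordinate of [a] whose points lie in S is holomorphic wherever [delta] does not vanish. It is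
    bounded, so Riemann's theorem extends it, and the zeros of the extension form the closure of S.
    If S misses the points over one [x0] with [delta x0] nonzero, the product is empty near [x0],
    and by the identity theorem the extension is 1 throughout. *)
Lemma good_wpol_local a : D a -> exists (W : set 'rV[C]_n.+1) (pts : seq 'rV[C]_n.+1), [/\ open W, W a, W `<=` D &
  forall S, clopen_in (smooth D w) S -> exists h : 'rV[C]_n.+1 -> C,
   [/\ forall x, W x -> hol h x, forall x, W x -> (closure S x <-> h x = 0) &
     (forall p, p \in pts -> ~ S p) -> forall x, W x -> ~ S x]].
Proof.
move=> Da; have Ua := DU Da; pose a' := proj a; pose an := lastc a.
have /open_rP/(_ a Da)[rD rD0 rDP] := oD.
have [eta eta0 [eta2 etaD etaR]] : exists2 eta : R, 0 < eta & [/\ eta <= 2^-1, 2 * eta <= rD &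
  forall z, z \in rs (c a') -> z != an -> 2 * eta < nm (z - an)].
 have [|e e0 eP] := @seq_radius _ (rs (c a')) (fun z e => z != an -> 2 * e < nm (z - an)).
  move=> z _; have [->|za] := eqVneq z an; first by exists 1.
  have zp : 0 < nm (z - an) by rewrite nm_gt0 subr_eq0.
  by exists (nm (z - an) / 3) => [|e' _ h _]; lra.
 exists (min e (min 2^-1 (rD / 2))).
  by rewrite !lt_min e0 divr_gt0 // invr_gt0 ltr0n.
 split=> [||z zr]; first by rewrite !ge_min lexx orbT.
  have : min e (min 2^-1 (rD / 2)) <= rD / 2 by rewrite !ge_min lexx !orbT.
  lra.
 by apply: (eP z zr); rewrite ?ge_min ?lexx // !lt_min e0 divr_gt0 // invr_gt0 ltr0n.
have eta4 : 0 < eta / 4 by lra.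
have [rc rc0 rcP] := roots_continuous (c a') eta4.
have /continuous_rP/(_ _ rc0)[r2 r20 r2P] := diff_cont (dc Ua).
have [rho rho0 [rhoeta rho2]] : exists2 rho : R, 0 < rho & rho <= eta /\ rho <= r2.
 by exists (min eta r2); [rewrite lt_min eta0|split; rewrite ge_min lexx ?orbT].
(* Roots over x close to [a'] stay near those over [a'], so the annulus between eta / 4 and eta
   around [an] contains none: the roots near [an] form a separate group. *)
have ring x z : nm (x - a') < rho -> z \in rs (c x) -> nm (z - an) < eta / 4 \/ eta < nm (z - an).
 move=> xa; rewrite -root_rs => rz; have [_ h] := rcP _ (r2P x (lt_le_trans xa rho2)).
 have [y] := h z rz; rewrite root_rs => yr zy; have [ya|ya] := eqVneq y an; first by left; rewrite -ya.
 by right; have := etaR y yr ya; have := nm_tri z y an; rewrite [nm (y - z)]nmC; lra.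
have inD x t : nm (x - a') < rho -> nm (t - an) < eta -> D (ext x t).
 move=> xa ta; apply: rDP; rewrite -[a]ext_eta; apply: (@lt_le_trans _ _ eta); last lra.
 by apply: ext_near => //; lra.
pose D0 := [set x : 'rV[C]_n.+1 | nm (x - a) < rho].
have D0P x : D0 x -> [/\ D x, nm (proj x - a') < rho & nm (lastc x - an) < eta].
 move=> h; have h1 : nm (proj x - a') < rho by apply: le_lt_trans h; have := norm_proj (x - a); rewrite projB.
 have h2 : nm (lastc x - an) < eta.
  by apply: (@lt_le_trans _ _ rho) => //; apply: le_lt_trans h; have := norm_lastc (x - a); rewrite lastcB.
 by split=> //; rewrite -[x]ext_eta; exact: inD.
have [|x /D0P[Dx _ _]|r r0|r r_gt0 [rD0' ext_]] := @riemann_ext R 'rV[C]_n.+1 D0 (fun x => delta (proj x)) a (open_rball _ _).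
- by rewrite /D0 /= subrr nm0.
- apply: (diff_compo (@proj R n) delta); first exact: diff_proj.
 exact/ddelta/DU.
- have [y' ya dy] := deltaD Da r0; exists (ext y' an); last by rewrite proj_ext.
 by have := norm_ext_l y' a' an; rewrite ext_eta => ->.
pose W := [set x : 'rV[C]_n.+1 | nm (x - a) < r].
have [x0 x0a dx0] := deltaD Da r_gt0.
have WD0 x : W x -> D0 x by exact: rD0'.
(* The points of all roots over a single [x0] with [delta x0] nonzero: a clopen set that meets [W]
   contains one of them. *)
exists W, [seq ext x0 z | z <- rs (c x0)]; split.
- exact: open_rball.
- by rewrite /W /= subrr nm0.
- by move=> x /WD0/D0P[].
move=> S [SA SO].
pose cond (x : 'rV[C]_n) (z : C) := `[< nm (z - an) < eta /\ S (ext x z) >].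
pose G (x : 'rV[C]_n.+1) := \prod_(z <- rs (c (proj x)) | cond (proj x) z) (lastc x - z).
(* S is constant along each branch near [x1] and no branch crosses the annulus, so the roots
   entering the product are the same branches for all nearby x. *)
have local x1 : nm (x1 - a') < rho -> delta x1 != 0 -> exists (e : R) (sig : C -> 'rV[C]_n -> C), 0 < e /\
  forall x, nm (x - x1) < e -> (forall z, z \in rs (c x1) -> hol (sig z) x) /\
   forall t, G (ext x t) = \prod_(z <- rs (c x1) | cond x1 z) (t - sig z x).
 move=> x1a dx1; have U1x1 : U1 x1 by have := DU (inD x1 an x1a ltac:(by rewrite subrr nm0)); rewrite proj_ext.
 have [|e e0 eP] := @seq_radius _ (rs (c x1)) (fun z e => nm (z - an) < eta ->
   forall y, smooth D w y -> nm (y - ext x1 z) < e -> (S (ext x1 z) <-> S y)).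
  move=> z zr; have [za|za] := ltP (nm (z - an)) eta; last by exists 1 => // e' _ _ h; lra.
  have [e e0 eP] := SO _ (smooth_ext (inD _ _ x1a za) dx1 zr).
  by exists e => // e' e'0 e'e _ y sy ye; apply: eP => //; exact: lt_le_trans e'e.
 have m0 : 0 < min e (eta / 4) by rewrite lt_min e0.
 have [rb [sig [rb0 sigP]]] := branches U1x1 dx1 m0.
 exists (min (min e rb) (rho - nm (x1 - a'))), sig; split.
  by rewrite !lt_min e0 rb0 /=; lra.
 move=> x; rewrite !lt_min => /andP[/andP[xe /sigP[Ux dx pe sP]] xr].
 have xa : nm (x - a') < rho by have := nm_tri x1 x a'; clear -oU1 dc ddelta deltaP rsP oD DU deltaD xr; lra.
 split=> [z zr|t]; first by have [] := sP z zr.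
 rewrite /G proj_ext lastc_ext (perm_big _ pe) /= big_map big_seq_cond [RHS]big_seq_cond.
 apply: eq_bigl => z; have [zr|//] := boolP (z \in rs (c x1)); rewrite /=.
 have [_] := sP z zr; rewrite lt_min => /andP[se sz].
 have sr : sig z x \in rs (c x) by rewrite (perm_mem pe) map_f.
 have t1 := @nm_tri R C (sig z x) z an; have t2 := @nm_tri R C z (sig z x) an.
 have sz' : @nm R C (z - sig z x) < eta / 4 by rewrite nmC.
 have g1 := ring x1 z x1a zr; have g2 := ring x (sig z x) xa sr.
 apply/asboolP/asboolP => -[h1 h2].
  have za : @nm R C (z - an) < eta.
   exact: (ring_cases eta0 sz' t1 g1 g2 h1).
  split=> //; apply/(eP z zr e e0 (lexx _) za (ext x (sig z x))) => //.
   by apply: smooth_ext => //; exact: inD.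
  exact: ext_near.
 have za : @nm R C (sig z x - an) < eta.
  exact: (ring_cases eta0 sz t2 g2 g1 h1).
 split=> //; apply/(eP z zr e e0 (lexx _) h1 (ext x (sig z x))) => //.
  by apply: smooth_ext => //; exact: inD.
 exact: ext_near.
have [|Gh GhP] := ext_ G 1.
 move=> x D0x dx; have [Dx xa ta] := D0P x D0x; split.
  have [e [sig [e0 eP]]] := local _ xa dx.
  pose G' (y : 'rV[C]_n.+1) := \prod_(z <- rs (c (proj x)) | cond (proj x) z) (lastc y - sig z (proj y)).
  have dG' : hol G' x.
   have [h _] := eP (proj x) ltac:(by rewrite subrr nm0).
   apply: diff_prodf => z zs; apply: holB; first exact: diff_lastc.
   apply: (diff_compo (@proj R n) (sig z)); first exact: diff_proj.
   exact: h.
  suff h : forall y, nm (y - x) < e -> G' y = G y by have [] := diff_local_eq e0 h dG'.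
  move=> y yx.
  have [_ h] := eP (proj y) ltac:(by apply: le_lt_trans yx; have := norm_proj (y - x); rewrite projB).
  by rewrite -[y]ext_eta h /G' ext_eta.
 (* Both points lie within [eta] of [an] and [eta] is at most 1/2, so each factor has modulus at
    most 1 and the bound does not depend on the number of factors. *)
 rewrite /G prod_norm; apply: prodr_ile1 => z /asboolP[zn _]; rewrite nm_ge0 /=.
 have := nm_tri an (lastc x) z; rewrite [nm (an - z)]nmC; clear -oU1 dc ddelta deltaP rsP oD DU deltaD zn ta eta2; lra.
have clz x : W x -> (closure S x <-> Gh x = 0).
 move=> Wx; have [dGx _] := GhP x Wx; split=> [clS|Gx0].
  apply/eqP/negPn/negP; rewrite -nm_gt0 => Gx.
  have /continuous_rP/(_ _ Gx)[e1 e10 e1P] := diff_cont dGx.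
  have /open_rP/(_ x Wx)[e2 e20 e2P] : open W by exact: open_rball.
  pose e := min e1 e2 / 2.
  have e0 : 0 < e by rewrite divr_gt0 // lt_min e10.
  have [s [Ss /= sx]] : S `&` [set y | nm (y - x) < e] !=set0.
   by apply: clS; apply/nbhs_rP; exists e.
  have [Ds ws _] := SA s Ss; have [e3 e30 e3P] := SO s (SA s Ss).
  have m0 : 0 < min e e3 by rewrite lt_min e0.
  have [y [Dy ys dy yr]] := dense_generic Ds ws m0.
  move: ys; rewrite lt_min => /andP[ye ye3].
  have sy : smooth D w y by rewrite -[y]ext_eta; apply: smooth_ext; rewrite ?ext_eta.
  have Sy : S y by apply/(e3P y sy ye3).
  have yx : nm (y - x) < min e1 e2.
   have h3 := nm_tri s y x; move: ye sx; rewrite /e; move: h3; clear -oU1 dc ddelta deltaP rsP oD DU deltaD ; lra.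
  move: yx; rewrite lt_min => /andP[/e1P h1 /e2P Wy].
  have [_ /(_ dy) GE] := GhP y Wy.
  have Gy0 : G y = 0.
   have [_ _ la] := D0P y (WD0 y Wy).
   apply/eqP; rewrite /G prodf_seq_eq0; apply/hasP; exists (lastc y) => //=.
   by rewrite subrr eqxx andbT; apply/asboolP; rewrite ext_eta.
  by move: h1; rewrite GE Gy0 sub0r nmN ltxx.
 move=> B /nbhs_rP[e e0 eB].
 have [e' [e'0 e'1 e'e]] : exists e' : R, [/\ 0 < e', 0 < e' <= 1 & e' <= e].
  exists (min e 1); have m0 : 0 < min e 1 by rewrite lt_min e0 ltr01.
  by split; rewrite ?m0 // ge_min lexx ?orbT.
 have ed : 0 < e' ^+ d by rewrite exprn_gt0.
 have /continuous_rP/(_ _ ed)[e1 e10 e1P] := diff_cont dGx.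
 have /open_rP/(_ x Wx)[e2 e20 e2P] : open W by exact: open_rball.
 have [D1 _ _] := D0P x (WD0 x Wx).
 have [|y' yx dy] := deltaD D1 (e := min e' (min e1 e2)).
  by rewrite !lt_min e'0 e10.
 move: yx; rewrite !lt_min => /andP[ye' /andP[ye1 ye2]].
 pose y := ext y' (lastc x).
 have yx : nm (y - x) = nm (y' - proj x) by have := norm_ext_l y' (proj x) (lastc x); rewrite ext_eta.
 have Wy : W y by apply: e2P; rewrite yx.
 have [_ GE] := GhP y Wy; rewrite proj_ext in GE.
 have := e1P y; rewrite yx Gx0 subr0 GE // => /(_ ye1).
 rewrite /G proj_ext lastc_ext -{1}(rsP (c y')).1 => /(small_factor e'1)[z zr [/asboolP[_ Sz] zx]].
 exists (ext y' z); split=> //; apply: eB; apply: lt_le_trans e'e.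
 by rewrite -[x in _ - x]ext_eta; apply: ext_near => //; rewrite nmC.
exists Gh; split=> [x /GhP[]//|//|].
move=> nS x Wx Sx.
have Wp : W (ext x0 an) by have := norm_ext_l x0 a' an; rewrite ext_eta /W /= => ->.
have [Dx0 x0r _] := D0P (ext x0 an) (WD0 _ Wp).
rewrite proj_ext in x0r; have Ux0 : U1 x0 by have := DU Dx0; rewrite proj_ext.
have [e [sig [e0 eP]]] := local x0 x0r dx0.
have /continuous_rP/(_ (nm (delta x0))) := diff_cont (ddelta Ux0).
rewrite nm_gt0 => /(_ dx0)[e1 e10 e1P].
have : (fun y => Gh y - 1) x = 0.
 apply: (@identity_connected R _ (fun y => Gh y - 1) W (ext x0 an)) => //.
 - exact: open_rball.
 - exact: rball_connected.
 - move=> y /GhP[dGy _]; apply: holB => //; exact: hol_cst.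
 have /open_rP/(_ _ Wp)[e2 e20 e2P] : open W by exact: open_rball.
 exists (min e (min e1 e2)); first by rewrite !lt_min e0 e10.
 move=> y; rewrite !lt_min => /andP[ye /andP[ye1 ye2]].
 have py (b : R) : nm (y - ext x0 an) < b -> nm (proj y - x0) < b.
  by apply: le_lt_trans; have := norm_proj (y - ext x0 an); rewrite projB proj_ext.
 have dy : delta (proj y) != 0.
  rewrite -nm_gt0; have := e1P _ (py _ ye1); have := nm_sub (delta x0) (delta (proj y)).
  by rewrite [nm (_ - delta (proj y))]nmC; move: (nm _) (nm _) (nm _) => p q t; lra.
 have [_ ->] := GhP y (e2P y ye2); last by [].
 have [_ h] := eP (proj y) (py _ ye).
 rewrite -[y]ext_eta h big1_seq ?subrr // => z /andP[/asboolP[_ Sz] zr].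
 by exfalso; apply: (nS (ext x0 z)) => //; apply: map_f.
have hh : Gh x = 0 by apply/(clz x Wx); exact: subset_closure.
by rewrite /= hh sub0r => /eqP; rewrite oppr_eq0 oner_eq0.
Qed.

Lemma good_wpol : good D w.
Proof.
split=> //.
- exact: diff_wpolD.
- move=> x [Dx wx] e e0; have [y [Dy ye dy yr]] := dense_generic Dx wx e0.
 by exists y => //; rewrite -[y]ext_eta; apply: smooth_ext; rewrite ?ext_eta.
- move=> x Dx e e0; apply: contrapT => ne.
 have [z _|e1 e10 e1P] := @seq_radius _ (rs (c (proj x))) (fun z e => z != lastc x -> e < nm (z - lastc x)).
  have [->|zx] := eqVneq z (lastc x); first by exists 1.
  have zp : 0 < nm (z - lastc x) by rewrite nm_gt0 subr_eq0.
  by exists (nm (z - lastc x) / 2) => [|e' _ h _]; [rewrite divr_gt0|clear -oU1 dc ddelta deltaP rsP oD DU deltaD zp h; lra].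
 have m0 : 0 < min e e1 by rewrite lt_min e0.
 have [me me1] : min e e1 <= e /\ min e e1 <= e1 by split; rewrite ge_min lexx ?orbT.
 move: (min e e1) m0 me me1 => k k0 ke ke1.
 have k2 : 0 < k / 2 by clear -oU1 dc ddelta deltaP rsP oD DU deltaD k0; lra.
 apply: ne; exists (ext (proj x) (lastc x + rc (k / 2))).
  rewrite ext_line ext_eta addrAC subrr add0r nmZ norm_elast mulr1 nm_rc gtr0_norm //; clear -oU1 dc ddelta deltaP rsP oD DU deltaD k0 ke; lra.
 apply/eqP => /wpol_root zr; have := e1P _ zr e1 e10 (lexx _).
 have -> : lastc x + rc (k / 2) - lastc x = rc (k / 2) by ring.
 rewrite -subr_eq0; have -> : lastc x + rc (k / 2) - lastc x = rc (k / 2) by ring.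
 by rewrite rc_eq0 gt_eqF // nm_rc gtr0_norm // => /(_ isT); clear -oU1 dc ddelta deltaP rsP oD DU deltaD ke1 k0; lra.
- exact: good_wpol_local.
Qed.

End Branches.

(** * Irreducible components of a hypersurface *)

Section Components.
Variable R : realType. Local Notation C := (cplx R).

Lemma closure_rP (V : nmod C) (A : set V) (a : V) :
 closure A a <-> forall e : R, 0 < e -> exists2 y, A y & nm (y - a) < e.
Proof.
split=> [cl e e0|h B /nbhs_rP[e e0 eB]].
 have [y [Ay /= ya]] : A `&` [set y | nm (y - a) < e] !=set0 by apply: cl; apply/nbhs_rP; exists e.
 by exists y.
by have [y Ay ya] := h e e0; exists y; split=> //; exact: eB.
Qed.

Lemma near_neq0 (V : nmod C) (a b : V) : nm (a - b) < nm b -> a != 0.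
Proof. by apply: contraTneq => ->; rewrite sub0r nmN ltxx. Qed.

Lemma closureU_or (V : nmod C) (A B : set V) (a : V) :
 closure (A `|` B) a -> closure A a \/ closure B a.
Proof. by rewrite closureU. Qed.

Lemma connected_iff (V : nmod C) (D : set V) (P : V -> Prop) : open D -> connected D ->
 (forall x, D x -> exists2 e : R, 0 < e & forall y, D y -> nm (y - x) < e -> (P x <-> P y)) ->
 forall x y, D x -> D y -> P x -> P y.
Proof.
move=> /open_rP oD cD hP x y Dx Dy Px.
suff /seteqP[_ /(_ y Dy)[]//] : D `&` P = D.
have oQ (Q : V -> Prop) : (forall x, D x -> exists2 e : R, 0 < e & forall y, D y -> nm (y - x) < e -> (Q x <-> Q y)) ->
  open (D `&` Q).
 move=> hQ; apply/open_rP => z [Dz Qz]; have [e e0 eP] := hQ z Dz; have [d d0 dP] := oD z Dz.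
 exists (min e d) => [|u]; first by rewrite lt_min e0.
 by rewrite lt_min => /andP[ue /dP Du]; split=> //; apply/(eP u Du ue).
apply: cD; first by exists x.
 by exists (D `&` P); [exact: oQ|rewrite setIA setIid].
exists (~` (D `&` (fun z => ~ P z))).
 apply: open_closedC; apply: oQ => z Dz; have [e e0 eP] := hP z Dz; exists e => // u Du ue.
 by split=> h h1; apply: h; apply/(eP u Du ue).
apply/seteqP; split=> z [Dz h]; split=> //; first by move=> [_ h']; exact: h'.
by apply: contrapT => h'; apply: h.
Qed.

Lemma identity_ball (V : nmod C) r (h : V -> 'rV[C]_r) (y z : V) (k : R) :
 (forall x, nm (x - y) < k -> hol h x) -> nm (z - y) < k ->
 (exists2 e : R, 0 < e & forall u, nm (u - z) < e -> h u = 0) ->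
 forall u, nm (u - y) < k -> h u = 0.
Proof.
move=> dh zk [e e0 eP] u uk; apply/matrixP => i j; rewrite [RHS]mxE.
have dhij x : nm (x - y) < k -> hol (fun u => h u i j) x.
 by move=> /dh dhx; have [] := diff_entry i j dhx.
have cb := @rball_connected R V y k; have ob := open_rball y k.
apply: (identity_connected ob cb dhij zk _ uk).
by exists e; [exact: e0|move=> x /eP ->; rewrite mxE].
Qed.

Section Analytic.
Variables (m : nat) (Om : set 'rV[C]_m).
Implicit Types A : set 'rV[C]_m.

Lemma analytic_closed A a : analytic Om A -> Om a -> closure A a -> A a.
Proof.
move=> [AO hA] Oa /closure_rP clA; have [W [r [h [oW Wa WO dh AW]]]] := hA a Oa.
suff ha : h a = 0 by have [] : (A `&` W) a by rewrite AW.
apply/eqP/negPn/negP; rewrite -nm_gt0 => h0.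
have /continuous_rP/(_ _ h0)[e e0 eP] := diff_cont (dh a Wa).
have /open_rP/(_ a Wa)[d d0 dP] := oW.
have [|y Ay] := clA (min e d); first by rewrite lt_min e0.
rewrite lt_min => /andP[/eP ye /dP Wy].
have [_ hy] : [set x | W x /\ h x = 0] y by rewrite -AW.
by move: ye; rewrite hy sub0r nmN ltxx.
Qed.

Lemma analyticI A1 A2 : analytic Om A1 -> analytic Om A2 -> analytic Om (A1 `&` A2).
Proof.
move=> [A1O h1] [A2O h2]; split=> [x [/A1O//]|a Oa].
have [W1 [r1 [g1 [oW1 W1a W1O d1 e1]]]] := h1 a Oa.
have [W2 [r2 [g2 [oW2 W2a W2O d2 e2]]]] := h2 a Oa.
exists (W1 `&` W2), (r1 + r2)%N, (fun x => row_mx (g1 x) (g2 x)); split.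
- exact: openI.
- by [].
- by move=> x [/W1O].
- move=> x [Wx1 Wx2]; apply: mx_differentiable => i j.
 case: (split_ordP j) => j' ->.
  rewrite (_ : (fun x => _) = (fun x => g1 x i j')); last by apply/funext => y; rewrite row_mxEl.
  by have [] := diff_entry i j' (d1 x Wx1).
 rewrite (_ : (fun x => _) = (fun x => g2 x i j')); last by apply/funext => y; rewrite row_mxEr.
 by have [] := diff_entry i j' (d2 x Wx2).
move/seteqP: e1 => [e1 e1']; move/seteqP: e2 => [e2 e2'].
apply/seteqP; split=> x.
 move=> [[A1x A2x] [Wx1 Wx2]]; split=> //.
 by have [_ ->] := e1 x (conj A1x Wx1); have [_ ->] := e2 x (conj A2x Wx2); rewrite row_mx0.
move=> [[Wx1 Wx2]]; rewrite -row_mx0 => /eq_row_mx[g1x g2x].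
by have [? _] := e1' x (conj Wx1 g1x); have [? _] := e2' x (conj Wx2 g2x).
Qed.

End Analytic.

Section Good.
Variables (m : nat) (Om : set 'rV[C]_m) (F : 'rV[C]_m -> C).
Hypothesis hF : good Om F.
Local Notation X := 'rV[C]_m.
Local Notation Sm := (smooth Om F).
Local Notation A := (zeros Om F).
Implicit Types (x y : X) (S : set X).

Lemma smooth_zeros x : Sm x -> A x.
Proof. by move=> []. Qed.

Lemma smooth_dom x : Sm x -> Om x.
Proof. by move=> []. Qed.

Lemma smooth_near x : Sm x -> exists (r : R) (v : X), [/\ 0 < r, 'd F x v != 0 &
 forall y, nm (y - x) < r -> Om y /\ 'd F y v != 0].
Proof.
move=> [Ox _ [v v0]]; have /open_rP/(_ x Ox)[r r0 rO] := good_open hF.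
have dv := @holo_derivative R X C (cauchy_targetC R) F x v r r0 (fun y h => good_holo hF (rO y h)).
move: (v0); rewrite -nm_gt0 => v0'.
have /continuous_rP/(_ _ v0')[e e0 eP] := diff_cont dv.
have m0 : 0 < min r e by rewrite lt_min r0.
exists (min r e), v; split; [exact: m0|exact: v0|] => y.
rewrite lt_min => /andP[yr ye]; split; [exact: rO|exact: (near_neq0 (eP y ye))].
Qed.

Lemma zeros_smooth_near x : Sm x -> exists2 r : R, 0 < r & forall y, A y -> nm (y - x) < r -> Sm y.
Proof.
move=> /smooth_near[r [v [r0 _ rP]]]; exists r; first exact: r0.
by move=> y [Oy Fy] /rP[_ vy]; split; [exact: Oy|exact: Fy|exists v; exact: vy].
Qed.

(** [implicit] moves z along a direction in which [F] has nonzero derivative. The smooth zeros near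
    [x] become the image of a ball under a holomorphic map, so connectedness and the identity
    theorem on the manifold reduce to those on the ball. *)
Lemma retraction x : Sm x -> exists (r : R) (ret : X -> X), 0 < r /\
 forall z, nm (z - x) < r -> [/\ Sm (ret z), hol ret z & A z -> ret z = z].
Proof.
move=> Sx; have [r [v [r0 kk rP]]] := smooth_near Sx.
have [k [k0 kE]] : exists k, k != 0 /\ 'd F x v = k by exists ('d F x v); split; [exact: kk|].
have linP : linear (fun s : C => (s * k^-1) *: v).
 move=> l u w; have -> : (l *: u + w) * k^-1 = l * (u * k^-1) + w * k^-1.
  by rewrite -[l *: u]/(l * u); ring.
 by rewrite scalerDl scalerA.
pose LM := GRing.isLinear.Build _ _ _ _ _ linP.
pose Rr : {linear C -> X} := HB.pack (fun s : C => (s * k^-1) *: v) LM.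
have Rc s : nm (Rr s) <= (nm k^-1 * nm v) * nm s.
 by rewrite /= nmZ nmM mulrC mulrCA mulrC [X in _ <= X * _]mulrC.
have Fx : F x = 0 by case: Sx.
have dR s : 'd F x (Rr s) = s.
 have h1 : 'd F x ((s * k^-1) *: v) = (s * k^-1) *: 'd F x v by exact: linearZ.
 apply: (etrans h1); apply: (etrans (congr1 (fun u => (s * k^-1) *: u) kE)).
 by rewrite -[LHS]/(s * k^-1 * k) -mulrA mulVf ?mulr1.
have [eps [eta [sig [eps0 eta0 sP]]]] := implicit (cauchy_targetC R) r0 Rc (fun y h => good_holo hF (rP y h).1) Fx dR.
exists eps, (fun z => z + (sig z * k^-1) *: v); split; [exact: eps0|] => z ze.
have [_ _ /rP[Oz vz] [Fz uz] dz] := sP z ze; split.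
- by split; [exact: Oz|exact: Fz|exists v; exact: vz].
- apply: holD; first by [].
 apply: (diff_compo sig Rr); first exact: dz.
 apply: linear_differentiable; exact: linear_cont Rc.
- move=> [_ Az]; have := uz 0; rewrite nm0 linear0 addr0 => /(_ (ltW eta0) Az) <-.
 by rewrite mul0r scale0r addr0.
Qed.

Opaque smooth.

(** The point is that the radius works for all clopen sets at once: the retraction of a ball is
    connected, and no clopen set separates it. *)
Lemma clopen_uniform x : Sm x -> exists2 e : R, 0 < e &
 forall S, clopen_in Sm S -> forall y, Sm y -> nm (y - x) < e -> (S x <-> S y).
Proof.
move=> Sx; have [r [ret [r0 rP]]] := retraction Sx.
exists r => // S [SA SO] y Sy yr.
pose D := [set z | nm (z - x) < r].
have Dx : D x by rewrite /D /= subrr nm0.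
have h : forall z, D z -> exists2 e : R, 0 < e & forall u, D u -> nm (u - z) < e -> (S (ret z) <-> S (ret u)).
 move=> z Dz; have [Sz dz _] := rP z Dz; have [e e0 eP] := SO _ Sz.
 have /continuous_rP/(_ _ e0)[d d0 dP] := diff_cont dz.
 by exists d => // u Du /dP; have [Su _ _] := rP u Du; exact: eP.
have hn z : D z -> exists2 e : R, 0 < e & forall u, D u -> nm (u - z) < e -> (~ S (ret z) <-> ~ S (ret u)).
 move=> Dz; have [e e0 eP] := h z Dz; exists e => // u Du uz.
 by split=> k k'; apply: k; apply/(eP u Du uz).
have [_ _ rx] := rP x Dx; have [_ _ ry] := rP y yr.
have rxE := rx (smooth_zeros Sx); have ryE := ry (smooth_zeros Sy).
split=> hS.
 have := @connected_iff X D (fun z => S (ret z)) (open_rball _ _) (@rball_connected R X x r) h x y Dx yr.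
 by rewrite rxE ryE; exact.
apply: contrapT; have := @connected_iff X D (fun z => ~ S (ret z)) (open_rball _ _) (@rball_connected R X x r) hn x y Dx yr.
by rewrite rxE ryE => k /k; exact.
Qed.

Lemma clopen_all : clopen_in Sm Sm.
Proof. by split=> // x Sx; exists 1. Qed.

Lemma clopenI S S' : clopen_in Sm S -> clopen_in Sm S' -> clopen_in Sm (S `&` S').
Proof.
move=> [SA SO] [_ SO']; split=> [x [/SA//]|x Sx].
have [e e0 eP] := SO x Sx; have [e' e'0 eP'] := SO' x Sx.
exists (min e e'); first by rewrite lt_min e0.
move=> y Sy; rewrite lt_min => /andP[/(eP y Sy) h /(eP' y Sy) h'].
by split=> -[/h ? /h'].
Qed.

Lemma clopenD S S' : clopen_in Sm S -> clopen_in Sm S' -> clopen_in Sm (S `\` S').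
Proof.
move=> cS [_ SO']; rewrite setDE (_ : S `&` ~` S' = S `&` (Sm `&` ~` S')).
 apply: clopenI => //; split=> [x []//|x Sx]; have [e e0 eP] := SO' x Sx; exists e => // y Sy ye.
 by split=> -[_ h]; split=> // h'; apply: h; apply/(eP y Sy ye).
by apply/seteqP; split=> x [Sx]; [split=> //; split=> //; case: cS => h _; exact: h|move=> []].
Qed.

Lemma clopen_closure S x : clopen_in Sm S -> Sm x -> closure S x -> S x.
Proof.
move=> [SA SO] Sx /closure_rP cl; have [e e0 eP] := SO x Sx; have [y Sy ye] := cl e e0.
by apply/(eP y (SA y Sy) ye).
Qed.

(** The quasi-component of [x] in the set of smooth zeros. By [clopen_uniform] it is itself clopen,
    hence a minimal nonempty clopen set, and it takes the place of the connected component. *)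
Definition qcomp x : set X := [set y | [/\ Sm x, Sm y & forall S, clopen_in Sm S -> S x -> S y]].

Lemma qcomp_self x : Sm x -> qcomp x x.
Proof. by []. Qed.

Lemma clopen_qcomp x : clopen_in Sm (qcomp x).
Proof.
split=> [y []//|y Sy]; have [e e0 eP] := clopen_uniform Sy; exists e; first exact: e0.
move=> z Sz ze; split=> -[Sx _ h].
 by split; [exact: Sx|exact: Sz|] => S cS Sx'; have [k _] := eP S cS z Sz ze; exact: (k (h S cS Sx')).
by split; [exact: Sx|exact: Sy|] => S cS Sx'; have [_ k] := eP S cS z Sz ze; exact: (k (h S cS Sx')).
Qed.

Lemma qcomp_min x y S : Sm x -> clopen_in Sm S -> qcomp x y -> S y -> qcomp x `<=` S.
Proof.
move=> Sx cS [_ Sy hy] Syy z [_ Sz hz]; apply: hz => //; apply: contrapT => nx.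
by have [] := hy _ (clopenD clopen_all cS) (conj Sx nx).
Qed.

Lemma qcomp_eq x y : Sm x -> Sm y -> qcomp x y -> qcomp x = qcomp y.
Proof.
move=> Sx Sy xy; apply/seteqP; split; first exact: (qcomp_min Sx (clopen_qcomp y) xy (qcomp_self Sy)).
by move=> z [_ Sz hz]; apply: (hz _ (clopen_qcomp x)).
Qed.

Definition branch x : set X := closure (qcomp x) `&` Om.

Lemma clopen_analytic S : clopen_in Sm S -> analytic Om (closure S `&` Om).
Proof.
move=> cS; split=> [x []//|a Oa]; have [W [pts [oW Wa WO WP]]] := good_local hF Oa.
have [h [dh hP _]] := WP S cS.
exists W, 1%N, (fun x => const_mx (h x)); split=> //.
 by move=> x /dh ?; apply: mx_differentiable => i j; under eq_fun do rewrite mxE.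
apply/seteqP; split=> x.
 by move=> [[clx Ox] Wx]; split=> //; have /hP -> := clx; rewrite // -[RHS](const_mx0).
move=> [Wx /matrixP/(_ 0 0)]; rewrite !mxE => /(hP x Wx) clx; split=> //.
by split=> //; exact: WO.
Qed.

Lemma branch_analytic x : analytic Om (branch x).
Proof. exact/clopen_analytic/clopen_qcomp. Qed.

Lemma closure_zeros S x : S `<=` A -> closure S x -> Om x -> A x.
Proof.
move=> SA /closure_rP cl Ox; split=> //; apply/eqP/negPn/negP; rewrite -nm_gt0 => F0.
have /continuous_rP/(_ _ F0)[e e0 eP] := diff_cont (good_holo hF Ox).
by have [y /SA[_ Fy] /eP] := cl e e0; rewrite Fy sub0r nmN ltxx.
Qed.

Lemma clopen_sub_zeros S : clopen_in Sm S -> closure S `&` Om `<=` A.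
Proof. by move=> [SA _] x [cl Ox]; apply: closure_zeros cl Ox => y /SA/smooth_zeros. Qed.

Lemma zeros_closure x : A x -> closure Sm x.
Proof. by move=> Ax; apply/closure_rP => e e0; have [y] := good_dense hF Ax e0; exists y. Qed.

(** Let S1 be the points of S near which all smooth zeros lie in A1. It is open, and it is
    relatively closed by the identity theorem applied to the equations of A1 composed with the
    retraction. If S1 is nonempty, minimality of S gives S inside A1; if it is empty, points of A2
    are dense in S and A2 is closed. *)
Lemma analytic_split S A1 A2 x : clopen_in Sm S -> analytic Om A1 -> analytic Om A2 ->
 Sm x -> S = qcomp x -> S `<=` A1 `|` A2 -> S `<=` A1 \/ S `<=` A2.
Proof.
move=> cS anA1 anA2 Sx SE S12.
pose S1 := [set y | S y /\ exists2 e : R, 0 < e & forall z, Sm z -> nm (z - y) < e -> A1 z].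
have [S1y|] := pselect (S1 !=set0); last first.
 move=> S10; right => y Sy; have Oy : Om y by case: cS => h _; exact/smooth_dom/h.
 apply: (analytic_closed anA2 Oy); apply/closure_rP => e e0; apply: contrapT => ne; apply: S10.
 have Smy : Sm y by case: cS => h _; exact: h.
 have [_ /(_ y Smy)[d d0 dP]] := cS.
 exists y; split=> //; exists (min e d); first by rewrite lt_min e0.
 move=> z Sz; rewrite lt_min => /andP[ze zd]; have Szz : S z by apply/(dP z Sz zd).
 by have [//|A2z] := S12 z Szz; exfalso; apply: ne; exists z.
left; have [y0 S1y0] := S1y.
suff cS1 : clopen_in Sm S1.
 have Ky0 : qcomp x y0 by rewrite -SE; case: S1y0.
 have h := qcomp_min Sx cS1 Ky0 S1y0.
 move=> y Sy; have [_ [e e0 eP]] : S1 y by apply: h; rewrite -SE.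
 by apply: eP; [case: cS => k _; exact: k|rewrite subrr nm0; exact: e0].
have SS : S `<=` Sm by case: cS.
split=> [y [/SS]//|y Smy].
have [_ /(_ y Smy)[d d0 dP]] := cS.
have [Sy|nSy] := pselect (S y); last first.
 exists d => // z Sz zd; split=> -[h _]; exfalso; apply: nSy => //.
 by apply/(dP z Sz zd).
have Oy := smooth_dom Smy.
have [_ /(_ y Oy)[W [r [h [oW Wy WO dh AW]]]]] := anA1.
have [r1 [ret [r10 rP]]] := retraction Smy.
have yy : nm (y - y) < r1 by rewrite subrr nm0.
have [_ dry /(_ (smooth_zeros Smy)) ryE] := rP y yy.
have /open_rP/(_ y Wy)[r2 r20 r2W] := oW.
have /continuous_rP/(_ _ r20)[r3 r30 r3P] := diff_cont dry; rewrite ryE in r3P.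
have [k k0 [k1 k3 kd]] : exists2 k : R, 0 < k & [/\ k <= r1, k <= r3 & k <= d].
 exists (min r1 (min r3 d)); first by rewrite !lt_min r10 r30.
 by rewrite !ge_min !lexx !orbT.
have kW z : nm (z - y) < k -> W (ret z) by move=> zk; apply/r2W/r3P; exact: lt_le_trans k3.
have A1W z : W z -> (A1 z <-> h z = 0).
 by move=> Wz; move/seteqP: AW => [q1 q2]; split=> [Az|hz]; [case: (q1 z (conj Az Wz))|case: (q2 z (conj Wz hz))].
have dhr x' : nm (x' - y) < k -> hol (h \o ret) x'.
 move=> xk; have [_ drx _] := rP x' (lt_le_trans xk k1).
 by apply: differentiable_comp; [exact: drx|exact/dh/kW].
have retE u : Sm u -> nm (u - y) < k -> ret u = u.
 by move=> Su uk; have [_ _ h'] := rP u (lt_le_trans uk k1); exact: (h' (smooth_zeros Su)).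
have all_A1 z (e : R) : 0 < e -> Sm z -> nm (z - y) < k -> (forall u, Sm u -> nm (u - z) < e -> A1 u) ->
  forall u, Sm u -> nm (u - y) < k -> A1 u.
 move=> e0 Sz zk eP u Su uk; rewrite -(retE u Su uk); apply/A1W; first exact: kW.
 apply: (identity_ball dhr zk _ uk).
 have [_ drz _] := rP z (lt_le_trans zk k1).
 have /continuous_rP/(_ _ e0)[e1 e10 e1P] := diff_cont drz; rewrite (retE z Sz zk) in e1P.
 exists (min e1 (k - nm (z - y))); first by rewrite lt_min e10 subr_gt0.
 move=> u'; rewrite lt_min => /andP[ue ukk].
 have uk' : nm (u' - y) < k by have := nm_tri z u' y; move: ukk; clra.
 have [Sru _ _] := rP u' (lt_le_trans uk' k1).
 by apply/A1W; [exact: kW|exact: (eP _ Sru (e1P _ ue))].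
have yk : nm (y - y) < k by rewrite subrr nm0.
exists (min k d); first by rewrite lt_min k0.
move=> z Sz; rewrite lt_min => /andP[zk zd]; split=> -[Szz [e e0 eP]].
 split; first by apply/(dP z Sz zd).
 exists (k - nm (z - y)); first by rewrite subr_gt0.
 move=> u Su uz; have uk : nm (u - y) < k by have := nm_tri z u y; move: uz; clra.
 exact: (all_A1 y e e0 Smy yk eP u Su uk).
split; first exact: Sy.
by exists k; [exact: k0|exact: (all_A1 z e e0 Sz zk eP)].
Qed.

Lemma branch_irreducible x : Sm x -> irreducible Om (branch x).
Proof.
move=> Sx; split; first exact: branch_analytic.
 by exists x; split; [exact/subset_closure/qcomp_self|exact: smooth_dom].
move=> A1 A2 an1 an2 E12.
have sub : qcomp x `<=` A1 `|` A2.
 by move=> y Ky; rewrite -E12; split; [exact: subset_closure|case: Ky => _ /smooth_dom].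
have cl (B : set X) : analytic Om B -> qcomp x `<=` B -> branch x `<=` B.
 move=> anB KB y [cly Oy]; apply: (analytic_closed anB Oy); exact: closure_subset cly.
have [h|h] := analytic_split (clopen_qcomp x) an1 an2 Sx erefl sub.
 by left; apply/seteqP; split=> [|y A1y]; [exact: cl|rewrite E12; left].
by right; apply/seteqP; split=> [|y A2y]; [exact: cl|rewrite E12; right].
Qed.

(** [hY] is a primality property, shared by irreducible sets and by single points: a decomposition
    of the closure that covers Y has a part covering it. The quasi-components of the listed points
    are split off one after the other. *)
Lemma prime_branch (Y : set X) (pts : seq X) :
 (forall S p, clopen_in Sm S -> Y `<=` closure S -> Y `<=` closure (S `&` qcomp p) \/ Y `<=` closure (S `\` qcomp p)) ->
 Y `<=` closure Sm ->
 (exists2 p, p \in pts & Y `<=` closure (qcomp p)) \/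
 (exists2 S, clopen_in Sm S & Y `<=` closure S /\ forall p, p \in pts -> ~ S p).
Proof.
move=> hY; elim: pts => [|p pts IH] YS; first by right; exists Sm; [exact: clopen_all|].
have [[p' pp' h]|[S cS [YcS nS]]] := IH YS; first by left; exists p' => //; rewrite inE pp' orbT.
have [h|h] := hY S p cS YcS.
 left; exists p; first exact: mem_head.
 by apply: (subset_trans h); apply: closure_subset => z [].
right; exists (S `\` qcomp p); first by apply: clopenD => //; exact: clopen_qcomp.
split=> // p'; rewrite inE => /orP[/eqP ->|pp'] [Sp]; last by case: (nS p' pp').
by apply; apply: qcomp_self; case: cS => k _; exact: k.
Qed.

(** With the points supplied by [good_local] at [a], a clopen set that avoids all of them misses a
    neighbourhood of [a], so its closure cannot contain Y. *)
Lemma prime_branch_in (Y : set X) a : Om a -> Y a -> Y `<=` Om ->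
 (forall S p, clopen_in Sm S -> Y `<=` closure S -> Y `<=` closure (S `&` qcomp p) \/ Y `<=` closure (S `\` qcomp p)) ->
 Y `<=` closure Sm -> exists2 x, Sm x & Y `<=` branch x.
Proof.
move=> Oa Ya YO hY YS; have [W [pts [oW Wa WO WP]]] := good_local hF Oa.
have [[p pp h]|[S cS [YcS nS]]] := prime_branch pts hY YS.
 have /closure_rP/(_ 1 ltr01)[y [Sp _ _] _] := h a Ya.
 by exists p => // z Yz; split; [exact: h|exact: YO].
exfalso; have [h [_ _ /(_ nS) hW]] := WP S cS.
have [z [Sz Wz]] : (S `&` W) !=set0 by apply: (YcS a Ya); exact: open_nbhs_nbhs.
exact: (hW z Wz Sz).
Qed.

End Good.
End Components.

Section Branches.
Variable R : realType. Local Notation C := (cplx R).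
Variables (m : nat) (Om : set 'rV[C]_m) (F : 'rV[C]_m -> C).
Hypothesis hF : good Om F.
Local Notation X := 'rV[C]_m.
Local Notation Sm := (smooth Om F).
Local Notation A := (zeros Om F).
Local Notation Z := (set_chain Om A).
Local Notation qc := (qcomp Om F).
Local Notation br := (branch Om F).

Opaque smooth.

Lemma irreducible_branch B : irreducible Om B -> B `<=` A -> exists2 x, Sm x & B `<=` br x.
Proof.
move=> [anB [a Ba] irr] BA; have BO : B `<=` Om by case: anB.
have BS : B `<=` closure Sm by move=> z /BA; exact: zeros_closure.
apply: (prime_branch_in hF (BO a Ba) Ba BO _ BS) => S p cS BcS.
have c1 := clopenI cS (clopen_qcomp hF p); have c2 := clopenD cS (clopen_qcomp hF p).
have a1 := analyticI anB (clopen_analytic hF c1); have a2 := analyticI anB (clopen_analytic hF c2).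
have [|h|h] := irr _ _ a1 a2.
- apply/seteqP; split=> [z Bz|z [[]|[]]//].
 have : closure ((S `&` qc p) `|` (S `\` qc p)) z.
  apply: closure_subset (BcS z Bz) => u Su.
  by have [k|k] := pselect (qc p u); [left|right].
 by move/closureU_or => [k|k]; [left|right]; split; [exact: Bz|split; [exact: k|exact: BO]|exact: Bz|split; [exact: k|exact: BO]].
- by left; rewrite h => z [_ []].
- by right; rewrite h => z [_ []].
Qed.

Lemma branch_sub x : br x `<=` A.
Proof. exact: (clopen_sub_zeros hF (clopen_qcomp hF x)). Qed.

Lemma branch_self x : Sm x -> br x x.
Proof. by move=> Sx; split; [exact/subset_closure/qcomp_self|exact: smooth_dom Sx]. Qed.

Lemma branch_smooth x y : Sm x -> Sm y -> br y x -> br x = br y.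
Proof.
move=> Sx Sy [cl _]; have h := clopen_closure (clopen_qcomp hF y) Sx cl.
by rewrite /branch (qcomp_eq hF Sy Sx h).
Qed.

Lemma component_branch B : irr_component Om A B <-> exists2 x, Sm x & B = br x.
Proof.
split=> [[irrB BA mx]|[x Sx ->]].
 have [x Sx Bx] := irreducible_branch irrB BA; exists x; first exact: Sx.
 by rewrite (mx _ (branch_irreducible hF Sx) (@branch_sub x) Bx).
split; [exact: (branch_irreducible hF Sx)|exact: branch_sub|] => B' irrB' B'A xB'.
have [y Sy B'y] := irreducible_branch irrB' B'A.
have yx : br y x by apply/B'y/xB'/branch_self.
apply/seteqP; split; last exact: xB'.
by rewrite (branch_smooth Sx Sy yx).
Qed.

Lemma set_chain_comps B : chain_comps Z B <-> irr_component Om A B.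
Proof.
rewrite /chain_comps /set_chain /=; split; last by move=> h; rewrite asboolT.
by case: ifP => // /asboolP.
Qed.

Lemma comp_branch B : chain_comps Z B <-> exists2 x, Sm x & B = br x.
Proof. exact: iff_trans (set_chain_comps B) (component_branch B). Qed.

Lemma set_chain1 B : chain_comps Z B -> Z B = 1%N.
Proof. by rewrite set_chain_comps /set_chain => h; rewrite asboolT. Qed.

Lemma comps_locally_finite a : Om a ->
 exists W, [/\ open W, W a & finite_set [set B | chain_comps Z B /\ B `&` W !=set0]].
Proof.
move=> Oa; have [W [pts [oW Wa WO WP]]] := good_local hF Oa; exists W; split; [exact: oW|exact: Wa|].
apply: (@sub_finite_set _ _ (br @` [set` pts])); last exact/finite_image/finite_seq.
move=> B [/comp_branch[x Sx ->] [z [[clz Oz] Wz]]].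
have [_ [_ _ hW]] := WP _ (clopen_qcomp hF x).
have [u [Ku Wu]] : (qc x `&` W) !=set0 by apply: clz; exact: open_nbhs_nbhs.
have [p pp Kp] : exists2 p, p \in pts & qc x p.
 apply: contrapT => ne; apply: (hW _ u Wu Ku) => p pp Kp; apply: ne; exists p; [exact: pp|exact: Kp].
have [_ Sp _] := Kp; exists p; first exact: pp.
by rewrite /branch (qcomp_eq hF Sx Sp Kp).
Qed.

Lemma chain_suppE : chain_supp Z = A.
Proof.
apply/seteqP; split=> [z [B /comp_branch[x Sx ->]]|a Aa]; first exact: branch_sub.
have Oa : Om a by case: Aa.
have [||S p cS aS|z ->|x Sx h] := @prime_branch_in R m Om F hF [set a] a Oa; try by [].
- by move=> z ->.
- have : closure ((S `&` qc p) `|` (S `\` qc p)) a.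
  apply: closure_subset (aS a erefl) => u Su.
  by have [k|k] := pselect (qc p u); [left|right].
 by move/closureU_or => [k|k]; [left|right] => z ->.
- exact: zeros_closure.
by exists (br x); [apply/comp_branch; exists x|exact: h].
Qed.

Lemma comps_smooth x : Sm x -> [set B | chain_comps Z B /\ B x] = [set br x].
Proof.
move=> Sx; apply/seteqP; split=> [B [/comp_branch[y Sy ->] yx]|B ->]; first exact: esym (branch_smooth Sx Sy yx).
by split; [apply/comp_branch; exists x|exact: branch_self].
Qed.

(** Zeros near a smooth point are smooth, and the class of [x] is clopen, so no other branch comes
    close. *)
Lemma branch_near x y : Sm x -> Sm y -> br x y -> exists2 e : R, 0 < e & forall z, nm (z - y) < e -> (br x z <-> A z).
Proof.
move=> Sx Sy [cly _]; have [r r0 rP] := zeros_smooth_near hF Sy.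
have Ky := clopen_closure (clopen_qcomp hF x) Sy cly.
have [_ /(_ y Sy)[e e0 eP]] := clopen_qcomp hF x.
have m0 : 0 < min r e by rewrite lt_min r0.
exists (min r e); [exact: m0|] => z; rewrite lt_min => /andP[zr ze]; split; first exact: branch_sub.
move=> Az; have Sz := rP z Az zr; split; last exact: (smooth_dom Sz).
by apply: subset_closure; have [k _] := eP z Sz ze; exact: k Ky.
Qed.

End Branches.

(** * Dimension and regular points *)

Section Dimension.
Variable R : realType. Local Notation C := (cplx R).
Variables (n : nat) (Om : set 'rV[C]_n.+1) (F : 'rV[C]_n.+1 -> C).
Hypothesis hF : good Om F.
Local Notation X := 'rV[C]_n.+1.
Local Notation Sm := (smooth Om F).
Local Notation A := (zeros Om F).
Local Notation Z := (set_chain Om A).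
Local Notation br := (branch Om F).

Opaque smooth.

Lemma diff_const_mx p (V : nmod C) (f : V -> C) x : hol f x ->
 hol (fun x => const_mx (f x) : 'rV[C]_p) x /\
 forall v, 'd (fun x => const_mx (f x) : 'rV[C]_p) x v = const_mx ('d f x v).
Proof.
move=> df; have [K K0 KP] := diff_bound df.
have linP : linear (fun v => const_mx ('d f x v) : 'rV[C]_p).
 by move=> l u v; apply/matrixP => i j; rewrite !mxE; exact: linearP.
pose LM := GRing.isLinear.Build _ _ _ _ _ linP.
pose L : {linear V -> 'rV[C]_p} := HB.pack (fun v => const_mx ('d f x v) : 'rV[C]_p) LM.
have [|e e0|h1 h2] := @rP_diff R V 'rV[C]_p (fun x => const_mx (f x)) x L K.
- move=> v; apply: nm_mx_le; first by apply: mulr_ge0; [exact: ltW|exact: nm_ge0].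
 by move=> i j; rewrite mxE; exact: KP.
- have [d d0 dP] := diff_rP df e0; exists d; first exact: d0.
 move=> h hd; apply: nm_mx_le; first by rewrite mulr_ge0 ?nm_ge0 // ltW.
 by move=> i j; rewrite !mxE; exact: dP.
by split; [exact: h1|move=> v; rewrite h2].
Qed.

(* in C^(n+1) the target C^((n+1)-n) of local_equation is a line, but not syntactically *)
Lemma subSn_ord (j j' : 'I_(n.+1 - n)) : j = j'.
Proof.
case: j j' => [a ha] [b hb]; apply: val_inj => /=; move: ha hb.
by rewrite subSnn !ltnS !leqn0 => /eqP -> /eqP ->.
Qed.

Lemma regular_zeros (Y : set X) b : Sm b ->
 (exists2 e : R, 0 < e & forall z, nm (z - b) < e -> (Y z <-> A z)) -> regular_dim Y n b.
Proof.
move=> Sb [e e0 eP]; have [r [v [r0 v0 rP]]] := smooth_near hF Sb.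
have bb (k : R) : 0 < k -> nm (b - b) < k by rewrite subrr nm0.
split; [exact/(eP b (bb e e0)).2/(smooth_zeros Sb)|exact: leqnSn|].
have m0 : 0 < min e r by rewrite lt_min e0.
exists [set z | nm (z - b) < min e r], (fun x => const_mx (F x)).
have dF z : nm (z - b) < min e r -> hol F z.
 by rewrite lt_min => /andP[_ /rP[Oz _]]; exact: (good_holo hF Oz).
split; [exact: open_rball|exact: bb|by move=> z /dF/(diff_const_mx (n.+1 - n))[]| |].
 apply/seteqP; split=> z.
  move=> [Yz zb]; split; first exact: zb.
  have [_ ->] : A z by apply/(eP z) => //; move: zb; rewrite /= lt_min => /andP[].
  by apply/matrixP => i j; rewrite !mxE.
 move=> [zb /matrixP/(_ 0 (cast_ord (esym (subSnn n)) 0))]; rewrite !mxE => Fz.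
 have /andP[ze /rP[Oz _]] : (nm (z - b) < e) && (nm (z - b) < r) by rewrite -lt_min.
 by split; [apply/(eP z ze)|exact: zb].
move=> x _ xb y; have [_ dE] := diff_const_mx (n.+1 - n) (dF x xb).
move: (xb); rewrite /= lt_min => /andP[_ /rP[_ xv]].
pose j0 : 'I_(n.+1 - n) := cast_ord (esym (subSnn n)) 0.
have [k [k0 kE]] : exists k, k != 0 /\ 'd F x v = k by exists ('d F x v); split; [exact: xv|].
exists ((y 0 j0 / k) *: v); apply: (etrans (dE _)); apply/matrixP => i j.
rewrite mxE (ord1 i) (subSn_ord j j0).
have h1 : 'd F x ((y 0 j0 / k) *: v) = (y 0 j0 / k) *: 'd F x v by exact: linearZ.
apply: (etrans h1); apply: (etrans (congr1 (fun u => (y 0 j0 / k) *: u) kE)).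
by rewrite -[LHS]/(y 0 j0 / k * k) divfK.
Qed.

(** In dimension n + 1 the local equation would have a target of dimension 0, so [Y] would contain a
    ball, against [good_empty]. *)
Lemma regular_le (Y : set X) q b : Y `<=` A -> regular_dim Y q b -> (q <= n)%N.
Proof.
move=> YA [Yb qn [W [h [oW Wb dh YW _]]]]; rewrite -ltnS ltn_neqAle qn andbT; apply/eqP => qE.
have h0 z : h z = 0.
 by apply/matrixP => i j; have := ltn_ord j; rewrite [X in (_ < X)%N](_ : _ = 0)%N // qE subnn.
have /open_rP/(_ b Wb)[e e0 eP] := oW.
have [y yb /eqP Fy] := good_empty hF (YA b Yb).1 e0; apply: Fy.
have : (Y `&` W) y by rewrite YW; split; [exact: eP|exact: h0].
by move=> [/YA[]].
Qed.

Lemma pure_dim_zeros (Y : set X) : Y `<=` A ->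
 (forall a e, Y a -> 0 < e -> exists2 b, Sm b & nm (b - a) < e /\
   exists2 e : R, 0 < e & forall z, nm (z - b) < e -> (Y z <-> A z)) -> pure_dim Y n.
Proof.
move=> YA hY a Ya; split.
 move=> W oW Wa; have /open_rP/(_ a Wa)[e e0 eP] := oW.
 by have [b Sb [ba hb]] := hY a e Ya e0; exists b; [exact: eP|exact: regular_zeros].
by exists setT; split=> [| //|b q _]; [exact: openT|exact: regular_le].
Qed.

Lemma zeros_pure_dim : pure_dim A n.
Proof.
apply: pure_dim_zeros => // a e Aa e0; have [b Sb ba] := good_dense hF Aa e0.
by exists b; [exact: Sb|split; [exact: ba|exists 1]].
Qed.

Lemma zeros_analytic : analytic Om A.
Proof.
split=> [x []//|a Oa]; exists Om, 1%N, (fun x => const_mx (F x)); split=> //; first exact: (good_open hF).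
 by move=> x Ox; have [] := diff_const_mx 1 (good_holo hF Ox).
apply/seteqP; split=> x.
 by move=> [[Ox Fx] _]; split=> //; apply/matrixP => i j; rewrite !mxE.
by move=> [Ox /matrixP/(_ 0 0)]; rewrite !mxE => Fx; split=> //; split.
Qed.

Lemma branch_pure_dim x : Sm x -> pure_dim (br x) n.
Proof.
move=> Sx; apply: (pure_dim_zeros (branch_sub hF (x := x))) => a e Ba e0.
have [/closure_rP/(_ e e0)[b Kb ba] Oa] := Ba; have [_ Sb _] := Kb.
exists b; [exact: Sb|split; first exact: ba].
by apply: (branch_near hF Sx Sb); split; [exact: subset_closure|exact: (smooth_dom Sb)].
Qed.

Lemma zeros_positive_chain : positive_chain Om n Z.
Proof.
split=> [B /(comp_branch hF)[x Sx ->]|a Oa]; last exact: comps_locally_finite.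
by split; [exact: branch_irreducible|exact: branch_pure_dim].
Qed.

Lemma zeros_pure_analytic : pure_analytic Om n A.
Proof. by split; [exact: zeros_analytic|exact: zeros_pure_dim]. Qed.

End Dimension.

Section LinearInverse.
Variable R : realType. Local Notation C := (cplx R).

Lemma right_inverse (V : nmod C) q (L : {linear V -> 'rV[C]_q}) : (forall y, exists v, L v = y) ->
 exists (Rr : {linear 'rV[C]_q -> V}) (c : R), [/\ 0 < c, forall s, nm (Rr s) <= c * nm s & forall s, L (Rr s) = s].
Proof.
move=> surj; have [e eP] := choice (fun j : 'I_q => surj (delta_mx 0 j)).
have linP : linear (fun s : 'rV[C]_q => \sum_j s 0 j *: e j).
 move=> l u w; rewrite scaler_sumr -big_split /=; apply: eq_bigr => j _.
 by rewrite !mxE scalerDl scalerA.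
pose LM := GRing.isLinear.Build _ _ _ _ _ linP.
pose Rr : {linear 'rV[C]_q -> V} := HB.pack (fun s : 'rV[C]_q => \sum_j s 0 j *: e j) LM.
exists Rr, (1 + \sum_j nm (e j)); split=> [|s|s].
- by rewrite ltr_pwDl // sumr_ge0 // => j _; exact: nm_ge0.
- rewrite mulrDl mul1r ler_wpDl ?nm_ge0 // mulr_suml.
 apply: (le_trans (nm_sum _ _ _)); apply: ler_sum => j _.
 by rewrite nmZ mulrC ler_wpM2l ?nm_ge0 // nm_mxij.
- rewrite [RHS]row_sum_delta /= linear_sum; apply: eq_bigr => j _.
 by rewrite linearZ eP.
Qed.

Lemma bij_lin p q (L : {linear 'rV[C]_p -> 'rV[C]_q}) (Rr : {linear 'rV[C]_q -> 'rV[C]_p}) :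
 p = q -> (forall s, L (Rr s) = s) -> forall v, Rr (L v) = v.
Proof.
move=> pq; move: L Rr; rewrite -pq => L Rr LR v.
have : lin1_mx Rr *m lin1_mx L = 1%:M.
 by apply/row_matrixP => i; rewrite !rowE mulmxA mulmx1 !mul_rV_lin1 LR.
move=> /mulmx1C h; rewrite -[RHS]mulmx1 -h mulmxA !mul_rV_lin1.
by [].
Qed.

(** For [u] in the kernel of df, the point a + t u is within o(t) of the zero set of [f], by the
    correction of [implicit]. There [g] vanishes, so dg(t u) is o(t), and being linear in t it is
    zero. *)
Lemma tangent_kernel (V : nmod C) q r (f : V -> 'rV[C]_q) (g : V -> 'rV[C]_r) a (e : R) : 0 < e ->
 (forall x, nm (x - a) < e -> hol f x) -> f a = 0 -> (forall y, exists v, 'd f a v = y) ->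
 hol g a -> (forall x, nm (x - a) < e -> f x = 0 -> g x = 0) ->
 forall u, 'd f a u = 0 -> 'd g a u = 0.
Proof.
move=> e0 df fa surj dg fg u fu.
have [Rr [c [c0 Rc LR]]] := @right_inverse V q ('d f a) surj.
have [eps [eta [sig [eps0 eta0 sP]]]] := implicit (cauchy_target_mx _ _ _) e0 Rc df fa LR.
have [K K0 KP] := diff_bound dg.
have ga : g a = 0 by apply: fg => //; rewrite subrr nm0.
have dfa : hol f a by apply: df; rewrite subrr nm0.
have [w wE] : exists w, 'd g a u = w by exists ('d g a u).
apply: (etrans wE); apply/eqP/negPn/negP; rewrite -nm_gt0 => w0.
have u0 : 0 < nm u.
 rewrite nm_gt0; apply/eqP => uE; have : 'd g a u = 0 by rewrite uE; exact: linear0.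
 by move=> h; move: w0; rewrite -(esym (etrans (esym wE) h)) nm0 ltxx.
(* It collects the errors per unit of d t |u|: 1 + 2 c from the differentiability of [g] at the
   corrected point and 2 K c from dg of the correction. The choice of [d] makes the total at most
   half of t |w|. *)
pose M := 1 + 2 * c + 2 * K * c; have M0 : 0 < M by rewrite /M; have := mulr_gt0 K0 c0; lra.
have [d [d0 d1 dM]] : exists d : R, [/\ 0 < d, d <= 1 & d * (2 * M * nm u) <= nm w].
 exists (min 1 (nm w / (2 * M * nm u))).
 have p0 : 0 < 2 * M * nm u by rewrite !mulr_gt0.
 split; [by rewrite lt_min ltr01 divr_gt0|by rewrite ge_min lexx|].
 by rewrite -ler_pdivlMr // ge_min lexx orbT.
have [d2 d20 h2] := diff_rP dfa d0; have [d3 d30 h3] := diff_rP dg d0.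
have [t [t0 te td2 td3]] : exists t : R, [/\ 0 < t, t * nm u < eps, t * nm u < d2 & t * nm u * (1 + 2 * c) < d3].
 pose k := min (min eps d2) (d3 / (1 + 2 * c)).
 have c1 : 0 < 1 + 2 * c by lra.
 have k0 : 0 < k by rewrite !lt_min eps0 d20 divr_gt0.
 have hk : k / (2 * nm u) * nm u < k.
  by rewrite invfM mulrA -mulrA mulVf ?gt_eqF // mulr1; lra.
 exists (k / (2 * nm u)); split.
 - by rewrite divr_gt0 // mulr_gt0.
 - by apply: (lt_le_trans hk); rewrite !ge_min lexx.
 - by apply: (lt_le_trans hk); rewrite !ge_min lexx orbT.
 - by rewrite -ltr_pdivlMr //; apply: (lt_le_trans hk); rewrite !ge_min lexx !orbT.
pose v := rc t *: u; have vn : nm v = t * nm u by rewrite nmZ nm_rc gtr0_norm.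
have fv : nm (f (a + v)) <= d * (t * nm u).
 have := h2 v; rewrite vn fa subr0 => /(_ td2).
 have -> : 'd f a v = 0.
  have h : 'd f a v = rc t *: 'd f a u by exact: linearZ.
  by apply: (etrans h); apply: (etrans (congr1 (fun z => rc t *: z) fu)); exact: scaler0.
 by rewrite subr0.
have av : nm (a + v - a) < eps by rewrite addrAC subrr add0r vn.
have [q1 q2 q3 [q4 _] _] := sP _ av.
set s := sig (a + v) in q1 q2 q3 q4.
have Rs : nm (Rr s) <= 2 * c * (t * nm u) * d.
 apply: (le_trans (Rc s)); have := le_trans q1 (ler_wpM2l (ltW (ltr0n _ 2)) fv); rewrite -(ler_pM2l c0).
 by move: (t * nm u) => b; lra.
have hE : a + v + Rr s = a + (v + Rr s) by rewrite addrA.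
have gz := fg _ q3 q4; rewrite hE in gz.
have tu0 : 0 < t * nm u by rewrite mulr_gt0.
have hb : nm (v + Rr s) <= t * nm u * (1 + 2 * c).
 apply: (le_trans (nmD _ _)); rewrite vn.
 have : 2 * c * (t * nm u) * d <= 2 * c * (t * nm u) * 1.
  by apply: ler_wpM2l => //; rewrite !mulr_ge0 // ltW.
 by move: Rs; clra.
have := h3 _ (le_lt_trans hb td3); rewrite gz ga subrr sub0r nmN => gb.
have gE : 'd g a (v + Rr s) = rc t *: w + 'd g a (Rr s).
 have h : 'd g a (v + Rr s) = 'd g a v + 'd g a (Rr s) by exact: linearD.
 apply: (etrans h); congr (_ + _).
 have h' : 'd g a v = rc t *: 'd g a u by exact: linearZ.
 by apply: (etrans h'); exact: (congr1 (fun z => rc t *: z) wE).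
have gb' : nm (rc t *: w + 'd g a (Rr s)) <= d * nm (v + Rr s).
 by move: gb; rewrite (_ : nm ('d g a (v + Rr s)) = nm (rc t *: w + 'd g a (Rr s))) //; exact: (congr1 _ gE).
have KR : nm ('d g a (Rr s)) <= K * (2 * c * (t * nm u) * d).
 by apply: (le_trans (KP _)); rewrite ler_pM2l.
have tw : t * nm w <= d * (t * nm u * (1 + 2 * c)) + K * (2 * c * (t * nm u) * d).
 have -> : t * nm w = nm (rc t *: w) by rewrite nmZ nm_rc gtr0_norm.
 have := nm_sub (rc t *: w) (- 'd g a (Rr s)); rewrite nmN opprK => h.
 have h' : d * nm (v + Rr s) <= d * (t * nm u * (1 + 2 * c)) by rewrite ler_pM2l.
 by move: h h' gb' KR; move: (nm _) (nm _) (nm _) (nm _) => x1 x2 x3 x4; clra.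
have : t * (d * (2 * M * nm u)) <= t * nm w by rewrite ler_pM2l.
have : 0 < t * (d * (M * nm u)) by rewrite !mulr_gt0.
have -> : t * (d * (2 * M * nm u)) = 2 * (t * (d * (M * nm u))) by ring.
have -> : t * (d * (M * nm u)) = d * (t * nm u * (1 + 2 * c)) + K * (2 * c * (t * nm u) * d) by rewrite /M; ring.
by move: tw; move: (d * _ + _) (t * nm w) => x y; clra.
Qed.

End LinearInverse.

Section RegularPoints.
Variable R : realType. Local Notation C := (cplx R).
Variables (n : nat) (Om : set 'rV[C]_n.+1) (F : 'rV[C]_n.+1 -> C).
Hypothesis hF : good Om F.
Local Notation X := 'rV[C]_n.+1.
Local Notation A := (zeros Om F).

Lemma surj_const_mx (f : X -> C) x v : hol f x -> 'd f x v != 0 ->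
 forall y : 'rV[C]_1, exists v, 'd (fun x => const_mx (f x) : 'rV[C]_1) x v = y.
Proof.
move=> df v0 y; have [_ dE] := diff_const_mx 1 df.
have [k [k0 kE]] : exists k, k != 0 /\ 'd f x v = k by exists ('d f x v); split; [exact: v0|].
exists ((y 0 0 / k) *: v); apply: (etrans (dE _)); apply/matrixP => i j.
rewrite mxE (ord1 i) (ord1 j).
have h1 : 'd f x ((y 0 0 / k) *: v) = (y 0 0 / k) *: 'd f x v by exact: linearZ.
apply: (etrans h1); apply: (etrans (congr1 (fun u => (y 0 0 / k) *: u) kE)).
by rewrite -[LHS]/(y 0 0 / k * k) divfK.
Qed.

Lemma const_mx_eq0 (z : C) : (const_mx z : 'rV[C]_1) = 0 <-> z = 0.
Proof.
split=> [/matrixP/(_ 0 0)|->]; first by rewrite !mxE.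
by apply/matrixP => i j; rewrite !mxE.
Qed.

(* If dF vanished at a, then on the lines parallel to a direction v transversal to the regular set the quotient
  F(b + s v) / s would have no zero for b smooth close to a, but one in the limit b = a. *)
Lemma regular_smooth a : regular A a -> smooth Om F a.
Proof.
move=> [p reg]; have pn := regular_le hF (fun x h => h) reg.
have [Aa _ [W [h [oW Wa dh AW surj]]]] := reg.
have [Oa Fa] := Aa.
have np : (0 < n.+1 - p)%N by rewrite subn_gt0.
pose j0 := Ordinal np.
have [v vE] := surj a Aa Wa (const_mx 1).
pose h1 x := h x 0 j0.
have dh1 x : W x -> hol h1 x /\ forall u, 'd h1 x u = 'd h x u 0 j0.
 by move=> Wx; exact: diff_entry (dh x Wx).
have h1v : 'd h1 a v = 1.
 by have [_ k] := dh1 a Wa; apply: (etrans (k v)); apply: (etrans (congr1 (fun z : 'rV[C]_(n.+1 - p) => z 0 j0) vE)); rewrite mxE.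
have AWz x : W x -> Om x -> F x = 0 -> h x = 0.
 by move=> Wx Ox Fx; move/seteqP: AW => [k _]; have [_ hx] := k x (conj (conj Ox Fx) Wx).
have /open_rP/(_ a Wa)[r1 r10 r1W] := oW.
have /open_rP/(_ a Oa)[r2 r20 r2O] := good_open hF.
have [r3 r30 [M M0 FM]] := locally_bounded (good_holo hF Oa).
have [r [r0 rW rO rM]] : exists r : R, [/\ 0 < r, forall x, nm (x - a) < r -> W x, forall x, nm (x - a) < r -> Om x &
  forall x, nm (x - a) < r -> nm (F x) <= M].
 exists (min r1 (min r2 r3)); first split.
 - by rewrite !lt_min r10 r20.
 - by move=> x; rewrite !lt_min => /andP[/r1W].
 - by move=> x; rewrite !lt_min => /and3P[_ /r2O].
 - by move=> x; rewrite !lt_min => /and3P[_ _ /FM].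
have dF x : nm (x - a) < r -> hol F x by move=> /rO; exact: good_holo.
have lipF := cauchy_lip (cauchy_targetC R) r0 dF rM.
pose Lp := 16 * M / r; have Lp0 : 0 < Lp by rewrite /Lp divr_gt0 // mulr_gt0.
have v0 : 0 < nm v.
 rewrite nm_gt0; apply/eqP => vz; have : 'd h1 a v = 0 by rewrite vz; exact: linear0.
 by move/(etrans (esym h1v))/eqP; rewrite oner_eq0.
have e0 : 0 < (2 * nm v)^-1 by rewrite invr_gt0 mulr_gt0.
have [d1 d10 [d1r d1P]] := strict_diff (cauchy_targetC R) r0 (fun x hx => (dh1 x (rW x hx)).1) e0.
have [d [d0 dd1 dr]] : exists d : R, [/\ 0 < d, d <= d1 & d <= r / 2].
 by exists (min d1 (r / 2)); rewrite lt_min d10 !ge_min !lexx orbT divr_gt0.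
(* [h1] has derivative 1 in the direction [v], so on a line parallel to [v] it takes the value 0 at
   most once near [a]. *)
have inj b (s : C) : nm (b - a) < d -> nm (b + s *: v - a) < d -> h1 b = 0 -> h1 (b + s *: v) = 0 -> s = 0.
 move=> bd sd hb hs; have := d1P _ _ (lt_le_trans sd dd1) (lt_le_trans bd dd1).
 rewrite hb hs subrr sub0r addrAC subrr add0r nmN.
 have -> : nm ('d h1 a (s *: v)) = nm s.
  have k : 'd h1 a (s *: v) = s *: 'd h1 a v by exact: linearZ.
  by congr nm; apply: (etrans k); apply: (etrans (congr1 (fun z => s *: z) h1v)); rewrite -[LHS]/(s * 1) mulr1.
 rewrite nmZ invfM mulrACA -!mulrA mulVf ?gt_eqF // mulr1 => k.
 by apply/eqP; rewrite -nm_eq0 eq_le nm_ge0 andbT; move: k; clear -hF; lra.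
apply: contrapT => nS.
have Fv0 : 'd F a v = 0.
 by apply: contrapT => /eqP k; apply: nS; split; [exact: Oa|exact: Fa|exists v; exact: k].
pose t := d / (8 * nm v); have t0 : 0 < t by rewrite divr_gt0 // mulr_gt0.
have tv : t * nm v = d / 8 by rewrite /t invfM mulrA -mulrA mulVf ?mulr1 // gt_eqF.
have line b (s : C) : nm (b - a) < d / 2 -> nm s < 4 * t -> nm (b + s *: v - a) < d.
 move=> bd s4; have : nm s * nm v < d / 2 by rewrite (_ : d / 2 = 4 * t * nm v) ?ltr_pM2r // -mulrA tv; clear -hF; lra.
 have := nmD (b - a) (s *: v); rewrite nmZ addrAC; move: bd; clear -hF; lra.
have aa : nm (a - a) < d / 2 by rewrite subrr nm0; lra.
have h1a : h1 a = 0 by rewrite /h1 AWz ?mxE.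
have ha0 : h a = 0 by exact: AWz.
have dle x : nm (x - a) < d -> nm (x - a) < r by move: dr r0; clear -hF; lra.
have fa (s : C) : nm s < 4 * t -> s != 0 -> F (a + s *: v) != 0.
 move=> s4; apply: contra_neq => k; have ad := line a s aa s4.
 have := AWz _ (rW _ (dle _ ad)) (rO _ (dle _ ad)) k => hz.
 by apply: (inj a s) => //; [rewrite subrr nm0|rewrite /h1 hz mxE].
pose Kc := [set z : C | nm z <= 2 * t] `&` ~` [set z : C | nm (z - 0) < t].
have cK : compact Kc by apply: compact_closedI; [exact: ball_compact_cplx|exact/open_closedC/open_rball].
have dline b (s : C) : nm (b - a) < d / 2 -> nm s < 4 * t ->
  hol (fun s : C => F (b + s *: v)) s /\ 'd (fun s : C => F (b + s *: v)) s 1 = 'd F (b + s *: v) v.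
 by move=> bd s4; apply: diff_line; exact/dF/dle/line.
have K4 s : Kc s -> nm s < 4 * t by move=> [/= k _]; move: k t0; clear -hF; lra.
have [||m0 m00 m0P] := @compact_lower R C C Kc (fun s : C => F (a + s *: v)) cK.
- by move=> s /K4 s4; have [k _] := dline a s aa s4; exact: diff_cont.
- move=> s Ks; apply: fa; first exact: K4.
 by case: Ks => _ /= k; apply/eqP => sE; apply: k; rewrite sE subrr nm0.
have dv := @holo_derivative R X C (cauchy_targetC R) F a v r r0 dF.
have dhv := @holo_derivative R X C (cauchy_targetC R) h1 a v r r0 (fun x hx => (dh1 x (rW x hx)).1).
have p1 : 0 < m0 / (16 * t) by rewrite divr_gt0 // mulr_gt0.
have /continuous_rP/(_ _ p1)[d2 d20 d2P] := diff_cont dv.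
have p2 : 0 < nm ('d h1 a v) by rewrite (_ : nm _ = 1) ?ltr01 //; apply: (etrans (congr1 _ h1v)); exact: nm1.
have /continuous_rP/(_ _ p2)[d3 d30 d3P] := diff_cont dhv.
have [eta [eta0 etad eta2 eta3 etaL]] : exists eta : R, [/\ 0 < eta, eta <= d / 2, eta <= d2, eta <= d3 & Lp * eta <= m0 / 2].
 exists (min (min (d / 2) d2) (min d3 (m0 / (2 * Lp)))); split.
 - by rewrite !lt_min d20 d30 !divr_gt0 // mulr_gt0.
 - by rewrite !ge_min lexx.
 - by rewrite !ge_min lexx orbT.
 - by rewrite !ge_min lexx !orbT.
 - rewrite mulrC -ler_pdivlMr // -mulrA -invfM !ge_min lexx !orbT //.
have [b [Ob Fb [u Fu]] ba] := good_dense hF Aa eta0.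
have bd := lt_le_trans ba etad; have bd' : nm (b - a) < d by move: bd d0; clear -hF; lra.
have br := dle b bd'; have hb0 := AWz b (rW b br) Ob Fb.
(* At the smooth point [b] the kernel of dF is contained in the kernel of dh by [tangent_kernel],
   and dh does not kill [v]. *)
have Fbv : 'd F b v != 0.
 have h1b : 'd h1 b v != 0 by apply: near_neq0 (d3P b (lt_le_trans ba eta3)).
 apply/negP => /eqP kv; move/negP: h1b; apply; apply/eqP.
 have [dhb k] := dh1 b (rW b br); apply: (etrans (k v)).
 have /open_rP/(_ b br)[r5 r50 r5P] := open_rball a r.
 have [dcF cE] := diff_const_mx 1 (dF b br).
 suff : 'd h b v = 0 by move=> kk; apply: (etrans (congr1 (fun z : 'rV[C]_(n.+1 - p) => z 0 j0) kk)); rewrite mxE.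
 apply: (@tangent_kernel R X 1 (n.+1 - p) (fun x => const_mx (F x)) h b r5 r50).
 - by move=> x /r5P/dF/(diff_const_mx 1)[].
 - exact/const_mx_eq0.
 - exact: surj_const_mx (dF b br) Fu.
 - exact/dh/rW.
 - by move=> x /r5P xr /const_mx_eq0 Fx; exact: (AWz x (rW x xr) (rO x xr) Fx).
 - by apply: (etrans (cE v)); apply/matrixP => i j; rewrite !mxE; exact: kv.
pose f (s : C) := F (b + s *: v).
have f0 : f 0 = 0 by rewrite /f scale0r addr0.
have t4 : 0 < 4 * t by rewrite mulr_gt0.
have df s : nm (s - 0) < 4 * t -> hol f s by rewrite subr0 => /(dline b s bd)[].
have dq := quotient_holo t4 df.
have df0 : 'd f 0 1 = 'd F b v.
 have [] := dline b 0 bd; first by rewrite nm0.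
 have bE : b + 0 *: v = b by rewrite scale0r addr0.
 by move=> _ k; apply: (etrans k); exact: (congr1 (fun z => 'd F z v) bE).
pose q (s : C) := if s == 0 then 'd f 0 1 else (f s - f 0) / (s - 0).
have sq4 (s : C) : sq 0 t s -> nm s < 4 * t by move=> /sq_norm; rewrite subr0; move: t0; clear -hF; lra.
have qs s : s != 0 -> q s = f s / s by move=> s0; rewrite /q ifN // f0 !subr0.
have q0 : q 0 = 'd F b v by apply: etrans df0; rewrite /q eqxx.
have qn0 s : sq 0 t s -> q s != 0.
 move=> /sq4 s4; have [s0|s0] := eqVneq s 0; first by rewrite s0; apply: contra Fbv => /eqP kk; apply/eqP/(etrans (esym q0) kk).
 rewrite qs // mulf_neq0 ?invr_eq0 //; apply: contra_neq s0 => fs.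
 have sd := line b s bd s4; have hz := AWz _ (rW _ (dle _ sd)) (rO _ (dle _ sd)) fs.
 by apply: (inj b s bd' sd); rewrite /h1 ?hz ?hb0 mxE.
have qside s : side 0 t s -> m0 / (4 * t) <= nm (q s).
 move=> [sqs st]; rewrite subr0 in st.
 have s0 : s != 0 by rewrite -nm_gt0; apply: lt_le_trans st.
 have s2 : nm s <= 2 * t by have := sq_norm sqs; rewrite subr0.
 have s4 : nm s < 4 * t by move: s2 t0; clear -hF; lra.
 have Ks : Kc s by split; [exact: s2|rewrite /= subr0; move=> k'; move: st k'; clear -hF; lra].
 have as2 := line a s aa s4; have bs2 := line b s bd s4.
 have := lipF (b + s *: v) (a + s *: v) (lt_le_trans bs2 dr) (lt_le_trans as2 dr).
 have -> : b + s *: v - (a + s *: v) = b - a by rewrite opprD addrACA subrr addr0.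
 rewrite -/Lp => k1; have k2 : Lp * nm (b - a) <= Lp * eta by rewrite ler_pM2l // ltW.
 have fs : m0 / 2 <= nm (f s).
  have := m0P s Ks; have := nm_sub (F (a + s *: v)) (F (b + s *: v)).
  by rewrite [nm (_ - F (b + s *: v))]nmC /f; move: k1 k2 etaL; clear -hF; lra.
 have rs0 : 0 < nm s by rewrite nm_gt0.
 rewrite qs // nmM nmV ler_pdivlMr // mulrAC ler_pdivrMr //.
 have k3 : m0 * nm s <= m0 * (2 * t) by rewrite ler_pM2l.
 have k4 : m0 / 2 * (4 * t) <= nm (f s) * (4 * t) by rewrite ler_pM2r.
 by move: k3 k4; move: (nm (f s)) (nm s) => x y; clear -hF; lra.
(* [q] has no zero in the square, so the minimum principle bounds its central value dF(b) v below by
   m0 / (8 t). But dF(a) v = 0, and [b] was taken so close to [a] that this value is less than m0 /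
   (16 t). *)
have mp : m0 / (4 * t) <= 2 * nm (q 0).
 apply: (min_principle t0 (divr_gt0 m00 t4) _ qn0 qside) => s /sq4 s4.
 by apply: dq; rewrite subr0.
have h2 : nm ('d F b v) < m0 / (16 * t).
 have := d2P b (lt_le_trans ba eta2).
 have E : 'd F b v - 'd F a v = 'd F b v by apply: (etrans (congr1 (fun z => 'd F b v - z) Fv0)); exact: subr0.
 by apply: le_lt_trans; apply: (eq_ind _ (fun z => nm ('d F b v) <= nm z) (lexx _)); exact: esym E.
have mp' : m0 / (4 * t) <= 2 * nm ('d F b v).
 by apply: (eq_ind _ (fun z => m0 / (4 * t) <= 2 * nm z) mp); exact: q0.
have E : m0 / (4 * t) = 4 * (m0 / (16 * t)) by field; rewrite gt_eqF.
move: mp' h2 p1; rewrite E; move: (nm _) (m0 / (16 * t)) => x y; clear -hF; lra.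
Qed.

End RegularPoints.

(** * Transversal intersections and their multiplicity *)

Section Intersection.
Variable R : realType. Local Notation C := (cplx R).

Lemma deriv_neq0 (V : nmod C) (G : V -> C) (b v : V) (d : R) : 0 < d -> hol G b ->
 (forall s : C, nm s < d -> @nm R C (G (b + s *: v) - G b - s) <= nm s / 2) -> 'd G b v != 0.
Proof.
move=> d0 dG hG; apply/negP => /eqP kv.
have v1 : 0 < nm v + 1 by rewrite ltr_wpDl ?nm_ge0.
have e0 : 0 < (4 * (nm v + 1))^-1 by rewrite invr_gt0 mulr_gt0.
have [d1 d10 d1P] := diff_rP dG e0.
have [t [t0 td td1]] : exists t : R, [/\ 0 < t, t < d & t * nm v < d1].
 exists (min (d / 2) (d1 / (nm v + 1))); split.
 - by rewrite lt_min !divr_gt0.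
 - by rewrite gt_min; apply/orP; left; move: d0; clra.
 - have : min (d / 2) (d1 / (nm v + 1)) * (nm v + 1) <= d1 by rewrite -ler_pdivlMr // ge_min lexx orbT.
  have : 0 < min (d / 2) (d1 / (nm v + 1)) by rewrite lt_min !divr_gt0.
  by move: (min _ _) => x; clra.
have tn : nm (rc t : C) = t by rewrite nm_rc gtr0_norm.
have h1 := hG (rc t) ltac:(by rewrite tn); rewrite tn in h1.
have := d1P (rc t *: v); rewrite nmZ tn => /(_ td1).
have -> : 'd G b (rc t *: v) = 0.
 have h : 'd G b (rc t *: v) = rc t *: 'd G b v by exact: linearZ.
 by apply: (etrans h); apply: (etrans (congr1 (fun z => rc t *: z) kv)); exact: scaler0.
rewrite subr0 => h2.
have h3 : (4 * (nm v + 1))^-1 * (t * nm v) <= t / 4.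
 rewrite mulrC ler_pdivrMr ?mulr_gt0 //.
 have -> : t / 4 * (4 * (nm v + 1)) = t * (nm v + 1) by field.
 by rewrite ler_pM2l // lerDl ler01.
have := nm_sub (rc t : C) (G (b + rc t *: v) - G b); rewrite tn nmC.
by move: h1 h2 h3 t0; move: (nm _) (nm _) (nm _) => x y z; clra.
Qed.

Lemma nm_row_mx p q (x : 'rV[C]_p) (y : 'rV[C]_q) (r : R) : 0 <= r -> nm x <= r -> nm y <= r ->
 nm (row_mx x y) <= r.
Proof.
move=> r0 xr yr; apply: nm_mx_le => // i j; case: (split_ordP j) => j' ->.
 by rewrite row_mxEl; apply: le_trans xr; exact: nm_mxij.
by rewrite row_mxEr; apply: le_trans yr; exact: nm_mxij.
Qed.

Lemma row_mxB p q (x x' : 'rV[C]_p) (y y' : 'rV[C]_q) : row_mx x y - row_mx x' y' = row_mx (x - x') (y - y').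
Proof. by rewrite opp_row_mx add_row_mx. Qed.

Lemma nm_const_mx (z : C) : nm (const_mx z : 'rV[C]_1) <= nm z.
Proof. by apply: nm_mx_le => [|i j]; rewrite ?nm_ge0 // mxE. Qed.

(** [hT] is a local equation of the transversal submanifold. The map sending y to G(y + c) and hT(y)
    is close to its linear part [L] at [a], which is invertible by transversality and the count of
    dimensions, so a contraction finds exactly one solution. The uniqueness radius [rho] precedes
    [G] and c; [rho'] controls how close the solution lies to [a]. *)
Lemma isolated_intersection n k (F : 'rV[C]_n.+1 -> C) (hT : 'rV[C]_n.+1 -> 'rV[C]_k) (a w : 'rV[C]_n.+1) (r : R) :
 (1 + k)%N = n.+1 -> 0 < r ->
 (forall x, nm (x - a) < r -> hol F x) -> (forall x, nm (x - a) < r -> hol hT x) ->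
 F a = 0 -> hT a = 0 -> 'd F a w != 0 -> 'd hT a w = 0 -> (forall y, exists v, 'd hT a v = y) ->
 exists2 rho : R, 0 < rho & forall rho', 0 < rho' -> exists (delta eps : R), [/\ 0 < delta, 0 < eps &
  forall G : 'rV[C]_n.+1 -> C, (forall x, nm (x - a) < r -> hol G x /\ @nm R C (G x - F x) <= delta) ->
  exists y_ : 'rV[C]_n.+1 -> 'rV[C]_n.+1, [/\
   forall c, nm c < eps -> [/\ nm (y_ c - a) < rho', hT (y_ c) = 0, G (y_ c + c) = 0 &
    forall y, nm (y - a) < rho -> hT y = 0 -> G (y + c) = 0 -> y = y_ c],
   forall c, nm c < eps -> {for c, continuous y_} & exists v, 'd G (y_ 0) v != 0]].
Proof.
move=> kn r0 dF dh Fa ha w0 hw surj.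
have aa (e : R) : 0 < e -> nm (a - a) < e by rewrite subrr nm0.
have dFa := dF a (aa r r0); have dha := dh a (aa r r0).
have linP : linear (fun v => row_mx (const_mx ('d F a v) : 'rV[C]_1) ('d hT a v)).
 move=> l u v; rewrite scale_row_mx add_row_mx; congr row_mx; last exact: linearP.
 by apply/matrixP => i j; rewrite !mxE; exact: linearP.
pose LM := GRing.isLinear.Build _ _ _ _ _ linP.
pose L : {linear 'rV[C]_n.+1 -> 'rV[C]_(1 + k)} :=
 HB.pack (fun v => row_mx (const_mx ('d F a v) : 'rV[C]_1) ('d hT a v)) LM.
have Lsurj y : exists v, L v = y.
 have [v vE] := surj (rsubmx y).
 have [kk [kk0 kE]] : exists kk, kk != 0 /\ 'd F a w = kk by exists ('d F a w); split; [exact: w0|].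
 have [l lE] : exists l, 'd F a v = l by exists ('d F a v).
 exists (((lsubmx y 0 0 - l) / kk) *: w + v); rewrite -[RHS]hsubmxK; congr row_mx.
  apply/matrixP => i j; rewrite mxE (ord1 i) (ord1 j).
  have h : 'd F a (((lsubmx y 0 0 - l) / kk) *: w + v) = ((lsubmx y 0 0 - l) / kk) *: 'd F a w + 'd F a v.
   by exact: linearP.
  apply: (etrans h); apply: (etrans (f_equal2 (fun s t => ((lsubmx y 0 0 - l) / kk) *: s + t) kE lE)).
  by rewrite -[_ *: _]/((lsubmx y 0 0 - l) / kk * kk) divfK // subrK.
 have h : 'd hT a (((lsubmx y 0 0 - l) / kk) *: w + v) = ((lsubmx y 0 0 - l) / kk) *: 'd hT a w + 'd hT a v.
  by exact: linearP.
 apply: (etrans h); apply: (etrans (f_equal2 (fun s t => ((lsubmx y 0 0 - l) / kk) *: s + t) hw vE)).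
 by rewrite scaler0 add0r.
have [Rr [c [c0 Rc LR]]] := right_inverse Lsurj.
have RL := bij_lin (esym kn) LR.
have [K1 K10 K1P] := diff_bound dFa; have [K2 K20 K2P] := diff_bound dha.
have LK v : nm (L v) <= (K1 + K2) * nm v.
 have v0 := nm_ge0 v; have h1 : 0 <= K1 * nm v by rewrite mulr_ge0 // ltW.
 have h2 : 0 <= K2 * nm v by rewrite mulr_ge0 // ltW.
 rewrite mulrDl; apply: nm_row_mx; first exact: addr_ge0.
  by apply: (le_trans (nm_const_mx _)); apply: (le_trans (K1P v)); rewrite lerDl.
 by apply: (le_trans (K2P v)); rewrite lerDr.
have kap0 : 0 < (4 * c)^-1 by rewrite invr_gt0 mulr_gt0.
have [d1 d10 [d1r d1P]] := strict_diff (cauchy_targetC R) r0 dF kap0.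
have kap0' : 0 < (2 * c)^-1 by rewrite invr_gt0 mulr_gt0.
have [d2 d20 [d2r d2P]] := strict_diff (cauchy_target_mx _ _ _) r0 dh kap0'.
have [d [d0 dd1 dd2 dr]] : exists d : R, [/\ 0 < d, d <= d1, d <= d2 & d <= r / 2].
 exists (min d1 (min d2 (r / 2))); split; last by rewrite !ge_min lexx !orbT.
 - by rewrite !lt_min d10 d20 divr_gt0.
 - by rewrite !ge_min lexx.
 - by rewrite !ge_min lexx orbT.
pose eta := d / (4 * c); have eta0 : 0 < eta by rewrite divr_gt0 // mulr_gt0.
have ceta : c * eta = d / 4 by rewrite /eta; field; rewrite gt_eqF.
have K0 : 0 < K1 + K2 by rewrite addr_gt0.
clearbody eta.
have [rho [rho0 rhod rhoe]] : exists rho : R, [/\ 0 < rho, rho <= d / 2 & rho <= eta / (K1 + K2)].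
 exists (min (d / 2) (eta / (K1 + K2))).
 by rewrite lt_min !ge_min !lexx orbT !divr_gt0.
exists rho => [//|].
move=> rho' rho'0.
have [be [be0 be1 be2]] : exists be : R, [/\ 0 < be, be <= eta / 4 & c * (2 * be) < rho'].
 exists (min (eta / 4) (rho' / (4 * c))); split; last 1 first.
 - have : min (eta / 4) (rho' / (4 * c)) * (4 * c) <= rho'.
   by rewrite -ler_pdivlMr ?mulr_gt0 // ge_min lexx orbT.
  by move: (min _ _) rho'0 => x; clra.
 - by rewrite lt_min !divr_gt0 // mulr_gt0.
 - by rewrite ge_min lexx.
have be20 : 0 < be / 2 by rewrite divr_gt0.
have /continuous_rP/(_ _ be20)[e1 e10 e1P] := diff_cont dFa.
(* The first condition keeps the Lipschitz constant of G - F below 1 / (4 c). With the same error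
   for [F] around its linear part this makes 1 / (2 c), which after composition with [Rr], of norm
   at most c, is the factor 1/2 of the contraction. *)
have [delta [delta0 del1 del2]] : exists delta : R, [/\ 0 < delta, 16 * delta / r <= (4 * c)^-1 & delta <= be / 2].
 exists (min (r / (64 * c)) (be / 2)); split; last by rewrite ge_min lexx orbT.
 - by rewrite lt_min !divr_gt0 // mulr_gt0.
 - have h : min (r / (64 * c)) (be / 2) <= r / (64 * c) by rewrite ge_min lexx.
  have -> : (4 * c)^-1 = 16 * (r / (64 * c)) / r by field; rewrite !gt_eqF.
  by rewrite ler_pM2r ?invr_gt0 // ler_pM2l.
exists delta, (min (d / 2) e1); split; [exact: delta0|by rewrite lt_min divr_gt0|] => G hG.
have Gr x : nm (x - a) < r -> hol G x by move=> /hG[].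
have lipE := @cauchy_lip R _ C (cauchy_targetC R) (fun x => G x - F x) a r delta r0
 (fun x xr => holB (Gr x xr) (dF x xr)) (fun x xr => (hG x xr).2).
(* G is kappa-close to its linear part dF(a), uniformly in G *)
have Glin x y : nm (x - a) < d -> nm (y - a) < d ->
  @nm R C (G x - G y - 'd F a (x - y)) <= (2 * c)^-1 * nm (x - y).
 move=> xd yd; have h1 := d1P x y (lt_le_trans xd dd1) (lt_le_trans yd dd1).
 have h2 := lipE x y (lt_le_trans xd dr) (lt_le_trans yd dr).
 have h3 : 16 * delta / r * nm (x - y) <= (4 * c)^-1 * nm (x - y) by rewrite ler_wpM2r ?nm_ge0.
 have hh (g g' f f' l : C) : g - g' - l = (g - f - (g' - f')) + (f - f' - l) by ring.
 have := @nmD R C (G x - F x - (G y - F y)) (F x - F y - 'd F a (x - y)).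
 have E := hh (G x) (G y) (F x) (F y) ('d F a (x - y)).
 move=> h4; have h5 : @nm R C (G x - G y - 'd F a (x - y)) <=
   @nm R C (G x - F x - (G y - F y)) + @nm R C (F x - F y - 'd F a (x - y)).
  by apply: (eq_ind _ (fun z => nm z <= _) h4); exact: esym E.
 apply: (le_trans h5); have -> : (2 * c)^-1 = (4 * c)^-1 + (4 * c)^-1 by field; rewrite gt_eqF.
 by rewrite mulrDl; apply: lerD; [exact: le_trans h3|exact: h1].
pose Phi (u y : 'rV[C]_n.+1) : 'rV[C]_(1 + k) := row_mx (const_mx (G (y + u))) (hT y).
pose B := [set u : 'rV[C]_n.+1 | nm u < min (d / 2) e1].
have Bd u : B u -> nm u < d / 2 by rewrite /B /= lt_min => /andP[].
have yu y u : nm (y - a) < d / 2 -> nm u < d / 2 -> nm (y + u - a) < d.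
 by move=> h1 h2; have := nmD (y - a) u; rewrite addrAC; move: h1 h2; clra.
have PhiL u y y' : B u -> nm (y - a) < d / 2 -> nm (y' - a) < d / 2 ->
  nm (Phi u y - Phi u y' - L (y - y')) <= (2 * c)^-1 * nm (y - y').
 move=> /Bd ud yd yd'; rewrite /Phi row_mxB row_mxB; apply: nm_row_mx.
 - by rewrite mulr_ge0 ?nm_ge0 // ltW.
 - have -> : const_mx (G (y + u)) - const_mx (G (y' + u)) - const_mx ('d F a (y - y')) =
    const_mx (G (y + u) - G (y' + u) - 'd F a (y - y')) :> 'rV[C]_1 by apply/matrixP => i j; rewrite !mxE.
  apply: (le_trans (nm_const_mx _)); have := Glin _ _ (yu y u yd ud) (yu y' u yd' ud).
  by rewrite [in X in _ -> X](_ : y - y' = y + u - (y' + u)) // opprD addrACA subrr addr0.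
 - by apply: d2P; apply: lt_le_trans dd2; move: yd yd' d0; clra.
have Rd s : nm s <= eta -> nm (a + Rr s - a) < d / 2.
 move=> se; rewrite addrAC subrr add0r; apply: (le_lt_trans (Rc s)).
 by have : c * nm s <= c * eta by [rewrite ler_pM2l]; rewrite ceta; move: d0; clra.
have G0be u : B u -> nm (Phi u (a + Rr 0)) <= be.
 move=> Bu; rewrite linear0 addr0 /Phi ha; apply: nm_row_mx; [exact: ltW| |rewrite nm0; exact: ltW].
 apply: (le_trans (nm_const_mx _)).
 have ud : nm u < d / 2 := Bd u Bu.
 have ur : nm (a + u - a) < r by rewrite addrAC subrr add0r; move: ud dr r0 d0; clra.
 have ue : nm (a + u - a) < e1 by move: Bu; rewrite /B /= lt_min addrAC subrr add0r => /andP[].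
 have := e1P _ ue; rewrite Fa subr0; have [_ h] := hG _ ur.
 by have := @nmD R C (G (a + u) - F (a + u)) (F (a + u)); rewrite subrK; move: h del2; clra.
have [|u Bu|sig sigP] := @fp_family R _ (cauchy_target_mx R 1 (1 + k)) _ B (fun u s => Phi u (a + Rr s)) eta eta0.
- move=> u Bu s s' se se'; have := PhiL u _ _ Bu (Rd s se) (Rd s' se').
 have -> : a + Rr s - (a + Rr s') = Rr (s - s') by rewrite opprD addrACA subrr add0r linearB.
 rewrite LR => h; apply: (le_trans h); apply: (@le_trans _ _ ((2 * c)^-1 * (c * nm (s - s')))).
  by rewrite ler_pM2l.
 by rewrite le_eqVlt; apply/orP; left; apply/eqP; field; rewrite gt_eqF.
- exact: le_trans (G0be u Bu) be1.
pose y_ u := a + Rr (sig u).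
have sigeta u : B u -> nm (sig u) <= eta.
 move=> Bu; have [h _ _ _] := sigP u Bu; apply: (le_trans h); have := G0be u Bu.
 by move: be1 eta0; clra.
have PhiE u y : Phi u y = 0 <-> G (y + u) = 0 /\ hT y = 0.
 rewrite /Phi; split=> [h|[h1 h2]]; last by rewrite h2 h1 -row_mx0; congr row_mx; exact/const_mx_eq0.
 by have [/const_mx_eq0] : const_mx (G (y + u)) = (0 : 'rV[C]_1) /\ hT y = 0 by apply: eq_row_mx; rewrite h row_mx0.
have yE u : B u -> [/\ nm (y_ u - a) < rho', hT (y_ u) = 0 & G (y_ u + u) = 0].
 move=> Bu; have [h1 /PhiE[h2 h3] _ _] := sigP u Bu; split=> //.
 rewrite /y_ addrAC subrr add0r; apply: (le_lt_trans (Rc _)); apply: le_lt_trans be2; rewrite ler_pM2l //.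
 by apply: (le_trans h1); rewrite ler_pM2l //; exact: G0be.
exists y_; split.
- move=> u Bu; have [h1 h2 h3] := yE u Bu; split; [exact: h1|exact: h2|exact: h3|] => y.
 move=> /lt_le_trans/(_ rhoe) ye hy Gy.
 have yE' : a + Rr (L (y - a)) = y by rewrite RL subrKC.
 have [_ _ uq _] := sigP u Bu; rewrite /y_ -(uq (L (y - a))) //.
  by apply: (le_trans (LK _)); move: ye; rewrite ltr_pdivlMr // mulrC => /ltW.
 by rewrite yE'; apply/PhiE.
- move=> u Bu; apply/continuous_rP => e e0.
 have yud := Rd _ (sigeta u Bu); rewrite -/(y_ u) in yud.
 have dG : hol G (y_ u + u).
  by apply: Gr; apply: lt_le_trans (yu _ _ yud (Bd u Bu)) _; move: dr r0; clra.
 have e20 : 0 < e / (2 * c) by rewrite divr_gt0 // mulr_gt0.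
 have /continuous_rP/(_ _ e20)[g g0 gP] := diff_cont dG.
 exists (min g (min (d / 2) e1 - nm u)); first by rewrite lt_min g0 subr_gt0.
 move=> u'; rewrite lt_min => /andP[ug uu].
 have Bu' : B u' by rewrite /B /=; have := nm_sub u' u; move: uu; move: (min _ _) => z; clra.
 have h1 := PhiL u' _ _ Bu' (Rd _ (sigeta u' Bu')) yud.
 have [_ h2 _ _] := sigP u' Bu'; have [_ /PhiE[h3 h4] _ _] := sigP u Bu.
 rewrite -/(y_ u') in h1 h2; rewrite h2 in h1; rewrite -/(y_ u) in h3 h4.
 have RyE : y_ u' - y_ u = Rr (sig u' - sig u) by rewrite /y_ opprD addrACA subrr add0r linearB.
 rewrite RyE LR sub0r -opprD nmN in h1.
 have h5 : nm (Phi u' (y_ u)) < e / (2 * c).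
  rewrite /Phi h4; apply: (@le_lt_trans _ _ (@nm R C (G (y_ u + u')))).
   by apply: nm_row_mx; [exact: nm_ge0|exact: nm_const_mx|rewrite nm0; exact: nm_ge0].
  have := gP (y_ u + u'); rewrite h3 subr0; apply.
  by rewrite opprD addrACA subrr add0r.
 have h6 : (2 * c)^-1 * nm (Rr (sig u' - sig u)) <= nm (sig u' - sig u) / 2.
  apply: (@le_trans _ _ ((2 * c)^-1 * (c * nm (sig u' - sig u)))); first by rewrite ler_pM2l.
  by rewrite le_eqVlt; apply/orP; left; apply/eqP; field; rewrite gt_eqF.
 have h7 : nm (sig u' - sig u) < e / c.
  have := nm_sub (sig u' - sig u) (- Phi u' (y_ u)); rewrite nmN opprK addrC.
  have -> : e / c = 2 * (e / (2 * c)) by field; rewrite gt_eqF.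
  rewrite [sig u' - sig u + _]addrC.
  by move: h1 h5 h6; rewrite !(addrC (Phi u' (y_ u))); move: (nm _) (nm _) (nm _) (nm _) (e / _) => x1 x2 x3 x4 x5; clra.
 rewrite RyE; apply: (le_lt_trans (Rc _)).
 by move: h7; rewrite ltr_pdivlMr // mulrC.
have B0 : B 0 by rewrite /B /= nm0 lt_min divr_gt0.
have [_ _ h3] := yE 0 B0; rewrite addr0 in h3.
have yd := Rd _ (sigeta 0 B0); rewrite -/(y_ 0) in yd.
(* The vector with dF(a) v = 1 and dhT(a) v = 0. Since its norm is at most c, [Glin] yields just the
   error |s| / 2 that [deriv_neq0] admits. *)
pose v := Rr (row_mx 1 0); exists v.
have Fv : 'd F a v = 1.
 have : L v = row_mx 1 0 by exact: LR.
 by move=> /eq_row_mx[/matrixP/(_ 0 0)]; rewrite !mxE => h _; exact: h.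
have v1 : 0 < nm v + 1 by rewrite ltr_wpDl ?nm_ge0.
have vc : nm v <= c.
 apply: (le_trans (Rc _)); rewrite -[leRHS]mulr1 ler_pM2l //; apply: nm_row_mx; [exact: ler01| |by rewrite nm0 ler01].
 by apply: nm_mx_le => // i j; rewrite (ord1 i) (ord1 j) mxE /= nm1.
apply: (@deriv_neq0 _ G (y_ 0) v (d / 2 / (nm v + 1))); first by rewrite !divr_gt0.
 by apply: Gr; move: yd dr r0 d0; clra.
move=> s; rewrite ltr_pdivlMr // => sd.
have s0 := nm_ge0 s; have h4 : nm (y_ 0 + s *: v - a) < d.
 by apply: yu => //; rewrite nmZ; move: sd; rewrite mulrDr mulr1; move: s0; clra.
have h5 : nm (y_ 0 - a) < d by move: yd d0; clra.
have E0 : y_ 0 + s *: v - y_ 0 = s *: v by rewrite addrAC subrr add0r.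
have := Glin _ _ h4 h5; rewrite E0.
have E : 'd F a (s *: v) = s.
 have h : 'd F a (s *: v) = s *: 'd F a v by exact: linearZ.
 by apply: (etrans h); apply: (etrans (congr1 (fun z => s *: z) Fv)); exact: mulr1.
move=> h6; have h7 : @nm R C (G (y_ 0 + s *: v) - G (y_ 0) - s) <= (2 * c)^-1 * nm (s *: v).
 by apply: (eq_ind _ (fun z => @nm R C (G (y_ 0 + s *: v) - G (y_ 0) - z) <= _) h6); exact: E.
apply: (le_trans h7); rewrite nmZ; have : (2 * c)^-1 * (nm s * nm v) <= (2 * c)^-1 * (nm s * c).
 by rewrite ler_pM2l // ler_wpM2l.
move/le_trans; apply; rewrite le_eqVlt; apply/orP; left; apply/eqP; field.
by rewrite gt_eqF.
Qed.

End Intersection.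

Section Multiplicity.
Variable R : realType. Local Notation C := (cplx R).

(** Sheet number one: over every small c the fibre of (x, y) to x - y consists of the single point
    (y_ c + c, y_ c). Continuity of [y_] gives properness, and the critical set is taken empty. *)
Lemma inter_mult1 m (B T : set 'rV[C]_m) (b : 'rV[C]_m) (y_ : 'rV[C]_m -> 'rV[C]_m) (eps eta : R) :
 0 < eps -> 0 < eta -> y_ 0 = b -> (forall c, nm c < eps -> {for c, continuous y_}) ->
 (forall c, nm c < eps -> [/\ nm (y_ c - b) < eta, T (y_ c), B (y_ c + c) &
   forall y, nm (y - b) < eta -> T y -> B (y + c) -> y = y_ c]) ->
 inter_mult B T b 1.
Proof.
move=> eps0 eta0 y0 cy hy.
pose N := [set z : 'rV[C]_m * 'rV[C]_m | nm (z.2 - b) < eta /\ nm (z.1 - z.2) < eps].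
pose N' := [set c : 'rV[C]_m | nm c < eps].
have N'E : N' = [set c | nm (c - 0) < eps] by apply/seteqP; split=> c; rewrite /N' /= subr0.
have cfst : continuous (fun z : 'rV[C]_m * 'rV[C]_m => z.1) by move=> z; exact: cvg_fst.
have csnd : continuous (fun z : 'rV[C]_m * 'rV[C]_m => z.2) by move=> z; exact: cvg_snd.
have bb (e : R) : 0 < e -> nm (b - b) < e by rewrite subrr nm0.
have N0 : nm (0 : 'rV[C]_m) < eps by rewrite nm0.
have E1 z : [/\ B z.1, T z.2 & N z] -> z = (y_ (z.1 - z.2) + (z.1 - z.2), y_ (z.1 - z.2)).
 case: z => z1 z2 /= [Bz Tz [zb zc]]; have [_ _ _ uq] := hy _ zc.
 by rewrite -(uq z2 zb Tz); rewrite subrKC.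
have E2 c : N' c -> [/\ B (y_ c + c), T (y_ c) & N (y_ c + c, y_ c)].
 move=> Nc; have [h1 h2 h3 _] := hy c Nc; split=> //; split=> //=.
 by rewrite addrAC subrr add0r.
exists N, N', set0; split.
- split.
 + rewrite (_ : N = ((fun z : 'rV[C]_m * 'rV[C]_m => z.2) @^-1` [set y | nm (y - b) < eta]) `&`
   ((fun z : 'rV[C]_m * 'rV[C]_m => z.1 - z.2) @^-1` [set c | nm (c - 0) < eps])); last first.
   by apply/seteqP; split=> z; rewrite /N /= subr0.
  apply: openI; apply: open_comp; try exact: open_rball.
   by move=> z _; exact: csnd.
  by move=> z _; apply: cvgB; [exact: cfst|exact: csnd].
 + by split=> /=; rewrite subrr nm0.
 + by rewrite N'E; exact: open_rball.
 + exact: N0.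
- have [_ T0 B0] := E2 0 N0.
 split.
 + by have := E2 0 N0; rewrite y0 addr0.
 + by move=> z /E1 zE z12; rewrite zE z12 y0 addr0.
 + by move=> z [_ _ [_ h]].
 + move=> K cK KN.
  rewrite (_ : [set z | _] = (fun c => (y_ c + c, y_ c)) @` K); last first.
   apply/seteqP; split=> [z [Ez Kz]|z [c Kc <-]]; first by exists (z.1 - z.2); [exact: Kz|exact: esym (E1 z Ez)].
   by split; [exact/E2/KN|rewrite /= addrAC subrr add0r].
  apply: continuous_compact cK; apply: continuous_in_subspaceT => c /set_mem Kc.
  have cc := cy c (KN c Kc).
  have c1 : {for c, continuous (fun c' => y_ c' + c')}.
   apply/continuous_rP => e e0; have e20 : 0 < e / 2 by rewrite divr_gt0.
   have [d d0 dP] := (continuous_rP _ _).1 cc _ e20.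
   exists (min d (e / 2)) => [|c']; first by rewrite lt_min d0.
   rewrite lt_min => /andP[/dP h1 h2]; have := nmD (y_ c' - y_ c) (c' - c).
   by rewrite opprD addrACA; move: h1 h2; move: (nm _) (nm _) (nm _) => p q r; clra.
  move=> Bs /= nB; apply: (@cvg_pair _ _ _ (nbhs c) (nbhs (y_ c + c)) (nbhs (y_ c)) _ _ _ _ _ _ _ Bs nB); [exact: c1|exact: cc].
- split; last by rewrite interior0.
 split=> [x []|a N'a]; exists N', 1%N, (fun=> const_mx 1); split=> //.
 + by rewrite N'E; exact: open_rball.
 + rewrite set0I; apply/seteqP; split=> x; first by [].
  by move=> [_ /matrixP/(_ 0 0)/eqP]; rewrite !mxE oner_eq0.
- move=> c Nc _.
 rewrite (_ : [set z | _] = [set (y_ c + c, y_ c)]); first exact: card_set1.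
 apply/seteqP; split=> [z [/E1 zE zc]|z ->]; first by rewrite zE zc.
 by split; [exact: E2|rewrite /= addrAC subrr add0r].
Qed.

End Multiplicity.

(** * Convergence of hypersurfaces as chains *)

Section ChainConvergence.
Variable R : realType. Local Notation C := (cplx R).
Variable n : nat.
Local Notation X := 'rV[C]_n.+1.

Opaque smooth.

Lemma smoothI (Om : set X) (F : X -> C) x v : Om x -> F x = 0 -> 'd F x v != 0 -> smooth Om F x.
Proof. by move=> h1 h2 h3; split; [exact: h1|exact: h2|exists v; exact: h3]. Qed.

Lemma smooth_dir (Om : set X) (F : X -> C) x : smooth Om F x -> exists v, 'd F x v != 0.
Proof. by move=> []. Qed.

(** On a complex line through [a] on which [F] is not identically zero, [F] has a positive minimum
    mm on a shell around [a]. If a close F_nu had no zero in the ball, the minimum principle would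
    give |F_nu(a)| at least mm / 4, while F_nu(a) tends to 0. *)
Lemma hurwitz (Om : set X) (F : X -> C) (F_ : nat -> X -> C) (a : X) (r : R) : good Om F -> zeros Om F a -> 0 < r ->
 (forall x, nm (x - a) < r -> Om x) -> (forall nu x, Om x -> hol (F_ nu) x) ->
 (forall e : R, 0 < e -> exists N, forall nu, (N <= nu)%N -> forall x, nm (x - a) < r -> nm (F_ nu x - F x) < e) ->
 exists N, forall nu, (N <= nu)%N -> exists2 y, zeros Om (F_ nu) y & nm (y - a) < r.
Proof.
move=> gF [Oa Fa] r0 rO dF_ cv.
have r640 : 0 < r / 64 by rewrite divr_gt0.
have [y ya Fy] := good_empty gF Oa r640.
have v0 : 0 < nm (y - a).
 by rewrite nm_gt0 subr_eq0; apply: contra_neq Fy => ->.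
have rr0 : 0 < r / nm (y - a) by rewrite divr_gt0.
have line (s : C) : nm s < r / nm (y - a) -> nm (a + s *: (y - a) - a) < r.
 by rewrite ltr_pdivlMr // [a + _ - _]addrAC subrr add0r nmZ.
have dl G s : (forall x, Om x -> hol G x) -> nm s < r / nm (y - a) -> hol (fun s : C => G (a + s *: (y - a))) s.
 by move=> dG /line/rO/dG/diff_line[].
have [|h|[d d0 dP]] := @isolated_zero R (fun s : C => F (a + s *: (y - a))) 0 _ rr0.
- by move=> s; rewrite subr0; apply: dl; exact: good_holo.
- exfalso; move/eqP: Fy; apply; have := h 1; rewrite scale1r subrKC subr0 nm1; apply.
 rewrite ltr_pdivlMr // mul1r ltr_pdivlMr //; move: ya r0; clra.
pose t := min d (r / nm (y - a)) / 4.
have m0 : 0 < min d (r / nm (y - a)) by rewrite lt_min d0.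
have t0 : 0 < t by rewrite divr_gt0.
have t4 : 4 * t <= d /\ 4 * t <= r / nm (y - a).
 by rewrite /t mulrC divfK //; split; rewrite ge_min lexx ?orbT.
have [td tr] := t4.
pose Kc := [set z : C | nm z <= 2 * t] `&` ~` [set z : C | nm (z - 0) < t].
have cK : compact Kc by apply: compact_closedI; [exact: ball_compact_cplx|exact/open_closedC/open_rball].
have K4 (s : C) : nm s <= 2 * t -> nm s < r / nm (y - a) /\ nm s < d.
 by move: td tr t0; move: (nm s) (r / _) => p q; clra.
have [||mm mm0 mP] := @compact_lower R C C Kc (fun s : C => F (a + s *: (y - a))) cK.
- by move=> s [/= /K4[s4 _] _]; apply: diff_cont; apply: dl s4; exact: good_holo.
- move=> s [/= /K4[_ sd] k]; apply: dP; first by rewrite subr0.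
 by apply/eqP => sE; apply: k; rewrite sE subrr nm0.
have mm4 : 0 < mm / 4 by rewrite divr_gt0.
have [N NP] := cv _ mm4; exists N => nu nuN; apply: contrapT => nz.
pose g (s : C) := F_ nu (a + s *: (y - a)).
have sq2 (s : C) : sq 0 t s -> nm s <= 2 * t by move=> /sq_norm; rewrite subr0.
have gn0 s : sq 0 t s -> g s != 0.
 move=> /sq2/K4[s4 _]; apply/eqP => gs; apply: nz; exists (a + s *: (y - a)); last exact: line.
 by split; [exact/rO/line|exact: gs].
have gside s : side 0 t s -> mm / 2 <= nm (g s).
 move=> [sqs st]; have [s4 _] := K4 s (sq2 s sqs).
 have Ks : Kc s by split; [exact: sq2|move=> /= k; move: st k; rewrite subr0; clra].
 have := mP s Ks; have := NP nu nuN _ (line s s4); have := nm_sub (F (a + s *: (y - a))) (g s).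
 by rewrite [nm (_ - g s)]nmC /g; move: (nm _) (nm _) (nm _) mm0 => p q u; clra.
have : mm / 2 <= 2 * nm (g 0).
 apply: (min_principle t0 _ _ gn0 gside); first by rewrite divr_gt0.
 by move=> s /sq2/K4[s4 _]; apply: dl s4; exact: dF_.
have aa : nm (a - a) < r by rewrite subrr nm0.
have := NP nu nuN a aa; rewrite Fa subr0 /g scale0r addr0.
by move: (nm _) => p; clra.
Qed.

Lemma zeros_deg1 (Om : set X) (G : X -> C) (T : set X) b : good Om G -> smooth Om G b ->
 zeros Om G `&` T = [set b] -> inter_mult (branch Om G b) T b 1 -> inter_deg (set_chain Om (zeros Om G)) T 1.
Proof.
move=> gG Sb ZT mb; have ZTb z : zeros Om G z -> T z -> z = b by move=> h1 h2; have : [set b] z by rewrite -ZT.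
split; rewrite chain_suppE // ZT; first exact: finite_set1.
exists (fun _ _ => 1%N); split.
 move=> B z cB Bz Tz; have [x Sx BE] := (comp_branch gG B).1 cB.
 have zb : z = b by apply: ZTb => //; apply: (branch_sub gG (x := x)); rewrite -BE.
 by rewrite zb in Bz *; rewrite (_ : B = branch Om G b) // BE; rewrite BE in Bz; exact: esym (branch_smooth gG Sb Sx Bz).
rewrite fsbig_set1 (comps_smooth gG Sb) fsbig_set1 muln1 set_chain1 //.
by apply/(comp_branch gG); exists b.
Qed.

Lemma tangent_zeros (Om : set X) (F : X -> C) a u : good Om F -> tangent (zeros Om F) a u -> 'd F a u = 0.
Proof.
move=> gF [p [W [h [[Aa _ _] [oW Wa dh AW surj] hu]]]]; have [Oa Fa] := Aa.
have /open_rP/(_ a Wa)[r r0 rW] := oW.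
have ha : h a = 0 by move/seteqP: AW => [k _]; have [_ kk] := k a (conj Aa Wa).
have [dc cE] := diff_const_mx 1 (good_holo gF Oa).
have : 'd (fun x => const_mx (F x) : 'rV[C]_1) a u = 0.
 apply: (tangent_kernel r0 _ ha (surj a Aa Wa) dc _ hu); first by move=> x /rW/dh.
 move=> x /rW Wx hx; apply/const_mx_eq0; move/seteqP: AW => [_ k].
 by have [[_ Fx] _] := k x (conj Wx hx).
by move=> k; apply/const_mx_eq0; apply: etrans k; exact: esym (cE u).
Qed.

(** [tangent] refers to some local equation; by [tangent_kernel] the kernel of its differential does
    not depend on which one. *)
Lemma tangent_sub p (T : set X) a u (W : set X) (h : X -> 'rV[C]_(n.+1 - p)) : T a ->
 local_equation T a W h -> tangent T a u -> 'd h a u = 0.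
Proof.
move=> Ta [oW Wa dh TW surj] [p' [W' [h' [_ [oW' Wa' dh' TW' surj'] hu]]]].
have /open_rP/(_ a Wa)[r r0 rW] := oW; have /open_rP/(_ a Wa')[r' r'0 rW'] := oW'.
have m0 : 0 < min r r' by rewrite lt_min r0.
have ha : h' a = 0 by move/seteqP: TW' => [k _]; have [_ kk] := k a (conj Ta Wa').
apply: (tangent_kernel m0 _ ha (surj' a Ta Wa') (dh a Wa) _ hu) => x; rewrite lt_min => /andP[/rW Wx /rW' Wx'].
 exact: dh'.
move=> hx; move/seteqP: TW' => [_ k']; have [Tx _] := k' x (conj Wx' hx).
by move/seteqP: TW => [k _]; have [_ kk] := k x (conj Tx Wx).
Qed.

(** One point that is good at every scale up to K at which the set has a point at all. It allows a
    sequence to be chosen for all indices without knowing in advance how close the sets come. *)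
Lemma approx_choice (A : set X) (a : X) : A !=set0 -> forall K, exists2 y, A y &
 forall k, (k <= K)%N -> (exists2 y', A y' & nm (y' - a) < k.+1%:R^-1) -> nm (y - a) < k.+1%:R^-1.
Proof.
move=> [y0 Ay0]; elim=> [|K [y Ay hy]].
 have [[y Ay ya]|ne] := pselect (exists2 y', A y' & nm (y' - a) < 1%:R^-1).
  by exists y => // k; rewrite leqn0 => /eqP ->.
 by exists y0 => // k; rewrite leqn0 => /eqP -> /ne.
have [[z Az za]|ne] := pselect (exists2 y', A y' & nm (y' - a) < K.+2%:R^-1).
 exists z => // k kK _; apply: (lt_le_trans za).
 by rewrite lef_pV2 ?posrE ?ltr0n // ler_nat.
by exists y => // k; rewrite leq_eqVlt => /orP[/eqP -> /ne //|]; rewrite ltnS; exact: hy.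
Qed.

Variables (Om : set X) (F : X -> C) (F_ : nat -> X -> C).
Hypothesis gF : good Om F.
Hypothesis gF_ : forall nu, good Om (F_ nu).
Hypothesis cvF : forall a, Om a -> exists2 r : R, 0 < r & forall e : R, 0 < e ->
 exists N, forall nu, (N <= nu)%N -> forall x, nm (x - a) < r -> nm (F_ nu x - F x) < e.
(** [sets_cvg] asks for a point in every set of the sequence, not just eventually. *)
Hypothesis neF : zeros Om F !=set0 -> forall nu, zeros Om (F_ nu) !=set0.

Lemma zeros_sets_cvg : sets_cvg Om (fun nu => zeros Om (F_ nu)) (zeros Om F).
Proof.
split=> [a Aa|K cK KO KA].
 have Oa : Om a by case: Aa.
 have ne nu := neF (ex_intro _ a Aa) nu.
 have [y yP] := choice (fun nu => (let: ex_intro2 z h1 h2 := approx_choice a (ne nu) nu in ex_intro _ z (conj h1 h2))).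
 exists y => [nu|]; first by have [] := yP nu.
 apply/cvg_rP => e e0; have [k kP] := arch_inv e0.
 have [r1 r10 r1P] := cvF Oa; have /open_rP/(_ a Oa)[r2 r20 r2P] := good_open gF.
 pose r := min (min r1 r2) k.+1%:R^-1.
 have r0 : 0 < r by rewrite !lt_min r10 r20 invr_gt0 ltr0n.
 have [|nu x Ox|e' e'0|N NP] := @hurwitz Om F F_ a r gF Aa r0.
 - by move=> x; rewrite !lt_min => /andP[/andP[_ /r2P]].
 - exact: (good_holo (gF_ nu)).
 - by have [N NP] := r1P e' e'0; exists N => nu /NP h x; rewrite !lt_min => /andP[/andP[/h]].
 exists (maxn N k) => nu; rewrite geq_max => /andP[nuN nuk]; have [_ h] := yP nu.
 apply: lt_trans (kP k (leqnn k)); apply: (h k nuk); have [z Az za] := NP nu nuN.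
 by exists z; [exact: Az|apply: (lt_le_trans za); rewrite ge_min lexx orbT].
apply/near_oo_rP.
have [x Kx|N NP] := @compact_eventually R X K (fun nu y => F_ nu y != 0) cK.
 have Ox := KO x Kx.
 have Fx : 0 < nm (F x).
  by rewrite nm_gt0; apply/eqP => Fx; have : (K `&` zeros Om F) x by []; rewrite KA.
 have Fx2 : 0 < nm (F x) / 2 by rewrite divr_gt0.
 have /continuous_rP/(_ _ Fx2)[d d0 dP] := diff_cont (good_holo gF Ox).
 have [r r0 rP] := cvF Ox; have [N NP] := rP _ Fx2.
 exists (min d r); first by rewrite lt_min d0.
 exists N => nu /NP h y; rewrite lt_min => /andP[/dP h1 /h h2].
 apply/eqP => Fy; move: h2; rewrite Fy sub0r nmN; move: h1.
 have := nm_sub (F x) (F y); rewrite [nm (_ - F y)]nmC.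
 by move: (nm _) (nm _) (nm _) => p q u; clear -gF; lra.
exists N => nu /NP h; apply/seteqP; split=> // y [Ky [_ Fy]].
by have := h y Ky; rewrite Fy eqxx.
Qed.

(** All degrees are 1. The local argument finds one intersection point near [a] for every close [G];
    compactness of the closure of T keeps the others away. *)
Lemma zeros_chain_cvg : sets_chain_cvg Om n (fun nu => zeros Om (F_ nu)) (zeros Om F).
Proof.
have sc := zeros_sets_cvg.
split; [by move=> nu; exact: zeros_pure_analytic|exact: zeros_pure_analytic|].
have sE (G : X -> C) : good Om G -> chain_supp (set_chain Om (zeros Om G)) = zeros Om G by exact: chain_suppE.
split; [by move=> nu; exact: zeros_positive_chain|exact: zeros_positive_chain| |].
 rewrite sE //; have -> // : (fun nu => chain_supp (set_chain Om (zeros Om (F_ nu)))) = (fun nu => zeros Om (F_ nu)).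
 by apply/funext => nu; exact: sE.
move=> a T; rewrite sE // => reg [TO subT] Ta tr [cT cTO] AT.
have Sa := regular_smooth gF reg; have Aa := smooth_zeros Sa; have Oa : Om a by case: Aa.
have [_ _ [W [h le]]] := subT a Ta; have [oW Wa dh TW surj] := le.
have Th x : W x -> T x -> h x = 0 by move=> Wx Tx; move/seteqP: TW => [k _]; have [_ kk] := k x (conj Tx Wx).
have hT x : W x -> h x = 0 -> T x by move=> Wx hx; move/seteqP: TW => [_ k]; have [kk _] := k x (conj Wx hx).
have [v Fv] := smooth_dir Sa.
have [u [w [tu tw vE]]] := tr v.
have Fw : 'd F a w != 0.
 apply: contra Fv => /eqP k; apply/eqP; have k' := tangent_zeros gF tu.
 have l : 'd F a v = 'd F a u + 'd F a w by rewrite vE; exact: linearD.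
 by apply: (etrans l); apply: (etrans (f_equal2 (fun s t => s + t) k' k)); exact: addr0.
have hw := tangent_sub Ta le tw.
have [r1 r10 r1P] := cvF Oa; have /open_rP/(_ a Oa)[r2 r20 r2P] := good_open gF; have /open_rP/(_ a Wa)[r3 r30 r3P] := oW.
have [r [r0 rcv rO rW]] : exists r : R, [/\ 0 < r, r <= r1, forall x, nm (x - a) < r -> Om x & forall x, nm (x - a) < r -> W x].
 exists (min r1 (min r2 r3)); split.
 - by rewrite !lt_min r10 r20.
 - by rewrite ge_min lexx.
 - by move=> x; rewrite !lt_min => /and3P[_ /r2P].
 - by move=> x; rewrite !lt_min => /and3P[_ _ /r3P].
have kn : (1 + (n.+1 - (n.+1 - n)))%N = n.+1 by rewrite subSnn subn1.
have [rho rho0 rhoP] := isolated_intersection kn r0 (fun x xr => good_holo gF (rO x xr)) (fun x xr => dh x (rW x xr)) Aa.2 (Th a Wa Ta) Fw hw (surj a Ta Wa).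
have [sg [sg0 sgrho sgr]] : exists sg : R, [/\ 0 < sg, sg <= rho & sg <= r].
 by exists (min rho r); rewrite lt_min rho0 !ge_min !lexx orbT.
have [delta [eps [delta0 eps0 key]]] := rhoP sg sg0.
(* Covers the limit and the members of the sequence at once: [G] is uniformly close to [F] near [a],
   and its zeros on T lie in the small ball. *)
have main (G : X -> C) : good Om G -> (forall x, nm (x - a) < r -> nm (G x - F x) <= delta) ->
  (forall x, zeros Om G x -> T x -> nm (x - a) < sg) -> inter_deg (set_chain Om (zeros Om G)) T 1.
 move=> gG Gd ZT.
 have [y_ [yP yc [v1 v1P]]] := key G (fun x xr => conj (good_holo gG (rO x xr)) (Gd x xr)).
 have n0 : nm (0 : X) < eps by rewrite nm0.
 have [b1 b2 b3 b4] := yP 0 n0; set b := y_ 0 in b1 b2 b3 b4 v1P; rewrite addr0 in b3.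
 have br := lt_le_trans b1 sgr; have Ob := rO b br.
 have Sb : smooth Om G b := smoothI Ob b3 v1P.
 have Tb : T b := hT b (rW b br) b2.
 apply: (zeros_deg1 gG Sb).
  apply/seteqP; split=> [x [[Ox Gx] Tx]|x ->]; last by split; [split; [exact: Ob|exact: b3]|exact: Tb].
  have xs := ZT x (conj Ox Gx) Tx; have xr := lt_le_trans xs sgr.
  by apply: b4; [exact: lt_le_trans sgrho|exact: (Th x (rW x xr) Tx)|rewrite addr0].
 have [e1 e10 e1P] := branch_near gG Sb Sb (branch_self Sb).
 have /open_rP/(_ b Ob)[e2 e20 e2P] := good_open gF.
 have [e [e0 ee1 ee2 es]] : exists e : R, [/\ 0 < e, e + e <= e1, e + e <= e2 & e <= sg - nm (b - a)].
  exists (min (min (e1 / 2) (e2 / 2)) (sg - nm (b - a))).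
  have : min (min (e1 / 2) (e2 / 2)) (sg - nm (b - a)) <= e1 / 2 by rewrite !ge_min lexx.
  have : min (min (e1 / 2) (e2 / 2)) (sg - nm (b - a)) <= e2 / 2 by rewrite !ge_min lexx orbT.
  have : 0 < min (min (e1 / 2) (e2 / 2)) (sg - nm (b - a)) by rewrite !lt_min !divr_gt0 ?subr_gt0.
  have : min (min (e1 / 2) (e2 / 2)) (sg - nm (b - a)) <= (sg - nm (b - a)) by rewrite !ge_min lexx orbT.
  by move: (min _ _) => z h1 h2 h3 h4; split=> //; move: h3 h4; clear -gF; lra.
 have /continuous_rP/(_ e e0)[d d0 dP] := yc 0 n0.
 have eps'0 : 0 < min eps (min e d) by rewrite !lt_min eps0 e0.
 apply: (@inter_mult1 R n.+1 _ T b y_ (min eps (min e d)) e eps'0 e0 erefl).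
  by move=> c; rewrite lt_min => /andP[/yc].
 move=> c; rewrite !lt_min => /and3P[ceps ce cd].
 have [c1 c2 c3 c4] := yP c ceps.
 have cb : nm (y_ c - b) < e by apply: dP; rewrite subr0.
 have ybc : nm (y_ c + c - b) < e + e by rewrite addrAC; apply: le_lt_trans (nmD _ _) _; exact: ltrD.
 have Oyc : Om (y_ c + c) by apply: e2P; exact: lt_le_trans ee2.
 split.
 - exact: cb.
 - by apply: hT c2; apply: rW; exact: lt_le_trans sgr.
 - by apply/e1P; [exact: lt_le_trans ee1|split].
 - move=> y yb Ty /(branch_sub gG)[_ Gy].
  have ya : nm (y - a) < sg by have := nm_tri b y a; move: yb es; clear -gF; lra.
  apply: c4 => //; first exact: lt_le_trans sgrho.
  by apply: Th => //; apply: rW; exact: lt_le_trans sgr.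
exists 1%N.
 apply: main => // [x _|x Ax Tx]; first by rewrite subrr nm0 ltW.
 have : [set a] x by rewrite -AT; split; [exact: Ax|exact: subset_closure].
 by move=> ->; rewrite subrr nm0.
have [N1 N1P] := r1P delta delta0.
(* Outside the ball of radius [sg] the closure of T is compact and misses the zeros of [F], hence by
   [zeros_sets_cvg] also those of F_nu for large nu. *)
pose K := closure T `&` ~` [set x | nm (x - a) < sg].
have cK : compact K by apply: compact_closedI => //; exact/open_closedC/open_rball.
have KO : K `<=` Om by move=> x [/cTO].
have KA : K `&` zeros Om F = set0.
 apply/seteqP; split=> // x [[clx nx] Ax]; apply: nx.
 have : [set a] x by rewrite -AT.
 by move=> ->; rewrite /= subrr nm0.
have /near_oo_rP[N2 N2P] := sc.2 K cK KO KA.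
apply/near_oo_rP; exists (maxn N1 N2) => nu; rewrite geq_max => /andP[nu1 nu2].
apply: main => // [x xr|x Ax Tx].
 by apply/ltW/(N1P nu nu1); exact: lt_le_trans rcv.
apply: contrapT => nx; have : (K `&` zeros Om (F_ nu)) x.
 by split; [split; [exact: subset_closure|exact: nx]|exact: Ax].
by rewrite (N2P nu nu2).
Qed.

End ChainConvergence.

(** * Algebraic dependence and Nash functions *)

Section PolynomialFunctions.
Variable R : realType. Local Notation C := (cplx R).

Lemma evalmpE n (p : mpoly n C) (x : 'rV[C]_n) :
 evalmp p x = \sum_(m <- msupp p) mcoeff m p * \prod_i x 0 i ^+ m i.
Proof. exact: mevalE. Qed.

Lemma diff_prods (V : nmod C) (I : eqType) (s : seq I) (f : I -> V -> C) x :
 (forall i, hol (f i) x) -> hol (fun y => \prod_(i <- s) f i y) x.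
Proof. by move=> h; apply: diff_prodf. Qed.

Lemma diff_evalmp n (p : mpoly n C) (x : 'rV[C]_n) : hol (evalmp p) x.
Proof.
rewrite (_ : evalmp p = fun x => \sum_(m <- msupp p) mcoeff m p * \prod_i x 0 i ^+ m i); last first.
 by apply/funext => y; exact: evalmpE.
apply: diff_sumf => m; apply: holM; first exact: hol_cst.
apply: diff_prods => i; apply: diff_pow.
exact: differentiable_coord.
Qed.

Lemma digits_inj (K n : nat) (f g : nat -> nat) : (forall i, f i < K)%N -> (forall i, g i < K)%N ->
 (\sum_(i < n) f i * K ^ i = \sum_(i < n) g i * K ^ i)%N -> forall i, (i < n)%N -> f i = g i.
Proof.
elim: n f g => [//|n IH] f g fK gK; rewrite !big_ord_recl /= !expn0 !muln1 => E.
have S (h : nat -> nat) : (\sum_(i < n) h (bump 0 i) * K ^ bump 0 i = K * \sum_(i < n) h i.+1 * K ^ i)%N.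
 by rewrite big_distrr /=; apply: eq_bigr => i _; rewrite /bump /= add1n expnS mulnCA.
rewrite !S in E.
have E0 : f 0%N = g 0%N.
 have := congr1 (modn^~ K) E; rewrite /= ![(K * _)%N]mulnC ![(f _ + _)%N]addnC ![(g _ + _)%N]addnC !modnMDl.
 by rewrite !modn_small.
case=> [//|i] iN; apply: (IH (fun i => f i.+1) (fun i => g i.+1)) => //.
have K0 : (0 < K)%N by apply: leq_ltn_trans (fK 0%N).
by move: E; rewrite E0 => /addnI/eqP; rewrite eqn_pmul2l // => /eqP.
Qed.

Lemma poly_nonroot (q : {poly C}) : q != 0 -> exists z, q.[z] != 0.
Proof.
move=> q0; apply: contrapT => h.
have := @max_poly_roots C q [seq i%:R | i <- iota 0 (size q)] q0; rewrite size_map size_iota ltnn.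
have -> : all (root q) [seq i%:R | i <- iota 0 (size q)].
 apply/allP => z _; rewrite rootE; apply/negPn/negP => qz; apply: h; exists z; exact: qz.
rewrite map_inj_uniq ?iota_uniq => [/(_ isT isT)//|a b /eqP].
by rewrite eqr_nat => /eqP.
Qed.

(* Kronecker's substitution x_i := z ^ (K ^ i) with K larger than all the exponents *)
Lemma evalmp_neq0 n (p : mpoly n C) : p != 0 -> exists x, evalmp p x != 0.
Proof.
move=> p0; pose K := mmeasure mdeg p.
pose kap (m : multinom n) := (\sum_(i < n) m i * K ^ i)%N.
have mK m i : m \in msupp p -> (m i < K)%N.
 by move=> /msize_mdeg_lt; apply: leq_ltn_trans; rewrite mdegE (bigD1 i) //= leq_addr.
have kinj m m' : m \in msupp p -> m' \in msupp p -> kap m = kap m' -> m = m'.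
 move=> ms ms' E; apply/mnmP => i.
 pose ex (u : multinom n) (j : nat) := if insub j is Some k then u (k : 'I_n) else 0%N.
 have exE u (k : 'I_n) : ex u k = u k by rewrite /ex valK.
 have K0 : (0 < K)%N by apply: leq_ltn_trans (mK m i ms).
 have exK u j : u \in msupp p -> (ex u j < K)%N by move=> us; rewrite /ex; case: insubP => // k _ _; exact: mK.
 rewrite -!exE; apply: (@digits_inj K n) => // [j|j|]; try exact: exK.
 have kE u : (\sum_(k < n) ex u k * K ^ k)%N = kap u by apply: eq_bigr => k _; rewrite exE.
 by rewrite !kE.
pose q : {poly C} := \sum_(m <- msupp p) mcoeff m p *: 'X^(kap m).
have [m0 m0s] : exists m0, m0 \in msupp p.
 by case E: (msupp p) => [|m0 s]; [rewrite -msupp_eq0 E in p0|exists m0; exact: mem_head].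
have q0 : q != 0.
 apply/eqP => qE; have := congr1 (fun q : {poly C} => q`_(kap m0)) qE; rewrite coef0 coef_sum.
 rewrite (bigD1_seq m0) //= coefZ coefXn eqxx mulr1 big1_seq ?addr0 => [|m /andP[mm0 ms]].
  by move/eqP; rewrite mcoeff_eq0 m0s.
 rewrite coefZ coefXn; case: eqP => [E|]; last by rewrite mulr0.
 by move: mm0; rewrite (kinj m m0) ?eqxx.
have [z qz] := poly_nonroot q0; exists (\row_i z ^+ (K ^ i)).
rewrite evalmpE; apply: contra qz => /eqP E; rewrite horner_sum; apply/eqP; rewrite -[RHS]E.
apply: eq_bigr => m _; rewrite hornerZ hornerXn /kap -prodrXr; congr (_ * _).
by apply: eq_bigr => i _; rewrite mxE -exprM mulnC.
Qed.

Lemma evalmp_dense n (p : mpoly n C) (a : 'rV[C]_n) (e : R) : p != 0 -> 0 < e ->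
 exists2 x, nm (x - a) < e & evalmp p x != 0.
Proof.
move=> /evalmp_neq0[z pz] e0; apply: contrapT => ne; move/eqP: pz; apply.
apply: (@identity_connected R _ (evalmp p) setT a) => //.
- exact: openT.
- by apply: convex_connected.
- by move=> x _; exact: diff_evalmp.
- by exists e => // x xe; apply/eqP/negPn/negP => px; apply: ne; exists x.
Qed.

Lemma evalmpM n (p q : mpoly n C) x : evalmp (p * q) x = evalmp p x * evalmp q x.
Proof. exact: rmorphM. Qed.
Lemma evalmp1 n x : evalmp (1 : mpoly n C) x = 1.
Proof. exact: rmorph1. Qed.
Lemma evalmpC n (c : C) x : evalmp (mpolyC n c) x = c.
Proof. exact: mevalC. Qed.
Lemma evalmp_sum n (I : finType) (p : I -> mpoly n C) x : evalmp (\sum_i p i) x = \sum_i evalmp (p i) x.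
Proof. exact: rmorph_sum. Qed.

(** An algebraic equation of [f] over the polynomials, solved for its highest power up to the
    leading coefficient [lc]; this is the form in which it lowers exponents. *)
Definition algrel n (W : set 'rV[C]_n) (f : 'rV[C]_n -> C) d (lc : mpoly n C) (co : 'I_d -> mpoly n C) :=
 lc != 0 /\ forall x, W x -> evalmp lc x * f x ^+ d = \sum_k evalmp (co k) x * f x ^+ k.

Lemma nash_algrel n (W : set 'rV[C]_n) (f : 'rV[C]_n -> C) (P : mpoly (n + 1) C) : P != 0 ->
 (forall x, W x -> evalmp P (row_mx x (const_mx (f x))) = 0) -> exists d lc co, @algrel n W f d lc co.
Proof.
move=> P0 hP.
pose h (i : 'I_(n + 1)) : {poly (mpoly n C)} := match fintype.split i with inl j => (mpolyX C (mnm1 j))%:P | inr _ => 'X end.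
pose q := mmap (fun c : C => (mpolyC n c)%:P) h P.
have qE (x : 'rV[C]_n) (t : C) : (map_poly (meval (x 0)) q).[t] = evalmp P (row_mx x (const_mx t)).
 rewrite evalmpE /q /mmap rmorph_sum horner_sum; apply: eq_bigr => m _.
 rewrite rmorphM hornerM /= map_polyC hornerC /= mevalC; congr (_ * _).
 rewrite /mmap1 rmorph_prod horner_prod; apply: eq_bigr => i _.
 rewrite rmorphXn horner_exp; congr (_ ^+ _); rewrite /h.
 have := splitK i; case: (fintype.split i) => j /= <-.
  by rewrite map_polyC hornerC /= mevalXU row_mxEl.
 by rewrite map_polyX hornerX row_mxEr mxE.
have q0 : q != 0.
 have [y Py] := evalmp_neq0 P0; apply: contra Py => /eqP qz; have := qE (lsubmx y) (rsubmx y 0 0).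
 rewrite qz rmorph0 horner0 (_ : const_mx (rsubmx y 0 0) = rsubmx y) ?hsubmxK => [<-//|].
 by apply/matrixP => i j; rewrite mxE (ord1 i) (ord1 j).
exists (size q).-1, (lead_coef q), (fun k => - q`_k); split; first by rewrite lead_coef_eq0.
move=> x Wx; have := qE x (f x); rewrite hP // horner_poly.
rewrite -(prednK (_ : 0 < size q)%N) ?lt0n ?size_poly_eq0 // big_ord_recr /= addrC => /eqP.
rewrite addr_eq0 => /eqP ->; rewrite -sumrN; apply: eq_bigr => k _.
by rewrite /evalmp rmorphN mulNr.
Qed.

Lemma algrel_pad n (W : set 'rV[C]_n) (f : 'rV[C]_n -> C) d lc co e : @algrel n W f d lc co ->
 exists co', @algrel n W f (d + e) lc co'.
Proof.
elim: e d co => [|e IH] d co h; first by rewrite addn0; exists co.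
rewrite addnS -addSn; apply: (IH _ (fun k : 'I_d.+1 => if unlift ord0 k is Some j then co j else 0)).
have [lc0 hE] := h; split=> // x Wx; rewrite exprSr mulrA hE // big_ord_recl unlift_none /evalmp rmorph0 mul0r add0r.
by rewrite mulr_suml; apply: eq_bigr => k _; rewrite liftK exprSr mulrA.
Qed.

End PolynomialFunctions.

(** * Counting monomials *)

Section Counting.
Variable R : realType. Local Notation C := (cplx R).
Variables (n r d : nat) (W : set 'rV[C]_n) (f : 'I_r -> 'rV[C]_n -> C).
Variables (lc : 'I_r -> mpoly n C) (co : 'I_r -> 'I_d -> mpoly n C).
Hypothesis d0 : (0 < d)%N.
Hypothesis alg : forall j, algrel W (f j) (lc j) (co j).
Local Notation X := 'rV[C]_n.

Definition monof (m : 'I_n -> nat) (b : 'I_r -> nat) (x : X) : C := \prod_i x 0 i ^+ m i * \prod_j f j x ^+ b j.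

Local Notation idx N := ({ffun 'I_n -> 'I_N} * {ffun 'I_r -> 'I_d})%type.

(** The span on [W] of the monomials with exponents below [N] in the coordinates and below [d] in
    the algebraic functions; its dimension is at most N^n d^r. *)
Definition Sp N (u : X -> C) := exists a : idx N -> C, forall x, W x -> u x = \sum_i a i * monof (fun k => i.1 k) (fun j => i.2 j) x.

Lemma Sp_ext N u v : (forall x, W x -> u x = v x) -> Sp N v -> Sp N u.
Proof. by move=> uv [a aP]; exists a => x Wx; rewrite uv // aP. Qed.

Lemma Sp0 N : Sp N (fun=> 0).
Proof. by exists (fun=> 0) => x _; rewrite big1 // => i _; rewrite mul0r. Qed.

Lemma SpD N u v : Sp N u -> Sp N v -> Sp N (fun x => u x + v x).
Proof.
move=> [a aP] [b bP]; exists (fun i => a i + b i) => x Wx; rewrite aP // bP // -big_split /=.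
by apply: eq_bigr => i _; rewrite mulrDl.
Qed.

Lemma SpZ N c u : Sp N u -> Sp N (fun x => c * u x).
Proof.
move=> [a aP]; exists (fun i => c * a i) => x Wx; rewrite aP // mulr_sumr.
by apply: eq_bigr => i _; rewrite mulrA.
Qed.

Lemma Sp_sum N (I : Type) (s : seq I) (u : I -> X -> C) : (forall i, Sp N (u i)) -> Sp N (fun x => \sum_(i <- s) u i x).
Proof.
move=> h; elim: s => [|i s IH]; first by apply: Sp_ext (Sp0 N) => x _; rewrite big_nil.
by apply: Sp_ext (SpD (h i) IH) => x _; rewrite big_cons.
Qed.

Lemma Sp_mon N m b : (forall k, m k < N)%N -> (forall j, b j < d)%N -> Sp N (monof m b).
Proof.
move=> mN bd; pose i0 : idx N := ([ffun k => Ordinal (mN k)], [ffun j => Ordinal (bd j)]).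
exists (fun i => (i == i0)%:R) => x _; rewrite (bigD1 i0) //= eqxx mul1r big1 ?addr0 => [|i /negbTE ->]; last by rewrite mul0r.
by congr (_ * _); apply: eq_bigr => k _; rewrite ffunE.
Qed.

Lemma Sp_lin N N' (g : X -> C) :
 (forall m b, (forall k, m k < N)%N -> (forall j, b j < d)%N -> Sp N' (fun x => g x * monof m b x)) ->
 forall u, Sp N u -> Sp N' (fun x => g x * u x).
Proof.
move=> h u [a aP]; apply: (@Sp_ext _ _ (fun x => \sum_i a i * (g x * monof (fun k => i.1 k) (fun j => i.2 j) x))).
 by move=> x Wx; rewrite aP // mulr_sumr; apply: eq_bigr => i _; rewrite mulrCA.
by apply: Sp_sum => i; apply: SpZ; apply: h => k; exact: ltn_ord.
Qed.

Lemma Sp_widen N N' u : (N <= N')%N -> Sp N u -> Sp N' u.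
Proof.
move=> NN h; apply: (@Sp_ext _ _ (fun x => 1 * u x)) => [x _|]; first by rewrite mul1r.
apply: Sp_lin h => m b mN bd; apply: (@Sp_ext _ _ (monof m b)) => [x _|]; first by rewrite mul1r.
by apply: Sp_mon => // k; exact: leq_trans NN.
Qed.

Lemma Sp_pol N (p : mpoly n C) u : Sp N u -> Sp (N + mmeasure mdeg p) (fun x => evalmp p x * u x).
Proof.
apply: Sp_lin => m b mN bd.
apply: (@Sp_ext _ _ (fun x => \sum_(m' <- msupp p) (if m' \in msupp p then mcoeff m' p * monof (fun k => m k + m' k)%N b x else 0))).
 move=> x _; rewrite evalmpE mulr_suml !big_seq; apply: eq_bigr => m' ->.
 have -> : monof (fun k => m k + m' k)%N b x = \prod_i x 0 i ^+ m' i * monof m b x.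
  by rewrite /monof mulrA -big_split /=; congr (_ * _); apply: eq_bigr => k _; rewrite exprD mulrC.
 exact: esym (mulrA _ _ _).
apply: Sp_sum => m'; have [ms|_] := boolP (m' \in msupp p); last exact: Sp0.
apply: SpZ; apply: Sp_mon => // k.
have := msize_mdeg_lt ms; rewrite mdegE (bigD1 k) //=; move: (mN k) => h1 h2.
by apply: leq_trans (leq_add h1 (ltnW (leq_ltn_trans (leq_addr _ _) h2))).
Qed.

(** Multiplication by [g] raises the bound on the polynomial exponents by a constant that does not
    depend on N. This is stable under sums and products. *)
Definition Mul (g : X -> C) := exists e, forall N u, Sp N u -> Sp (N + e) (fun x => g x * u x).

Lemma Mul_ext g h : (forall x, W x -> g x = h x) -> Mul h -> Mul g.
Proof. by move=> gh [e eP]; exists e => N u /eP; apply: Sp_ext => x Wx; rewrite gh. Qed.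

Lemma Mul_pol p : Mul (evalmp p).
Proof. by exists (mmeasure mdeg p) => N u; exact: Sp_pol. Qed.

Lemma MulD g h : Mul g -> Mul h -> Mul (fun x => g x + h x).
Proof.
move=> [e eP] [e' eP']; exists (e + e')%N => N u uN.
apply: (@Sp_ext _ _ (fun x => g x * u x + h x * u x)) => [x _|]; first by rewrite mulrDl.
by apply: SpD; [apply: Sp_widen (eP N u uN)|apply: Sp_widen (eP' N u uN)]; rewrite leq_add2l ?leq_addr ?leq_addl.
Qed.

Lemma MulM g h : Mul g -> Mul h -> Mul (fun x => g x * h x).
Proof.
move=> [e eP] [e' eP']; exists (e' + e)%N => N u uN; rewrite addnA.
by apply: Sp_ext (eP _ _ (eP' N u uN)) => x _; rewrite mulrA.
Qed.

(** The factor [lc] pays for the reduction: when the exponent of f_j reaches [d], the relation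
    replaces the power by lower ones with polynomial coefficients. *)
Lemma Mul_gen j : Mul (fun x => evalmp (lc j) x * f j x).
Proof.
have [_ rel] := alg j.
pose e := (mmeasure mdeg (lc j) + \sum_k mmeasure mdeg (co j k))%N.
exists e => N; apply: Sp_lin => m b mN bd.
pose b' k := fun j' => if j' == j then k else b j'.
have bE k x : monof m (b' k) x = \prod_i x 0 i ^+ m i * (f j x ^+ k * \prod_(j' | j' != j) f j' x ^+ b j').
 rewrite /monof (bigD1 j) //= /b' eqxx; congr (_ * (_ * _)).
 by apply: eq_bigr => j' /negbTE ->.
have mE x : monof m b x = monof m (b' (b j)) x.
 by congr (_ * _); apply: eq_bigr => j' _; rewrite /b'; case: eqP => [->|].
have fE x k : f j x * monof m (b' k) x = monof m (b' k.+1) x by rewrite !bE exprS; ring.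
have b'd k j' : (k < d)%N -> (b' k j' < d)%N by rewrite /b'; case: ifP.
have [bj|bj] := ltnP (b j).+1 d.
 apply: (@Sp_ext _ _ (fun x => evalmp (lc j) x * monof m (b' (b j).+1) x)) => [x _|].
  by rewrite mE -mulrA fE.
 apply: (@Sp_widen (N + mmeasure mdeg (lc j))); first by rewrite leq_add2l leq_addr.
 by apply: Sp_pol; apply: Sp_mon => // j'; exact: b'd.
have bjd : (b j).+1 = d by apply/eqP; rewrite eqn_leq bj bd.
apply: (@Sp_ext _ _ (fun x => \sum_k evalmp (co j k) x * monof m (b' k) x)) => [x Wx|].
 rewrite mE -mulrA fE bjd bE mulrCA mulrA [_ * (_ * _)]mulrC.
 transitivity ((\prod_i x 0 i ^+ m i * \prod_(j' | j' != j) f j' x ^+ b j') * (evalmp (lc j) x * f j x ^+ d)); first ring.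
 rewrite rel // mulr_sumr; apply: eq_bigr => k _; rewrite bE; ring.
apply: Sp_sum => k; apply: (@Sp_widen (N + mmeasure mdeg (co j k))).
 by rewrite leq_add2l /e (bigD1 k) //= addnA [(_ + mmeasure _ (co j k))%N]addnC -addnA leq_addr.
by apply: Sp_pol; apply: Sp_mon => // j'; exact: b'd.
Qed.

Definition Bd (g : X -> C) := exists c : mpoly n C, c != 0 /\ Mul (fun x => evalmp c x * g x).

Lemma BdD g h : Bd g -> Bd h -> Bd (fun x => g x + h x).
Proof.
move=> [c [c0 cP]] [c' [c'0 cP']]; exists (c * c'); rewrite mulf_neq0 //; split=> //.
apply: (@Mul_ext _ (fun x => evalmp c' x * (evalmp c x * g x) + evalmp c x * (evalmp c' x * h x))).
 by move=> x _; rewrite evalmpM; ring.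
by apply: MulD; apply: MulM => //; exact: Mul_pol.
Qed.

Lemma BdM g h : Bd g -> Bd h -> Bd (fun x => g x * h x).
Proof.
move=> [c [c0 cP]] [c' [c'0 cP']]; exists (c * c'); rewrite mulf_neq0 //; split=> //.
apply: (@Mul_ext _ (fun x => (evalmp c x * g x) * (evalmp c' x * h x))).
 by move=> x _; rewrite evalmpM; ring.
exact: MulM.
Qed.

Lemma Bd_pol p : Bd (evalmp p).
Proof.
exists 1; rewrite oner_neq0; split=> //; apply: Mul_ext (Mul_pol p) => x _.
by rewrite evalmp1 mul1r.
Qed.

Lemma Bd_gen j : Bd (f j).
Proof. by exists (lc j); split; [case: (alg j)|exact: Mul_gen]. Qed.

(** The power products of n + 1 functions with exponents below M number M^(n+1). Multiplied by a
    common power of the denominator [c], they lie in a space whose dimension grows like M^n, so for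
    large M they are dependent. *)
Lemma counting s (U : 'I_s -> X -> C) : s = n.+1 -> (forall l, Bd (U l)) ->
 exists c, c != 0 /\ exists (M : nat) (lam : {ffun 'I_s -> 'I_M} -> C),
  (exists g, lam g != 0) /\ forall x, W x -> evalmp c x * (\sum_g lam g * \prod_l U l x ^+ g l) = 0.
Proof.
move=> sE /choice[cs csP].
pose c := \prod_l cs l.
have c0 : c != 0 by apply/prodf_neq0 => l _; case: (csP l).
have MulU l : Mul (fun x => evalmp c x * U l x).
 apply: (@Mul_ext _ (fun x => evalmp (\prod_(l' | l' != l) cs l') x * (evalmp (cs l) x * U l x))).
  by move=> x _; rewrite /c (bigD1 l) //= evalmpM; ring.
 by apply: MulM; [exact: Mul_pol|case: (csP l)].
have [es esP] := choice MulU; have [ec ecP] := Mul_pol c.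
pose e := (ec + \sum_l es l)%N.
have eP l N u : Sp N u -> Sp (N + e) (fun x => evalmp c x * U l x * u x).
 by move=> /(esP l); apply: Sp_widen; rewrite leq_add2l /e (bigD1 l) //= addnCA leq_addr.
have ecP' N u : Sp N u -> Sp (N + e) (fun x => evalmp c x * u x).
 by move=> /ecP; apply: Sp_widen; rewrite leq_add2l leq_addr.
have powU l k N u : Sp N u -> Sp (N + k * e) (fun x => (evalmp c x * U l x) ^+ k * u x).
 elim: k N u => [|k IH] N u uN; first by rewrite mul0n addn0; apply: Sp_ext uN => x _; rewrite expr0 mul1r.
 rewrite mulSn addnA; have := IH _ _ (eP l N u uN); apply: Sp_ext => x _; rewrite exprSr; ring.
have powc k N u : Sp N u -> Sp (N + k * e) (fun x => evalmp c x ^+ k * u x).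
 elim: k N u => [|k IH] N u uN; first by rewrite mul0n addn0; apply: Sp_ext uN => x _; rewrite expr0 mul1r.
 rewrite mulSn addnA; have := IH _ _ (ecP' N u uN); apply: Sp_ext => x _; rewrite exprSr; ring.
(* Since 1 + s M e is at most (1 + s e) M, the dimension is at most (1 + s e)^n d^r M^n, which is
   less than M^(n+1) for this M. *)
pose M := ((1 + s * e) ^ n * d ^ r).+1.
have mono (g : {ffun 'I_s -> 'I_M}) : Sp (1 + s * M * e) (fun x => evalmp c x ^+ (s * M) * \prod_l U l x ^+ g l).
 have step (q : seq 'I_s) : Sp (1 + size q * M * e) (fun x => \prod_(l <- q) (evalmp c x ^+ M * U l x ^+ g l)).
  elim: q => [|l q IH].
   rewrite mul0n addn0; apply: (@Sp_ext _ _ (monof (fun=> 0%N) (fun=> 0%N))); last exact: Sp_mon.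
   by move=> x _; rewrite big_nil /monof !big1 ?mulr1.
  have gM : (g l <= M)%N by exact: ltnW.
  have h := powc (M - g l)%N _ _ (powU l (g l) _ _ IH).
  rewrite /= mulSn mulnDl addnCA [(M * e)%N](_ : _ = (M - g l) * e + g l * e)%N; last by rewrite -mulnDl subnK.
  rewrite addnC addnA addnAC; apply: Sp_ext h => x _; rewrite big_cons exprMn -{1}(subnK gM) exprD; ring.
 have := step (enum 'I_s); rewrite size_enum_ord; apply: Sp_ext => x _.
 by rewrite big_enum /= big_split /= prodr_const card_ord -exprM [(s * M)%N]mulnC.
have [a aP] := choice mono.
pose I := idx (1 + s * M * e); pose G := {ffun 'I_s -> 'I_M}.
have cardlt : (#|{: I}| < #|{: G}|)%N.
 rewrite card_prod !card_ffun !card_ord sE.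
 have leqX a' b' k : (a' <= b')%N -> (a' ^ k <= b' ^ k)%N.
  by move=> ab; elim: k => // k IH; rewrite !expnS leq_mul.
 have h : (1 + n.+1 * M * e <= (1 + n.+1 * e) * M)%N by rewrite mulnDl mul1n mulnAC leq_add2r.
 apply: (@leq_ltn_trans (((1 + n.+1 * e) * M) ^ n * d ^ r)%N); first by rewrite leq_mul2r leqX ?orbT.
 rewrite expnMn mulnAC expnS ltn_pmul2r ?expn_gt0 // /M sE.
 exact: leqnn.
pose A := \matrix_(i < #|{: G}|, j < #|{: I}|) a (enum_val i) (enum_val j).
have [v vA v0] : exists2 v : 'rV[C]_#|{: G}|, v *m A = 0 & v != 0.
 have : kermx A != 0.
  rewrite kermx_eq0 /row_free; apply/negP => /eqP rk; have := rank_leq_col A; rewrite rk.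
  by rewrite leqNgt cardlt.
 move=> /rowV0Pn[v /sub_kermxP vA v0]; by exists v.
exists (c ^+ (s * M)); split; first by rewrite expf_neq0.
exists M, (fun g => v 0 (enum_rank g)); split.
 have [j vj] : exists j, v 0 j != 0.
  apply: contrapT => h; move/eqP: v0; apply; apply/rowP => j; rewrite mxE; apply/eqP/negPn/negP => vj.
  by apply: h; exists j.
 by exists (enum_val j); rewrite enum_valK.
move=> x Wx; rewrite /evalmp rmorphXn mulr_sumr -/(evalmp c x).
transitivity (\sum_(g : G) v 0 (enum_rank g) * \sum_(i : I) a g i * monof (fun k => i.1 k) (fun j => i.2 j) x).
 by apply: eq_bigr => g _; rewrite -aP // mulrCA.
transitivity (\sum_(i : I) (\sum_(g : G) v 0 (enum_rank g) * a g i) * monof (fun k => i.1 k) (fun j => i.2 j) x).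
 rewrite (eq_bigr (fun g : G => \sum_(i : I) v 0 (enum_rank g) * (a g i * monof (fun k => i.1 k) (fun j => i.2 j) x))).
  by rewrite exchange_big /=; apply: eq_bigr => i _; rewrite mulr_suml; apply: eq_bigr => g _; rewrite mulrA.
 by move=> g _; rewrite mulr_sumr.
rewrite big1 // => i _; have := congr1 (fun u : 'rV[C]__ => u 0 (enum_rank i)) vA; rewrite !mxE => h.
rewrite (_ : \sum_g _ = 0) ?mul0r // -[RHS]h (reindex (@enum_val G predT)) /=; last first.
 by exists enum_rank => z _; [exact: enum_valK|exact: enum_rankK].
by apply: eq_bigr => j _; rewrite enum_valK mxE enum_rankK.
Qed.

End Counting.

(** * Transport by biholomorphic maps and maps close to the identity *)

Section Transport.
Variable R : realType. Local Notation C := (cplx R).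
Variable m : nat.
Local Notation X := 'rV[C]_m.

Lemma chain_rule (V W Z : nmod C) (f : V -> W) (g : W -> Z) x v : hol f x -> hol g (f x) ->
 'd (fun y => g (f y)) x v = 'd g (f x) ('d f x v).
Proof. by move=> df dg; have -> : 'd (fun y => g (f y)) x = 'd g (f x) \o 'd f x :> (V -> Z) by exact: diff_comp. Qed.

Variables (Om D : set X) (psi phi : X -> X) (w : X -> C).
Hypothesis oOm : open Om.
Hypothesis psiD : forall y, Om y -> D (psi y).
Hypothesis phiO : forall x, D x -> Om (phi x).
Hypothesis dpsi : forall y, Om y -> hol psi y.
Hypothesis dphi : forall x, D x -> hol phi x.
Hypothesis psiK : forall y, Om y -> phi (psi y) = y.
Hypothesis phiK : forall x, D x -> psi (phi x) = x.
Hypothesis gw : good D w.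
Local Notation F := (fun y => w (psi y)).

Lemma transport_smooth y : Om y -> (smooth Om F y <-> smooth D w (psi y)).
Proof.
move=> Oy; have Dx := psiD Oy; have dw := good_holo gw Dx; have dp := dpsi Oy.
split=> [[_ Fy [v v0]]|[_ wx [v v0]]].
 split; [exact: Dx|exact: Fy|exists ('d psi y v)].
 by apply: contra v0 => /eqP k; apply/eqP; exact: (etrans (chain_rule v dp dw) k).
split; [exact: Oy|exact: wx|exists ('d phi (psi y) v)].
have dphx := dphi Dx; have dpp : hol psi (phi (psi y)) := eq_ind _ (fun z => hol psi z) dp _ (esym (psiK Oy)).
have E : 'd psi y ('d phi (psi y) v) = v.
 have /open_rP/(_ _ Dx)[r r0 rD] := good_open gw.
 have [_ k] := @diff_local_eq R X X (fun x => psi (phi x)) id (psi y) r r0 (fun z zr => phiK (rD z zr)) (differentiable_comp dphx dpp).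
 have k1 : 'd (fun x => psi (phi x)) (psi y) v = 'd psi y ('d phi (psi y) v) :=
  eq_ind _ (fun z => 'd (fun x => psi (phi x)) (psi y) v = 'd psi z ('d phi (psi y) v)) (chain_rule v dphx dpp) _ (psiK Oy).
 apply: (etrans (esym k1)); apply: (etrans (esym (congr1 (fun f => f v) k))).
 by apply: (@diff_linear_at R X X idfun) => z.
apply: contra v0 => /eqP k; apply/eqP.
exact: (etrans (congr1 (fun u => 'd w (psi y) u) (esym E)) (etrans (esym (chain_rule _ dp dw)) k)).
Qed.

Lemma phi_near y (e : R) : Om y -> 0 < e -> exists2 d : R, 0 < d &
 forall x, D x -> nm (x - psi y) < d -> nm (phi x - y) < e.
Proof.
move=> Oy e0; have /continuous_rP/(_ e e0)[d d0 dP] := diff_cont (dphi (psiD Oy)).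
by exists d => // x Dx /dP; rewrite psiK.
Qed.

Lemma psi_near y (e : R) : Om y -> 0 < e -> exists2 d : R, 0 < d &
 forall z, Om z -> nm (z - y) < d -> nm (psi z - psi y) < e.
Proof.
move=> Oy e0; have /continuous_rP/(_ e e0)[d d0 dP] := diff_cont (dpsi Oy).
by exists d => // z _ /dP.
Qed.

(** In the inductive step the approximating zero sets are given by monic polynomials only in the
    source of phi^nu, so the properties collected in [good] have to be carried to the target. *)
Lemma good_transport : good Om F.
Proof.
split.
- exact: oOm.
- move=> y Oy; apply: (diff_compo psi w); first exact: dpsi.
 exact: (good_holo gw (psiD Oy)).
- move=> y [Oy Fy] e e0; have [d d0 dP] := phi_near Oy e0.
 have [x Sx xy] := good_dense gw (conj (psiD Oy) Fy) d0.
 have Dx : D x by case: Sx.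
 by exists (phi x); [apply/(transport_smooth (phiO Dx)); rewrite phiK|exact: dP].
- move=> y Oy e e0; have [d d0 dP] := phi_near Oy e0.
 have /open_rP/(_ _ (psiD Oy))[r r0 rD] := good_open gw.
 have m0 : 0 < min d r by rewrite lt_min d0.
 have [x + wx] := good_empty gw (psiD Oy) m0; rewrite lt_min => /andP[xd xr].
 have Dx := rD x xr.
 by exists (phi x); [exact: dP|rewrite phiK].
- move=> a Oa; have [W [pts [oW Wa WD WP]]] := good_local gw (psiD Oa).
 exists [set y | Om y /\ W (psi y)], (map phi pts); split.
 + apply/open_rP => y [Oy Wy]; have /open_rP/(_ _ Wy)[r r0 rW] := oW.
  have [d d0 dP] := psi_near Oy r0; have /open_rP/(_ y Oy)[t t0 tO] := oOm.
  exists (min d t) => [|z]; first by rewrite lt_min d0.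
  by rewrite lt_min => /andP[zd /tO Oz]; split=> //; apply/rW/dP.
 + by [].
 + by move=> y [].
 + move=> S [SS SO]; pose S' := [set x | D x /\ S (phi x)].
  have cS' : clopen_in (smooth D w) S'.
   split=> [x [Dx Sx]|x Sx].
    by have := (transport_smooth (phiO Dx)).1 (SS _ Sx); rewrite phiK.
   have Dx : D x by case: Sx.
   have Sp : smooth Om F (phi x) by apply/(transport_smooth (phiO Dx)); rewrite phiK.
   have [e e0 eP] := SO _ Sp; have [d d0 dP] := phi_near (phiO Dx) e0; rewrite phiK // in dP.
   exists d; first exact: d0.
   move=> z Sz zd; have Dz : D z by case: Sz.
   have Sz' : smooth Om F (phi z) by apply/(transport_smooth (phiO Dz)); rewrite phiK.
   have [k1 k2] := eP _ Sz' (dP z Dz zd).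
   by split=> -[_ h]; split; [exact: Dz|exact: k1|exact: Dx|exact: k2].
  have [h [dh hP hpts]] := WP S' cS'.
  exists (fun y => h (psi y)); split.
  * move=> y [Oy Wy]; apply: (diff_compo psi h); [exact: dpsi|exact: dh].
  * move=> y [Oy Wy]; apply: iff_trans (hP _ Wy); split=> /closure_rP cl; apply/closure_rP => e e0.
    have [d d0 dP] := psi_near Oy e0; have [s Ss sd] := cl d d0.
    have Os : Om s by case: (SS s Ss).
    by exists (psi s); [split; [exact: psiD|rewrite psiK]|exact: dP].
   have [d d0 dP] := phi_near Oy e0; have [x [Dx Sx] xd] := cl d d0.
   by exists (phi x); [exact: Sx|exact: dP].
  * move=> np y [Oy Wy] Sy; apply: (hpts _ (psi y) Wy); last by split; [exact: psiD|rewrite psiK].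
   by move=> p pp [Dp Sp]; apply: (np (phi p)) => //; exact: map_f.
Qed.

End Transport.

Section NearIdentity.
Variable R : realType. Local Notation C := (cplx R).
Variable m : nat.
Local Notation X := 'rV[C]_m.

(** Solve th(z + s) = z for a small s. As th - id is bounded by [delta] on balls of radius [rho], it
    has Lipschitz constant 16 delta / rho there, and 32 delta <= rho makes this at most 1/2.
    Uniqueness of s gives the inverse on the other side. *)
Lemma near_identity_inverse (O1 O2 : set X) (th : X -> X) (rho delta : R) : 0 < rho -> 0 < delta -> open O1 ->
 (forall z x, O1 z -> nm (x - z) < rho -> O2 x) -> 32 * delta <= rho ->
 (forall x, O2 x -> hol th x) -> (forall x, O2 x -> nm (th x - x) <= delta) ->
 exists om : X -> X, [/\ forall z, O1 z -> [/\ O2 (om z), th (om z) = z, hol om z & nm (om z - z) <= 2 * delta] &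
  forall x, O2 x -> O1 (th x) -> om (th x) = x].
Proof.
move=> rho0 delta0 oO1 O12 dr dth hth.
have eta0 : 0 < rho / 4 by rewrite divr_gt0.
pose E x := th x - x.
have dE x : O2 x -> hol E x by move=> /dth h; apply: holB.
have inO z s : O1 z -> nm s <= rho / 4 -> O2 (z + s).
 by move=> Oz sr; apply: (O12 z) => //; rewrite addrAC subrr add0r; move: sr rho0; clra.
have [z Oz s s' se se'|z Oz|z f Oz df fe|sig sigP] :=
 @fp_holo R _ (cauchy_target_mx R 1 m) _ O1 (fun z s => th (z + s) - z) (rho / 4) eta0 oO1.
- have -> : th (z + s) - z - (th (z + s') - z) - (s - s') = E (z + s) - E (z + s').
  rewrite /E; move: (th (z + s)) (th (z + s')) => p q.
  by rewrite opprB addrA subrK [in RHS]opprB !opprD !addrA; rewrite [LHS](_ : _ = p - q - s + s') ?opprK // [RHS](_ : _ = p - q - s + s') //; apply/rowP => j; rewrite !mxE; ring.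
 have lip := @cauchy_lip R _ _ (cauchy_target_mx R 1 m) E z rho delta rho0 (fun x xz => dE x (O12 z x Oz xz)) (fun x xz => hth x (O12 z x Oz xz)).
 have h1 : nm (z + s - z) < rho / 2 by rewrite addrAC subrr add0r; move: se rho0; clra.
 have h2 : nm (z + s' - z) < rho / 2 by rewrite addrAC subrr add0r; move: se' rho0; clra.
 have := lip _ _ h1 h2; have -> : z + s - (z + s') = s - s' by rewrite opprD addrACA subrr add0r.
 have : 16 * delta / rho <= 2^-1 by rewrite ler_pdivrMr //; move: dr; clra.
 by move=> k /le_trans; apply; rewrite mulrC ler_wpM2l ?nm_ge0.
- rewrite addr0; apply: (le_trans (hth z _)); last by move: dr rho0; clra.
 by apply: (O12 z) => //; rewrite subrr nm0.
- apply: holB => //; apply: (diff_compo (fun y => y + f y) th).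
  by apply: holD.
 by apply: dth; exact: inO.
have O2z z : O1 z -> O2 z by move=> Oz; apply: (O12 z) => //; rewrite subrr nm0.
have sd z : O1 z -> nm (sig z) <= 2 * delta.
 move=> Oz; have [h _ _ _] := sigP z Oz; apply: (le_trans h); rewrite addr0 ler_pM2l //.
 exact/hth/O2z.
have d4 : 2 * delta <= rho / 4 by move: dr delta0; clra.
exists (fun z => z + sig z); split=> [z Oz|x Ox Ot].
 have [_ h2 _ h4] := sigP z Oz; split.
 - by apply: inO => //; apply: le_trans (sd z Oz) d4.
 - by apply/eqP; rewrite -subr_eq0; apply/eqP.
 - by apply: holD.
 - by rewrite addrAC subrr add0r; exact: sd.
have [_ _ uq _] := sigP (th x) Ot; rewrite -(uq (x - th x)) ?subrKC //; last by rewrite subrr.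
by rewrite nmC; apply: le_trans (hth x Ox) _; move: dr delta0; clra.
Qed.

End NearIdentity.

(** * Algebraic dependence and Nash functions *)

Section AlgebraicDependence.
Variable R : realType. Local Notation C := (cplx R).

Inductive polyf n r (f : 'I_r -> 'rV[C]_n -> C) : ('rV[C]_n -> C) -> Prop :=
| polyf_pol p : polyf f (evalmp p)
| polyf_gen j : polyf f (f j)
| polyf_add u v : polyf f u -> polyf f v -> polyf f (fun x => u x + v x)
| polyf_mul u v : polyf f u -> polyf f v -> polyf f (fun x => u x * v x).

Lemma polyf_holo n r (f : 'I_r -> 'rV[C]_n -> C) u x : (forall j, hol (f j) x) ->
 polyf f u -> hol u x.
Proof.
move=> df; elim=> [p|j|u1 v1 _ h1 _ h2|u1 v1 _ h1 _ h2].
- exact: diff_evalmp.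
- exact: df.
- exact: holD.
- exact: holM.
Qed.

(** [counting] gives the relation only after multiplication by a polynomial [c]. The zeros of [c]
    are nowhere dense, so continuity removes the factor. *)
Lemma alg_dep n r (W : set 'rV[C]_n) (f : 'I_r -> 'rV[C]_n -> C) (U : 'I_(n + 1) -> 'rV[C]_n -> C) :
 open W -> (forall j, exists d lc co, @algrel R n W (f j) d lc co) ->
 (forall j x, W x -> hol (f j) x) -> (forall l, polyf f (U l)) ->
 exists2 P : mpoly (n + 1) C, P != 0 & forall x, W x -> evalmp P (\row_l U l x) = 0.
Proof.
move=> oW /choice[d dP] df pU.
pose D := (1 + \sum_j d j)%N.
have hD j : exists q : mpoly n C * ('I_D -> mpoly n C), algrel W (f j) q.1 q.2.
 have [lc [co rel]] := dP j; have [co' rel'] := algrel_pad (D - d j) rel.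
 have E : (d j + (D - d j))%N = D by rewrite subnKC // /D (bigD1 j) //= addnCA leq_addr.
 by move: co' rel'; rewrite E => co' rel'; exists (lc, co').
have [q qP] := choice hD.
have bU l : Bd D W f (U l).
 elim: (pU l) => [p|j|u v _ h1 _ h2|u v _ h1 _ h2].
 - exact: Bd_pol.
 - exact: (Bd_gen (lc := fun j => (q j).1) (co := fun j => (q j).2) qP).
 - exact: BdD.
 - exact: BdM.
have [c [c0 [M [lam [[g0 g0P] rel]]]]] := counting (d := D) (W := W) (f := f) isT (addn1 n) bU.
pose mn (g : {ffun 'I_(n + 1) -> 'I_M}) : multinom (n + 1) := Multinom [tuple (g l : nat) | l < n + 1].
have mnE g l : mn g l = g l :> nat by rewrite /mn multinomE tnth_mktuple.
pose P : mpoly (n + 1) C := \sum_g lam g *: mpolyX C (mn g).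
exists P.
 apply/eqP => P0; have := congr1 (mcoeff (mn g0)) P0; rewrite mcoeff0 /P raddf_sum /= (bigD1 g0) //= big1.
  by rewrite mcoeffZ mcoeffX eqxx mulr1 addr0 => /eqP; rewrite (negbTE g0P).
 move=> g gg0; rewrite mcoeffZ mcoeffX; case: eqP => [E|]; last by rewrite mulr0.
 by move/eqP: gg0; case; apply/ffunP => l; apply: val_inj; rewrite /= -[LHS](mnE g) -[RHS](mnE g0) E.
have PE x : evalmp P (\row_l U l x) = \sum_g lam g * \prod_l U l x ^+ g l.
 rewrite /P evalmp_sum; apply: eq_bigr => g _; rewrite /evalmp mevalZ mevalX; congr (_ * _).
 by apply: eq_bigr => l _; rewrite mxE mnE.
move=> x Wx; apply/eqP/negPn/negP; rewrite -nm_gt0 => Px.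
have dPU y : W y -> hol (fun y => evalmp P (\row_l U l y)) y.
 move=> Wy; apply: (diff_compo (fun y => \row_l U l y) (evalmp P)); last exact: diff_evalmp.
 apply: mx_differentiable => i j; under eq_fun do rewrite mxE.
 by apply: polyf_holo (pU j) => k; exact: df.
have /continuous_rP/(_ _ Px)[e e0 eP] := diff_cont (dPU x Wx).
have /open_rP/(_ x Wx)[r0 r00 rW] := oW.
have m0 : 0 < min e r0 by rewrite lt_min e0.
have [y + cy] := evalmp_dense x c0 m0; rewrite lt_min => /andP[/eP ye /rW Wy].
have := rel y Wy; rewrite -PE => /eqP; rewrite mulf_eq0 (negbTE cy) => /eqP Py.
by move: ye; rewrite Py sub0r nmN ltxx.
Qed.

(** A criterion for functions given through a parameter: the point y and the value g y are both
    polynomial expressions in coordinates and algebraic functions at [th y]. A relation among these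
    n + 1 expressions becomes, at [th y], a polynomial relation between y and g y. *)
Lemma nash_comp n r (D : set 'rV[C]_n) (g : 'rV[C]_n -> C) : open D -> holo D g ->
 (forall y0, D y0 -> exists (W N : set 'rV[C]_n) (th : 'rV[C]_n -> 'rV[C]_n) (f : 'I_r -> 'rV[C]_n -> C)
   (u : 'I_n -> 'rV[C]_n -> C) (v : 'rV[C]_n -> C),
  [/\ [/\ open W, open N, N y0 & N `<=` D], forall j, exists d lc co, @algrel R n W (f j) d lc co,
    forall j x, W x -> hol (f j) x, (forall i, polyf f (u i)) /\ polyf f v &
    forall y, N y -> [/\ W (th y), forall i, u i (th y) = y 0 i & g y = v (th y)]]) ->
 nash_fun D g.
Proof.
move=> oD dg h; split=> // y0 Dy0; have [W [N [th [f [u [v [[oW oN Ny ND] hf df [pu pv] hN]]]]]]] := h y0 Dy0.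
exists N; split=> //.
pose U (l : 'I_(n + 1)) := match fintype.split l with inl i => u i | inr _ => v end.
have [|P P0 PP] := @alg_dep n r W f U oW hf df.
 by move=> l; rewrite /U; case: (fintype.split l).
exists P => // y Ny'; have [Wy uy gy] := hN y Ny'; rewrite -(PP _ Wy); congr evalmp.
apply/rowP => l; rewrite [RHS]mxE /U; have := splitK l; case: (fintype.split l) => i /= <-.
 by rewrite row_mxEl uy.
by rewrite row_mxEr mxE gy.
Qed.

End AlgebraicDependence.

(** * Runge's theorem in one variable *)

Section Grid.
Variable R : realType. Local Notation C := (cplx R).

Lemma Re_rcM (t : R) (z : C) : Re (rc t * z) = t * Re z.
Proof. by case: z => u v /=; rewrite mul0r subr0. Qed.

Lemma Im_rcM (t : R) (z : C) : Im (rc t * z) = t * Im z.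
Proof. by case: z => u v /=; rewrite mul0r addr0. Qed.

Lemma ReD (z w : C) : Re (z + w) = Re z + Re w.
Proof. by case: z; case: w. Qed.
Lemma ImD (z w : C) : Im (z + w) = Im z + Im w.
Proof. by case: z; case: w. Qed.
Lemma ReB (z w : C) : Re (z - w) = Re z - Re w.
Proof. by case: z; case: w. Qed.
Lemma ImB (z w : C) : Im (z - w) = Im z - Im w.
Proof. by case: z; case: w. Qed.

Lemma cplx_eq (z w : C) : Re z = Re w -> Im z = Im w -> z = w.
Proof. by case: z => a b; case: w => c d /= -> ->. Qed.

Lemma on_seg_coord (a b w : C) : on_seg a b w -> exists t : R, [/\ 0 <= t <= 1,
 Re w = Re a + t * (Re b - Re a) &
 Im w = Im a + t * (Im b - Im a)].
Proof.
by move=> [t t01 ->]; exists t; split=> //; rewrite ?ReD ?ImD ?Re_rcM ?Im_rcM ?ReB ?ImB.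
Qed.

(** Summation by parts, with boundary terms zero. It turns sums over grid cells into sums over the
    edges at which the indicator of the selected cells jumps. *)
Lemma abel_sum (m : nat) (x a : nat -> C) : x 0%N = 0 -> x m = 0 ->
 \sum_(j < m) x j * (a j - a j.+1) = \sum_(j < m) (x j.+1 - x j) * a j.+1.
Proof.
move=> x0 xm; apply/eqP; rewrite -subr_eq0 -sumrB.
have -> : \sum_(j < m) (x j * (a j - a j.+1) - (x j.+1 - x j) * a j.+1) = \sum_(j < m) (x j * a j - x j.+1 * a j.+1).
 by apply: eq_bigr => j _; ring.
have -> : \sum_(j < m) (x j * a j - x j.+1 * a j.+1) = x 0%N * a 0%N - x m * a m.
 by elim: m {xm} => [|m IH]; rewrite ?big_ord0 ?subrr // big_ord_recr IH /=; ring.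
by rewrite x0 xm !mul0r subrr.
Qed.

Lemma nat_cell (x : R) (m : nat) : 0 <= x -> x < m%:R -> exists2 i, (i < m)%N & i%:R <= x <= i.+1%:R.
Proof.
move=> x0; elim: m => [|m IH] xm; first by move: x0; rewrite leNgt xm.
have [h|h] := ltP x m%:R; first by have [i im ix] := IH h; exists i; rewrite // ltnW.
by exists m; rewrite // h ltW.
Qed.

(** Weight, starting point and end point of a segment. *)
Definition edge := (C * C * C)%type.

(** Select the squares of a grid that come within [eta] of [K]. Edges between two selected squares
    cancel, and an edge that remains has distance at least [eta] from [K], because a closer point of
    [K] would select the squares on both of its sides. *)
Lemma grid (K : set C) (B r : R) : 0 < r -> 0 <= B -> (forall y, K y -> nm y <= B) ->
 exists (s eta : R) (Qs : seq C) (E : seq edge), [/\ [/\ 0 < s, 0 < eta, 4 * s <= r & uniq Qs],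
  forall n f, \sum_(c <- Qs) bd n f c (rc s) = \sum_(e <- E) e.1.1 * seg n f e.1.2 e.2,
  forall e, e \in E -> [/\ nm e.1.1 <= 2, nm (e.2 - e.1.2) = 2 * s &
   forall z w, K z -> on_seg e.1.2 e.2 w -> eta <= nm (w - z)],
  (forall c w, c \in Qs -> sq c s w -> exists2 y, K y & nm (w - y) < r) /\
  (forall z, K z -> exists2 c, c \in Qs & sq c s z) &
  forall c c' w, c \in Qs -> c' \in Qs -> c != c' ->
   `|Re (w - c)| < s -> `|Im (w - c)| < s -> ~ sq c' s w].
Proof.
move=> r0 B0 KB; pose s := r / 16; pose eta := s / 2.
have s0 : 0 < s by rewrite divr_gt0.
have eta0 : 0 < eta by rewrite divr_gt0.
have s20 : 0 < 2 * s by rewrite mulr_gt0.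
have [a aP] : exists a : nat, B + 3 * s < 2 * s * a%:R.
 have sB : 0 < 2 * s / (B + 3 * s) by rewrite divr_gt0 // ?mulr_gt0 //; move: s0 B0; clra.
 have [N NP] := arch_inv sB; exists N.+1; have := NP N (leqnn N).
 have p0 : 0 < B + 3 * s by move: s0 B0; clra.
 by rewrite ltr_pdivlMr // ltr_pdivrMl ?ltr0n // [_ * (2 * s)]mulrC; apply.
pose m := (2 * a)%N.
pose x (i : nat) : R := 2 * s * (i%:R - a%:R).
have xS i : x i.+1 = x i + 2 * s by rewrite /x -natr1; ring.
have xlt i j : (i < j)%N -> x i + 2 * s <= x j.
 move=> ij; rewrite -xS /x ler_pM2l ?mulr_gt0 // lerB // ler_nat //.
have x0 : x 0%N = - (2 * s * a%:R) by rewrite /x; ring.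
have xm : x m = 2 * s * a%:R by rewrite /x /m natrM; ring.
pose node i j : C := Complex (x i) (x j).
pose ct i j : C := Complex (x i + s) (x j + s).
(* The square is enlarged by [eta], so that a point of [K] within [eta] of an edge lies in the
   enlargements of both squares at this edge. *)
pose near i j := `[< exists2 y, K y & sq (ct i j) (s + eta) y >].
have etas : eta = s / 2 by [].
clearbody eta.
have nearP i j y : K y -> `|Re y - (x i + s)| <= s + eta -> `|Im y - (x j + s)| <= s + eta -> near i j.
 by move=> Ky h1 h2; apply/asboolP; exists y => //; split; rewrite ?ReB ?ImB.
(* The grid reaches beyond [K] by more than a square, so the indicator vanishes at its rim, as
   [abel_sum] requires. *)
have border i j : near i j -> [/\ i != 0%N, i != m, j != 0%N & j != m].
 move=> /asboolP[y Ky []]; rewrite ReB ImB /= => h1 h2.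
 have := KB y Ky; have := Re_le_nm y; have := Im_le_nm y; move: h1 h2; rewrite !ler_norml.
 move=> /andP[h1 h2] /andP[h3 h4] /andP[h5 h6] /andP[h7 h8] h9.
 split; apply/eqP => k; rewrite ?k ?x0 ?xm in h1 h2 h3 h4; move: aP h1 h2 h3 h4 h5 h6 h7 h8 h9 s0; rewrite etas; clra.
pose chi i j : C := (near i j)%:R.
have chi0 i j : ~~ near i j -> chi i j = 0 by rewrite /chi => /negbTE ->.
have c1 j : chi 0%N j = 0 by apply: chi0; apply/negP => /border[]; rewrite eqxx.
have c2 j : chi m j = 0 by apply: chi0; apply/negP => /border[_]; rewrite eqxx.
have c3 i : chi i 0%N = 0 by apply: chi0; apply/negP => /border[_ _]; rewrite eqxx.
have c4 i : chi i m = 0 by apply: chi0; apply/negP => /border[_ _ _]; rewrite eqxx.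
have corner i j u v : ct i j + rc s * cor R u v = node (i + u)%N (j + v)%N.
 have [h1 h2] := cor_coord (ct i j) s u v 0; apply: cplx_eq.
  by rewrite h1 /= /sgr; clear h1 h2; case: u; rewrite ?addn0 ?addn1 ?xS; ring.
 by rewrite h2 /= /sgr; clear h1 h2; case: v; rewrite ?addn0 ?addn1 ?xS; ring.
pose Hs n f i j := seg n f (node i j) (node i.+1 j).
pose Vs n f i j := seg n f (node i j) (node i j.+1).
have bdE n f i j : bd n f (ct i j) (rc s) = (Hs n f i j - Hs n f i j.+1) - (Vs n f i j - Vs n f i.+1 j).
 rewrite /bd !corner /= !addn0 !addn1 (seg_anti n f (node i j.+1) (node i.+1 j.+1)) (seg_anti n f (node i j) (node i j.+1)) /Hs /Vs; ring.
pose T := ('I_m * 'I_m)%type.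
pose Qs := [seq ct p.1 p.2 | p : T <- enum [pred p : T | near p.1 p.2]].
pose EH := [seq ((chi p.1 p.2.+1 - chi p.1 p.2, node p.1 p.2.+1), node p.1.+1 p.2.+1) | p : T <- enum [pred p : T | near p.1 p.2.+1 != near p.1 p.2]].
pose EV := [seq ((- (chi p.1.+1 p.2 - chi p.1 p.2), node p.1.+1 p.2), node p.1.+1 p.2.+1) | p : T <- enum [pred p : T | near p.1.+1 p.2 != near p.1 p.2]].
have edgeH i j w : on_seg (node i j) (node i.+1 j) w -> x i <= Re w <= x i + 2 * s /\ Im w = x j.
 move=> /on_seg_coord[t [t01 -> ->]] /=; rewrite xS subrr mulr0 addr0; split=> //.
 have -> : x i + 2 * s - x i = 2 * s by ring.
 have h1 : 0 <= t * (2 * s) by apply: mulr_ge0; [case/andP: t01|exact: ltW].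
 have h2 : t * (2 * s) <= 1 * (2 * s) by apply: ler_wpM2r; [exact: ltW|case/andP: t01].
 by move: h1 h2; clra.
have edgeV i j w : on_seg (node i j) (node i j.+1) w -> x j <= Im w <= x j + 2 * s /\ Re w = x i.
 move=> /on_seg_coord[t [t01 -> ->]] /=; rewrite xS subrr mulr0 addr0; split=> //.
 have -> : x j + 2 * s - x j = 2 * s by ring.
 have h1 : 0 <= t * (2 * s) by apply: mulr_ge0; [case/andP: t01|exact: ltW].
 have h2 : t * (2 * s) <= 1 * (2 * s) by apply: ler_wpM2r; [exact: ltW|case/andP: t01].
 by move: h1 h2; clra.
have chi_bound (b1 b2 : bool) : nm (b1%:R - b2%:R : C) <= 2.
 by case: b1; case: b2; rewrite ?subrr ?subr0 ?sub0r ?nmN ?nm0 ?nm1; lra.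
have nb (p q : R) : `|p| <= q -> - q <= p /\ p <= q by rewrite ler_norml => /andP.
exists s, eta, Qs, (EH ++ EV); split.
- split; [exact: s0|exact: eta0|by rewrite /s; move: r0; clra|].
 rewrite map_inj_uniq ?enum_uniq // => -[i j] [i' j'] /= [/addIr h1 /addIr h2].
 have inj u v : x u = x v -> u = v.
  by move=> h; case: (ltngtP u v) => // /xlt; rewrite h => k; exfalso; move: k s20; move: (x v) (2 * s) => p1 p2; clra.
 by congr (_, _); apply: val_inj; exact: inj.
- move=> n f; rewrite big_cat /= !big_map !big_enum /=.
 transitivity (\sum_(i < m) \sum_(j < m) chi i j * bd n f (ct i j) (rc s)).
  rewrite pair_big big_mkcond /=; apply: eq_bigr => -[i j] _ /=; rewrite inE /chi /=.
  by case: (near i j); rewrite ?mul1r ?mul0r.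
 transitivity (\sum_(i < m) \sum_(j < m) chi i j * (Hs n f i j - Hs n f i j.+1) - \sum_(i < m) \sum_(j < m) chi i j * (Vs n f i j - Vs n f i.+1 j)).
  rewrite -sumrB; apply: eq_bigr => i _; rewrite -sumrB; apply: eq_bigr => j _; rewrite bdE; ring.
 congr (_ + _).
  transitivity (\sum_(i < m) \sum_(j < m) (chi i j.+1 - chi i j) * Hs n f i j.+1).
   by apply: eq_bigr => i _; exact: (abel_sum (x := fun j => chi i j) (Hs n f i)).
  rewrite pair_big [RHS]big_mkcond /=; apply: eq_bigr => -[i j] _ /=; rewrite inE /chi /=.
  by case: eqP => [->|//]; rewrite subrr mul0r.
 rewrite exchange_big /=.
 transitivity (- \sum_(j < m) \sum_(i < m) (chi i.+1 j - chi i j) * Vs n f i.+1 j).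
  congr (- _); apply: eq_bigr => j _.
  exact: (abel_sum (x := fun i => chi i j) (fun i => Vs n f i j)).
 rewrite exchange_big pair_big [RHS]big_mkcond -sumrN /=; apply: eq_bigr => -[i j] _ /=; rewrite inE /chi mulNr /=.
 by case: eqP => [->|//]; rewrite subrr mul0r oppr0.
- move=> e; rewrite mem_cat => /orP[] /mapP[[i j]]; rewrite mem_enum inE /= => ne -> /=.
  split; first exact: chi_bound.
   have -> : node i.+1 j.+1 - node i j.+1 = rc (2 * s) by apply: cplx_eq; rewrite ?ReB ?ImB /= ?xS; ring.
   by rewrite nm_rc gtr0_norm // mulr_gt0.
  move=> z w Kz /edgeH[/andP[w1 w2] w3]; rewrite leNgt; apply/negP => wz; move/negP: ne; apply; apply/eqP.
  have := Re_le_nm (w - z); have := Im_le_nm (w - z); rewrite ReB ImB w3 xS => /nb[k1 k2] /nb[k3 k4].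
  have h (j' : nat) : `|x j + 2 * s - (x j' + s)| <= s -> near i j'.
   move=> /nb[l1 l2]; apply: (nearP i j' z Kz); rewrite ler_norml; apply/andP; split;
   move: w1 w2 wz k1 k2 k3 k4 l1 l2; move: (nm _) (Re z) (Im z) (Re w) (x i) (x j) (x j') => p1 p2 p3 p4 p5 p6 p7; move: (s) => p8; clra.
  have -> : near i j by apply: h; move: s0; move: (x j) (s) => p1 p2 q; rewrite ler_norml; apply/andP; split; move: q; clra.
  by rewrite h // xS; move: s0; move: (x j) (s) => p1 p2 q; rewrite ler_norml; apply/andP; split; move: q; clra.
 split; first by rewrite nmN; exact: chi_bound.
  have -> : node i.+1 j.+1 - node i.+1 j = Complex 0 (2 * s) by apply: cplx_eq; rewrite ?ReB ?ImB /= ?xS; ring.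
  have -> : (Complex 0 (2 * s) : C) = rc (2 * s) * 'i%C by apply: cplx_eq; rewrite ?Re_rcM ?Im_rcM /= ?mulr0 ?mulr1.
  by rewrite nmM nm_i mulr1 nm_rc gtr0_norm // mulr_gt0.
 move=> z w Kz /edgeV[/andP[w1 w2] w3]; rewrite leNgt; apply/negP => wz; move/negP: ne; apply; apply/eqP.
 have := Re_le_nm (w - z); have := Im_le_nm (w - z); rewrite ReB ImB w3 xS => /nb[k1 k2] /nb[k3 k4].
 have h (i' : nat) : `|x i + 2 * s - (x i' + s)| <= s -> near i' j.
  move=> /nb[l1 l2]; apply: (nearP i' j z Kz); rewrite ler_norml; apply/andP; split;
  move: w1 w2 wz k1 k2 k3 k4 l1 l2; move: (nm _) (Re z) (Im z) (Im w) (x i) (x j) (x i') => p1 p2 p3 p4 p5 p6 p7; move: (s) => p8; clra.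
 have -> : near i j by apply: h; move: s0; move: (x i) (s) => p1 p2 q; rewrite ler_norml; apply/andP; split; move: q; clra.
 by rewrite h // xS; move: s0; move: (x i) (s) => p1 p2 q; rewrite ler_norml; apply/andP; split; move: q; clra.
- split.
  move=> c w /mapP[[i j] pin cE] qw; have nr : near i j by move: pin; rewrite mem_enum.
  have [y Ky qy] := asboolW nr; exists y; first exact: Ky.
  rewrite {}cE in qw.
  have h1 := sq_norm qy; have h2 := sq_norm qw.
  have := @nm_tri R C (ct i j) w y; rewrite [@nm R C (ct i j - y)]nmC; move: h1 h2 r0; rewrite etas /s; clra.
 move=> z Kz; have zB := KB z Kz; have := Re_le_nm z; have := Im_le_nm z => /nb[k1 k2] /nb[k3 k4].
 have cell (y : R) : - B <= y -> y <= B -> exists2 i, (i < m)%N & x i <= y <= x i + 2 * s.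
  move=> y1 y2; have s2 : 0 < 2 * s by rewrite mulr_gt0.
  have [||i im /andP[i1 i2]] := @nat_cell (y / (2 * s) + a%:R) m.
  - by rewrite -lerBlDr sub0r ler_pdivlMr // mulNr mulrC; move: aP y1 s0; clra.
  - rewrite -ltrBrDr ltr_pdivrMr // /m natrM; have -> : (2 * a%:R - a%:R) * (2 * s) = 2 * s * a%:R by ring.
   by move: aP y2 s0; clra.
  exists i => //; rewrite -xS /x; apply/andP; split.
   by rewrite -ler_pdivlMl // lerBlDr [X in _ <= X + _]mulrC.
  by rewrite -ler_pdivrMl // lerBrDr [X in X + _ <= _]mulrC.
 have lerNl_ (p q : R) : p <= q -> - q <= - p by rewrite lerN2.
 have [i im /andP[i1 i2]] := cell (Re z) (le_trans (lerNl_ _ _ zB) k3) (le_trans k4 zB).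
 have [j jm /andP[j1 j2]] := cell (Im z) (le_trans (lerNl_ _ _ zB) k1) (le_trans k2 zB).
 have qz : sq (ct i j) s z.
  by split; rewrite ?ReB ?ImB /= ler_norml; apply/andP; split; move: i1 i2 j1 j2; move: (x i) (x j) (Re z) (Im z) (s) => p1 p2 p3 p4 p5; clra.
 have nr : near i j.
  apply: asboolT; exists z => //; case: qz => q1 q2.
  by split; [apply: le_trans q1 _|apply: le_trans q2 _]; rewrite lerDl ltW.
 by exists (ct i j) => //; apply/mapP; exists (Ordinal im, Ordinal jm); rewrite // mem_enum.
- move=> c c' w /mapP[[i j] _ ->] /mapP[[i' j'] _ ->] /= cc; rewrite ReB ImB /= => h1 h2.
 move=> []; rewrite ReB ImB /= => /nb[h3 h4] /nb[h5 h6]; move/eqP: cc; apply.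
 move: h1 h2; rewrite !ltr_norml => /andP[g1 g2] /andP[g3 g4].
 have ii' : i = i' :> nat.
  by case: (ltngtP i i') => // /xlt => k; exfalso; move: k g1 g2 h3 h4; move: (x i) (x i') (Re w) (s) => p1 p2 p3 p4; clra.
 have jj' : j = j' :> nat.
  by case: (ltngtP j j') => // /xlt => k; exfalso; move: k g3 g4 h5 h6; move: (x j) (x j') (Im w) (s) => p1 p2 p3 p4; clra.
 by rewrite ii' jj'.
Qed.

End Grid.

Section Runge.
Variable R : realType. Local Notation C := (cplx R).

Lemma seg_turn n (k z a b : C) : k != 0 ->
 seg n (fun w => (w - k * z)^-1) (k * a) (k * b) = seg n (fun w => (w - z)^-1) a b.
Proof.
move=> k0; rewrite seg_mul -segZ; apply: eq_seg => w _.
by rewrite -mulrBr invfM mulrA mulfV // mul1r.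
Qed.

Lemma Im_inv_lower (u : C) (s y : R) : 0 < s -> 0 < y -> Im u = - y -> `|Re u| <= 2 * s -> y <= 2 * s ->
 y / (8 * s ^+ 2) <= Im u^-1.
Proof.
move=> s0 y0 uI; rewrite ler_norml; move pE: (Re u) => p /andP[p1 p2] y1.
have uE : u = Complex p (- y) by apply: cplx_eq.
have h := Im_inv p (- y); rewrite opprK sqrrN -uE in h; rewrite h.
rewrite ler_pM2l // lef_pV2 ?posrE ?mulr_gt0 ?exprn_gt0 ?ltr_wpDl ?sqr_ge0 ?exprn_gt0 //.
have : p ^+ 2 <= 4 * s ^+ 2 by rewrite -subr_ge0 (_ : _ - _ = (2 * s - p) * (2 * s + p)); [rewrite mulr_ge0 //; lra|ring].
have : y ^+ 2 <= 4 * s ^+ 2 by rewrite -subr_ge0 (_ : _ - _ = (2 * s - y) * (2 * s + y)); [rewrite mulr_ge0 //; lra|ring].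
lra.
Qed.

Lemma edge_lower n (a z : C) (s : R) : 0 < s -> 0 < Im (z - a) < 2 * s -> 0 <= Re (z - a) <= 2 * s ->
 Im (z - a) / (4 * s) <= Im (seg n (fun w => (w - z)^-1) a (a + rc (2 * s))).
Proof.
move=> s0 /andP[y0 y1] /andP[x0 x1]; set y := Im (z - a) in y0 y1 *.
have -> : y / (4 * s) = (2 * s) * (y / (8 * s ^+ 2)) by field; rewrite gt_eqF.
apply: seg_Im; [by rewrite mulr_ge0 // ltW|by rewrite addrAC subrr add0r|].
move=> w /on_seg_coord[t [/andP[t0 t1] wR wI]].
have h1 : Im (w - z) = - y.
 by rewrite /y !ImB wI ImD /=; ring.
apply: (Im_inv_lower s0 y0 h1 _ (ltW y1)).
have wR' : Re w = Re a + t * (2 * s) by rewrite wR ReD /=; ring.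
rewrite ReB wR'; rewrite ReB in x0 x1.
have s2 : 0 <= 2 * s by rewrite mulr_ge0 // ltW.
have h2 : 0 <= t * (2 * s) by rewrite mulr_ge0.
have h3 : t * (2 * s) <= 1 * (2 * s) by rewrite ler_wpM2r.
rewrite ler_norml; apply/andP; split; move: h2 h3 x0 x1; move: (t * _) => q; clra.
Qed.

(** Each side contributes at least the distance from z to it divided by 4 s, and the four distances
    add up to 4 s. The bound is uniform in the level n and in z, even for z near the boundary, where
    the sums themselves are large. *)
Lemma square_lower n (c z : C) (s : R) : `|Re (z - c)| < s -> `|Im (z - c)| < s ->
 1 <= Im (bd n (fun w => (w - z)^-1) c (rc s)).
Proof.
rewrite !ltr_norml => /andP[x0 x1] /andP[y0 y1].
have s0 : 0 < s by lra.
have i0 := ii_neq0 R.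
have turn (k : C) : k != 0 ->
  seg n (fun w => (w - z)^-1) (c + rc s * (k * cor R false false)) (c + rc s * (k * cor R true false)) =
  seg n (fun w => (w - z / k)^-1) (c / k + rc s * cor R false false) (c / k + rc s * cor R false false + rc (2 * s)).
 move=> k0; rewrite -(seg_turn n (z / k) _ _ k0); congr (seg n _ _ _).
 - by apply/funext => w; rewrite [k * _]mulrC divfK.
 - by rewrite (mulrDr k (c / k)) [k * (c / k)]mulrC divfK // mulrCA.
 - rewrite (mulrDr k (c / k + rc s * cor R false false)) (mulrDr k (c / k)) [k * (c / k)]mulrC divfK // rcM rc_nat /cor /sgb; ring.
have lower (k : C) : k != 0 -> - s < Re ((z - c) / k) < s -> - s < Im ((z - c) / k) < s ->
  (Im ((z - c) / k) + s) / (4 * s) <= Im (seg n (fun w => (w - z)^-1) (c + rc s * (k * cor R false false)) (c + rc s * (k * cor R true false))).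
 move=> k0 /andP[p1 p2] /andP[p3 p4]; rewrite turn //.
 have [e1 e2] := cor_coord (c / k) s false false 0.
 have -> : Im ((z - c) / k) + s = Im (z / k - (c / k + rc s * cor R false false)).
  by rewrite [in RHS]ImB e2 /sgr mulrBl ImB; ring.
 apply: edge_lower => //; rewrite ?ImB ?ReB ?e1 ?e2 /sgr; move: p1 p2 p3 p4; rewrite mulrBl !ReB !ImB; lra.
have u1 : (z - c) / 1 = z - c by rewrite divr1.
have im1 : ((-1)^-1 : C) = -1 by rewrite invrN invr1.
have iE : (ii R)^-1 = - ii R.
 by apply/eqP; rewrite -(inj_eq (mulfI i0)) mulfV // mulrN; apply/eqP; apply: cplx_eq => /=; ring.
have iE2 : (- ii R)^-1 = ii R by rewrite invrN iE opprK.
have l1 := lower 1 (oner_neq0 _); have l2 := lower (ii R) i0.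
have l3 := lower (-1) ltac:(by rewrite oppr_eq0 oner_neq0); have l4 := lower (- ii R) ltac:(by rewrite oppr_eq0).
rewrite ?mul1r u1 in l1; rewrite iE !ii_cor /= in l2; rewrite im1 in l3; rewrite iE2 in l4.
have r1 : Re ((z - c) * - ii R) = Im (z - c) by case: (z - c) => p q /=; ring.
have r2 : Im ((z - c) * - ii R) = - Re (z - c) by case: (z - c) => p q /=; ring.
have r3 : Re ((z - c) * -1) = - Re (z - c) by case: (z - c) => p q /=; ring.
have r4 : Im ((z - c) * -1) = - Im (z - c) by case: (z - c) => p q /=; ring.
have r5 : Re ((z - c) * ii R) = - Im (z - c) by case: (z - c) => p q /=; ring.
have r6 : Im ((z - c) * ii R) = Re (z - c) by case: (z - c) => p q /=; ring.
rewrite r1 r2 in l2; rewrite r3 r4 in l3; rewrite r5 r6 in l4.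
have ncor b1 b2 : - cor R b1 b2 = cor R (~~ b1) (~~ b2) by rewrite /cor /sgb; case: b1; case: b2 => /=; ring.
rewrite !mulN1r !ncor /= in l3; rewrite !mulNr !ii_cor /= !ncor /= in l4.
have q1 : - s < Re (z - c) < s by rewrite x0.
have q2 : - s < Im (z - c) < s by rewrite y0.
have q3 : - s < - Re (z - c) < s by rewrite ltrN2 x1 /=; lra.
have q4 : - s < - Im (z - c) < s by rewrite ltrN2 y1 /=; lra.
have := lerD (lerD (l1 q1 q2) (l2 q2 q3)) (lerD (l3 q3 q4) (l4 q4 q1)).
have -> : (Im (z - c) + s) / (4 * s) + (- Re (z - c) + s) / (4 * s) +
  ((- Im (z - c) + s) / (4 * s) + (Re (z - c) + s) / (4 * s)) = 1 by field; rewrite gt_eqF.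
by rewrite /bd ImD ImD ImD addrA.
Qed.

Lemma uniform_radius (K V : set C) (F : C -> C) : compact K -> open V -> K `<=` V -> (forall z, V z -> hol F z) ->
 exists (r M : R), [/\ 0 < r, 0 < M & forall y w, K y -> nm (w - y) < r -> V w /\ nm (F w) <= M].
Proof.
move=> cK oV KV dF.
have [y Ky|N NP] := @compact_eventually R C K (fun n y => forall w, nm (w - y) < n.+1%:R^-1 -> V w /\ nm (F w) <= n.+1%:R) cK.
 have Vy := KV y Ky; have [r1 r10 [M M0 MP]] := locally_bounded (dF y Vy).
 have /open_rP/(_ y Vy)[r2 r20 r2P] := oV.
 have m0 : 0 < min r1 r2 / 2 by rewrite divr_gt0 // lt_min r10.
 have [N1 N1P] := arch_inv m0.
 have [N2 N2P] := @arch_inv R M^-1 ltac:(by rewrite invr_gt0).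
 exists (min r1 r2 / 2); first exact: m0.
 exists (maxn N1 N2) => n; rewrite geq_max => /andP[n1 n2] z zy w wz.
 have : nm (w - y) < min r1 r2.
  by have := nm_tri z w y; have := N1P n n1; move: zy wz; move: (min r1 r2) (n.+1%:R^-1) => p1 p2; clra.
 rewrite lt_min => /andP[w1 w2]; split; first exact: r2P.
 apply: (le_trans (MP w w1)); have := N2P n n2; rewrite ltf_pV2 ?posrE ?ltr0n //; exact: ltW.
exists N.+1%:R^-1, N.+1%:R; split; rewrite ?invr_gt0 ?ltr0n // => y w Ky wy.
exact: (NP N (leqnn N) y Ky w wy).
Qed.

Section Rational.
Variable K : set C.
Definition rational (u : C -> C) := exists p q : {poly C}, forall z, K z -> q.[z] != 0 /\ u z = p.[z] / q.[z].

Lemma rationalD u v : rational u -> rational v -> rational (fun z => u z + v z).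
Proof.
move=> [p [q h]] [p' [q' h']]; exists (p * q' + p' * q), (q * q') => z Kz.
have [q0 ->] := h z Kz; have [q'0 ->] := h' z Kz; rewrite !(hornerM, hornerD) mulf_neq0 //; split=> //.
by field; rewrite q0 q'0.
Qed.

Lemma rationalZ c u : rational u -> rational (fun z => c * u z).
Proof.
move=> [p [q h]]; exists (c *: p), q => z Kz; have [q0 ->] := h z Kz.
by rewrite hornerZ mulrA.
Qed.

Lemma rational_ext u v : (forall z, K z -> u z = v z) -> rational v -> rational u.
Proof. by move=> uv [p [q h]]; exists p, q => z Kz; rewrite uv //; exact: h. Qed.

Lemma rational_sum (I : eqType) (s : seq I) (u : I -> C -> C) : (forall i, i \in s -> rational (u i)) -> rational (fun z => \sum_(i <- s) u i z).
Proof.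
elim: s => [|i s IH] h.
 by exists 0, 1 => z _; rewrite hornerC; split; [exact: oner_neq0|rewrite big_nil horner0 mul0r].
apply: (@rational_ext _ (fun z => u i z + \sum_(j <- s) u j z)); first by move=> z _; rewrite big_cons.
by apply: rationalD; [apply: h; exact: mem_head|apply: IH => j js; apply: h; rewrite inE js orbT].
Qed.

Lemma rational_div u v : rational u -> rational v -> (forall z, K z -> v z != 0) -> rational (fun z => u z / v z).
Proof.
move=> [p [q h]] [p' [q' h']] v0; exists (p * q'), (q * p') => z Kz; have := v0 z Kz.
have [q0 ->] := h z Kz; have [q'0 ->] := h' z Kz; rewrite mulf_eq0 negb_or invr_eq0 => /andP[p'0 _].
rewrite !hornerM mulf_neq0 //; split=> //.
by field; rewrite q0 q'0 p'0.
Qed.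

(** Each midpoint sum of the Cauchy kernel is already a rational function of z, with its poles on
    the segment. *)
Lemma rational_seg n (g : C -> C) a b : (forall z w, K z -> on_seg a b w -> w - z != 0) ->
 rational (fun z => seg n (fun w => g w / (w - z)) a b).
Proof.
elim: n a b => [|n IH] a b h /=.
 apply: rationalZ; exists (g ((a + b) / 2))%:P, (((a + b) / 2)%:P - 'X) => z Kz.
 by rewrite !hornerE; split=> //; apply: h => //; exact: on_seg_mid.
by apply: rationalD; apply: IH => z w Kz hw; apply: h => //; [exact: on_seg_half1|exact: on_seg_half2].
Qed.

End Rational.

End Runge.

Section RungeTheorem.
Variable R : realType. Local Notation C := (cplx R).

Lemma segB n (f g : C -> C) a b : seg n (fun w => f w - g w) a b = seg n f a b - seg n g a b.
Proof. by elim: n a b => [|n IH] a b /=; [rewrite mulrBr|rewrite !IH; ring]. Qed.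

Lemma diff_quot (V : nmod C) (f g : V -> C) x : hol f x -> hol g x -> g x != 0 ->
 hol (fun y => f y / g y) x.
Proof. by move=> df dg g0; apply: holM; [exact: df|apply: differentiableV; [exact: dg|exact: g0]]. Qed.

Lemma difference_quotient (K : set C) (F : C -> C) (r M : R) z : 0 < r -> 0 <= M ->
 (forall y w, K y -> nm (w - y) < r -> hol F w /\ nm (F w) <= M) -> K z ->
 exists q : C -> C, [/\ forall w, w != z -> q w = (F w - F z) / (w - z),
  forall w y, K y -> nm (w - y) < r -> hol q w &
  forall w y, K y -> nm (w - y) < r / 2 -> nm (q w) <= 16 * M / r].
Proof.
move=> r0 M0 hF Kz.
have dF w : nm (w - z) < r -> hol F w by move=> /(hF z w Kz)[].
have bF w : nm (w - z) < r -> nm (F w) <= M by move=> /(hF z w Kz)[].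
have h0 := deriv_bound1 r0 dF bF.
have hq := quotient_holo r0 dF.
have [D1 D1E] : exists D1, 'd F z 1 = D1 by exists ('d F z 1).
have D1b : nm D1 <= 8 * M / r by rewrite -D1E.
have dz : hol (fun w => if w == z then D1 else (F w - F z) / (w - z)) z.
 by rewrite -D1E; apply: hq; rewrite subrr nm0.
clear h0 hq D1E.
pose q w := if w == z then D1 else (F w - F z) / (w - z).
have qE w : w != z -> q w = (F w - F z) / (w - z) by rewrite /q => /negbTE ->.
exists q; split; [exact: qE| |] => w y Ky wy.
 have [->|wz] := eqVneq w z; first exact: dz.
 have wz0 : 0 < nm (w - z) by rewrite nm_gt0 subr_eq0.
 have dw : hol (fun w => (F w - F z) / (w - z)) w.
  apply: diff_quot; last by rewrite subr_eq0.
   by apply: holB; [case: (hF y w Ky wy)|exact: hol_cst].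
  exact: diff_subc.
 have loc u : nm (u - w) < nm (w - z) -> (F u - F z) / (u - z) = q u.
  by move=> uw; rewrite qE //; apply: contraTneq uw => ->; rewrite nmC ltxx.
 exact: (@diff_local_eq R C C (fun w => (F w - F z) / (w - z)) q w _ wz0 loc dw).1.
have Mr : 8 * M / r <= 16 * M / r by rewrite ler_pM2r ?invr_gt0 // ler_wpM2r // ler_nat.
have [->|wz] := eqVneq w z; first by rewrite /q eqxx; exact: le_trans Mr.
rewrite qE // nmM nmV.
have wz0 : 0 < nm (w - z) by rewrite nm_gt0 subr_eq0.
rewrite ler_pdivrMr //.
have [wzr|wzr] := ltP (nm (w - z)) (r / 2).
 by apply: (cauchy_lip (cauchy_targetC R) r0 dF bF wzr); rewrite subrr nm0 divr_gt0.
have h1 : nm (F w) <= M by case: (hF y w Ky _) => //; move: wy r0; clra.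
have h2 : nm (F z) <= M by apply: bF; rewrite subrr nm0.
apply: (le_trans (nmB _ _)); apply: (@le_trans _ _ (16 * M / r * (r / 2))).
 by rewrite (_ : 16 * M / r * (r / 2) = 8 * M); [move: h1 h2 M0; clra|field; rewrite gt_eqF].
by rewrite ler_wpM2l // divr_ge0 ?mulr_ge0 // ltW.
Qed.

Lemma geom_small (A e : R) : 0 <= A -> 0 < e -> exists N, forall n, (N <= n)%N -> A / 2 ^+ n < e.
Proof.
move=> A0 e0; have [k kP] := pow2_small A0 e0; exists k => n kn; apply: le_lt_trans kP.
by rewrite ler_wpM2l // lef_pV2 ?posrE ?exprn_gt0 // ler_eXn2l // ltr1n.
Qed.

Lemma sum_norm_le (I : eqType) (s : seq I) (f : I -> C) (A : R) : (forall i, i \in s -> nm (f i) <= A) ->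
 nm (\sum_(i <- s) f i) <= (size s)%:R * A.
Proof.
elim: s => [|i s IH] h; first by rewrite big_nil nm0 mul0r.
rewrite big_cons /= -natr1 mulrDl mul1r [leRHS]addrC; apply: (le_trans (nmD _ _)); apply: lerD.
 exact: h (mem_head _ _).
by apply: IH => j js; apply: h; rewrite inE js orbT.
Qed.

(** Goursat's theorem gives the limit 0 without a rate and [bd_lip] gives the distance to later
    levels; together they bound each level, uniformly in a parameter on which L does not depend. *)
Lemma bd_vanish_rate n (f : C -> C) c (s L : R) : 0 < s -> 0 <= L ->
 (forall w, sq c s w -> hol f w /\ nm ('d f w 1) <= L) ->
 nm (bd n f c (rc s)) <= 16 * L * s ^+ 2 / 2 ^+ n.
Proof.
move=> s0 L0 hf; apply/ler_addgt0Pr => e e0.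
have [N NP] := goursat s0 (fun w ws => (hf w ws).1) e0.
have := bd_lip n N (ltW s0) L0 (fun w (ws : side c s w) => hf w ws.1).
have := NP (n + N)%N (leq_addl _ _); have := nm_sub (bd n f c (rc s)) (bd (n + N) f c (rc s)).
rewrite [nm (bd n f c (rc s) - _)]nmC.
by move: (nm _) (nm _) (nm _) (_ / _) => p1 p2 p3 p4; clra.
Qed.

(** The approximant is N_n / D_n, with F(w) / (w - z) summed over the edges in the numerator and 1 /
    (w - z) in the denominator, so the value of 2 pi i never enters. By the grid identity N_n - F(z)
    D_n is a sum over whole squares of the holomorphic difference quotient, hence uniformly small;
    it remains to keep D_n away from 0. *)
Theorem runge (K V : set C) (F : C -> C) : compact K -> open V -> K `<=` V -> (forall z, V z -> hol F z) ->
 forall e : R, 0 < e -> exists2 u, rational K u & forall z, K z -> nm (u z - F z) < e.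
Proof.
move=> cK oV KV dF e e0.
have [r [M [r0 M0 rM]]] := uniform_radius cK oV KV dF.
have [B B0 KB] := @compact_upper R C C K id cK (fun x _ => @cvg_id _ (nbhs x)).
have hF y w : K y -> nm (w - y) < r -> hol F w /\ nm (F w) <= M.
 by move=> Ky /(rM y w Ky)[/dF].
have r40 : 0 < r / 4 by rewrite divr_gt0.
have [s [eta [Qs [E [[s0 eta0 sr uQ] gridE EP [Qnear Qcov] Qdis]]]]] := grid r40 (ltW B0) KB.
pose L := 8 * (16 * M / r) / (r / 4).
have L0 : 0 <= L by rewrite /L !(divr_ge0, mulr_ge0) // ltW.
pose N_ n z := \sum_(x <- E) x.1.1 * seg n (fun w => F w / (w - z)) x.1.2 x.2.
pose D_ n z := \sum_(x <- E) x.1.1 * seg n (fun w => 1 / (w - z)) x.1.2 x.2.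
pose far z := forall x, x \in E -> forall w, on_seg x.1.2 x.2 w -> eta / 2 <= nm (w - z).
have eta20 : 0 < eta / 2 by rewrite divr_gt0.
have farK z z' : K z -> nm (z' - z) <= eta / 2 -> far z'.
 move=> Kz zz x xE w hw; have [_ _ /(_ z w Kz hw) h] := EP x xE.
 by have := @nm_tri R C z' w z; move: zz h; clra.
have far0 z x w : far z -> x \in E -> on_seg x.1.2 x.2 w -> w - z != 0.
 by move=> fz xE hw; rewrite -nm_gt0; apply: lt_le_trans (fz x xE w hw).
have far_self z : K z -> far z by move=> Kz; apply: (farK z) => //; rewrite subrr nm0 ltW.
have num_small n z : K z -> nm (N_ n z - F z * D_ n z) <= (size Qs)%:R * (16 * L * s ^+ 2 / 2 ^+ n).
 move=> Kz; have [q [qE dq bq]] := difference_quotient r0 (ltW M0) hF Kz.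
 have -> : N_ n z - F z * D_ n z = \sum_(c <- Qs) bd n q c (rc s).
  rewrite gridE /N_ /D_ mulr_sumr -sumrB !big_seq; apply: eq_bigr => x xE.
  rewrite mulrCA -mulrBr; congr (_ * _).
  rewrite -segZ -segB; apply: eq_seg => w hw.
  have wz := far0 z x w (far_self z Kz) xE hw.
  by rewrite qE; [field|rewrite -subr_eq0].
 apply: sum_norm_le => c cQ; apply: bd_vanish_rate => // w /(Qnear c w cQ)[y Ky wy].
 have wy' : nm (w - y) < r by move: wy r0; clra.
 split; first exact: dq Ky wy'.
 apply: (deriv_bound1 r40) => u uw.
  by apply: (dq u y Ky); have := @nm_tri R C w u y; move: wy uw r0; clra.
 by apply: (bq u y Ky); have := @nm_tri R C w u y; move: wy uw r0; clra.
have inv_lip z w w' x : far z -> x \in E -> on_seg x.1.2 x.2 w -> on_seg x.1.2 x.2 w' ->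
  nm (1 / (w - z) - 1 / (w' - z)) <= (eta / 2) ^- 2 * nm (w - w').
 move=> fz xE hw hw'; have a0 := far0 z x w fz xE hw; have b0 := far0 z x w' fz xE hw'.
 have -> : 1 / (w - z) - 1 / (w' - z) = (w' - w) / ((w - z) * (w' - z)) by field; rewrite a0 b0.
 rewrite nmM nmV nmM [@nm R C (w' - w)]nmC [leRHS]mulrC ler_wpM2l ?nm_ge0 // lef_pV2 ?posrE ?exprn_gt0 ?mulr_gt0 ?nm_gt0 //.
 by rewrite expr2; apply: ler_pM; rewrite ?(ltW eta20) //; [exact: (fz x xE w hw)|exact: (fz x xE w' hw')].
pose CC := (size E)%:R * (2 * ((eta / 2) ^- 2 * (2 * s) ^+ 2)).
have e2 : 0 <= (eta / 2) ^- 2 by rewrite invr_ge0 exprn_ge0 // ltW.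
have s2p : 0 <= (2 * s) ^+ 2 by rewrite exprn_ge0 // mulr_ge0 // ltW.
have CC0 : 0 <= CC by apply: mulr_ge0 => //; apply: mulr_ge0 => //; apply: mulr_ge0.
have den_cauchy n k z : far z -> nm (D_ (n + k) z - D_ n z) <= CC / 2 ^+ n.
 move=> fz; rewrite /D_ -sumrB; apply: (@le_trans _ _ ((size E)%:R * (2 * ((eta / 2) ^- 2 * (2 * s) ^+ 2 / 2 ^+ n)))).
  apply: sum_norm_le => x xE; rewrite -mulrBr nmM; have [c2 ln _] := EP x xE.
  apply: ler_pM; rewrite ?nm_ge0 //; rewrite -ln.
  by apply: seg_lip => // w w' hw hw'; exact: (inv_lip z w w' x).
 by rewrite /CC !mulrA.
have den_lip n z z' : far z -> far z' -> nm (D_ n z - D_ n z') <= (size E)%:R * (2 * ((eta / 2) ^- 2 * nm (z - z') * (2 * s))).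
 move=> fz fz'; rewrite /D_ -sumrB; apply: sum_norm_le => x xE; rewrite -mulrBr nmM; have [c2 ln _] := EP x xE.
 apply: ler_pM; rewrite ?nm_ge0 //; rewrite -ln -segB; apply: seg_bound => w hw.
 have a0 := far0 z x w fz xE hw; have b0 := far0 z' x w fz' xE hw.
 have -> : 1 / (w - z) - 1 / (w - z') = (z - z') / ((w - z) * (w - z')) by field; rewrite a0 b0.
 rewrite nmM nmV nmM [leRHS]mulrC ler_wpM2l ?nm_ge0 // lef_pV2 ?posrE ?exprn_gt0 ?mulr_gt0 ?nm_gt0 //.
 by rewrite expr2; apply: ler_pM; rewrite ?(ltW eta20) //; [exact: (fz x xE w hw)|exact: (fz' x xE w hw)].
have four0 : 0 < 4^-1 :> R by rewrite invr_gt0.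
have [n0 n0P] := geom_small CC0 four0.
(* A point z of [K] may lie on the boundary of a selected square. It is moved slightly towards the
   centre, to z', where its own square contributes at least 1 and the others tend to 0. Passing
   between levels and from z' back to z costs less than 3/4 in all. *)
have den_lower n z : (n0 <= n)%N -> K z -> 4^-1 <= nm (D_ n z).
 move=> nn Kz; have [c cQ [q1 q2]] := Qcov z Kz.
 pose A := (size E)%:R * (2 * ((eta / 2) ^- 2 * (2 * s))).
 have A0 : 0 <= A by apply: mulr_ge0 => //; apply: mulr_ge0 => //; apply: mulr_ge0 => //; rewrite mulr_ge0 // ltW.
 have [t [t0 t1 ts tA]] : exists t : R, [/\ 0 < t, t < 1, t * (2 * s) <= eta / 2 & A * (t * (2 * s)) <= 4^-1].
  have A1 : 0 < A + 1 by rewrite ltr_wpDl.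
  have As : 0 < 8 * ((A + 1) * s) by rewrite mulr_gt0 // mulr_gt0.
  have a10 : 0 < eta / (4 * s) by rewrite divr_gt0 // mulr_gt0.
  have a20 : 0 < (8 * ((A + 1) * s))^-1 by rewrite invr_gt0.
  have [t [t0 th ta1 ta2]] : exists t : R, [/\ 0 < t, t <= 2^-1, t <= eta / (4 * s) & t <= (8 * ((A + 1) * s))^-1].
   exists (min 2^-1 (min (eta / (4 * s)) (8 * ((A + 1) * s))^-1)).
   by rewrite !lt_min a10 a20 invr_gt0 ltr0n !ge_min !lexx !orbT.
  have s20 : 0 < 2 * s by rewrite mulr_gt0.
  exists t; split; [exact: t0|by move: th; clra| |].
   have -> : eta / 2 = eta / (4 * s) * (2 * s) by field; rewrite gt_eqF.
   by rewrite ler_pM2r.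
  apply: (@le_trans _ _ ((A + 1) * (t * (2 * s)))).
   by rewrite ler_wpM2r ?mulr_ge0 ?lerDl // ltW.
  have -> : 4^-1 = (A + 1) * ((8 * ((A + 1) * s))^-1 * (2 * s)) by field; rewrite !gt_eqF.
  by rewrite ler_pM2l // ler_pM2r.
 pose z' := z + rc t * (c - z).
 have zz : nm (z' - z) <= t * (2 * s).
  rewrite /z' addrAC subrr add0r nmM nm_rc gtr0_norm // ler_pM2l // nmC; exact: (@sq_norm R c s z (conj q1 q2)).
 have fz' : far z' by apply: (farK z) => //; exact: le_trans ts.
 have fz := far_self z Kz.
 have in1 (p : R) : `|p| <= s -> `|(1 - t) * p| < s.
  move=> ps; rewrite normrM ger0_norm; last by move: t1; clra.
  have h : (1 - t) * `|p| <= (1 - t) * s by rewrite ler_wpM2l //; move: t1; clra.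
  have ts0 : 0 < t * s by rewrite mulr_gt0.
  by move: h ts0; rewrite mulrBl mul1r; clra.
 have zc : z' - c = rc (1 - t) * (z - c) by rewrite /z' rcB rc1; ring.
 have i1 : `|Re (z' - c)| < s by rewrite zc Re_rcM; exact: in1.
 have i2 : `|Im (z' - c)| < s by rewrite zc Im_rcM; exact: in1.
 have Dge : 1 <= nm (D_ n z') + 4^-1 + 4^-1.
  apply/ler_addgt0Pr => d d0.
  have others : van (fun k => \sum_(c' <- rem c Qs) bd k (fun w => 1 / (w - z')) c' (rc s)).
   have : forall c', c' \in rem c Qs -> van (fun k => bd k (fun w => 1 / (w - z')) c' (rc s)).
    move=> c' c'r; apply: (goursat s0) => w ws.
    have [c'c c'Q] : c' != c /\ c' \in Qs by have := c'r; rewrite mem_rem_uniq // inE => /andP[].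
    apply: diff_quot; [exact: hol_cst|exact: diff_subc|].
    rewrite subr_eq0; apply: contraTneq c'c => wz; rewrite eq_sym negbK eq_sym; apply/negPn/negP => cc.
    by rewrite wz in ws; apply: (Qdis c c' z' cQ c'Q _ i1 i2 ws); rewrite eq_sym.
   elim: (rem c Qs) => [|c' s' IH] h d' d'0; first by exists 0%N => k _; rewrite big_nil nm0.
   have := vanD (h c' (mem_head _ _)) (IH (fun y ys => h y (mem_behead (s := c' :: s') ys))) d'0.
   by move=> [k kP]; exists k => k' /kP; rewrite big_cons.
  have [k kP] := others d d0.
  have h1 := kP (n + k)%N (leq_addl _ _).
  have DE : D_ (n + k) z' = bd (n + k) (fun w => 1 / (w - z')) c (rc s) + \sum_(c' <- rem c Qs) bd (n + k) (fun w => 1 / (w - z')) c' (rc s).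
   by rewrite /D_ -(gridE (n + k)%N (fun w => 1 / (w - z'))) (perm_big _ (perm_to_rem cQ)) big_cons.
  have h2 : 1 <= nm (bd (n + k) (fun w => 1 / (w - z')) c (rc s)).
   apply: le_trans (Im_le_nm _); apply: le_trans (ler_norm _).
   have -> : (fun w => 1 / (w - z')) = (fun w => (w - z')^-1) by apply/funext => w; rewrite mul1r.
   exact: square_lower.
  have h3 := den_cauchy n k z' fz'; have h4 := n0P n nn.
  have := @nm_sub R C (bd (n + k) (fun w => 1 / (w - z')) c (rc s)) (- \sum_(c' <- rem c Qs) bd (n + k) (fun w => 1 / (w - z')) c' (rc s)).
  rewrite opprK nmN -DE.
  have := @nm_sub R C (D_ (n + k) z') (D_ n z').
  move: h1 h2 h3 h4; move: (nm _) (nm _) (nm _) (nm _) (nm _) (_ / _) => p1 p2 p3 p4 p5 p6; clra.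
 have h5 := den_lip n z' z fz' fz.
 have h6 : (size E)%:R * (2 * ((eta / 2) ^- 2 * nm (z' - z) * (2 * s))) <= A * (t * (2 * s)).
  have -> : (size E)%:R * (2 * ((eta / 2) ^- 2 * nm (z' - z) * (2 * s))) = A * nm (z' - z) by rewrite /A; ring.
  by rewrite ler_wpM2l.
 have := @nm_sub R C (D_ n z') (D_ n z).
 move: Dge h5 h6 tA; move: (nm _) (nm _) (nm _) (A * _) (_%:R * _) => p1 p2 p3 p4 p5; clra.
have A20 : 0 <= (size Qs)%:R * (16 * L * s ^+ 2) by apply: mulr_ge0 => //; apply: mulr_ge0; [rewrite mulr_ge0|rewrite exprn_ge0 // ltW].
have e40 : 0 < e / 4 by rewrite divr_gt0.
have [n1 n1P] := geom_small A20 e40.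
pose n := maxn n0 n1.
have Dn z : K z -> D_ n z != 0.
 by move=> Kz; rewrite -nm_gt0; apply: lt_le_trans (den_lower n z (leq_maxl _ _) Kz); rewrite invr_gt0.
exists (fun z => N_ n z / D_ n z).
 apply: rational_div => [||//]; apply: rational_sum => x xE; apply: rationalZ.
  by apply: rational_seg => z w Kz hw; exact: (far0 z x w (far_self z Kz) xE hw).
 by apply: (@rational_seg R K n (fun=> 1)) => z w Kz hw; exact: (far0 z x w (far_self z Kz) xE hw).
move=> z Kz; have -> : N_ n z / D_ n z - F z = (N_ n z - F z * D_ n z) / D_ n z by field; exact: Dn.
have D0 : 0 < nm (D_ n z) by rewrite nm_gt0 Dn.
rewrite nmM nmV ltr_pdivrMr //.
have h1 := num_small n z Kz; have h2 := n1P n (leq_maxr _ _); have h3 := den_lower n z (leq_maxl _ _) Kz.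
apply: (le_lt_trans h1); rewrite mulrA; apply: (lt_le_trans h2).
by rewrite ler_pM2l.
Qed.

End RungeTheorem.

(** * Compact neighbourhoods; division and interpolation in one variable *)

Section Neighbourhoods.
Variable R : realType. Local Notation C := (cplx R).
Variable n : nat.
Local Notation X := 'rV[C]_n.

Definition thick (K : set X) (d : R) : set X := [set x | exists2 y, K y & nm (x - y) < d].

Lemma thick_open K d : open (thick K d).
Proof.
apply/open_rP => x [y Ky xy]; exists (d - nm (x - y)); first by rewrite subr_gt0.
move=> z zx; exists y; first exact: Ky.
by have := nm_tri x z y; move: zx; clra.
Qed.

Lemma thick_self (K : set X) d : 0 < d -> K `<=` thick K d.
Proof. by move=> d0 x Kx; exists x; rewrite // subrr nm0. Qed.

Lemma thick_closure K d d' : d < d' -> closure (thick K d) `<=` thick K d'.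
Proof.
move=> dd x /closure_rP cl; have e0 : 0 < d' - d by rewrite subr_gt0.
have [z [y Ky zy] zx] := cl _ e0; exists y => //.
by have := nm_tri z x y; rewrite [nm (x - z)]nmC; move: zx zy; clra.
Qed.

Lemma thick_compact K d : compact K -> compact (closure (thick K d)).
Proof.
move=> cK; have [B B0 KB] := @compact_upper R X X K id cK (fun x _ => @cvg_id _ (nbhs x)).
apply: (@bounded_closed_cpt R n _ (B + (d + 1))); first exact: closed_closure.
move=> x /(@thick_closure K d (d + 1)) [|y Ky xy]; first by rewrite ltrDl.
by have := KB y Ky; have := nmD y (x - y); rewrite subrKC; move: xy; clra.
Qed.

Lemma thick_sub K (V : set X) : compact K -> open V -> K `<=` V -> exists2 d : R, 0 < d & thick K d `<=` V.
Proof.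
move=> cK /open_rP oV KV.
have [y Ky|e e0 eP] := @compact_radius R X K (fun d y => forall w, nm (w - y) < d -> V w) cK.
 have [e e0 eP] := oV y (KV y Ky); exists (e / 2); first by rewrite divr_gt0.
 move=> d d0 de z zy w wz; apply: eP; have := nm_tri z w y; move: zy wz de; clra.
exists (e / 2); first by rewrite divr_gt0.
by move=> x [y Ky xy]; apply: (eP (e / 2)) xy => //; move: e0; clra.
Qed.

Lemma evalmp_lip (p : mpoly n C) (rho : R) : exists2 L : R, 0 < L & forall x y, nm x < rho -> nm y < rho ->
 nm (evalmp p x - evalmp p y) <= L * nm (x - y).
Proof.
have [rho0|rho0] := leP rho 0.
 by exists 1 => // x y xr; have := le_lt_trans (nm_ge0 x) xr; rewrite ltNge rho0.
have [M M0 MP] := @compact_upper R X C [set x | nm x <= 2 * rho] (evalmp p) (@ball_compact R n (2 * rho))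
 (fun x _ => diff_cont (diff_evalmp p x)).
have r0 : 0 < 2 * rho by rewrite mulr_gt0.
exists (16 * M / (2 * rho)); first by rewrite divr_gt0 // mulr_gt0.
move=> x y xr yr; apply: (@cauchy_lip R X C (cauchy_targetC R) (evalmp p) 0 (2 * rho) M r0).
- by move=> z _; exact: diff_evalmp.
- by move=> z; rewrite subr0 => zr; apply: MP; exact: ltW.
- by rewrite subr0; move: xr; clra.
- by rewrite subr0; move: yr; clra.
Qed.

End Neighbourhoods.

Section OneVariable.
Variable R : realType. Local Notation C := (cplx R).
Variable V : set C.
Hypothesis oV : open V.

Lemma divide_at (F : C -> C) a : V a -> (forall z, V z -> hol F z) ->
 exists2 F1 : C -> C, (forall z, V z -> hol F1 z) & forall z, V z -> F z = F a + (z - a) * F1 z.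
Proof.
move=> Va dF; have /open_rP/(_ a Va)[r r0 rV] := oV.
have dF' w : nm (w - a) < r -> hol F w by move=> /rV/dF.
have hq := quotient_holo r0 dF'.
have [D1 D1E] : exists D1, 'd F a 1 = D1 by exists ('d F a 1).
have dz : hol (fun w => if w == a then D1 else (F w - F a) / (w - a)) a.
 by rewrite -D1E; apply: hq; rewrite subrr nm0.
clear hq D1E.
pose q w := if w == a then D1 else (F w - F a) / (w - a).
have qE w : w != a -> q w = (F w - F a) / (w - a) by rewrite /q => /negbTE ->.
exists q => z Vz.
 have [->|za] := eqVneq z a; first exact: dz.
 have za0 : 0 < nm (z - a) by rewrite nm_gt0 subr_eq0.
 have dw : hol (fun w => (F w - F a) / (w - a)) z.
  apply: diff_quot; [|exact: diff_subc|by rewrite subr_eq0].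
  by apply: holB; [exact: dF|exact: hol_cst].
 have loc u : nm (u - z) < nm (z - a) -> (F u - F a) / (u - a) = q u.
  by move=> uw; rewrite qE //; apply: contraTneq uw => ->; rewrite nmC ltxx.
 exact: (@diff_local_eq R C C (fun w => (F w - F a) / (w - a)) q z _ za0 loc dw).1.
have [->|za] := eqVneq z a; first by rewrite subrr mul0r addr0.
by rewrite qE // mulrC divfK ?subr_eq0 // subrKC.
Qed.

(** Repeated division at the listed points. Repetitions in the list are allowed, so the remainder
    interpolates with multiplicities. *)
Lemma interpolation (zs : seq C) (F : C -> C) : (forall a, a \in zs -> V a) -> (forall z, V z -> hol F z) ->
 exists (p : {poly C}) (F1 : C -> C), (forall z, V z -> hol F1 z) /\
  forall z, V z -> F z = p.[z] + (\prod_(a <- zs) ('X - a%:P)).[z] * F1 z.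
Proof.
elim: zs F => [|a zs IH] F zsV dF.
 by exists 0, F; split=> [|z _]; [exact: dF|rewrite big_nil horner0 hornerC add0r mul1r].
have [F1 dF1 FE] := divide_at (zsV a (mem_head _ _)) dF.
have [|p [F2 [dF2 F1E]]] := IH F1 _ dF1; first by move=> b bz; apply: zsV; rewrite inE bz orbT.
exists ((F a)%:P + ('X - a%:P) * p), F2; split=> // z Vz.
by rewrite FE // F1E // big_cons !hornerE; ring.
Qed.

(** Finitely many discs cover [K], each without zeros except possibly at its centre. The power of z
    - a at the centres is divided out disc by disc, and a factor already free of zeros on a disc
    remains so. *)
Lemma factor_zeros (K : set C) (f : C -> C) : compact K -> K `<=` V -> (forall z, V z -> hol f z) ->
 (forall a, K a -> forall e : R, 0 < e -> exists2 z, nm (z - a) < e & f z != 0) ->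
 exists (zs : seq C) (u : C -> C), [/\ forall a, a \in zs -> V a, forall z, V z -> hol u z,
  forall z, V z -> f z = (\prod_(a <- zs) ('X - a%:P)).[z] * u z & forall z, K z -> u z != 0].
Proof.
move=> cK KV df nz.
have iso a : exists r : R, K a -> [/\ 0 < r, forall z, nm (z - a) < r -> V z & forall z, nm (z - a) < r -> z != a -> f z != 0].
 have [Ka|nKa] := pselect (K a); last by exists 0.
 have /open_rP/(_ a (KV a Ka))[r r0 rV] := oV.
 have [h|[d d0 dP]] := isolated_zero r0 (fun z zr => df z (rV z zr)).
  have r16 : 0 < r / 16 by rewrite divr_gt0.
  by have [z /h ->] := nz a Ka _ r16; rewrite eqxx.
 exists (min r d) => _; split; first by rewrite lt_min r0.
  by move=> z; rewrite lt_min => /andP[/rV].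
 by move=> z; rewrite lt_min => /andP[_ /dP].
have [r rP] := choice iso.
have := cK; rewrite compact_cover => /(_ _ K (fun a => [set z | nm (z - a) < r a])) [].
- by move=> a Ka; exact: open_rball.
- by move=> z Kz; exists z => //=; have [r0 _ _] := rP z Kz; rewrite subrr nm0.
move=> D DK cov.
have main : forall l : seq C, (forall a, a \in l -> K a) -> exists (zs : seq C) (u : C -> C), [/\ forall a, a \in zs -> V a,
  forall z, V z -> hol u z, forall z, V z -> f z = (\prod_(a <- zs) ('X - a%:P)).[z] * u z &
  forall a z, a \in l -> nm (z - a) < r a -> u z != 0].
 elim=> [|a l IH] lD.
  by exists [::], f; split=> // z _; rewrite big_nil hornerC mul1r.
 have [|zs [u [zsV du fE un]]] := IH; first by move=> b bl; apply: lD; rewrite inE bl orbT.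
 have Ka : K a by apply: lD; exact: mem_head.
 have [r0 rV rf] := rP a Ka.
 have [h|[k [g [dg ga ug]]]] := zero_dichotomy r0 (fun z zr => du z (rV z zr)).
  have m0 : 0 < r a / 16 by rewrite divr_gt0.
  have [z za] := nz a Ka _ m0; rewrite fE ?h ?mulr0 ?eqxx //; apply: rV; apply: lt_trans za _.
  by move: r0; clra.
 pose u' z := if z == a then g a else u z / (z - a) ^+ k.
 have u'E z : z != a -> u' z = u z / (z - a) ^+ k by rewrite /u' => /negbTE ->.
 have u'g z : nm (z - a) < r a -> g z = u' z.
  move=> zr; have [->|za] := eqVneq z a; first by rewrite /u' eqxx.
  by rewrite u'E // ug // [_ * g z]mulrC mulfK // expf_neq0 // subr_eq0.
 have uE z : V z -> u z = (z - a) ^+ k * u' z.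
  move=> Vz; have [->|za] := eqVneq z a; last by rewrite u'E // mulrC divfK // expf_neq0 // subr_eq0.
  by rewrite ug ?subrr ?nm0 // /u' eqxx.
 exists (nseq k a ++ zs), u'; split.
 - move=> b; rewrite mem_cat => /orP[|/zsV//]; rewrite mem_nseq => /andP[_ /eqP ->]; exact: KV.
 - move=> z Vz; have [->|za] := eqVneq z a.
   by have aa : nm (a - a) < r a by [rewrite subrr nm0]; exact: (diff_local_eq r0 u'g (dg a aa)).1.
  have za0 : 0 < nm (z - a) by rewrite nm_gt0 subr_eq0.
  have dw : hol (fun w => u w / (w - a) ^+ k) z.
   apply: diff_quot; [exact: du|apply: diff_pow; exact: diff_subc|].
   by rewrite expf_neq0 // subr_eq0.
  have loc w : nm (w - z) < nm (z - a) -> u w / (w - a) ^+ k = u' w.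
   by move=> uw; rewrite u'E //; apply: contraTneq uw => ->; rewrite nmC ltxx.
  exact: (diff_local_eq za0 loc dw).1.
 - move=> z Vz; rewrite fE // uE // big_cat /= hornerM.
  have -> : (\prod_(b <- nseq k a) ('X - b%:P)).[z] = (z - a) ^+ k.
   by rewrite big_nseq -Monoid.iteropE /= -[iterop _ _ _ _]/(('X - a%:P) ^+ k) horner_exp hornerXsubC.
  ring.
 - move=> b z; rewrite inE => /orP[/eqP ->|bl] zr.
   have [->|za] := eqVneq z a; first by rewrite /u' eqxx.
   have := rf z zr za; rewrite fE ?uE; try exact: rV.
   by rewrite mulrA mulf_eq0 negb_or => /andP[].
  have := un b z bl zr; have Kb : K b by apply: lD; rewrite inE bl orbT.
  by rewrite uE ?mulf_eq0 ?negb_or => [/andP[]//|]; have [_ h _] := rP b Kb; exact: h.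
have [zs [u [h1 h2 h3 h4]]] := main (finmap.enum_fset D) (fun a aD => set_mem (DK a aD)).
by exists zs, u; split=> // z /cov[a aD za]; exact: h4 za.
Qed.

End OneVariable.

(** * The case n = 1 *)

Section Base.
Variable R : realType. Local Notation C := (cplx R).

(** Stronger than the required conclusion by a neighbourhood of the closure of [U0]. The inductive
    step needs the approximations of the coefficients on an open set into which compact
    neighbourhoods fit. *)
Definition approximable n k q (f : 'rV[C]_n -> 'rV[C]_k) (Nu : set 'rV[C]_(n + k)) (Q : 'rV[C]_(n + k) -> 'rV[C]_q)
  (U0 : set 'rV[C]_n) :=
 exists U0' : set 'rV[C]_n, [/\ open U0', closure U0 `<=` U0' & exists f_ : nat -> 'rV[C]_n -> 'rV[C]_k,
  [/\ forall nu, nash U0' (f_ nu), {uniform U0', f_ @ \oo --> f} & forall nu, solves Nu Q U0' (f_ nu)]].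

Lemma unipoly_coefs (K : nzRingType) d (p : {poly K}) : p \is monic -> size p = d.+1 -> unipoly (\row_(i < d) p`_(d - i.+1)) = p.
Proof.
move=> pm ps; apply/polyP => i; rewrite /unipoly /lowpoly coefD coefXn coef_sum.
have [->|id] := eqVneq i d.
 rewrite big1 => [|j _]; first by rewrite addr0; have /monicP := pm; rewrite /lead_coef ps.
 rewrite coefZ coefXn mxE; case: eqP => [E|]; last by rewrite mulr0.
 by have := ltn_ord j; lia.
rewrite add0r; have [idlt|dlt] := ltnP i d.
 have h : (d - i.+1 < d)%N by lia.
 rewrite (bigD1 (Ordinal h)) //= coefZ coefXn mxE /= big1 => [|j /eqP jn].
  by rewrite addr0 (_ : d - (d - i.+1).+1 = i)%N ?eqxx ?mulr1 //; lia.
 rewrite coefZ coefXn; case: eqP => [E|]; last by rewrite mulr0.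
 by case: jn; apply: val_inj => /=; have := ltn_ord j; lia.
rewrite big1 => [|j _]; first by rewrite nth_default // ps; lia.
by rewrite coefZ coefXn; case: eqP => [E|]; rewrite ?mulr0 //; lia.
Qed.

Lemma wpol_roots_choice d : exists rs : 'rV[C]_d -> seq C, forall a, size (rs a) = d /\ unipoly a = \prod_(z <- rs a) ('X - z%:P).
Proof. by have [rs rsP] := choice (fun a : 'rV[C]_d => unipoly_roots a); exists rs. Qed.

Lemma poly_mpoly n (i : 'I_n) (p : {poly C}) : exists P : mpoly n C, forall x : 'rV[C]_n, evalmp P x = p.[x 0 i].
Proof.
exists (\sum_(j < size p) mpolyC n p`_j * mpolyX C (mnm1 i) ^+ j) => x.
rewrite evalmp_sum horner_coef; apply: eq_bigr => j _.
by rewrite evalmpM evalmpC /evalmp rmorphXn /= mevalXU.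
Qed.

Lemma solves_adapted n k q (U : set 'rV[C]_n.+1) (f : 'rV[C]_n.+1 -> 'rV[C]_k) Nu (Q : 'rV[C]_(n.+1 + k) -> 'rV[C]_q) P (U0 U0' Ut : set 'rV[C]_n.+1) :
 adapted U f Nu Q P -> open Ut -> open U0' -> closure U0 `<=` U0' -> Ut `<=` U -> relcompact_in U0' Ut ->
 (exists g : nat -> 'rV[C]_n.+1 -> 'rV[C]_k,
    [/\ forall nu, nash Ut (g nu), loc_unif_cvg Ut g f &
      sets_chain_cvg Ut n (fun nu => zeros_along P Ut (g nu)) (zeros_along P Ut f)]) ->
 approximable f Nu Q U0.
Proof. by move=> [_ h] oUt oU0' cl UtU rc hg; exists U0'; split=> //; apply: (h Ut U0'). Qed.

Definition emb (t : C) : 'rV[C]_1 := ext (0 : 'rV[C]_0) t.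

Lemma lastcK (x : 'rV[C]_1) : emb (lastc x) = x.
Proof. by rewrite -[RHS]ext_eta; congr ext; apply/rowP => -[]. Qed.

Lemma emb_lastc t : lastc (emb t) = t. Proof. exact: lastc_ext. Qed.

Lemma nm1_lastc (x y : 'rV[C]_1) : nm (x - y) = nm (lastc x - lastc y).
Proof.
apply/eqP; rewrite eq_le; apply/andP; split; last by rewrite -lastcB; exact: norm_lastc.
apply: nm_mx_le => [|i j]; first exact: nm_ge0.
by rewrite (ord1 i) (ord1 j) -lastcB /lastc (_ : ord_max = 0 :> 'I_1) //; exact: val_inj.
Qed.

Lemma diff_emb t : hol emb t.
Proof.
apply: mx_differentiable => i j; rewrite (_ : (fun t => _) = (fun s => s + 0)); first exact: diff_shift.
by apply/funext => s; rewrite mxE addr0; case: unliftP => [[]|].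
Qed.

(** Write R(x, f) = q0 u with [u] free of zeros on a compact neighbourhood, and f_j = p_j + q0 F_j
    by interpolation at the zeros. Replacing F_j by a close rational function changes R(x, f) by a
    small multiple of q0, too small to create zeros beyond those of q0. *)
Lemma base_case k q (U : set 'rV[C]_1) (f : 'rV[C]_1 -> 'rV[C]_k) Nu (Q : 'rV[C]_(1 + k) -> 'rV[C]_q) P (U0 : set 'rV[C]_1) :
 domain U -> holo U f -> adapted U f Nu Q P -> in_family1 U f P U0 -> approximable f Nu Q U0.
Proof.
move=> [oU cU _] hf ad [oU0 [V [oV VU _ [cK KV]]]].
set K := closure U0 in cK KV.
have [d0 d00 d0P] := thick_sub cK oV KV.
have d20 : 0 < d0 / 2 by rewrite divr_gt0.
have d40 : 0 < d0 / 4 by rewrite divr_gt0.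
have d42 : d0 / 4 < d0 / 2 by move: d00; clra.
have d21 : d0 / 2 < d0 by move: d00; clra.
set Ut := thick K (d0 / 2).
have UtV : Ut `<=` V by move=> x [y Ky xy]; apply: d0P; exists y => //; exact: lt_trans d21.
have sa := @solves_adapted 0 k q U f Nu Q P U0 (thick K (d0 / 4)) Ut ad (@thick_open R 1 K _) (@thick_open R 1 K _).
apply: sa.
- exact: thick_self.
- by move=> x /UtV/VU.
- by split; [exact: thick_compact|exact: thick_closure].
set K1 := closure Ut.
have cK1 : compact K1 by exact: thick_compact.
have K1V : K1 `<=` V by move=> x /(thick_closure d21)/d0P.
have UK1 : Ut `<=` K1 by exact: subset_closure.
pose Vc := [set t : C | V (emb t)]; pose Kc := [set t : C | K1 (emb t)].
have oVc : open Vc.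
 apply/open_rP => t Vt; have /open_rP/(_ _ Vt)[e e0 eP] := oV.
 by exists e => // s st; apply: eP; rewrite nm1_lastc !emb_lastc.
have cKc : compact Kc.
 rewrite (_ : Kc = (@lastc R 0) @` K1); last first.
  by apply/seteqP; split=> [t Kt|t [x Kx <-]]; [exists (emb t); rewrite ?emb_lastc|rewrite /Kc /= lastcK].
 apply: continuous_compact cK1; apply: continuous_subspaceT => x.
 exact: diff_cont (diff_lastc x).
have KVc : Kc `<=` Vc by move=> t /K1V.
have df t : Vc t -> hol (fun t => f (emb t)) t.
 by move=> Vt; apply: (diff_compo emb f); [exact: diff_emb|exact/hf/VU].
pose rf t := evalmp P (row_mx (emb t) (f (emb t))).
have dgr x : U x -> hol (fun x => evalmp P (row_mx x (f x))) x.
 move=> Ux; apply: (diff_compo (fun x => row_mx x (f x)) (evalmp P)); last exact: diff_evalmp.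
 apply: mx_differentiable => i j; case: (split_ordP j) => j' ->.
  under eq_fun do rewrite row_mxEl; exact: differentiable_coord.
 under eq_fun do rewrite row_mxEr; exact: (diff_entry i j' (hf x Ux)).1.
have drf t : Vc t -> hol rf t.
 by move=> Vt; apply: (diff_compo emb (fun x => evalmp P (row_mx x (f x)))); [exact: diff_emb|exact/dgr/VU].
have nz a : Kc a -> forall e : R, 0 < e -> exists2 z, nm (z - a) < e & rf z != 0.
 move=> Ka e e0; apply: contrapT => ne; case: (ad.1) => x Ux; apply.
 apply: (identity_connected oU cU dgr (VU _ (K1V _ Ka)) _ Ux).
 exists e => // y ya; apply/eqP/negPn/negP => Py; apply: ne; exists (lastc y).
  by move: ya; rewrite nm1_lastc emb_lastc.
 by rewrite /rf lastcK.
have [zs [u [zsV du rfE un0]]] := factor_zeros oVc cKc KVc drf nz.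
set q0 := \prod_(a <- zs) ('X - a%:P) in rfE.
have hj j : exists pF : {poly C} * (C -> C), (forall z, Vc z -> hol pF.2 z) /\ forall z, Vc z -> f (emb z) 0 j = pF.1.[z] + q0.[z] * pF.2 z.
 have [z Vz|p [F1 [dF1 FE]]] := @interpolation R Vc oVc zs (fun t => f (emb t) 0 j) zsV.
  exact: (diff_entry 0 j (df z Vz)).1.
 by exists (p, F1).
have [pF pFP] := choice hj.
have cont (g : C -> C) z : hol g z -> {for z, continuous g} by exact: diff_cont.
have [m0 m00 m0P] := compact_lower cKc (fun z Kz => cont _ z (du z (KVc z Kz))) un0.
have [Mq Mq0 MqP] := compact_upper cKc (fun z _ => cont _ z (der_diff (der_horner q0 z)).1).
have [Mx Mx0 MxP] := compact_upper cK1 (fun x _ => @cvg_id _ (nbhs x) : {for x, continuous id}).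
have [Mf Mf0 MfP] := compact_upper cK1 (fun x Kx => diff_cont (hf x (VU _ (K1V _ Kx)))).
pose rho := Mx + Mf + Mq + 1.
have [Lp Lp0 LpP] := evalmp_lip P rho.
(* The change of R(x, f) is at most Lp |q0| ep, hence at most |q0| m0 / 2, while |R(x, f)| = |q0 u|
   is at least |q0| m0. The bound 1 keeps the approximations in the ball where [Lp] is a Lipschitz
   constant. *)
pose ep := min 1 (m0 / (2 * Lp)).
have ep0 : 0 < ep by rewrite lt_min ltr01 divr_gt0 // mulr_gt0.
have ep1 : ep <= 1 by rewrite ge_min lexx.
have epL : Lp * ep <= m0 / 2.
 have : ep <= m0 / (2 * Lp) by rewrite ge_min lexx orbT.
 by rewrite ler_pdivlMr ?mulr_gt0 //; move: (ep) => p; clra.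
clearbody ep.
have hh (nu : nat) j : exists h : C -> C, rational Kc h /\ forall z, Kc z -> nm (h z - (pF j).2 z) < ep / nu.+1%:R.
 have [dF _] := pFP j; have e0 : 0 < ep / nu.+1%:R by rewrite divr_gt0.
 by have [h h1 h2] := runge cKc oVc KVc dF e0; exists h.
have hh2 (nu : nat) : exists h : 'I_k -> C -> C, forall j, rational Kc (h j) /\ forall z, Kc z -> nm (h j z - (pF j).2 z) < ep / nu.+1%:R.
 by have [h hP] := choice (hh nu); exists h.
have [h hP] := choice hh2.
pose g nu (x : 'rV[C]_1) : 'rV[C]_k := \row_j ((pF j).1.[lastc x] + q0.[lastc x] * h nu j (lastc x)).
have Kl x : Ut x -> Kc (lastc x) by move=> /UK1; rewrite /Kc /= lastcK.
have gE nu x j : Ut x -> g nu x 0 j - f x 0 j = q0.[lastc x] * (h nu j (lastc x) - (pF j).2 (lastc x)).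
 move=> Ux; have fE : f x 0 j = (pF j).1.[lastc x] + q0.[lastc x] * (pF j).2 (lastc x).
  by rewrite -((pFP j).2 (lastc x) (KVc _ (Kl x Ux))) lastcK.
 by rewrite fE mxE; ring.
have gf nu x : Ut x -> nm (g nu x - f x) <= nm q0.[lastc x] * (ep / nu.+1%:R).
 move=> Ux; apply: nm_mx_le => [|i j]; first by rewrite mulr_ge0 ?nm_ge0 // divr_ge0 // ltW.
 have -> : (g nu x - f x) i j = g nu x 0 j - f x 0 j by rewrite (ord1 i) [LHS]mxE [X in _ + X]mxE.
 rewrite gE // nmM ler_wpM2l ?nm_ge0 //; apply/ltW.
 by have [_] := hP nu j; apply; exact: Kl.
have epn (nu : nat) : ep / nu.+1%:R <= ep.
 by rewrite ler_pdivrMr ?ltr0n // -{1}[ep]mulr1 ler_pM2l // ler1n.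
have rown (x : 'rV[C]_1) (y : 'rV[C]_k) : K1 x -> nm y <= Mf + Mq -> nm (row_mx x y) < rho.
 move=> Kx yb; apply: (@le_lt_trans _ _ (Mx + (Mf + Mq))); last by rewrite /rho; move: (Mx) (Mf) (Mq) => a b c; clra.
 apply: nm_row_mx; first by rewrite !addr_ge0 // ltW.
  by have := MxP x Kx; move: Mf0 Mq0; rewrite /=; clra.
 by move: yb Mx0; clra.
have zE (gg : 'rV[C]_1 -> 'rV[C]_k) : (forall x, Ut x -> nm (gg x - f x) <= nm q0.[lastc x] * ep) ->
  zeros_along P Ut gg = [set x | Ut x /\ q0.[lastc x] = 0].
 move=> ggf; apply/seteqP; split=> x [Ux Px]; split=> //.
  apply/eqP/negPn/negP => q0x; have Kx := Kl x Ux.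
  have qp : 0 < nm q0.[lastc x] by rewrite nm_gt0.
  have fx : nm (f x) <= Mf by exact: MfP (UK1 x Ux).
  have gx : nm (gg x) <= Mf + Mq.
   have := nmD (f x) (gg x - f x); rewrite subrKC => h1; have h2 := ggf x Ux.
   have h3 : nm q0.[lastc x] * ep <= Mq * 1 by apply: ler_pM; rewrite ?nm_ge0 ?(ltW ep0) // MqP.
   by move: h1 h2 h3 fx; clra.
  have := LpP _ _ (rown x (gg x) (UK1 x Ux) gx) (rown x (f x) (UK1 x Ux) ltac:(by move: fx Mq0; clra)).
  rewrite Px sub0r nmN row_mxB subrr.
  have -> : evalmp P (row_mx x (f x)) = q0.[lastc x] * u (lastc x) by rewrite -rfE ?/rf ?lastcK //; exact: KVc.
  have h4 : nm (row_mx (0 : 'rV[C]_1) (gg x - f x)) <= nm q0.[lastc x] * ep.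
   by apply: nm_row_mx; [rewrite mulr_ge0 ?nm_ge0 // ltW|rewrite nm0 mulr_ge0 ?nm_ge0 // ltW|exact: ggf].
  rewrite nmM => h5; have h6 : nm q0.[lastc x] * m0 <= nm q0.[lastc x] * nm (u (lastc x)) by rewrite ler_pM2l // m0P.
  have h7 : Lp * nm (row_mx (0 : 'rV[C]_1) (gg x - f x)) <= nm q0.[lastc x] * (m0 / 2).
   apply: (@le_trans _ _ (Lp * (nm q0.[lastc x] * ep))); first by rewrite ler_pM2l.
   by rewrite mulrCA ler_pM2l.
  have h8 : 0 < nm q0.[lastc x] * m0 by rewrite mulr_gt0.
  by move: h5 h6 h7 h8; rewrite mulrA; move: (nm _ * m0) (nm _ * nm _) (Lp * _) => p1 p2 p3; clra.
 have gfx : gg x = f x.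
  by apply/eqP; rewrite -subr_eq0 -nm_eq0 eq_le nm_ge0 andbT; have := ggf x Ux; rewrite Px nm0 mul0r.
 by rewrite gfx; have := rfE (lastc x) (KVc _ (Kl x Ux)); rewrite /rf lastcK Px mul0r.
(* The zero set is that of a polynomial with simple roots and constant coefficients, a monic
   polynomial over C^0; so [good_wpol] applies with [delta] equal to 1, and the sequence of zero
   sets is constant. *)
pose zr := undup zs; pose pr := \prod_(a <- zr) ('X - a%:P).
have prs : size pr = (size zr).+1 by rewrite /pr size_prod_XsubC.
have prm : pr \is monic by exact: monic_prod_XsubC.
have prE := unipoly_coefs prm prs.
pose c0 : 'rV[C]_0 -> 'rV[C]_(size zr) := fun=> \row_(i < size zr) pr`_(size zr - i.+1).
have [rs rsP] := wpol_roots_choice (size zr).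
have gW : good Ut (wpol c0).
 apply: (@good_wpol R 0 (size zr) setT c0 (fun=> 1) openT _ _ _ rs rsP Ut (@thick_open R 1 K _)) => //.
 - move=> x _ _ z; rewrite /c0 prE root_prod_XsubC => zz; have : uniq zr by exact: undup_uniq.
  rewrite /pr (big_rem z) //= => uz; rewrite derivM derivXsubC mul1r hornerD hornerM hornerXsubC subrr mul0r addr0.
  by rewrite -rootE root_prod_XsubC mem_rem_uniq // inE eqxx.
 - by move=> x _ e e0; exists (proj x); rewrite ?subrr ?nm0 ?oner_neq0.
have ZE : zeros Ut (wpol c0) = [set x | Ut x /\ q0.[lastc x] = 0].
 have rt x : (wpol c0 x = 0) <-> q0.[lastc x] = 0.
  rewrite /wpol /c0 prE; split=> /rootP; rewrite root_prod_XsubC ?mem_undup => hx; apply/rootP; rewrite root_prod_XsubC ?mem_undup //.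
 by apply/seteqP; split=> x [Ux hx]; split=> //; apply/rt.
exists g; split.
- move=> nu j; apply: (@nash_comp R 1 k); first exact: thick_open.
  move=> x Ux; under eq_fun do rewrite mxE; have [[p [r hr]] _] := hP nu j.
  have dl := diff_lastc x.
  have dpol (pp : {poly C}) : hol (fun x : 'rV[C]_1 => pp.[lastc x]) x.
   apply: (diff_compo (@lastc R 0) (fun t => pp.[t])); [exact: dl|exact: (der_diff (der_horner pp (lastc x))).1].
  have dh : hol (fun x : 'rV[C]_1 => h nu j (lastc x)) x.
   have /open_rP/(_ x Ux)[e e0 eP] := @thick_open R 1 K (d0 / 2).
   have loc y : nm (y - x) < e -> p.[lastc y] / r.[lastc y] = h nu j (lastc y).
    by move=> /eP/Kl/hr[].
   apply: (diff_local_eq e0 loc _).1; apply: diff_quot; [exact: dpol|exact: dpol|].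
   by have [] := hr _ (Kl x Ux).
  by apply: holD; [exact: dpol|apply: holM; [exact: dpol|exact: dh]].
 move=> y0 Uy0; exists Ut, Ut, id, (fun j x => h nu j (lastc x)), (fun i x => x 0 i), (fun x => g nu x 0 j).
 have lE (x : 'rV[C]_1) : lastc x = x 0 ord_max by [].
 split.
 + by split=> //; exact: thick_open.
 + move=> i; have [[p [r hr]] _] := hP nu i.
  have [Pp PpE] := poly_mpoly (ord_max : 'I_1) p; have [Pr PrE] := poly_mpoly (ord_max : 'I_1) r.
  exists 1%N, Pr, (fun=> Pp); split.
   apply/eqP => Pr0; have [] := hr _ (Kl _ Uy0).
   by rewrite lE -PrE Pr0 /evalmp rmorph0 eqxx.
  move=> x /Kl/hr[r0 ->]; rewrite PrE PpE big_ord1 expr0 expr1 mulr1 -lE mulrC divfK //.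
 + move=> i x Ux; have [[p [r hr]] _] := hP nu i.
  have dpol (pp : {poly C}) : hol (fun x : 'rV[C]_1 => pp.[lastc x]) x.
   apply: (diff_compo (@lastc R 0) (fun t => pp.[t])); [exact: diff_lastc|exact: (der_diff (der_horner pp (lastc x))).1].
  have /open_rP/(_ x Ux)[e e0 eP] := @thick_open R 1 K (d0 / 2).
  have loc y : nm (y - x) < e -> p.[lastc y] / r.[lastc y] = h nu i (lastc y).
   by move=> /eP/Kl/hr[].
  apply: (diff_local_eq e0 loc _).1; apply: diff_quot; [exact: dpol|exact: dpol|].
  by have [] := hr _ (Kl x Ux).
 + split=> [i|].
   rewrite (_ : (fun x => _) = evalmp (mpolyX C (mnm1 i))); first exact: polyf_pol.
   by apply/funext => x; rewrite /evalmp mevalXU.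
  have [Pp PpE] := poly_mpoly (ord_max : 'I_1) (pF j).1; have [Pr PrE] := poly_mpoly (ord_max : 'I_1) q0.
  rewrite (_ : (fun x => _) = (fun x => evalmp Pp x + evalmp Pr x * h nu j (lastc x))); last first.
   by apply/funext => x; rewrite PpE PrE mxE.
  apply: polyf_add; first exact: polyf_pol.
  by apply: polyf_mul; [exact: polyf_pol|exact: (polyf_gen (fun j x => h nu j (lastc x)) j)].
 + by [].
- move=> a Ua; exists Ut; split=> //; first exact: thick_open.
 apply/uniform_rP => e e0; have m1 : 0 < e / (Mq * ep) by rewrite divr_gt0 // mulr_gt0.
 have [N NP] := arch_inv m1; exists N => nu /NP nuN x Ux; apply: (le_lt_trans (gf nu x Ux)).
 apply: (@le_lt_trans _ _ (Mq * (ep / nu.+1%:R))).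
  by rewrite ler_wpM2r ?divr_ge0 ?(ltW ep0) // MqP //; exact: Kl.
 by move: nuN; rewrite ltr_pdivlMr ?mulr_gt0 // mulrC mulrA.
have -> : zeros_along P Ut f = zeros Ut (wpol c0).
 by rewrite ZE zE // => x Ux; rewrite subrr nm0 mulr_ge0 ?nm_ge0 // ltW.
have -> : (fun nu => zeros_along P Ut (g nu)) = (fun nu => zeros Ut ((fun=> wpol c0) nu)).
 apply/funext => nu; rewrite ZE zE // => x Ux; apply: (le_trans (gf nu x Ux)).
 by rewrite ler_wpM2l ?nm_ge0.
apply: zeros_chain_cvg => //.
move=> a _; exists 1 => // e e0; exists 0%N => nu _ x _; by rewrite subrr nm0.
Qed.

End Base.

(** * The formal division *)

Section Remainder.
Variable R : realType. Local Notation C := (cplx R).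

Lemma map_lowpoly (K K' : nzRingType) (f : {rmorphism K -> K'}) d (b : 'rV[K]_d) : map_poly f (lowpoly b) = lowpoly (map_mx f b).
Proof.
rewrite /lowpoly rmorph_sum; apply: eq_bigr => i _; rewrite -mul_polyC rmorphM /= map_polyC map_polyXn mxE mul_polyC //.
Qed.

Lemma map_unipoly (K K' : nzRingType) (f : {rmorphism K -> K'}) d (b : 'rV[K]_d) : map_poly f (unipoly b) = unipoly (map_mx f b).
Proof. by rewrite /unipoly rmorphD /= map_polyXn map_lowpoly. Qed.

Lemma lowpoly_coef (K : nzRingType) d (b : 'rV[K]_d) (i : 'I_d) : (lowpoly b)`_(d - i.+1) = b 0 i.
Proof.
rewrite coef_sum (bigD1 i) //= coefZ coefXn eqxx mulr1 big1 => [|j /eqP jn]; first by rewrite addr0.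
rewrite coefZ coefXn; case: eqP => [E|]; last by rewrite mulr0.
by case: jn; apply: val_inj => /=; have := ltn_ord j; have := ltn_ord i; lia.
Qed.

Lemma evalmp_subst N M (q : 'I_N -> mpoly M C) (p : mpoly N C) :
 exists P : mpoly M C, forall x, evalmp P x = evalmp p (\row_i evalmp (q i) x).
Proof.
exists (\sum_(m <- msupp p) mpolyC M (mcoeff m p) * \prod_i q i ^+ m i) => x.
rewrite [RHS]evalmpE /evalmp rmorph_sum; apply: eq_bigr => m _; rewrite rmorphM /= mevalC rmorph_prod.
by congr (_ * _); apply: eq_bigr => i _; rewrite rmorphXn /= mxE.
Qed.

(** Evaluates a polynomial in x_n over the ring of the variables u and S: the last entry of [z] is
    the value of x_n, the others are those of the variables. *)
Definition evz N (A : {poly (mpoly N C)}) (z : 'rV[C]_(N + 1)) : C := (map_poly (meval (lsubmx z 0)) A).[rsubmx z 0 0].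

Definition evz_morph N (z : 'rV[C]_(N + 1)) : {rmorphism {poly (mpoly N C)} -> C} :=
 horner_eval (rsubmx z 0 0) \o map_poly (meval (lsubmx z 0)).

Lemma evzE N (A : {poly (mpoly N C)}) z : evz A z = evz_morph z A. Proof. by []. Qed.

Lemma evz_mpoly N (A : {poly (mpoly N C)}) : exists F : mpoly (N + 1) C, forall z, evalmp F z = evz A z.
Proof.
have [L LP] : exists L : nat -> mpoly (N + 1) C, forall i x, evalmp (L i) x = evalmp A`_i (lsubmx x).
 have [L LP] := choice (fun i => evalmp_subst (fun j : 'I_N => mpolyX C (mnm1 (lshift 1 j))) A`_i).
 exists L => i x; rewrite LP; congr (evalmp _ _); apply/rowP => j; rewrite !mxE /evalmp mevalXU //.
exists (\sum_(i < size A) L i * mpolyX C (mnm1 (rshift N 0)) ^+ i) => z.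
rewrite evalmp_sum /evz (@horner_coef_wide _ (size A)); last exact: size_poly.
apply: eq_bigr => i _; rewrite coef_map evalmpM LP; congr (_ * _).
by rewrite /evalmp rmorphXn /= mevalXU mxE.
Qed.

Lemma evz_mmap N m (h : 'I_m -> {poly (mpoly N C)}) (P : mpoly m C) z :
 evz (mmap (fun c : C => (mpolyC N c)%:P) h P) z = evalmp P (\row_i evz (h i) z).
Proof.
rewrite evalmpE evzE /mmap rmorph_sum; apply: eq_bigr => mm _; rewrite rmorphM /mmap1 rmorph_prod.
congr (_ * _); first by rewrite -evzE /evz map_polyC hornerC /= mevalC.
by apply: eq_bigr => i _; rewrite rmorphXn mxE evzE.
Qed.

Section Coefs.
Variables (sh : nat) (p e : 'I_sh -> nat) (k n d : nat).
Local Notation NC := (ncoef p k n d).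
Local Notation M := (mpoly (NC + (k + n)) C).
Implicit Type z : 'rV[C]_(NC + (k + n) + 1).
Local Notation coefA u l := (@coefA R sh p k n d C u l).

Definition upart z : 'rV[C]_NC := lsubmx (lsubmx z).
Definition xpart z : C := rsubmx z 0 0.

Definition sqf (K : nzRingType) (u : 'rV[K]_NC) : {poly K} := \prod_(l < sh) unipoly (Defs.coefA u l).
Definition powf (K : nzRingType) (u : 'rV[K]_NC) : {poly K} := \prod_(l < sh) unipoly (Defs.coefA u l) ^+ e l.

Lemma evz_var i z : evz (var R i)%:P z = lsubmx z 0 i.
Proof. by rewrite /evz map_polyC hornerC /= mevalXU. Qed.

Lemma map_uvars z : map_mx (meval (lsubmx z 0)) (@uvars R sh p k n d) = upart z.
Proof. by apply/rowP => i; rewrite !mxE mevalXU mxE. Qed.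

Lemma map_coefA (K K' : nzRingType) (f : {rmorphism K -> K'}) (u : 'rV[K]_NC) l : map_mx f (Defs.coefA u l) = Defs.coefA (map_mx f u) l.
Proof. by apply/rowP => i; rewrite !mxE. Qed.
Lemma map_coefB (K K' : nzRingType) (f : {rmorphism K -> K'}) (u : 'rV[K]_NC) j : map_mx f (row j (coefB u)) = row j (coefB (map_mx f u)).
Proof. by apply/rowP => i; rewrite !mxE. Qed.
Lemma map_coefC (K K' : nzRingType) (f : {rmorphism K -> K'}) (u : 'rV[K]_NC) j : map_mx f (row j (coefC u)) = row j (coefC (map_mx f u)).
Proof. by apply/rowP => i; rewrite !mxE. Qed.

Lemma evz_sqf z : evz (sqf (@uvars R sh p k n d)) z = (sqf (upart z)).[xpart z].
Proof.
rewrite /evz rmorph_prod -map_uvars; congr (_.[_]); apply: eq_bigr => l _.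
by rewrite /= map_unipoly map_coefA.
Qed.

Lemma evz_genP z : evz (@genP R sh p e k n d) z = (powf (upart z)).[xpart z].
Proof.
rewrite /evz rmorph_prod -map_uvars; congr (_.[_]); apply: eq_bigr => l _.
by rewrite rmorphXn /= map_unipoly map_coefA.
Qed.

Lemma evz_alpha j z : evz (@alpha R sh p e k n d j) z =
 (powf (upart z)).[xpart z] * rsubmx (lsubmx z) 0 (lshift n j) + (lowpoly (row j (coefB (upart z)))).[xpart z].
Proof.
rewrite evzE rmorphD rmorphM -!evzE evz_genP evz_var; congr (_ * _ + _); first by rewrite !mxE.
by rewrite /evz map_lowpoly map_coefB map_uvars.
Qed.

Lemma evz_beta i z : evz (@beta R sh p e k n d i) z =
 (powf (upart z)).[xpart z] * rsubmx (lsubmx z) 0 (rshift k i) + (lowpoly (row i (coefC (upart z)))).[xpart z].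
Proof.
rewrite evzE rmorphD rmorphM -!evzE evz_genP evz_var; congr (_ * _ + _); first by rewrite !mxE.
by rewrite /evz map_lowpoly map_coefC map_uvars.
Qed.

Lemma remainder_eval P (T : 'I_d -> mpoly NC C) : @remainder_coefs R sh p e k n d P T -> exists Wt : {poly M}, forall z,
 evalmp P (row_mx (\row_i evz (@beta R sh p e k n d i) z) (\row_j evz (@alpha R sh p e k n d j) z)) =
 evz Wt z * (powf (upart z)).[xpart z] + (lowpoly (\row_i evalmp (T i) (upart z))).[xpart z].
Proof.
move=> [Wt WtE]; exists Wt => z; have := congr1 (fun A => evz A z) WtE.
rewrite evz_mmap [in RHS]evzE rmorphD rmorphM -!evzE evz_genP => E.
have -> : row_mx (\row_i evz (@beta R sh p e k n d i) z) (\row_j evz (@alpha R sh p e k n d j) z) =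
  \row_i evz (match fintype.split i with inl i => @beta R sh p e k n d i | inr j => @alpha R sh p e k n d j end) z.
 by apply/rowP => i; rewrite !mxE; case: fintype.split => j; rewrite mxE.
rewrite E; congr (_ + _); rewrite /evz map_lowpoly; congr ((lowpoly _).[_]); apply/rowP => i; rewrite !mxE.
rewrite /lift_u /mmap rmorph_sum evalmpE; apply: eq_bigr => m _; rewrite rmorphM /= mevalC /mmap1 rmorph_prod.
by congr (_ * _); apply: eq_bigr => j _; rewrite rmorphXn /= mevalXU !mxE.
Qed.

End Coefs.

Lemma punctured_zero (h : C -> C) z (r : R) : 0 < r -> hol h z -> (forall t, nm (t - z) < r -> t != z -> h t = 0) -> h z = 0.
Proof.
move=> r0 dh h0; apply/eqP/negPn/negP => hz; have hp : 0 < nm (h z) by rewrite nm_gt0.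
have /continuous_rP/(_ _ hp)[e e0 eP] := diff_cont dh.
pose s : R := min r e / 2; have s0 : 0 < s by rewrite divr_gt0 // lt_min r0 e0.
have sE : s < min r e by rewrite /s gtr_pMr ?lt_min ?r0 ?e0 // invf_lt1 // ltr1n.
have sz : nm (z + rc s - z) = s by rewrite addrC addKr nm_rc gtr0_norm.
have h1 : h (z + rc s) = 0.
 apply: h0; first by rewrite sz; move: sE; rewrite lt_min => /andP[].
 by rewrite -subr_eq0 -nm_eq0 sz gt_eqF.
have : nm (h (z + rc s) - h z) < nm (h z) by apply: eP; rewrite sz; move: sE; rewrite lt_min => /andP[].
by rewrite h1 sub0r nmN ltxx.
Qed.

(** Divisibility by holomorphic factors near each root implies divisibility of polynomials. The
    roots are removed one at a time; cancelling t - z loses the point z, which [punctured_zero]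
    recovers by continuity. *)
Lemma roots_dvd (rs : seq C) (L : {poly C}) :
 (forall z, z \in rs -> exists (r : R) (G : C -> C), [/\ 0 < r, forall t, nm (t - z) < r -> hol G t &
   forall t, nm (t - z) < r -> L.[t] = (\prod_(a <- rs) ('X - a%:P)).[t] * G t]) ->
 exists L', L = (\prod_(a <- rs) ('X - a%:P)) * L'.
Proof.
elim: rs L => [|z rs IH] L hL; first by exists L; rewrite big_nil mul1r.
have [r [G [r0 dG LG]]] := hL z (mem_head _ _).
have : root L z.
 apply/rootP; rewrite LG ?subrr ?nm0 // big_cons hornerM hornerXsubC subrr !mul0r //.
move=> /factor_theorem[L1 L1E].
have [y yrs|L' L'E] := IH L1; last by exists L'; rewrite L1E L'E big_cons mulrC mulrA.
have [s [H [s0 dH LH]]] := hL y (@mem_behead _ (z :: rs) y yrs).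
exists s, H; split=> // t ts; set q := \prod_(a <- rs) _ in IH *.
pose f := fun t => L1.[t] - q.[t] * H t.
have dpol (p : {poly C}) u : hol (fun t => p.[t]) u by exact: (der_diff (der_horner p u)).1.
have df u : nm (u - y) < s -> hol f u.
 by move=> us; apply: holB; [exact: dpol|apply: holM; [exact: dpol|exact: dH]].
have f0 u : nm (u - y) < s -> u != z -> f u = 0.
 move=> us uz; apply/eqP; rewrite subr_eq0; apply/eqP; have uz0 : u - z != 0 by rewrite subr_eq0.
 apply: (mulIf uz0); have := LH u us; rewrite L1E hornerM big_cons hornerM !hornerXsubC => ->.
 by rewrite -/q; ring.
apply/eqP; rewrite -subr_eq0; apply/eqP; rewrite -/(f t).
have [tz|/(f0 _ ts)//] := eqVneq t z; rewrite tz.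
have zy : 0 < s - nm (z - y) by rewrite subr_gt0 -tz.
apply: (punctured_zero zy); first by apply: df; rewrite -tz.
move=> u uz; apply: f0; have := @nm_tri R C z u y; move: uz; clra.
Qed.

(** Uniqueness of division with remainder, from information near the roots alone: a fibre of the
    domain contains the roots of the monic polynomial but need not be the whole line. *)
Lemma lowpoly_zero d (a b : 'rV[C]_d) :
 (forall z, root (unipoly a) z -> exists (r : R) (G : C -> C), [/\ 0 < r, forall t, nm (t - z) < r -> hol G t &
   forall t, nm (t - z) < r -> (lowpoly b).[t] = (unipoly a).[t] * G t]) -> b = 0.
Proof.
have [rs [srs aE]] := unipoly_roots a => h.
have [z zrs|L' LE] := @roots_dvd rs (lowpoly b); first by rewrite -aE; apply: h; rewrite aE root_prod_XsubC.
suff L0 : lowpoly b = 0 by apply/rowP => i; rewrite -lowpoly_coef L0 coef0 mxE.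
apply/eqP/negPn/negP => bn; have := size_lowpoly b; rewrite leqNgt => /negP; apply.
have L'0 : L' != 0 by apply: contraNneq bn => L'0; rewrite LE L'0 mulr0.
have am : \prod_(a <- rs) ('X - a%:P) \is monic by exact: monic_prod_XsubC.
rewrite LE size_monicM // size_prod_XsubC srs; move: L'0; rewrite -size_poly_gt0; lia.
Qed.

End Remainder.

(** * Resultants and the reduced polynomial *)

Section SquareFree.
Variable R : realType. Local Notation C := (cplx R).

(** The Sylvester determinant with sizes fixed in advance, so that it is visibly holomorphic in the
    coefficients; [resultant] reads its sizes off the polynomials. *)
Definition resf dp dq (a b : {poly C}) : C := \det (\matrix_(i < dq + dp, j < dq + dp)
 match fintype.split i with inl k => a`_(j - k) *+ (k <= j) | inr k => b`_(j - k) *+ (k <= j) end)%N.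

Lemma resfE dp dq (a b : {poly C}) : (size a).-1 = dp -> (size b).-1 = dq -> resf dp dq a b = resultant a b.
Proof.
by move=> <- <-; rewrite /resf /resultant; congr (\det _); apply/matrixP => i j; rewrite Sylvester_mxE mxE.
Qed.

Lemma diff_resf (V : nmod C) dp dq (a b : V -> {poly C}) x :
 (forall i, hol (fun y => (a y)`_i) x) -> (forall i, hol (fun y => (b y)`_i) x) ->
 hol (fun y => resf dp dq (a y) (b y)) x.
Proof.
move=> da db; apply: diff_sumf => s; apply: holM; first exact: hol_cst.
apply: diff_prods => i.
under eq_fun do rewrite mxE.
case: (fintype.split i) => l; case: leqP => _; rewrite ?mulr1n ?mulr0n; [exact: da|exact: hol_cst|exact: db|exact: hol_cst].
Qed.

Lemma size_deriv_unipoly d (a : 'rV[C]_d) : (size (unipoly a)^`()).-1 = d.-1.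
Proof.
have le : (size (unipoly a)^`() <= d)%N by have := size_poly (size (unipoly a)).-1 (fun i => (unipoly a)`_i.+1 *+ i.+1); rewrite -/(deriv _) size_unipoly.
case: d a le => [a|d a le]; first by case: (size _).
suff : (d < size (unipoly a)^`())%N by move: le; lia.
rewrite ltnNge; apply/negP => /(nth_default 0)/eqP; rewrite coef_deriv.
have /monicP := monic_unipoly a; rewrite /lead_coef size_unipoly /= => ->; by rewrite pnatr_eq0.
Qed.

Lemma unipoly_common d d' (a : 'rV[C]_d) (b : {poly C}) : (size b).-1 = d' ->
 (resf d d' (unipoly a) b != 0) <-> forall z, root (unipoly a) z -> b.[z] != 0.
Proof.
move=> sb; rewrite (resfE _ sb) ?size_unipoly // resultant_eq0 -leqNgt; split=> [h z az|h].
 apply/negP => /eqP/rootP bz; move: h; rewrite leqNgt => /negP; apply.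
 have : 'X - z%:P %| gcdp (unipoly a) b by rewrite dvdp_gcd !dvdp_XsubCl az bz.
 move=> /dvdp_leq; rewrite size_XsubC; apply.
 by rewrite gcdp_eq0 negb_and monic_neq0 ?monic_unipoly.
rewrite leqNgt; apply/negP => sg; have /closed_rootP[z] : size (gcdp (unipoly a) b) != 1%N by rewrite neq_ltn sg orbT.
by rewrite root_gcd => /andP[/h/negP + /rootP/eqP]; apply.
Qed.

Section Coefs.
Variables (sh : nat) (p : 'I_sh -> nat) (k n d : nat).
Local Notation NC := (ncoef p k n d).
Implicit Type u : 'rV[C]_NC.
Local Notation cA u l := (Defs.coefA u l).

Definition dsq := (\sum_(l < sh) p l)%N.
Definition cf u : 'rV[C]_dsq := \row_(i < dsq) (sqf u)`_(dsq - i.+1).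
Definition rff u l := resf (p l) (p l).-1 (unipoly (cA u l)) (unipoly (cA u l))^`().
Definition rfr u l l' := resf (p l) (p l') (unipoly (cA u l)) (unipoly (cA u l')).
(** Resultants of the factors with their derivatives, times resultants of pairs of different
    factors. This matches the two conditions in the definition of the family, and where it is
    nonzero all roots of [sqf] are simple. *)
Definition disf u : C := (\prod_l rff u l) * \prod_l \prod_(l' | l' != l) rfr u l l'.

Lemma monic_sqf u : sqf u \is monic.
Proof. by apply: monic_prod => l _; exact: monic_unipoly. Qed.

Lemma size_sqf u : size (sqf u) = dsq.+1.
Proof.
have E (I : seq 'I_sh) : size (\prod_(l <- I) unipoly (cA u l)) = (\sum_(l <- I) p l).+1.
 elim: I => [|l I IH]; first by rewrite !big_nil size_poly1.
 rewrite !big_cons size_monicM ?monic_unipoly // ?size_unipoly ?IH ?addSn ?addnS //.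
 by apply: monic_neq0; apply: monic_prod => i _; exact: monic_unipoly.
exact: E.
Qed.

Lemma unipoly_cf u : unipoly (cf u) = sqf u.
Proof. exact: unipoly_coefs (monic_sqf u) (size_sqf u). Qed.

Lemma diff_unipoly_coef (V : nmod C) m (a : V -> 'rV[C]_m) x i : hol a x ->
 hol (fun y => (unipoly (a y))`_i) x.
Proof.
move=> da; under eq_fun do rewrite coefD coef_sum; apply: holD; first exact: hol_cst.
apply: diff_sumf => j; under eq_fun do rewrite coefZ.
by apply: holM; [exact: (diff_entry 0 j da).1|exact: hol_cst].
Qed.

Lemma diff_coefA l u : hol (fun u => cA u l) u.
Proof.
by apply: mx_differentiable => i j; under eq_fun do rewrite !mxE; exact: differentiable_coord.
Qed.

Lemma diff_cf u : hol cf u.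
Proof.
have E (I : seq 'I_sh) i : hol (fun u => (\prod_(l <- I) unipoly (cA u l))`_i) u.
 elim: I i => [|l I IH] i; first by under eq_fun do rewrite big_nil; exact: hol_cst.
 under eq_fun do rewrite big_cons coefM; apply: diff_sumf => j.
 apply: holM; last exact: IH.
 exact: diff_unipoly_coef (diff_coefA l u).
by apply: mx_differentiable => i j; under eq_fun do rewrite mxE; exact: E.
Qed.

Lemma diff_rff l u : hol (rff ^~ l) u.
Proof.
apply: diff_resf => i; first exact: diff_unipoly_coef (diff_coefA l u).
under eq_fun do rewrite coef_deriv -mulr_natl.
by apply: holM; [exact: hol_cst|exact: diff_unipoly_coef (diff_coefA l u)].
Qed.

Lemma diff_rfr l l' u : hol (fun u => rfr u l l') u.
Proof. by apply: diff_resf => i; [exact: diff_unipoly_coef (diff_coefA l u)|exact: diff_unipoly_coef (diff_coefA l' u)]. Qed.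

Lemma rffP u l : rff u l != 0 <-> forall z, root (unipoly (cA u l)) z -> (unipoly (cA u l))^`().[z] != 0.
Proof. exact: unipoly_common (size_deriv_unipoly _). Qed.

Lemma rfrP u l l' : rfr u l l' != 0 <-> forall z, root (unipoly (cA u l)) z -> (unipoly (cA u l')).[z] != 0.
Proof. by apply: unipoly_common; rewrite size_unipoly. Qed.

Lemma disf_simple u : disf u != 0 -> forall z, root (unipoly (cf u)) z -> (unipoly (cf u))^`().[z] != 0.
Proof.
rewrite mulf_eq0 negb_or => /andP[/prodf_neq0 h1 /prodf_neq0 h2] z; rewrite unipoly_cf => /rootP.
rewrite horner_prod => /eqP/prodf_eq0[l _ /eqP/rootP lz].
rewrite /sqf (bigD1 l) //= derivM hornerD !hornerM (rootP lz) mul0r addr0 mulf_neq0 //.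
 exact: ((rffP u l).1 (h1 l isT)).
rewrite horner_prod; apply/prodf_neq0 => l' ll.
exact: ((rfrP u l l').1 ((prodf_neq0 _ _ (h2 l isT)) l' ll)).
Qed.

Lemma powf_root (e : 'I_sh -> nat) u t : (forall l, 0 < e l)%N -> ((powf e u).[t] = 0 <-> (sqf u).[t] = 0).
Proof.
move=> e0; rewrite !horner_prod; split=> /eqP/prodf_eq0[l _ /eqP lt]; apply/eqP/prodf_eq0; exists l => //.
 by move: lt => /eqP; rewrite horner_exp expf_eq0 e0.
by rewrite horner_exp lt expf_eq0 e0 eqxx.
Qed.

End Coefs.
End SquareFree.

(** * Uniform convergence and functions with nowhere dense zeros *)

Section Generic.
Variable R : realType. Local Notation C := (cplx R).

Definition ucvg (V W : nmod C) (D : set V) (f_ : nat -> V -> W) (f : V -> W) :=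
 forall e : R, 0 < e -> exists N, forall nu, (N <= nu)%N -> forall x, D x -> nm (f_ nu x - f x) < e.

Lemma compact_continuity (V W Z : nmod C) (M : set V) (a : V -> W) (F : W -> Z) (e : R) : compact M ->
 (forall x, M x -> {for x, continuous a}) -> (forall x, M x -> {for a x, continuous F}) -> 0 < e ->
 exists2 dl : R, 0 < dl & forall x y, M x -> nm (y - a x) < dl -> nm (F y - F (a x)) < e.
Proof.
move=> cM ca cF e0; have e2 : 0 < e / 2 by rewrite divr_gt0.
have [|eps eps0 epsP] := @compact_radius R V M (fun dl x => forall y, nm (y - a x) < dl -> nm (F y - F (a x)) < e) cM.
 move=> x Mx; have /continuous_rP/(_ _ e2)[eta eta0 etaP] := cF x Mx.
 have eta2 : 0 < eta / 2 by rewrite divr_gt0.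
 have /continuous_rP/(_ _ eta2)[et et0 etP] := ca x Mx.
 exists (min (eta / 2) et); first by rewrite lt_min eta2 et0.
 move=> dl dl0; rewrite lt_min => /andP[d1 _] x'; rewrite lt_min => /andP[_ x'x] y yx'.
 have h1 := etP _ x'x.
 have h2 : nm (F (a x') - F (a x)) < e / 2 by apply: etaP; move: h1 eta0; clra.
 have h4 : nm (F y - F (a x)) < e / 2.
  by apply: etaP; have := @nm_tri R _ (a x') y (a x); move: h1 d1 yx'; clra.
 by have := @nm_tri R _ (F (a x)) (F y) (F (a x')); rewrite (nmC (F (a x))); move: h2 h4; clra.
have ep2 : 0 < eps / 2 by rewrite divr_gt0.
by exists (eps / 2) => // x y Mx; apply: (epsP (eps / 2)) => //; move: eps0; clra.
Qed.

Lemma ucvg_comp (V W Z : nmod C) (D M : set V) (a_ : nat -> V -> W) (a : V -> W) (F : W -> Z) : compact M -> D `<=` M ->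
 (forall x, M x -> {for x, continuous a}) -> (forall x, M x -> {for a x, continuous F}) -> ucvg D a_ a ->
 ucvg D (fun nu x => F (a_ nu x)) (fun x => F (a x)).
Proof.
move=> cM DM ca cF cv e e0; have [dl dl0 dlP] := compact_continuity cM ca cF e0.
have [N NP] := cv _ dl0; exists N => nu nuN x Dx; apply: dlP; [exact: DM|exact: NP].
Qed.

Lemma image_compact (V W : nmod C) (K : set V) (f : V -> W) : compact K ->
 (forall x, K x -> {for x, continuous f}) -> compact (f @` K).
Proof.
move=> cK cf; apply: continuous_compact cK; apply: continuous_in_subspaceT => x; rewrite inE; exact: cf.
Qed.

Lemma open_preim (V W : nmod C) (D : set V) (E : set W) (f : V -> W) : open D -> open E ->
 (forall x, D x -> {for x, continuous f}) -> open [set x | D x /\ E (f x)].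
Proof.
move=> /open_rP oD /open_rP oE cf; apply/open_rP => x [Dx Ex].
have [r r0 rP] := oD x Dx; have [s s0 sP] := oE _ Ex; have /continuous_rP/(_ _ s0)[t t0 tP] := cf x Dx.
exists (min r t); first by rewrite lt_min r0 t0.
by move=> y; rewrite lt_min => /andP[yr yt]; split; [exact: rP|apply: sP; exact: tP].
Qed.

Definition locnz (V : nmod C) (U : set V) (f : V -> C) :=
 forall x, U x -> forall e : R, 0 < e -> exists2 y, nm (y - x) < e & f y != 0.

Lemma locnz_connected (V : nmod C) (U : set V) (f : V -> C) x0 : open U -> connected U ->
 (forall x, U x -> hol f x) -> U x0 -> f x0 != 0 -> locnz U f.
Proof.
move=> oU cU df Ux0 /eqP fx x Ux e e0; apply: contrapT => ne; apply: fx.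
apply: (identity_connected oU cU df Ux _ Ux0); exists e => // y yx.
by apply/eqP/negPn/negP => fy; apply: ne; exists y.
Qed.

Lemma locnz_mul (V : nmod C) (U : set V) (f g : V -> C) : open U -> (forall x, U x -> hol f x) ->
 locnz U f -> locnz U g -> locnz U (fun x => f x * g x).
Proof.
move=> /open_rP oU df hf hg x Ux e e0; have [r r0 rP] := oU x Ux.
have m0 : 0 < min r (e / 2) by rewrite lt_min r0 divr_gt0.
have [y] := hf x Ux _ m0; rewrite lt_min => /andP[yr ye] fy.
have fp : 0 < nm (f y) by rewrite nm_gt0.
have /continuous_rP/(_ _ fp)[d d0 dP] := diff_cont (df y (rP y yr)).
have n0 : 0 < min d (e / 2) by rewrite lt_min d0 divr_gt0.
have [z] := hg y (rP y yr) _ n0; rewrite lt_min => /andP[zd ze] gz; exists z.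
 by have := @nm_tri R _ y z x; move: ye ze; clra.
by rewrite mulf_neq0 //; apply: near_neq0 (dP z zd).
Qed.

Lemma locnz_prod (V : nmod C) (I : Type) (U : set V) (s : seq I) (P : pred I) (f : I -> V -> C) : open U ->
 (forall i x, U x -> hol (f i) x) -> (forall i, P i -> locnz U (f i)) ->
 locnz U (fun x => \prod_(i <- s | P i) f i x).
Proof.
move=> oU df hf; elim: s => [|i s IH].
 by move=> x Ux e e0; exists x; rewrite ?subrr ?nm0 // big_nil oner_neq0.
have E : (fun x => \prod_(j <- i :: s | P j) f j x) = fun x => (if P i then f i x else 1) * \prod_(j <- s | P j) f j x.
 by apply/funext => x; rewrite big_cons; case: (P i); rewrite ?mul1r.
rewrite E; case Pi : (P i); last by move=> x Ux e /(IH x Ux)[y h1 h2]; exists y; rewrite ?mul1r.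
by apply: locnz_mul => //; [move=> x; exact: df|exact: hf].
Qed.

Lemma root_separation (s : seq C) : exists2 e : R, 0 < e & forall z z', z \in s -> z' \in s -> nm (z' - z) < 2 * e -> z' = z.
Proof.
have [z zs|e e0 eP] := @seq_radius R C s (fun z e => forall z', z' \in s -> nm (z' - z) < 2 * e -> z' = z); last first.
 by exists e => // z z' zs; exact: (eP z zs e e0 (lexx e)).
have [z' z's|e e0 eP] := @seq_radius R C s (fun z' e => nm (z' - z) < 2 * e -> z' = z); last first.
 by exists e => // e' e'0 e'e z' z's; exact: (eP z' z's).
have [->|zz] := eqVneq z' z; first by exists 1.
have zp : 0 < nm (z' - z) by rewrite nm_gt0 subr_eq0.
exists (nm (z' - z) / 2); first by rewrite divr_gt0.
by move=> e' _; move: (nm _) => t h1 h2; exfalso; move: h1 h2; clra.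
Qed.

Section Coprime.
Variables (n pa pb : nat) (U1 : set 'rV[C]_n.+1) (a : 'rV[C]_n.+1 -> 'rV[C]_pa) (b : 'rV[C]_n.+1 -> 'rV[C]_pb).

(** Turns the dimension condition into a nonvanishing resultant. If the resultant vanished
    identically, then over a ball where the first polynomial has distinct holomorphic roots the
    product of the values of the second at these roots would vanish, hence one factor would, by the
    identity theorem. The common zero set would contain a full branch, of dimension n + 1. *)
Lemma generic_coprime x0 : open U1 -> connected U1 -> holo U1 a -> holo U1 b -> U1 x0 ->
 resf pa pa.-1 (unipoly (a x0)) (unipoly (a x0))^`() != 0 ->
 dim_lt ([set x : 'rV[C]_n.+2 | U1 (proj x) /\ (unipoly (a (proj x))).[lastc x] = 0] `&`
     [set x | U1 (proj x) /\ (unipoly (b (proj x))).[lastc x] = 0]) n.+1 ->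
 exists2 x, U1 x & resf pa pb (unipoly (a x)) (unipoly (b x)) != 0.
Proof.
move=> oU1 cU1 ha hb Ux0 r0 dl; apply: contrapT => ne.
have [rs rsP] := wpol_roots_choice R pa.
pose delta x := resf pa pa.-1 (unipoly (a x)) (unipoly (a x))^`().
have ddelta x : U1 x -> hol delta x.
 move=> Ux; apply: diff_resf => i; first exact: diff_unipoly_coef (ha x Ux).
 under eq_fun do rewrite coef_deriv -mulr_natl.
 by apply: holM; [exact: hol_cst|exact: diff_unipoly_coef (ha x Ux)].
have deltaP x : U1 x -> delta x != 0 -> forall z, root (unipoly (a x)) z -> (unipoly (a x))^`().[z] != 0.
 by move=> _ /(unipoly_common _ (size_deriv_unipoly (a x))).
pose D := [set x : 'rV[C]_n.+2 | U1 (proj x)].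
have oD : open D.
 have := @open_preim _ _ [set: 'rV[C]_n.+2] U1 (@proj R n.+1) openT oU1.
 rewrite (_ : [set x | _] = D); last by apply/seteqP; split=> [x []|x].
 by apply=> x _; exact: diff_cont (diff_proj x).
have locd := locnz_connected oU1 cU1 ddelta Ux0 r0.
have gA : good D (wpol a).
 by apply: (@good_wpol R n.+1 pa U1 a delta oU1 ha ddelta deltaP rs rsP D oD) => // x Dx; exact: locd.
have [se se0 seP] := root_separation (rs (a x0)).
have [rho [sig [rho0 sigP]]] := branches oU1 ha ddelta deltaP rsP Ux0 r0 se0.
pose B := [set x : 'rV[C]_n.+1 | nm (x - x0) < rho].
have BU x : B x -> U1 x by case/sigP.
pose h z x := (unipoly (b x)).[sig z x].
have dh z : z \in rs (a x0) -> forall x, B x -> hol (h z) x.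
 move=> zr x Bx; have [Ux _ _ /(_ z zr)[ds _]] := sigP x Bx.
 by apply: diff_unipoly; [exact: hb|exact: ds].
have B0 : B x0 by rewrite /B /= subrr nm0.
have oB : open B by exact: open_rball.
have cB : connected B by exact: rball_connected.
have [z [zr hz]] : exists z, z \in rs (a x0) /\ forall x, B x -> h z x = 0.
 apply: contrapT => nz.
 have lz z : z \in rs (a x0) -> locnz B (h z).
  move=> zr; apply: contrapT => nl; apply: nz; exists z; split=> // x Bx; apply/eqP/negPn/negP => hx; apply: nl.
  by exact: (@locnz_connected _ B (h z) x oB cB (dh z zr) Bx hx).
 pose h' z x := if z \in rs (a x0) then h z x else 1.
 have [|z zr|y yB] := @locnz_prod 'rV[C]_n.+1 C B (rs (a x0)) (mem (rs (a x0))) h' oB _ _ x0 B0 rho rho0.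
 - move=> z x Bx; rewrite /h'; case zr : (z \in rs (a x0)); [exact: (dh z zr)|exact: hol_cst].
 - have zr' : z \in rs (a x0) by exact: zr.
  by have := lz z zr'; rewrite /h' zr'.
 rewrite prodf_seq_neq0 => /allP hy.
 apply: ne; exists y; first exact: BU.
 apply/(unipoly_common (a y)) => [|t]; first by rewrite size_unipoly.
 rewrite (root_rs rsP); have [_ _ /perm_mem-> _] := sigP y yB => /mapP[z zr ->].
 by have := hy z zr; rewrite /= zr /h' zr.
have zroot : root (unipoly (a x0)) z by rewrite (root_rs rsP).
pose pt := ext x0 z.
have Dpt : D pt by rewrite /D /pt /= proj_ext.
have Spt : smooth D (wpol a) pt by exact: (smooth_ext ha deltaP rsP (fun x (Dx : D x) => Dx) Dpt r0 zr).
set E := _ `&` _ in dl.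
have Epos y : nm (y - pt) < min rho se -> (E y <-> zeros D (wpol a) y).
 rewrite lt_min => /andP[y1 y2]; split=> [[[h1 h2] _]|[Dy wy]]; first by split.
 have yB : B (proj y) by rewrite /B /= -(proj_ext x0 z) -projB; exact: le_lt_trans (norm_proj _) y1.
 have yl : nm (lastc y - z) < se by rewrite -{1}(lastc_ext x0 z) -lastcB; exact: le_lt_trans (norm_lastc _) y2.
 split; split=> //.
 have [_ _ pm sg] := sigP _ yB.
 have : lastc y \in rs (a (proj y)) by rewrite -(root_rs rsP); apply/rootP.
 rewrite (perm_mem pm) => /mapP[z' z'r yE].
 have zz : z' = z.
  apply: (seP z z' zr z'r); have [_] := sg z' z'r; rewrite -yE => h1.
  by have := @nm_tri R C (lastc y) z' z; rewrite (nmC z' (lastc y)); move: h1 yl; clra.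
 by have := hz _ yB; rewrite /h -zz -yE.
have m0 : 0 < min rho se by rewrite lt_min rho0 se0.
have Ept : E pt by apply/Epos; rewrite ?subrr ?nm0 //; case: Spt.
have EA : E `<=` zeros D (wpol a) by move=> y [[h1 h2] _]; split.
have reg : regular_dim E n.+1 pt by apply: (regular_zeros gA Spt); exists (min rho se).
suff : (n.+1 < n.+1)%N by rewrite ltnn.
apply: (dl pt n.+1 Ept); split; first by move=> W oW Wp; exists pt.
by exists setT; split=> [||y q _]; [exact: openT| |exact: (regular_le gA EA)].
Qed.

End Coprime.

Section Disc.
Variables (sh : nat) (p : 'I_sh -> nat) (k m d : nat).
Local Notation NC := (ncoef p k m d).

Lemma diff_disf (u : 'rV[C]_NC) : hol (@disf R sh p k m d) u.
Proof.
apply: holM.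
 by apply: diff_prods => l; exact: diff_rff.
apply: diff_prods => l; apply: diff_prodf => l' _; exact: diff_rfr.
Qed.

Lemma disf_locnz n (U : set 'rV[C]_n) (g : 'rV[C]_n -> 'rV[C]_NC) : open U -> connected U -> holo U g ->
 (forall l, exists2 x, U x & rff (g x) l != 0) -> (forall l l', l' != l -> exists2 x, U x & rfr (g x) l l' != 0) ->
 locnz U (fun x => disf (g x)).
Proof.
move=> oU cU hg h1 h2.
have df l x : U x -> hol (fun x => rff (g x) l) x.
 by move=> Ux; apply: (diff_compo g (fun u => rff u l)); [exact: hg|exact: diff_rff].
have dr l l' x : U x -> hol (fun x => rfr (g x) l l') x.
 by move=> Ux; apply: (diff_compo g (fun u => rfr u l l')); [exact: hg|exact: diff_rfr].
apply: locnz_mul => //.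
- by move=> x Ux; apply: diff_prodf => l _; exact: df.
- apply: locnz_prod => // l _; have [x Ux rx] := h1 l; exact: locnz_connected oU cU (df l) Ux rx.
- apply: locnz_prod => //; first by move=> l x Ux; apply: diff_prodf => l' _; exact: dr.
 move=> l _; apply: locnz_prod => //; first by move=> l' x; exact: dr.
 by move=> l' ll; have [x Ux rx] := h2 l l' ll; exact: locnz_connected oU cU (dr l l') Ux rx.
Qed.

Lemma good_cf n (U : set 'rV[C]_n) (g : 'rV[C]_n -> 'rV[C]_NC) (D : set 'rV[C]_n.+1) : open U -> holo U g -> open D ->
 (forall x, D x -> U (proj x)) -> (forall x, D x -> forall e : R, 0 < e -> exists2 y, nm (y - proj x) < e & disf (g y) != 0) ->
 good D (wpol (fun x => cf (g x))).
Proof.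
move=> oU hg oD DU dD; have [rs rsP] := wpol_roots_choice R (dsq p).
apply: (@good_wpol R n (dsq p) U (fun x => cf (g x)) (fun x => disf (g x)) oU _ _ _ rs rsP D oD DU dD).
- by move=> x Ux; apply: (diff_compo g (@cf R sh p k m d)); [exact: hg|exact: diff_cf].
- by move=> x Ux; apply: (diff_compo g (@disf R sh p k m d)); [exact: hg|exact: diff_disf].
- by move=> x _; exact: disf_simple.
Qed.

End Disc.
End Generic.

(** * Substitution of approximations into the division formulas *)

Section Substitution.
Variable R : realType. Local Notation C := (cplx R).

Lemma half_lt (x : R) : 0 < x -> x / 2 < x. Proof. by lra. Qed.

Section Closure.
Variables (n r : nat) (f : 'I_r -> 'rV[C]_n -> C).

Lemma polyf_cst c : polyf f (fun=> c).
Proof. by rewrite (_ : (fun=> c) = evalmp (mpolyC n c)); [exact: polyf_pol|apply/funext => x; rewrite evalmpC]. Qed.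

Lemma polyf_sum (I : Type) (s : seq I) (u : I -> 'rV[C]_n -> C) : (forall i, polyf f (u i)) -> polyf f (fun x => \sum_(i <- s) u i x).
Proof.
move=> h; elim: s => [|i s IH]; first by under eq_fun do rewrite big_nil; exact: polyf_cst.
by under eq_fun do rewrite big_cons; exact: polyf_add.
Qed.

Lemma polyf_prod (I : Type) (s : seq I) (u : I -> 'rV[C]_n -> C) : (forall i, polyf f (u i)) -> polyf f (fun x => \prod_(i <- s) u i x).
Proof.
move=> h; elim: s => [|i s IH]; first by under eq_fun do rewrite big_nil; exact: polyf_cst.
by under eq_fun do rewrite big_cons; exact: polyf_mul.
Qed.

Lemma polyf_exp (u : 'rV[C]_n -> C) k : polyf f u -> polyf f (fun x => u x ^+ k).
Proof.
move=> hu; elim: k => [|k IH]; first by under eq_fun do rewrite expr0; exact: polyf_cst.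
by under eq_fun do rewrite exprS; exact: polyf_mul.
Qed.

Lemma polyf_evalmp N (F : mpoly N C) (a : 'rV[C]_n -> 'rV[C]_N) : (forall i, polyf f (fun x => a x 0 i)) -> polyf f (fun x => evalmp F (a x)).
Proof.
move=> h; under eq_fun do rewrite evalmpE.
apply: polyf_sum => m; apply: polyf_mul; first exact: polyf_cst.
by apply: polyf_prod => i; exact: polyf_exp.
Qed.

End Closure.

Lemma algrel_proj n (W : set 'rV[C]_n) (f : 'rV[C]_n -> C) dd lc co : @algrel R n W f dd lc co ->
 exists lc' co', @algrel R n.+1 [set x | W (proj x)] (fun x => f (proj x)) dd lc' co'.
Proof.
move=> [lc0 rel].
have E (P : mpoly n C) : exists P' : mpoly n.+1 C, forall x, evalmp P' x = evalmp P (proj x).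
 have [P' P'E] := evalmp_subst (fun i : 'I_n => mpolyX C (mnm1 (lift ord_max i))) P.
 by exists P' => x; rewrite P'E; congr (evalmp _ _); apply/rowP => i; rewrite !mxE /evalmp mevalXU.
have [lc' lcE] := E lc; have [co' coE] := choice (fun i => E (co i)).
exists lc', co'; split.
 have [x lx] := evalmp_neq0 lc0; apply: contraNneq lx => l0.
 by rewrite -(proj_ext x 0) -lcE l0 /evalmp rmorph0.
move=> x Wx; rewrite lcE rel //; apply: eq_bigr => i _; by rewrite coE.
Qed.

Section Jet.
Variables (n k : nat) (sh : nat) (p e : 'I_sh -> nat) (d : nat).
Local Notation NC := (ncoef p k n.+2 d).
Local Notation X := 'rV[C]_n.+2.
Local Notation X1 := 'rV[C]_n.+1.
Local Notation Z := 'rV[C]_(NC + (k + n.+2) + 1).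
Implicit Types (G : X1 -> 'rV[C]_NC) (s : X -> 'rV[C]_(k + n.+2)).

(** The point at which the generic formulas are evaluated: the coefficients u = G(x'), the quotients
    S = s(x) and the last coordinate. *)
Definition jet G s (x : X) : Z := row_mx (row_mx (G (proj x)) (s x)) (const_mx (lastc x)).
Definition bet (z : Z) : X := \row_i evz (@beta R sh p e k n.+2 d i) z.
Definition alp (z : Z) : 'rV[C]_k := \row_j evz (@alpha R sh p e k n.+2 d j) z.
Definition wz (z : Z) : C := (powf e (upart z)).[xpart z].

Lemma upart_jet G s x : upart (jet G s x) = G (proj x).
Proof. by rewrite /upart /jet !row_mxKl. Qed.
Lemma xpart_jet G s x : xpart (jet G s x) = lastc x.
Proof. by rewrite /xpart /jet row_mxKr mxE. Qed.
Lemma spart_jet G s x : rsubmx (lsubmx (jet G s x)) = s x.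
Proof. by rewrite /jet row_mxKl row_mxKr. Qed.

Lemma diff_evz N (A : {poly (mpoly N C)}) z : hol (evz A) z.
Proof.
have [F FE] := evz_mpoly A; rewrite (_ : evz A = evalmp F); first exact: diff_evalmp.
by apply/funext => y; rewrite FE.
Qed.

Lemma diff_bet z : hol bet z.
Proof. by apply: mx_differentiable => i j; under eq_fun do rewrite mxE; exact: diff_evz. Qed.
Lemma diff_alp z : hol alp z.
Proof. by apply: mx_differentiable => i j; under eq_fun do rewrite mxE; exact: diff_evz. Qed.

Lemma diff_jet G s x : hol G (proj x) -> hol s x -> hol (jet G s) x.
Proof.
move=> dG ds; apply: mx_differentiable => i j; case: (split_ordP j) => j' ->.
 under eq_fun do rewrite row_mxEl; case: (split_ordP j') => j2 ->.
  under eq_fun do rewrite row_mxEl.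
  apply: (diff_compo (@proj R n.+1) (fun x => G x i j2)); first exact: diff_proj.
  exact: (diff_entry i j2 dG).1.
 under eq_fun do rewrite row_mxEr; exact: (diff_entry i j2 ds).1.
under eq_fun do rewrite row_mxEr mxE; exact: diff_lastc.
Qed.

Lemma jet_ucvg (M : set X) (Y : set X1) (G_ : nat -> X1 -> 'rV[C]_NC) G (s_ : nat -> X -> 'rV[C]_(k + n.+2)) s :
 (forall x, M x -> Y (proj x)) -> ucvg Y G_ G -> ucvg M s_ s -> ucvg M (fun nu => jet (G_ nu) (s_ nu)) (jet G s).
Proof.
move=> MY cG cs ep ep0; have e2 : 0 < ep / 2 by rewrite divr_gt0.
have [N NP] := cG _ e2; have [N' N'P] := cs _ e2; exists (maxn N N') => nu; rewrite geq_max => /andP[n1 n2] x Mx.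
apply: (@le_lt_trans _ _ (ep / 2)); last exact: half_lt.
rewrite /jet !row_mxB; apply: nm_row_mx; first exact: ltW.
 by apply: nm_row_mx; [exact: ltW|apply/ltW/NP => //; exact: MY|apply/ltW/N'P].
rewrite (_ : _ - _ = 0) ?nm0 ?ltW //; apply/rowP => i; rewrite !mxE subrr //.
Qed.

(** For Nash [G] and polynomial quotients, every expression in the jet is polynomial in the
    coordinates and in algebraic functions of x'. Since [bet] recovers y from [th y], the criterion
    [nash_comp] applies. *)
Lemma nash_jet (Y : set X1) G (ps : 'I_(k + n.+2) -> mpoly n.+2 C) (Ut : set X) (th : X -> X) A : open Y -> nash Y G -> open Ut ->
 (forall y, Ut y -> [/\ Y (proj (th y)), hol th y & bet (jet G (fun x => \row_i evalmp (ps i) x) (th y)) = y]) ->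
 nash_fun Ut (fun y => evz A (jet G (fun x => \row_i evalmp (ps i) x) (th y))).
Proof.
set s := fun x => _ => oY nG oUt hth.
have dG x : Y x -> hol G x by move=> Yx; apply: mx_differentiable => i j; rewrite (ord1 i); exact: (nG j).1.
have ds x : hol s x by apply: mx_differentiable => i j; under eq_fun do rewrite mxE; exact: diff_evalmp.
apply: (@nash_comp R n.+2 NC Ut _ oUt).
 move=> y Uy; have [Yy dy _] := hth y Uy.
 apply: (diff_compo th (fun x => evz A (jet G s x))); first exact: dy.
 apply: (diff_compo (jet G s) (evz A)); last exact: diff_evz.
 by apply: diff_jet; [exact: dG|exact: ds].
move=> y0 Uy0; set x1 := proj (th y0); have [Yx1 _ _] := hth y0 Uy0.
have [j _|r r0 rP] := @seq_radius R 'I_NC (enum 'I_NC) (fun j r => exists dd lc co, @algrel R n.+1 [set x | nm (x - x1) < r] (fun x => G x 0 j) dd lc co).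
 have [W [/open_rP oW Wx WY [P P0 PW]]] := (nG j).2 x1 Yx1; have [r r0 rW] := oW _ Wx.
 have [dd [lc [co [lc0 rel]]]] := @nash_algrel R n.+1 W (fun x => G x 0 j) P P0 PW.
 exists r => // r' r'0 r'r; exists dd, lc, co; split=> // x xr; apply: rel; apply: rW; exact: lt_le_trans r'r.
have /open_rP/(_ _ Yx1)[r2 r20 r2Y] := oY.
pose ra := min r r2; have ra0 : 0 < ra by rewrite lt_min r0 r20.
pose W := [set x : X | nm (proj x - x1) < ra].
have oW : open W.
 have := @open_preim _ _ _ [set: X] [set x' : X1 | nm (x' - x1) < ra] (@proj R n.+1) openT (open_rball x1 ra).
 rewrite (_ : [set x | _] = W); last by apply/seteqP; split=> [x []|x].
 by apply=> x _; exact: diff_cont (diff_proj x).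
have Wth : W (th y0) by rewrite /W /= subrr nm0.
have cth y : Ut y -> {for y, continuous th} by move=> /hth[_ dy _]; exact: diff_cont.
pose gen (j : 'I_NC) (x : X) := G (proj x) 0 j.
have jetp A' : polyf gen (fun x => evz A' (jet G s x)).
 have [F FE] := evz_mpoly A'; rewrite (_ : (fun x => _) = fun x => evalmp F (jet G s x)); last by apply/funext => x; rewrite FE.
 apply: polyf_evalmp => j; case: (split_ordP j) => j' ->.
  under eq_fun do rewrite row_mxEl; case: (split_ordP j') => j2 ->.
   by under eq_fun do rewrite row_mxEl; exact: (polyf_gen gen).
  by under eq_fun do rewrite row_mxEr mxE; exact: polyf_pol.
 under eq_fun do rewrite row_mxEr mxE.
 rewrite (_ : (fun x => _) = evalmp (mpolyX C (mnm1 ord_max))); first exact: polyf_pol.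
 by apply/funext => x; rewrite /evalmp mevalXU.
exists W, [set y | Ut y /\ W (th y)], th, gen, (fun i x => bet (jet G s x) 0 i), (fun x => evz A (jet G s x)); split.
- by split; [exact: oW|exact: open_preim|split|move=> y []].
- move=> j; have [dd [lc [co rel]]] := rP j (mem_enum _ j) ra ra0 ltac:(by rewrite ge_min lexx).
 have [lc' [co' [h1 h2]]] := algrel_proj rel; exists dd, lc', co'; split=> //.
- move=> j x Wx; apply: (diff_compo (@proj R n.+1) (fun x => G x 0 j)); first exact: diff_proj.
 apply: (nG j).1; apply: r2Y; apply: (lt_le_trans Wx); by rewrite ge_min lexx orbT.
- by split; [move=> i; under eq_fun do rewrite mxE; exact: jetp|exact: jetp].
- by move=> y [Uy Wy]; have [_ _ bE] := hth y Uy; split=> // i; rewrite bE.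
Qed.

End Jet.
End Substitution.

(** * The inductive step *)

Section Step.
Variable R : realType. Local Notation C := (cplx R).

Lemma ball_thick (m : nat) (K : set 'rV[C]_m) (a b : R) z x : thick K a z -> nm (x - z) < b -> thick K (a + b) x.
Proof.
move=> [y Ky zy] xz; exists y => //; have := @nm_tri R _ z x y; move: zy xz; clra.
Qed.

Lemma quarter (d : R) : 0 < d -> [/\ 0 < d / 8, d / 8 < d / 4, d / 4 < d / 2, d / 2 < d & d / 4 + d / 4 = d / 2].
Proof. by move=> d0; split; move: d0; clra. Qed.

Lemma step_delta (d : R) : 0 < d -> 0 < d / 4 / 32 /\ 32 * (d / 4 / 32) <= d / 4.
Proof. by move=> d0; split; move: d0; clra. Qed.

Lemma diff_bet_comp (V : nmod C) n k (sh : nat) (p e : 'I_sh -> nat) (d : nat)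
 (a : V -> 'rV[C]_(ncoef p k n.+2 d + (k + n.+2) + 1)) x : hol a x -> hol (fun x => bet e (a x)) x.
Proof.
move=> da; apply: mx_differentiable => i j; under eq_fun do rewrite mxE.
apply: (diff_compo a (evz (@beta R sh p e k n.+2 d j))); first exact: da.
exact: diff_evz.
Qed.

(** The recursive definition unpacked: [psi] inverts [phi], and at the jet of [g] and the quotients
    [s0] the generic formulas [bet] and [alp] return phi and the composite of f with phi. The
    division identity [rem] holds for all values of the variables, so [TG] removes the remainder for
    the approximations as well. *)
Lemma step_main n k q (sh : nat) (p e : 'I_sh -> nat) (d : nat)
 (U Uh Uc : set 'rV[C]_n.+2) (U1 Y : set 'rV[C]_n.+1) (f : 'rV[C]_n.+2 -> 'rV[C]_k) Nu (Q : 'rV[C]_(n.+2 + k) -> 'rV[C]_q) P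
 (U0 : set 'rV[C]_n.+2) (phi psi : 'rV[C]_n.+2 -> 'rV[C]_n.+2) (H : 'rV[C]_n.+2 -> C)
 (g : 'rV[C]_n.+1 -> 'rV[C]_(ncoef p k n.+2 d)) (G_ : nat -> 'rV[C]_n.+1 -> 'rV[C]_(ncoef p k n.+2 d))
 (s0 : 'rV[C]_n.+2 -> 'rV[C]_(k + n.+2)) (Wt : {poly (mpoly (ncoef p k n.+2 d + (k + n.+2)) C)})
 (T : 'I_d -> mpoly (ncoef p k n.+2 d) C) :
 open Uc -> open Uh -> Uh `<=` U -> open U1 -> adapted U f Nu Q P -> relcompact_in U0 Uh ->
 (forall x, Uc x -> [/\ Uh (phi x), psi (phi x) = x & hol phi x]) ->
 (forall y, Uh y -> [/\ Uc (psi y), phi (psi y) = y & hol psi y]) ->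
 (forall x, Uc x -> U1 (proj x)) -> holo U1 g -> holo Uc s0 -> holo Uc H ->
 (forall x, Uc x -> phi x = bet e (jet g s0 x) /\ f (phi x) = alp e (jet g s0 x)) ->
 (forall x, Uc x -> evalmp P (row_mx (phi x) (f (phi x))) = H x * wz e (jet g s0 x)) ->
 (forall z, evalmp P (row_mx (bet e z) (alp e z)) = evz Wt z * wz e z + (lowpoly (\row_i evalmp (T i) (upart z))).[xpart z]) ->
 (forall x', U1 x' -> forall i, evalmp (T i) (g x') = 0) ->
 locnz U1 (fun x' => disf (g x')) -> (forall l, 0 < e l)%N ->
 (forall y, closure U0 y -> H (psi y) != 0) ->
 open Y -> (forall y, closure U0 y -> Y (proj (psi y))) -> (forall nu, nash Y (G_ nu)) -> ucvg Y G_ g ->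
 (forall nu x', Y x' -> forall i, evalmp (T i) (G_ nu x') = 0) ->
 (forall M : set 'rV[C]_n.+2, compact M -> M `<=` Uc -> forall ep : R, 0 < ep -> exists ps : 'I_(k + n.+2) -> mpoly n.+2 C,
   forall x, M x -> nm (\row_i evalmp (ps i) x - s0 x) < ep) ->
 approximable f Nu Q U0.
Proof.
move=> oUc oUh UhU oU1 ad [cK0 K0Uh] hphi hpsi UcU1 hg hs0 hH pf pP rem Tg dis e0 HK oY YK nG cvG TG apx.
have cpsi y : Uh y -> {for y, continuous psi} by case/hpsi => _ _ ?; exact: diff_cont.
have cphi x : Uc x -> {for x, continuous phi} by case/hphi => _ _ ?; exact: diff_cont.
have dGn nu x' : Y x' -> hol (G_ nu) x'.
 by move=> Yx; apply: mx_differentiable => i j; rewrite (ord1 i); exact: (nG nu j).1.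
have T0 u t : (forall i, evalmp (T i) u = 0) -> (lowpoly (\row_(i < d) evalmp (T i) u)).[t] = 0.
 by move=> Tu; rewrite (_ : \row__ _ = 0); [rewrite lowpoly_eval big1 // => i _; rewrite mxE mul0r|apply/rowP => i; rewrite !mxE].
pose K : set 'rV[C]_n.+2 := psi @` closure U0.
have cK : compact K by apply: image_compact cK0 _ => y /K0Uh; exact: cpsi.
pose E : set 'rV[C]_n.+2 := [set x | [/\ Uc x, Y (proj x) & H x != 0]].
have oE : open E.
 have o1 := @open_preim _ _ _ _ _ (@proj R n.+1) oUc oY (fun x _ => diff_cont (diff_proj x)).
 have oN : open [set z : C | z != 0].
  apply/open_rP => z z0; exists (nm z); first by rewrite nm_gt0.
  by move=> y; exact: near_neq0.
 have := open_preim o1 oN (fun x (h : (_ : set 'rV[C]_n.+2) x) => diff_cont (hH x h.1)).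
 by rewrite (_ : [set x | _] = E) //; apply/seteqP; split=> x; [case=> -[]|case].
have KE : K `<=` E by move=> _ [y Ky <-]; have [uc _ _] := hpsi y (K0Uh y Ky); split=> //; [exact: YK|exact: HK].
have [d0 d00 d0E] := thick_sub cK oE KE.
have [d80 d84 d42 d21 dsum] := quarter d00.
have [dl0 dlE] := step_delta d00.
have d40 : 0 < d0 / 4 by exact: lt_trans d84.
have d20 : 0 < d0 / 2 by exact: lt_trans d42.
(* Three nested neighbourhoods of psi(closure U0). [Oh] yields the neighbourhood on which the
   approximations are delivered, [O1] the set [Ut] on which adaptedness is applied, and [O2]
   contains the preimages of [O1] under the maps close to the identity. *)
set O1 := thick K (d0 / 4); set O2 := thick K (d0 / 2); set Oh := thick K (d0 / 8).
have oO1 : open O1 by exact: thick_open.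
have oO2 : open O2 by exact: thick_open.
have O12 z x : O1 z -> nm (x - z) < d0 / 4 -> O2 x by move=> h1 h2; rewrite /O2 -dsum; exact: ball_thick h1 h2.
have O12' : O1 `<=` O2 by move=> z Oz; apply: (O12 z) => //; rewrite subrr nm0.
pose M2 := closure O2.
have cM2 : compact M2 by exact: thick_compact.
have M2E : M2 `<=` E by move=> x /(thick_closure d21)/d0E.
have O2M : O2 `<=` M2 by exact: subset_closure.
have O1M : O1 `<=` M2 by move=> x /O12'/O2M.
have M2c : M2 `<=` Uc by move=> x /M2E[].
have M2Y x : M2 x -> Y (proj x) by case/M2E.
have O1c : O1 `<=` Uc by move=> x /O1M/M2c.
have hps (nu : nat) : exists ps : 'I_(k + n.+2) -> mpoly n.+2 C, forall x, M2 x -> nm (\row_i evalmp (ps i) x - s0 x) < nu.+1%:R^-1.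
 by apply: apx => //; rewrite invr_gt0.
have [ps psP] := choice hps.
pose s_ nu (x : 'rV[C]_n.+2) : 'rV[C]_(k + n.+2) := \row_i evalmp (ps nu i) x.
have cvS : ucvg M2 s_ s0.
 move=> ep ep0; have [N NP] := arch_inv ep0; exists N => nu nuN x Mx; exact: lt_trans (psP nu x Mx) (NP nu nuN).
pose z0 := jet g s0; pose z_ nu := jet (G_ nu) (s_ nu).
have cvz : ucvg M2 z_ z0 by exact: jet_ucvg M2Y cvG cvS.
have dz0 x : Uc x -> hol z0 x by move=> Ux; apply: diff_jet; [exact/hg/UcU1|exact: hs0].
have dz_ nu x : Y (proj x) -> hol (z_ nu) x.
 move=> Yx; apply: diff_jet; first exact: dGn.
 by apply: mx_differentiable => i j; under eq_fun do rewrite mxE; exact: diff_evalmp.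
have cz0 x : M2 x -> {for x, continuous z0} by move=> /M2c/dz0; exact: diff_cont.
have cvA A : ucvg M2 (fun nu x => evz A (z_ nu x)) (fun x => evz A (z0 x)).
 by apply: (ucvg_comp cM2 _ cz0 _ cvz) => // x _; exact: diff_cont (diff_evz _ _).
have cvb : ucvg M2 (fun nu x => bet e (z_ nu x)) (fun x => bet e (z0 x)).
 move=> ep ep0; have cb x : M2 x -> {for z0 x, continuous (@bet R n k sh p e d)} by move=> _; exact: diff_cont (diff_bet e (z0 x)).
 have [dl dl0' dlP] := compact_continuity cM2 cz0 cb ep0.
 have [N NP] := cvz _ dl0'; exists N => nu nuN x Mx; exact: (dlP x (z_ nu x) Mx (NP nu nuN x Mx)).
have wzE (GG : 'rV[C]_n.+1 -> 'rV[C]_(ncoef p k n.+2 d)) s x : wz e (jet GG s x) = 0 <-> wpol (fun x' => cf (GG x')) x = 0.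
 by rewrite /wz upart_jet xpart_jet /wpol unipoly_cf; exact: powf_root.
have gU : good Uc (wpol (fun x' => cf (g x'))).
 by apply: (good_cf oU1 hg oUc UcU1) => x /UcU1; exact: dis.
(* Where the polynomial does not vanish it cancels, and elsewhere continuity decides. This
   identifies [H] with the limit of the cofactors evaluated at the approximations, so these are free
   of zeros for large nu. *)
have HE x : Uc x -> H x = evz Wt (z0 x).
 move=> Ux; apply/eqP; rewrite -subr_eq0; apply/negPn/negP => hx.
 pose h y := H y - evz Wt (z0 y).
 have dh : hol h x.
  apply: holB; first exact: hH.
  by apply: (diff_compo z0 (evz Wt)); [exact: dz0|exact: diff_evz].
 have hp : 0 < nm (h x) by rewrite nm_gt0.
 have /continuous_rP/(_ _ hp)[r r0 rP] := diff_cont dh.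
 have /open_rP/(_ x Ux)[r' r'0 r'P] := oUc.
 have m0 : 0 < min r r' by rewrite lt_min r0 r'0.
 have [y] := good_empty gU Ux m0; rewrite lt_min => /andP[y1 y2] wy.
 have /negP := near_neq0 (rP y y1); apply; rewrite subr_eq0; have Uy := r'P y y2.
 have wn : wz e (z0 y) != 0 by apply: contraNneq wy => w0; apply/eqP/(wzE g s0 y).
 apply/eqP; apply: (mulIf wn); rewrite -pP //; have [-> ->] := pf y Uy.
 by rewrite rem T0 ?addr0 // => i; rewrite upart_jet; apply: Tg; exact: UcU1.
have [m0 m00 m0P] := compact_lower cM2 (fun x (Mx : M2 x) => diff_cont (hH x (M2c x Mx))) (fun x Mx => let: And3 _ _ h := M2E x Mx in h).
have [N1 N1P] := cvA Wt _ m00.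
have Wtn nu x : (N1 <= nu)%N -> M2 x -> evz Wt (z_ nu x) != 0.
 move=> n1 Mx; apply: near_neq0 (lt_le_trans (N1P nu n1 x Mx) _); rewrite -HE; [exact: m0P|exact: M2c].
have cphiM : compact (phi @` M2) by apply: image_compact cM2 _ => x /M2c; exact: cphi.
have [d1 d10 d1P] : exists2 d1 : R, 0 < d1 & thick (phi @` M2) d1 `<=` Uh.
 by apply: thick_sub => // _ [x /M2c/hphi[? _ _] <-].
have [N2 N2P] := cvb _ d10.
have bUh nu x : (N2 <= nu)%N -> M2 x -> Uh (bet e (z_ nu x)).
 move=> n2 Mx; apply: d1P; exists (phi x); first by exists x.
 by rewrite (pf x (M2c x Mx)).1; exact: N2P.
pose th nu x := psi (bet e (z_ nu x)).
have cvth (ep : R) : 0 < ep -> exists N, forall nu, (N <= nu)%N -> forall x, M2 x -> nm (th nu x - x) < ep.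
 have cb x : M2 x -> {for x, continuous (fun x => bet e (z0 x))}.
  move=> Mx; apply: diff_cont; apply: diff_bet_comp.
  exact/dz0/M2c.
 have cp x : M2 x -> {for bet e (z0 x), continuous psi}.
  by move=> Mx; rewrite -(pf x (M2c x Mx)).1; have [? _ _] := hphi x (M2c x Mx); exact: cpsi.
 move=> /(ucvg_comp cM2 (fun x Mx => Mx) cb cp cvb)[N NP]; exists N => nu nuN x Mx.
 have := NP nu nuN x Mx; rewrite -(pf x (M2c x Mx)).1; by have [_ -> _] := hphi x (M2c x Mx).
have dth nu x : (N2 <= nu)%N -> M2 x -> hol (th nu) x.
 move=> n2 Mx; apply: (diff_compo (fun x => bet e (z_ nu x)) psi).
  apply: diff_bet_comp.
  exact/dz_/M2Y.
 by have [] := hpsi _ (bUh nu x n2 Mx).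
(* A point near x' with nonzero discriminant for [g] keeps it for G_nu with nu large, and the
   identity theorem spreads this over a whole ball around x'; compactness makes the index
   uniform. *)
have [N3 N3P] : exists N3, forall nu, (N3 <= nu)%N -> forall x', (@proj R n.+1 @` M2) x' -> forall ep : R, 0 < ep ->
  exists2 y, nm (y - x') < ep & disf (G_ nu y) != 0.
 apply: compact_eventually; first by apply: image_compact cM2 _ => x _; exact: diff_cont (diff_proj x).
 move=> x' [x Mx <-]; have U1x := UcU1 x (M2c x Mx).
 have /open_rP/(_ _ (M2Y x Mx))[r r0 rP] := oY; exists r => //.
 have [y1 yr dy] := dis _ U1x _ r0.
 have dp : 0 < nm (disf (g y1)) by rewrite nm_gt0.
 have /continuous_rP/(_ _ dp)[t t0 tP] := diff_cont (diff_disf (g y1)).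
 have [N NP] := cvG _ t0; exists N => nu nuN y yx ep ep0.
 have dn : disf (G_ nu y1) != 0 by apply: near_neq0 (tP _ (NP nu nuN y1 (rP y1 yr))).
 have hd z : nm (z - proj x) < r -> hol (fun z => disf (G_ nu z)) z.
  by move=> zr; apply: (diff_compo (G_ nu) (@disf R sh p k n.+2 d)); [exact/dGn/rP|exact: diff_disf].
 exact: (@locnz_connected R _ [set z | nm (z - proj x) < r] (fun z => disf (G_ nu z)) y1 (open_rball _ r) (@rball_connected R _ (proj x) r) hd yr dn y yx ep ep0).
have [N4 N4P] := cvth _ dl0.
pose N0 := maxn (maxn N1 N2) (maxn N3 N4).
have N0P nu : (N0 <= nu)%N -> [/\ N1 <= nu, N2 <= nu, N3 <= nu & N4 <= nu]%N.
 by rewrite !geq_max => /andP[/andP[? ?] /andP[? ?]]; split.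
have hom (nu : nat) : exists om : 'rV[C]_n.+2 -> 'rV[C]_n.+2, (N0 <= nu)%N ->
  (forall z, O1 z -> [/\ O2 (om z), th nu (om z) = z & hol om z]) /\ forall x, O2 x -> O1 (th nu x) -> om (th nu x) = x.
 have [nN|_] := leqP N0 nu; last by exists id.
 have [_ n2 _ n4] := N0P nu nN.
 have [om [h1 h2]] := @near_identity_inverse R _ O1 O2 (th nu) (d0 / 4) (d0 / 4 / 32) d40 dl0 oO1 O12 dlE
  (fun x Ox => dth nu x n2 (O2M x Ox)) (fun x Ox => ltW (N4P nu n4 x (O2M x Ox))).
 by exists om => _; split=> // z /h1[].
have [om omP] := choice hom.
pose Ut : set 'rV[C]_n.+2 := [set y | Uh y /\ O1 (psi y)].
have oUt : open Ut by apply: open_preim.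
pose zz nu y := z_ nu (om nu (psi y)).
have bzz nu y : (N0 <= nu)%N -> Ut y -> bet e (zz nu y) = y.
 move=> nN [Uy Oy]; have [h1 h2 _] := (omP nu nN).1 _ Oy; have [_ n2 _ _] := N0P nu nN.
 have [_ <- _] := hpsi _ (bUh nu _ n2 (O2M _ h1)).
 by rewrite -/(th nu _) h2; have [_ ->] := hpsi y Uy.
have cvzz (V : nmod C) (F : 'rV[C]_(ncoef p k n.+2 d + (k + n.+2) + 1) -> V) : (forall z, {for z, continuous F}) ->
  forall ep : R, 0 < ep -> exists N, forall nu, (N <= nu)%N -> (N0 <= nu)%N -> forall y, Ut y -> nm (F (zz nu y) - F (z0 (psi y))) < ep.
 move=> cF ep ep0; have [t t0 tP] := compact_continuity cM2 cz0 (fun x _ => cF (z0 x)) ep0.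
 have t2 : 0 < t / 2 by rewrite divr_gt0.
 have [t' t'0 t'P] := @compact_continuity R _ _ _ M2 id z0 (t / 2) cM2 (fun x _ => @cvg_id _ (nbhs x)) cz0 t2.
 have [N NP] := cvz _ t2; have [N' N'P] := cvth _ t'0.
 exists (maxn N N') => nu; rewrite geq_max => /andP[n1 n2] nN y [Uy Oy]; have [h1 h2 _] := (omP nu nN).1 _ Oy.
 apply: tP; first exact: O1M.
 have h3 := NP nu n1 _ (O2M _ h1).
 have h4 : nm (z0 (om nu (psi y)) - z0 (psi y)) < t / 2.
  apply: (t'P (psi y)); first exact: O1M.
  by rewrite nmC -{1}h2; apply: N'P => //; exact: O2M.
 have := @nm_tri R _ (z0 (om nu (psi y))) (zz nu y) (z0 (psi y)); move: h3 h4; rewrite /zz; move: (nm _) (nm _) (nm _) => u v w; clra.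
pose F y := wpol (fun x' => cf (g x')) (psi y).
pose F_ nu y := wpol (fun x' => cf (G_ nu x')) (om nu (psi y)).
have zF : zeros_along P Ut f = zeros Ut F.
 apply/seteqP; split=> y [[Uy Oy] yP]; split=> //; have [uc pE _] := hpsi y Uy.
  apply/(wzE g s0); apply/eqP; move: yP => /eqP; rewrite -{1 2}pE pP // mulf_eq0.
  by have [_ _ /negPf->] := M2E _ (O1M _ Oy).
 by rewrite -{1 2}pE pP //; move: yP => /(wzE g s0)->; rewrite mulr0.
pose Gn nu y := alp e (zz nu y).
have zFn nu : (N0 <= nu)%N -> zeros_along P Ut (Gn nu) = zeros Ut (F_ nu).
 move=> nN; have [n1 _ _ _] := N0P nu nN.
 have PE y : Ut y -> evalmp P (row_mx y (Gn nu y)) = evz Wt (zz nu y) * wz e (zz nu y).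
  move=> Uy; rewrite -{1}(bzz nu y nN Uy) rem T0 ?addr0 // => i; rewrite upart_jet; apply: TG; apply: M2Y.
  by have [/O2M ? _ _] := (omP nu nN).1 _ Uy.2.
 apply/seteqP; split=> y [Uy yP]; split=> //.
  apply/(wzE (G_ nu) (s_ nu)); apply/eqP; move: yP => /eqP; rewrite PE // mulf_eq0 (negPf (Wtn nu _ n1 _)) //.
  by have [/O2M ? _ _] := (omP nu nN).1 _ Uy.2.
 by rewrite PE //; move: yP => /(wzE (G_ nu) (s_ nu))->; rewrite mulr0.
have gF : good Ut F.
 have gO1 : good O1 (wpol (fun x' => cf (g x'))).
  by apply: (good_cf oU1 hg oO1) => x /O1c/UcU1 //; exact: dis.
 apply: (@good_transport R _ Ut O1 psi phi _ oUt _ _ _ _ _ _ gO1).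
 - by move=> y [].
 - move=> x Ox; have [h1 h2 _] := hphi x (O1c x Ox); split; [exact: h1|by rewrite h2].
 - by move=> y [/hpsi[]].
 - by move=> x /O1c/hphi[].
 - by move=> y [/hpsi[]].
 - by move=> x /O1c/hphi[].
have dom nu y : (N0 <= nu)%N -> Ut y -> hol (fun y => om nu (psi y)) y.
 move=> nN [Uy Oy]; apply: (diff_compo psi (om nu)); first by have [] := hpsi y Uy.
 by have [] := (omP nu nN).1 _ Oy.
have gF_ nu : (N0 <= nu)%N -> good Ut (F_ nu).
 move=> nN; have [n1 n2 n3 n4] := N0P nu nN; have [om1 om2] := omP nu nN.
 pose D := [set x | O2 x /\ O1 (th nu x)].
 have oD : open D by exact: (@open_preim R _ _ O2 O1 (th nu) oO2 oO1 (fun x Ox => diff_cont (dth nu x n2 (O2M x Ox)))).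
 have gD : good D (wpol (fun x' => cf (G_ nu x'))).
  apply: (good_cf oY (fun x' => dGn nu x') oD) => x [/O2M Mx _]; first exact: M2Y.
  by apply: N3P => //; exists x.
 apply: (@good_transport R _ Ut D (fun y => om nu (psi y)) (fun x => bet e (z_ nu x)) _ oUt _ _ _ _ _ _ gD).
 - by move=> y [Uy Oy]; have [h1 h2 _] := om1 _ Oy; split; rewrite ?h2.
 - by move=> x [/O2M Mx Ox]; split; [exact: bUh|exact: Ox].
 - by move=> y Uy; exact: dom.
 - move=> x [/O2M Mx _]; apply: diff_bet_comp.
  exact/dz_/M2Y.
 - by move=> y Uy; exact: bzz.
 - by move=> x [Ox O1x]; exact: om2.
(* The reduced polynomial is a fixed polynomial in the entries of the jet, so its convergence is
   that of the jets composed with a continuous function. *)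
have cvF (ep : R) : 0 < ep -> exists N, forall nu, (N <= nu)%N -> (N0 <= nu)%N -> forall y, Ut y -> nm (F_ nu y - F y) < ep.
 move=> ep0; have cE z : {for z, continuous (evz (sqf (@uvars R sh p k n.+2 d)))}.
  exact: diff_cont (diff_evz _ _).
 have [N NP] := cvzz _ _ cE _ ep0; exists N => nu n1 n2 y Uy; have := NP nu n1 n2 y Uy.
 by rewrite !evz_sqf /zz !upart_jet !xpart_jet /F /F_ /wpol !unipoly_cf.
have UtO a : Ut a -> exists2 r : R, 0 < r & forall x, nm (x - a) < r -> Ut x by move: oUt => /open_rP; apply.
(* Hurwitz's theorem makes the zero sets nonempty from some index on, if the limit is nonempty;
   [idx] skips the earlier indices. *)
have [N5 N5P] : exists N5, zeros Ut F !=set0 -> forall nu, (N5 <= nu)%N -> zeros Ut (F_ (N0 + nu)) !=set0.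
 have [[a Fa]|ne] := pselect (zeros Ut F !=set0); last by exists 0%N.
 have [r r0 rP] := UtO a Fa.1.
 have [|ep ep0|N NP] := @hurwitz R _ Ut F (fun nu => F_ (N0 + nu)%N) a r gF Fa r0 rP; last first.
 - by exists N => _ nu /NP[y hy _]; exists y.
 - have [N NP] := cvF ep ep0; exists N => nu nuN x xr.
  by apply: NP; [exact: leq_trans (leq_addl _ _)|exact: leq_addr|exact: rP].
 - by move=> nu x Ux; apply: (good_holo (gF_ _ (leq_addr _ _))).
pose idx nu := (N0 + (N5 + nu))%N.
have idxN nu : (N0 <= idx nu)%N by exact: leq_addr.
have idx_ge nu N : (N <= nu)%N -> (N <= idx nu)%N by move=> h; apply: (leq_trans h); rewrite /idx addnA leq_addl.
pose U0' : set 'rV[C]_n.+2 := [set y | Uh y /\ Oh (psi y)].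
have oU0' : open U0' by apply: open_preim => //; exact: thick_open.
have K0U : closure U0 `<=` U0'.
 by move=> y Ky; split; [exact: K0Uh|apply: thick_self => //; exists y].
pose L := phi @` closure Oh.
have OhO1 : closure Oh `<=` O1 by exact: thick_closure.
have cL : compact L by apply: image_compact (thick_compact cK) _ => x /OhO1/O1c; exact: cphi.
have U0L : closure U0' `<=` L.
 have cl : closed L by exact: compact_is_closed.
 have -> : L = closure L by apply/closure_id.
 apply: closure_subset => y [Uy Oy]; exists (psi y); first exact: subset_closure.
 by have [] := hpsi y Uy.
have LUt : L `<=` Ut.
 move=> _ [x /OhO1 Ox <-]; have [h1 h2 _] := hphi x (O1c x Ox); split; [exact: h1|by rewrite h2].
apply: (@solves_adapted R _ _ _ _ _ _ _ _ _ U0' Ut ad oUt oU0' K0U).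
- by move=> y [/UhU].
- split; last by move=> y /U0L/LUt.
 by apply: subclosed_compact cL U0L; exact: closed_closure.
exists (fun nu => Gn (idx nu)); split.
- move=> nu j; rewrite (_ : (fun y => _) = fun y => evz (@alpha R sh p e k n.+2 d j) (zz (idx nu) y)); last first.
  by apply/funext => y; rewrite mxE.
 apply: (nash_jet (e := e) _ oY (nG _) oUt) => y Uy; have [h1 _ _] := (omP _ (idxN nu)).1 _ Uy.2; split.
 + exact/M2Y/O2M.
 + exact: dom.
 + exact: bzz.
- move=> a Ua; exists Ut; split; [exact: oUt|exact: Ua|by []|].
 apply/uniform_rP => ep ep0.
 have [N NP] := cvzz _ _ (fun z => diff_cont (diff_alp e z)) _ ep0.
 exists N => nu nuN y Uy; have [uc pE _] := hpsi y Uy.1.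
 have -> : f y = alp e (z0 (psi y)) by rewrite -(pf _ uc).2 pE.
 by apply: NP => //; exact: idx_ge.
- rewrite zF (_ : (fun nu => zeros_along P Ut (Gn (idx nu))) = fun nu => zeros Ut (F_ (idx nu))); last first.
  by apply/funext => nu; exact: zFn.
 apply: (zeros_chain_cvg gF (fun nu => gF_ _ (idxN nu))).
 + move=> a Ua; have [r r0 rP] := UtO a Ua; exists r; first exact: r0.
  move=> ep ep0; have [N NP] := cvF ep ep0; exists N => nu nuN x /rP Ux.
  by apply: NP => //; exact: idx_ge.
 + by move=> ne nu; apply: N5P => //; exact: leq_addr.
Qed.

End Step.

(** * Induction on the dimension *)

Section Induction.
Variable R : realType. Local Notation C := (cplx R).

Section Pack.
Variables (sh : nat) (p : 'I_sh -> nat) (k n d : nat).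

Lemma coefA_pack (A : forall l, 'rV[C]_(p l)) (B : 'M[C]_(k, d)) (D : 'M[C]_(n, d)) l : coefA (pack_coef A B D) l = A l.
Proof. by rewrite /coefA /pack_coef row_mxKl mxrowK. Qed.
Lemma coefB_pack (A : forall l, 'rV[C]_(p l)) (B : 'M[C]_(k, d)) (D : 'M[C]_(n, d)) : coefB (pack_coef A B D) = B.
Proof. by rewrite /coefB /pack_coef row_mxKr row_mxKl mxvecK. Qed.
Lemma coefC_pack (A : forall l, 'rV[C]_(p l)) (B : 'M[C]_(k, d)) (D : 'M[C]_(n, d)) : coefC (pack_coef A B D) = D.
Proof. by rewrite /coefC /pack_coef row_mxKr row_mxKr mxvecK. Qed.

Lemma diff_pack (V : nmod C) (A : forall l, V -> 'rV[C]_(p l)) (B : V -> 'M[C]_(k, d)) (D : V -> 'M[C]_(n, d)) x :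
 (forall l, hol (A l) x) -> hol B x -> hol D x ->
 hol (fun x => pack_coef (fun l => A l x) (B x) (D x)) x.
Proof.
move=> dA dB dD; apply: mx_differentiable => i j; rewrite (ord1 i); case: (split_ordP j) => j' ->.
 under eq_fun do rewrite row_mxEl mxE; exact: (diff_entry _ _ (dA _)).1.
under eq_fun do rewrite row_mxEr; case: (split_ordP j') => j2 ->; case/mxvec_indexP: j2 => a b.
 under eq_fun do rewrite row_mxEl mxvecE; exact: (diff_entry _ _ dB).1.
under eq_fun do rewrite row_mxEr mxvecE; exact: (diff_entry _ _ dD).1.
Qed.

End Pack.

Lemma diff_ext n (x' : 'rV[C]_n) t : hol (ext x') t.
Proof.
apply: mx_differentiable => i j; under eq_fun do rewrite mxE.
case: unliftP => [j' _|_]; first exact: hol_cst.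
rewrite (_ : (fun t => _) = (fun s => s + 0)); first exact: diff_shift.
by apply/funext => s; rewrite addr0.
Qed.

Lemma step_case n :
 (forall k q U f Nu (Q : 'rV[C]_(n.+1 + k) -> 'rV[C]_q) P U0, domain U -> holo U f -> adapted U f Nu Q P ->
   @in_family R n k U f P U0 -> approximable f Nu Q U0) ->
 forall k q U f Nu (Q : 'rV[C]_(n.+2 + k) -> 'rV[C]_q) P U0, domain U -> holo U f -> adapted U f Nu Q P ->
   in_family_step (@in_family R n) U f P U0 -> approximable f Nu Q U0.
Proof.
move=> IH k q U f Nu Q P U0 _ hf ad [oU0 [Uc [Uh [phi [U1 hstep]]]]].
set V0 := [set x | Uc x /\ U0 (phi x)] in hstep.
case: hstep => [[[oUh cUh neUh] UhU [[oUc cUc neUc] rUc] [dphi phiE [psi [dpsi psiK]]] rcU0] [dU1 UcU1]].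
case=> d [w hw0]; set W := fun x : 'rV[C]_n.+2 => (unipoly (w (proj x))).[x 0 ord_max] in hw0.
case: hw0 => hw WUc [H [hH HV0 HP]] [Hf [B [Hphi [D [sh [p [e [A [T [S hdat]]]]]]]]]].
set g := fun x' => pack_coef (fun l => A l x') (B x') (D x') in hdat.
case: hdat => [[hHf hB fE] [hHphi hD phE] [e0 hA hdim powE] hrem [adS famS]].
have oU1 : open U1 by case: dU1.
have cU1 : connected U1 by case: dU1.
have hg : holo U1 g.
 by move=> x' Ux; apply: diff_pack => [l||]; [exact: (hA l).1|exact: hB|exact: hD].
have [Y [oY clY [G_ [nG cG sG]]]] := IH _ _ U1 g setT _ S _ dU1 hg adS famS.
have [Wt WtE] := remainder_eval hrem.
pose s0 (x : 'rV[C]_n.+2) : 'rV[C]_(k + n.+2) := row_mx (Hf x) (Hphi x).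
have powg x' : U1 x' -> powf e (g x') = unipoly (w x').
 by move=> Ux; rewrite powE //; apply: eq_bigr => l _; rewrite coefA_pack.
have wzW x : U1 (proj x) -> wz e (jet g s0 x) = W x.
 by move=> Ux; rewrite /wz upart_jet xpart_jet powg.
have hphi x : Uc x -> [/\ Uh (phi x), psi (phi x) = x & hol phi x].
 by move=> Ux; split; [rewrite -phiE; exists x|exact: psiK|exact: dphi].
have hpsi y : Uh y -> [/\ Uc (psi y), phi (psi y) = y & hol psi y].
 move=> Uy; have := Uy; rewrite -{1}phiE => -[x Ux xy].
 have E : psi y = x by rewrite -xy psiK.
 by split; [rewrite E|rewrite E|exact: dpsi].
have pf x : Uc x -> phi x = bet e (jet g s0 x) /\ f (phi x) = alp e (jet g s0 x).
 move=> Ux; have U1x := UcU1 x Ux; split; apply/rowP => i; rewrite mxE.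
  by rewrite evz_beta spart_jet upart_jet xpart_jet row_mxEr coefC_pack powg // phE.
 by rewrite evz_alpha spart_jet upart_jet xpart_jet row_mxEl coefB_pack powg // fE.
have dz0 x : Uc x -> hol (jet g s0) x.
 move=> Ux; apply: diff_jet; first exact/hg/UcU1.
 apply: mx_differentiable => i j; rewrite (ord1 i); case: (split_ordP j) => j' ->.
  by under eq_fun do rewrite row_mxEl; exact: (diff_entry 0 j' (hHf x Ux)).1.
 by under eq_fun do rewrite row_mxEr; exact: (diff_entry 0 j' (hHphi x Ux)).1.
have hs0 : holo Uc s0.
 move=> x Ux; apply: mx_differentiable => i j; rewrite (ord1 i); case: (split_ordP j) => j' ->.
  by under eq_fun do rewrite row_mxEl; exact: (diff_entry 0 j' (hHf x Ux)).1.
 by under eq_fun do rewrite row_mxEr; exact: (diff_entry 0 j' (hHphi x Ux)).1.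
(* On the fibre over x' both formulas for R(phi, f(phi)) hold near the roots of W, which lie in
   [Uc]. Hence the remainder is there W times the holomorphic function H minus the cofactor, and as
   a polynomial of degree below d it vanishes. *)
have Tg x' : U1 x' -> forall i, evalmp (T i) (g x') = 0.
 move=> Ux i; suff /rowP/(_ i) : \row_i evalmp (T i) (g x') = 0 by rewrite !mxE.
 apply: (@lowpoly_zero R d (w x')) => z /rootP zr.
 have Uz : Uc (ext x' z) by apply: WUc; rewrite ?proj_ext // /W /= -/(lastc _) proj_ext lastc_ext.
 have /open_rP/(_ _ Uz)[r r0 rP] := oUc.
 have Ut t : nm (t - z) < r -> Uc (ext x' t).
  by move=> tz; apply: rP; apply: ext_near; rewrite ?subrr ?nm0.
 exists r, (fun t => H (ext x' t) - evz Wt (jet g s0 (ext x' t))); split; first exact: r0.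
  move=> t /Ut Uxt; apply: holB.
   by apply: (diff_compo (ext x') H); [exact: diff_ext|exact: hH].
  apply: (diff_compo (ext x') (fun x => evz Wt (jet g s0 x))); first exact: diff_ext.
  by apply: (diff_compo (jet g s0) (evz Wt)); [exact: dz0|exact: diff_evz].
 move=> t /Ut Uxt; have := HP _ Uxt; have [pE1 pE2] := pf _ Uxt.
 have := WtE (jet g s0 (ext x' t)); rewrite -/(bet e _) -/(alp e _) -pE1 -pE2 => -> .
 rewrite upart_jet xpart_jet proj_ext lastc_ext powg //.
 rewrite /W -/(lastc _) proj_ext lastc_ext => E; rewrite mulrBr mulrC -E.
 by rewrite [_ * evz _ _]mulrC addrAC subrr add0r.
(* Optimality of the W_l makes their discriminants not identically zero, and the condition on the
   dimensions of intersections does the same for the resultants of pairs. *)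
have dis : locnz U1 (fun x' => disf (g x')).
 have h1 l : exists2 x, U1 x & rff (g x) l != 0.
  have [_ [x Ux dx]] := hA l; exists x => //; rewrite /rff coefA_pack.
  rewrite resfE ?size_unipoly ?size_deriv_unipoly //; apply: contra_notN dx => /eqP; rewrite /discr => ->; by rewrite mulr0.
 apply: disf_locnz => // l l' ll; have [x0 Ux0 r0] := h1 l.
 have [x Ux rx] : exists2 x, U1 x & resf (p l) (p l') (unipoly (A l x)) (unipoly (A l' x)) != 0.
  apply: (@generic_coprime R n (p l) (p l') U1 (A l) (A l') x0 oU1 cU1 (hA l).1 (hA l').1 Ux0).
   by move: r0; rewrite /rff coefA_pack.
  by apply: hdim; rewrite eq_sym.
 by exists x; [exact: Ux|rewrite /rfr !coefA_pack].
(* The conditions on the unit and on the projection concern [V0], the part of the source over [U0];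
   continuity of [psi] carries them to the points over the closure of [U0]. *)
have clV y : closure U0 y -> forall ep : R, 0 < ep -> exists2 x, V0 x & nm (x - psi y) < ep.
 move=> Ky ep ep0; have Uy := rcU0.2 y Ky; have [_ _ dy] := hpsi y Uy.
 have /continuous_rP/(_ _ ep0)[r r0 rP] := diff_cont dy.
 have /open_rP/(_ _ Uy)[r' r'0 r'P] := oUh.
 have m0 : 0 < min r r' by rewrite lt_min r0 r'0.
 have [y' U0y] := (closure_rP U0 y).1 Ky _ m0; rewrite lt_min => /andP[h1 h2].
 by exists (psi y'); [have [h3 h4 _] := hpsi y' (r'P y' h2); split; rewrite ?h4|exact: rP].
apply: (@step_main R n k q sh p e d U Uh Uc U1 Y f Nu Q P U0 phi psi H g G_ s0 Wt T oUc oUh UhU oU1 ad rcU0 hphi hpsi UcU1 hg hs0 hH pf).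
- by move=> x Ux; rewrite wzW; [exact: HP|exact: UcU1].
- exact: WtE.
- exact: Tg.
- exact: dis.
- exact: e0.
- move=> y Ky; apply/eqP; apply: HV0; apply/closure_rP => ep ep0; exact: clV.
- exact: oY.
- move=> y Ky; apply: clY; apply/closure_rP => ep ep0; have [x Vx xy] := clV y Ky ep ep0.
 by exists (proj x); [exists x|rewrite -projB; exact: le_lt_trans (norm_proj _) xy].
- exact: nG.
- by move=> ep ep0; have /uniform_rP/(_ _ ep0) := cG.
- move=> nu x' Yx i; have [_ /rowP/(_ i)] := sG nu x' Yx; by rewrite !mxE row_mxKr.
- move=> M cM MU ep ep0.
 have hp i : exists P' : mpoly n.+2 C, forall x, M x -> nm (evalmp P' x - s0 x 0 i) < ep.
  have hi : holo Uc (fun x => s0 x 0 i) by move=> x Ux; exact: (diff_entry 0 i (hs0 x Ux)).1.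
  have epc : 0 < rc ep by rewrite -rc0 rc_lt.
  have [P' P'E] := rUc _ hi M cM MU (rc ep) epc; exists P' => x Mx.
  by rewrite (@nmC R C) -rc_lt -nmE; exact: P'E.
 have [ps psP] := choice hp; exists ps => x Mx; apply: nm_mx_lt => // i j.
 by rewrite (ord1 i) 3!mxE; have := psP j x Mx; rewrite mxE.
Qed.

Lemma family_approximable n : forall k q U f Nu (Q : 'rV[C]_(n.+1 + k) -> 'rV[C]_q) P U0, domain U -> holo U f -> adapted U f Nu Q P ->
 @in_family R n k U f P U0 -> approximable f Nu Q U0.
Proof.
elim: n => [|n IH] k q U f Nu Q P U0; first exact: base_case.
exact: step_case.
Qed.

Lemma nash_sub n k (D D' : set 'rV[C]_n) (f : 'rV[C]_n -> 'rV[C]_k) : open D -> D `<=` D' -> nash D' f -> nash D f.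
Proof.
move=> oD DD nf j; have [hf lf] := nf j; split=> [x /DD/hf //|x Dx].
have [W [oW Wx _ [P P0 PW]]] := lf x (DD x Dx).
by exists (W `&` D); split=> [||y []|]; [exact: openI|split| |exists P => // y [/PW]].
Qed.

End Induction.

Theorem theorem3p8 (R : realType) (n k q : nat)
  (U : set 'rV[cplx R]_n.+1) (f : 'rV[cplx R]_n.+1 -> 'rV[cplx R]_k)
  (Nu : set 'rV[cplx R]_(n.+1 + k))
  (Q : 'rV[cplx R]_(n.+1 + k) -> 'rV[cplx R]_q)
  (P : mpoly (n.+1 + k) (cplx R))
  (hU : domain U) (hf : holo U f)
  (hNu : open Nu) (hQ : nash Nu Q) (hfQ : solves Nu Q U f)
  (hP : adapted U f Nu Q P)
  (U0 : set 'rV[cplx R]_n.+1) (hU0 : in_family U f P U0) :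
  exists f_ : nat -> 'rV[cplx R]_n.+1 -> 'rV[cplx R]_k,
    [/\ forall nu, nash U0 (f_ nu), {uniform U0, f_ @ \oo --> f} &
        forall nu, solves Nu Q U0 (f_ nu)].
Proof.
have [U0' [_ cl [f_ [nf cf sf]]]] := family_approximable hU hf hP hU0.
have oU0 : open U0 by case: n U f Nu Q P hU hf hNu hQ hfQ hP U0 hU0 {U0' cl f_ nf cf sf} => [|m] ? ? ? ? ? _ _ _ _ _ _ ? [].
have U0U : U0 `<=` U0' by move=> x /subset_closure/cl.
exists f_; split=> [nu||nu x /U0U/sf //].
 exact: nash_sub oU0 U0U (nf nu).
apply/uniform_rP => e e0; have /uniform_rP/(_ _ e0)[N NP] := cf.
by exists N => nu nuN x /U0U; exact: NP.
Qed.
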